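(* Let $2<\alpha<\infty$, let $\Omega_1,\Omega_2\subset\mathbb C$ be a conformal $\alpha$-regular pair, and let $\varphi_1,\varphi_2$ be conformal mappings of the unit disc $\mathbb D$ with $\Omega_1=\varphi_1(\mathbb D)$, $\Omega_2=\varphi_2(\mathbb D)$. Then for any $n\in\mathbb N$ $$ |\lambda_{n}[\Omega_{1}]-\lambda_{n}[\Omega_{2}]|\leq 2c_n \left[C\left(\frac{4\alpha}{\alpha-2}\right)\right]^2 E_{\alpha}(\varphi_1,\varphi_2)\Big(\big[\mathrm{meas}(\varphi_1(\mathbb D^+))-\mathrm{meas}(\varphi_2(\mathbb D^+))\big]+\big[\mathrm{meas}(\varphi_2(\mathbb D^-))-\mathrm{meas}(\varphi_1(\mathbb D^-))\big]\Big)^{\frac12}, $$ where $c_{n}=\max\{\lambda_{n}^{2}[\Omega_{1}],\lambda_{n}^{2}[\Omega_{2}]\}$, $\mathbb D^+=\{z\in\mathbb D:J_{\varphi_1}(z)\geq J_{\varphi_2}(z)\}$, $\mathbb D^-=\{z\in\mathbb D:J_{\varphi_1}(z)<J_{\varphi_2}(z)\}$, and $J_{\varphi_k}=|\varphi_k'|^2$ is the Jacobian of $\varphi_k$.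
   Context: Conformal mappings are conformal homeomorphisms onto the indicated domain (univalent holomorphic maps); $\mathrm{meas}$ is planar Lebesgue measure. A domain $\Omega\subset\mathbb C$ is conformal $\alpha$-regular ($\alpha>2$) if there is a conformal mapping $\varphi$ of the unit disc $\mathbb D$ onto $\Omega$ with $\varphi'\in L^{\alpha}(\mathbb D)$ (this does not depend on the choice of $\varphi$). Two conformal $\alpha$-regular domains $\Omega_1,\Omega_2$ form a conformal $\alpha$-regular pair if there exists a conformal mapping $\psi:\Omega_1\to\Omega_2$ (onto) such that $\iint_{\Omega_1}|\psi'(z)|^{\alpha}\,dxdy<\infty$ and $\iint_{\Omega_2}|(\psi^{-1})'(w)|^{\alpha}\,dudv<\infty$. For a conformal regular domain $\Omega$ (i.e. conformal $\alpha$-regular for some $\alpha>2$) the embedding $W^{1,2}(\Omega)\to L^2(\Omega)$ is compact, and $0=\lambda_1[\Omega]<\lambda_2[\Omega]\le\dots\le\lambda_n[\Omega]\le\dots$ denote the eigenvalues of the Neumann Laplacian $-\Delta$ in $\Omega$ (weak formulation in $W^{1,2}(\Omega)$), repeated according to multiplicity; equivalently $$\lambda_n[\Omega]=\inf_{L\subset W^{1,2}(\Omega),\ \dim L=n}\ \sup_{f\in L,\ f\neq0}\frac{\iint_\Omega|\nabla f|^2\,dxdy}{\iint_\Omega|f|^2\,dxdy}.$$ Energy functional: $$E_{\alpha}(\varphi_1,\varphi_2)=\left(\iint_{\mathbb D}\max\left\{\frac{|\varphi_1'(z)|^{\alpha}}{|\varphi_2'(z)|^{\alpha-2}},\frac{|\varphi_2'(z)|^{\alpha}}{|\varphi_1'(z)|^{\alpha-2}}\right\}dxdy\right)^{1/\alpha}.$$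 Constant $C(q)$, $2\le q<\infty$: put $h_k=|\varphi_k'|^2$ and $f_{\mathbb D,h_k}=\big(\iint_{\mathbb D}h_k\,dxdy\big)^{-1}\iint_{\mathbb D}f h_k\,dxdy$ for $k=1,2$. Let $C_k(q)$ be the best possible constant in $$\Big(\iint_{\mathbb D}|f-f_{\mathbb D,h_k}|^q h_k\,dxdy\Big)^{1/q}\le C_k(q)\Big(\iint_{\mathbb D}|\nabla f|^2dxdy\Big)^{1/2}\quad\text{for all } f\in W^{1,2}(\mathbb D,h_k,1),$$ where $W^{1,2}(\mathbb D,h,1)$ is the space of locally integrable weakly differentiable $f:\mathbb D\to\mathbb R$ with $\big(\iint_{\mathbb D}|f|^2h\big)^{1/2}+\big(\iint_{\mathbb D}|\nabla f|^2\big)^{1/2}<\infty$. Then $C(q)=\max\{C_1(q),C_2(q)\}$. *)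

(* Defs.v *)
From HB Require Import structures.
From mathcomp Require Import all_boot all_order all_algebra.
From mathcomp Require Import all_classical all_reals all_analysis.
From mathcomp Require Export complex.

Set Implicit Arguments.
Unset Strict Implicit.
Unset Printing Implicit Defensive.

Import Order.TTheory GRing.Theory Num.Theory.
Import numFieldNormedType.Exports.

Local Open Scope classical_set_scope.
Local Open Scope ring_scope.

(* Sobolev functions live on R * R, which carries the product Lebesgue measure;
   conformal mappings live on R[i]^o, the complex numbers as a normed space over
   themselves, so that derivable and derive1 are complex differentiability and
   the complex derivative.  The two are identified through [cplx]. *)

Definition leb2 {R : realType}
    : {measure set (measurableTypeR R * measurableTypeR R) -> \bar R} :=
  (@lebesgue_measure R \x @lebesgue_measure R)%E.

(** * Weak derivatives and weighted Sobolev spaces in the plane *)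

Definition e1 {R : realType} : R * R := (1, 0).
Definition e2 {R : realType} : R * R := (0, 1).

Fixpoint Ck {R : realType} (k : nat) (f : R * R -> R) : Prop :=
  if k is k'.+1 then
    (forall p, derivable f p e1 /\ derivable f p e2) /\
    Ck k' ('D_e1 f) /\ Ck k' ('D_e2 f)
  else continuous f.

(* eta belongs to C_c^oo(U) *)
Definition test_function {R : realType} (U : set (R * R)) (eta : R * R -> R) :=
  (forall k, Ck k eta) /\
  exists K : set (R * R),
    [/\ compact K, K `<=` U & forall p, ~ K p -> eta p = 0].

Definition loc_integrable {R : realType} (U : set (R * R)) (f : R * R -> R) :=
  measurable_fun U f /\
  forall K, compact K -> K `<=` U -> (\int[leb2]_(p in K) `|f p|%:E < +oo)%E.

Definition is_weak_gradient {R : realType} (U : set (R * R)) (f : R * R -> R)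
    (g : R * R -> R * R) :=
  [/\ loc_integrable U (fun p => (g p).1),
      loc_integrable U (fun p => (g p).2) &
      forall eta, test_function U eta ->
        (\int[leb2]_(p in U) (f p * 'D_e1 eta p) =
           - \int[leb2]_(p in U) ((g p).1 * eta p)) /\
        (\int[leb2]_(p in U) (f p * 'D_e2 eta p) =
           - \int[leb2]_(p in U) ((g p).2 * eta p))].

Definition weakly_differentiable {R : realType} (U : set (R * R))
    (f : R * R -> R) :=
  loc_integrable U f /\ exists g, is_weak_gradient U f g.

(* A weak gradient is unique up to a null set of U, so the choice made here is
   immaterial inside integrals over U. *)
Definition weak_gradient {R : realType} (U : set (R * R)) (f : R * R -> R)
    : R * R -> R * R :=
  xget (fun=> (0, 0)) [set g | is_weak_gradient U f g].

Definition grad_sqr {R : realType} (U : set (R * R)) (f : R * R -> R)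
    (p : R * R) : R :=
  (weak_gradient U f p).1 ^+ 2 + (weak_gradient U f p).2 ^+ 2.

(* W^{1,2}(U, h, 1): the weight h is on f only, not on its gradient *)
Definition W12w {R : realType} (U : set (R * R)) (h : R * R -> R)
    : set (R * R -> R) :=
  [set f | [/\ weakly_differentiable U f,
               (\int[leb2]_(p in U) (`|f p| ^+ 2 * h p)%:E < +oo)%E &
               (\int[leb2]_(p in U) (grad_sqr U f p)%:E < +oo)%E]].

Definition W12 {R : realType} (U : set (R * R)) : set (R * R -> R) :=
  W12w U (fun=> 1).

(** * Eigenvalues of the Neumann Laplacian *)

(* f = 0 as an element of L^2(U) *)
Definition null_on {R : realType} (U : set (R * R)) (f : R * R -> R) :=
  {ae leb2, forall p, U p -> f p = 0}.

Definition lincomb {R : realType} n (b : 'I_n -> R * R -> R) (c : 'I_n -> R)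
    (p : R * R) : R :=
  \sum_(i < n) c i * b i p.

(* L is an n-dimensional linear subspace of W^{1,2}(U), whose elements are
   functions modulo equality almost everywhere on U: linear independence of the
   basis b is meant modulo null sets. *)
Definition W12_subspace {R : realType} (n : nat) (U : set (R * R))
    (L : set (R * R -> R)) :=
  exists b : 'I_n -> R * R -> R,
    [/\ forall i, W12 U (b i),
        forall c, null_on U (lincomb b c) -> forall i, c i = 0 &
        L = range (lincomb b)].

Definition rayleigh {R : realType} (U : set (R * R)) (f : R * R -> R) : R :=
  (\int[leb2]_(p in U) grad_sqr U f p) / (\int[leb2]_(p in U) (`|f p| ^+ 2)).

(* The n-th Neumann eigenvalue (n >= 1, counted with multiplicity), given by the
   min-max formula. *)
Definition neumann_eigenvalue {R : realType} (n : nat) (U : set (R * R))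
    : \bar R :=
  ereal_inf [set ereal_sup [set (rayleigh U f)%:E | f in
                              [set f | L f /\ ~ null_on U f]]
            | L in [set L | W12_subspace n U L]].

(** * Conformal mappings and conformal regular domains *)

Definition cplx {R : realType} (p : R * R) : R[i]^o := Complex p.1 p.2.

Definition plane {R : realType} (A : set R[i]^o) : set (R * R) :=
  cplx @^-1` A.

Definition meas {R : realType} (A : set R[i]^o) : \bar R := leb2 (plane A).

Definition disc {R : realType} : set R[i]^o := [set z | `|z| < 1].

Definition planar_domain {R : realType} (A : set R[i]^o) :=
  [/\ open A, connected A & A !=set0].

Definition conformal {R : realType} (A B : set R[i]^o) (f : R[i]^o -> R[i]^o) :=
  [/\ forall z, A z -> derivable f z 1,
      {in A &, injective f} &
      f @` A = B].

(* |f'| as a real number *)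
Definition mod_deriv {R : realType} (f : R[i]^o -> R[i]^o) (z : R[i]^o) : R :=
  ComplexField.Normc.normc (derive1 f z).

Definition cjacobian {R : realType} (f : R[i]^o -> R[i]^o) (z : R[i]^o) : R :=
  mod_deriv f z ^+ 2.

Definition deriv_in_Lp {R : realType} (a : R) (A : set R[i]^o)
    (f : R[i]^o -> R[i]^o) :=
  (\int[leb2]_(p in plane A) (mod_deriv f (cplx p) `^ a)%:E < +oo)%E.

Definition conformal_regular {R : realType} (a : R) (Om : set R[i]^o) :=
  planar_domain Om /\ exists phi, conformal disc Om phi /\ deriv_in_Lp a disc phi.

Definition conformal_regular_pair {R : realType} (a : R)
    (Om1 Om2 : set R[i]^o) :=
  [/\ conformal_regular a Om1, conformal_regular a Om2 &
      exists psi psi_inv : R[i]^o -> R[i]^o,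
        [/\ conformal Om1 Om2 psi,
            {in Om1, cancel psi psi_inv},
            deriv_in_Lp a Om1 psi &
            deriv_in_Lp a Om2 psi_inv]].

(** * The energy functional and the constant C(q) *)

Definition energy {R : realType} (a : R) (phi1 phi2 : R[i]^o -> R[i]^o)
    : \bar R :=
  ((\int[leb2]_(p in plane disc)
     (Num.max
       (mod_deriv phi1 (cplx p) `^ a / mod_deriv phi2 (cplx p) `^ (a - 2))
       (mod_deriv phi2 (cplx p) `^ a / mod_deriv phi1 (cplx p) `^ (a - 2)))%:E)
   `^ a^-1)%E.

Definition weight {R : realType} (phi : R[i]^o -> R[i]^o) (p : R * R) : R :=
  cjacobian phi (cplx p).

(* f_{D,h} *)
Definition wmean {R : realType} (h f : R * R -> R) : R :=
  (\int[leb2]_(p in plane disc) h p)^-1 *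
  \int[leb2]_(p in plane disc) (f p * h p).

(* the best constant is +oo if no real constant is admissible *)
Definition best_constant {R : realType} (h : R * R -> R) (q : R) : \bar R :=
  ereal_inf [set K%:E | K in [set K : R | 0 <= K /\
    forall f, W12w (plane disc) h f ->
      ((\int[leb2]_(p in plane disc) (`|f p - wmean h f| `^ q * h p)%:E) `^ q^-1
       <= K%:E * (\int[leb2]_(p in plane disc) (grad_sqr (plane disc) f p)%:E)
                   `^ 2^-1)%E]].

Definition Cq {R : realType} (phi1 phi2 : R[i]^o -> R[i]^o) (q : R) : \bar R :=
  Order.max (best_constant (weight phi1) q) (best_constant (weight phi2) q).

(* Main.v *)
(** Composition with [phi_k] turns the Neumann problem on [Om_k] into the weighted
    problem int |grad f|^2 = lambda int |f|^2 h_k on the disc, h_k = |phi_k'|^2,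
    because the Dirichlet integral is conformally invariant.  Hoelder's inequality
    with the exponents (4 alpha/(alpha - 2), 2, alpha) and the definition of C give
      int |f - m_1|^2 |h_1 - h_2| <= M int |grad f|^2,
      M = C^2 E (int |h_1 - h_2|)^(1/2),
    where m_k is the h_k-mean of f.  Suppose int |grad f|^2 <= L int |f|^2 h_2 on an
    n-dimensional space with L M < 1.  Replace the space by the constants plus its
    elements of h_2-mean zero; there, since means minimize the variance,
      int |grad f|^2 <= L int |f - m_2|^2 h_2 <= L int |f - m_1|^2 h_2
                     <= L (int |f|^2 h_1 + M int |grad f|^2),
    so the space realizes the level L / (1 - L M) for h_1.  Letting L tend to
    lambda_n[Om_2] yields lambda_n[Om_1] - lambda_n[Om_2] <=
    lambda_n[Om_1] lambda_n[Om_2] M, and int |h_1 - h_2| is the sum of measures in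
    the theorem by the area formula.

    Complex analysis (Goursat's theorem with a removable singularity, Cauchy's
    formula, non-vanishing derivative of a univalent map) enters only to show that
    conformal maps and their inverses are smooth, so that weak gradients can be
    pulled back along them. *)
Require Import Defs.
From HB Require Import structures.
From mathcomp Require Import all_boot all_order all_algebra.
From mathcomp Require Import all_classical all_reals all_analysis.
From mathcomp Require Import ring lra measurable_realfun.

Set Implicit Arguments.
Unset Strict Implicit.
Unset Printing Implicit Defensive.

Import Order.TTheory GRing.Theory Num.Theory.
Import numFieldNormedType.Exports.
Import ComplexField.Normc.

Local Open Scope classical_set_scope.
Local Open Scope ring_scope.

Local Notation Re := complex.Re.
Local Notation Im := complex.Im.

(** Conformal invariance is needed for weak gradients of arbitrary Sobolev functions. The chain rule
    is carried by the test functions: a test function on one domain, composed with the inverse map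
    and multiplied by the real or imaginary part of the derivative of that inverse, is a test
    function on the other domain, and the Cauchy-Riemann equations cancel the extra terms. This is
    what asks for smoothness of the maps in both directions. Rectangles take the place of curves.
    One bisection principle gives both Goursat's theorem and the area formula, and Cauchy's formula
    keeps the integral of 1/(w - z) as an unevaluated nonzero factor. The spectrum enters through
    levels realized on finite-dimensional spaces, hence the passage to the limit in L. The
    right-hand side of the theorem is an extended real with 0 * oo = 0. An infinite constant or
    energy makes the claim trivial only when all other factors are positive, so positivity of the
    best constant is proved and the cases of vanishing eigenvalues and of equal Jacobians are
    treated apart. *)

Section ComplexDerivative.
Context {R : realType}.
Implicit Types (f g : R[i] -> R[i]) (z w d : R[i]) (r : R).

Lemma normc_ge0 z : 0 <= normc z.
Proof. by case: z => a b /=; exact: sqrtr_ge0. Qed.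

Lemma normc_eq0 z : (normc z == 0) = (z == 0).
Proof. by apply/eqP/eqP => [/eq0_normc|->]//; exact: normc0. Qed.

Lemma normc_gt0 z : (0 < normc z) = (z != 0).
Proof. by rewrite lt_neqAle normc_ge0 andbT eq_sym normc_eq0. Qed.

Lemma normcB z w : normc (z - w) = normc (w - z).
Proof. by rewrite -[RHS]normcN opprB. Qed.

Lemma sqr_normc z : normc z ^+ 2 = Re z ^+ 2 + Im z ^+ 2.
Proof. by case: z => a b /=; rewrite sqr_sqrtr// addr_ge0// sqr_ge0. Qed.

Lemma Re_le_normc z : `|Re z| <= normc z.
Proof.
case: z => a b /=; rewrite -sqrtr_sqr ler_sqrt ?addr_ge0 ?sqr_ge0//.
by rewrite lerDl sqr_ge0.
Qed.

Lemma Im_le_normc z : `|Im z| <= normc z.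
Proof.
case: z => a b /=; rewrite -sqrtr_sqr ler_sqrt ?addr_ge0 ?sqr_ge0//.
by rewrite lerDr sqr_ge0.
Qed.

Lemma normc_real r : normc (r%:C)%C = `|r|.
Proof. by rewrite /= expr0n addr0 sqrtr_sqr. Qed.

Lemma normc_le_ReIm z : normc z <= `|Re z| + `|Im z|.
Proof.
rewrite -(@ler_pXn2r _ 2) ?nnegrE ?normc_ge0 ?addr_ge0// sqr_normc.
rewrite -[Re z ^+ 2]real_normK ?num_real// -[Im z ^+ 2]real_normK ?num_real//.
by rewrite sqrrD -addrA lerD2l lerDr mulrn_wge0// mulr_ge0.
Qed.

Lemma ler_normcB z w : normc z - normc w <= normc (z - w).
Proof. by rewrite lerBlDr (le_trans _ (le_normcD _ _))// subrK. Qed.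

(** Multiplying out the difference quotient removes the excluded point [w = z], and [normc] keeps
    every estimate in [R] rather than in the complex numbers. *)
Definition cdiff f z d := forall e : R, 0 < e -> exists2 r : R, 0 < r &
  forall w, normc (w - z) < r ->
    normc (f w - f z - d * (w - z)) <= e * normc (w - z).

Definition ccont f z := forall e : R, 0 < e -> exists2 r : R, 0 < r &
  forall w, normc (w - z) < r -> normc (f w - f z) < e.

Lemma derivable_cdiff (f : R[i]^o -> R[i]^o) (z : R[i]^o) :
  derivable f z 1 -> cdiff f z (derive1 f z).
Proof.
move=> df e e0.
have /cvgrPdist_le/(_ (e%:C)%C) : h^-1 *: (f (h + z) - f z) @[h --> 0^'] --> derive1 f z.
  rewrite /derive1; move: df; rewrite /derivable.
  have -> // : (fun h : R[i] => h^-1 *: ((f \o shift z) (h *: (1 : R[i]^o)) - f z)) =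
     (fun h : R[i] => h^-1 *: (f (h + z) - f z)).
  by apply/funext => h /=; rewrite [h *: _]mulr1.
have e0' : 0 < (e%:C)%C by rewrite ltcR.
move=> /(_ e0'); rewrite /dnbhs near_withinE => /nbhs_ballP[[a b]] /=.
(* Radii of balls in [R[i]^o] are complex numbers; positivity says that the imaginary part is zero
   and the real part positive. *)
rewrite ltcE/= => /andP[/eqP -> a0] H; exists a => // w wz.
have [->|wz0] := eqVneq w z.
  by rewrite !subrr mulr0 subrr normc0 mulr0.
have /(_ _) := H (w - z); rewrite /ball/= sub0r normrN subr_eq0.
move=> /(_ _ wz0); rewrite /GRing.scale/= subrK.
rewrite {1}/Num.norm/= ltcR => /(_ wz).
rewrite /Num.norm/= lecR => H'.
have -> : f w - f z - derive1 f z * (w - z) =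
   - ((derive1 f z - (w - z)^-1 * (f w - f z)) * (w - z)).
  by rewrite mulrBl mulrAC mulVf ?subr_eq0// mul1r opprB.
rewrite normcN normcM; apply: ler_wpM2r => //; exact: normc_ge0.
Qed.

Lemma cdiff_ccont f z d : cdiff f z d -> ccont f z.
Proof.
move=> /(_ 1 ltr01) [r r0 H] e e0.
have k0 : 0 < 1 + normc d by rewrite ltr_wpDr// normc_ge0.
exists (Num.min r (e / (1 + normc d))); first by rewrite lt_min r0 divr_gt0.
move=> w; rewrite lt_min => /andP[wr we].
have -> : f w - f z = (f w - f z - d * (w - z)) + d * (w - z) by ring.
apply: (le_lt_trans (le_normcD _ _)); rewrite normcM.
apply: (@le_lt_trans _ _ ((1 + normc d) * normc (w - z))).
  by rewrite mulrDl lerD2r H.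
by rewrite mulrC -ltr_pdivlMr.
Qed.

Lemma cdiff_unique f z d d' : cdiff f z d -> cdiff f z d' -> d = d'.
Proof.
move=> H H'; apply/eqP; rewrite -subr_eq0 -normc_eq0; apply/negPn/negP.
rewrite -normr_eq0 -normr_gt0 normr_id ger0_norm ?normc_ge0// => e0.
have [r r0 {}H] := H _ (divr_gt0 e0 (ltr0n _ 4)).
have [r' r'0 {}H'] := H' _ (divr_gt0 e0 (ltr0n _ 4)).
(* Both expansions are tested on the same real increment [m]; together their errors are at most half
   of |d - d'| m, which contradicts that d m - d' m has modulus |d - d'| m. *)
pose m := Num.min r r' / 2.
have m0 : 0 < m by rewrite divr_gt0// lt_min r0.
have mr : m < r /\ m < r'.
  have : m < Num.min r r' by rewrite /m ltr_pdivrMr// mulr_natr mulr2n ltrDl lt_min r0.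
  by rewrite lt_min => /andP.
have nm : normc (z + (m%:C)%C - z) = m.
  by rewrite addrC addKr normc_real gtr0_norm.
have := H (z + (m%:C)%C); rewrite nm => /(_ mr.1) h1.
have := H' (z + (m%:C)%C); rewrite nm => /(_ mr.2) h2.
have : normc ((d - d') * (z + (m%:C)%C - z)) <= normc (d - d') / 2 * m.
  rewrite (_ : _ * _ = (f (z + (m%:C)%C) - f z - d' * (z + (m%:C)%C - z)) -
      (f (z + (m%:C)%C) - f z - d * (z + (m%:C)%C - z))); last by ring.
  apply: (le_trans (le_normcD _ _)); rewrite normcN.
  apply: (le_trans (lerD h2 h1)); rewrite -mulrDl; apply: ler_wpM2r; first exact: ltW.
  by lra.
rewrite normcM nm ler_pM2r//; lra.
Qed.

Lemma cdiff_cst (c z : R[i]) : cdiff (fun=> c) z 0.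
Proof.
move=> e e0; exists 1 => // w _.
by rewrite subrr mul0r subrr normc0 mulr_ge0 ?normc_ge0 ?ltW.
Qed.

Lemma cdiff_id z : cdiff id z 1.
Proof.
move=> e e0; exists 1 => // w _.
by rewrite mul1r subrr normc0 mulr_ge0 ?normc_ge0 ?ltW.
Qed.

Lemma cdiff_near f g z d : (exists2 r, 0 < r & forall w, normc (w - z) < r -> f w = g w) ->
  cdiff f z d -> cdiff g z d.
Proof.
move=> [r r0 fg] H e e0; have [r' r'0 {}H] := H e e0.
exists (Num.min r r'); first by rewrite lt_min r0.
move=> w; rewrite lt_min => /andP[wr wr'].
by rewrite -!fg ?H// subrr normc0.
Qed.

Lemma cdiffD f g z d d' : cdiff f z d -> cdiff g z d' ->
  cdiff (fun x => f x + g x) z (d + d').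
Proof.
move=> H H' e e0.
have [r r0 {}H] := H _ (divr_gt0 e0 (ltr0n _ 2)).
have [r' r'0 {}H'] := H' _ (divr_gt0 e0 (ltr0n _ 2)).
exists (Num.min r r'); first by rewrite lt_min r0.
move=> w; rewrite lt_min => /andP[wr wr'].
have -> : f w + g w - (f z + g z) - (d + d') * (w - z) =
  (f w - f z - d * (w - z)) + (g w - g z - d' * (w - z)) by ring.
apply: (le_trans (le_normcD _ _)); apply: (le_trans (lerD (H _ wr) (H' _ wr'))).
by rewrite -mulrDl -splitr.
Qed.

Lemma cdiffM f g z d d' : cdiff f z d -> cdiff g z d' ->
  cdiff (fun x => f x * g x) z (d * g z + f z * d').
Proof.
move=> H H' e e0.
have cg := cdiff_ccont H'.
have [r1 r10 cg1] := cg 1 ltr01.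
have kg : 0 < normc (g z) + 1 by rewrite ltr_wpDl// normc_ge0.
have kf : 0 < normc (f z) + 1 by rewrite ltr_wpDl// normc_ge0.
have kd : 0 < normc d + 1 by rewrite ltr_wpDl// normc_ge0.
have e3 : 0 < e / 3 by rewrite divr_gt0.
have [r2 r20 cg2] := cg _ (divr_gt0 e3 kd).
have [r3 r30 {}H] := H _ (divr_gt0 e3 kg).
have [r4 r40 {}H'] := H' _ (divr_gt0 e3 kf).
exists (Num.min (Num.min r1 r2) (Num.min r3 r4)).
  by rewrite !lt_min r10 r20 r30.
move=> w; rewrite !lt_min => /andP[/andP[wr1 wr2] /andP[wr3 wr4]].
have -> : f w * g w - f z * g z - (d * g z + f z * d') * (w - z) =
  (f w - f z - d * (w - z)) * g w + d * (g w - g z) * (w - z)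
  + f z * (g w - g z - d' * (w - z)) by ring.
have h0 : 0 <= normc (w - z) by exact: normc_ge0.
have gw : normc (g w) <= normc (g z) + 1.
  have := cg1 _ wr1; have := ler_normcB (g w) (g z); lra.
apply: (le_trans (le_normcD _ _)).
have T1 : normc ((f w - f z - d * (w - z)) * g w) <= e / 3 * normc (w - z).
  rewrite normcM; apply: (le_trans (ler_pM _ _ (H _ wr3) gw)); rewrite ?normc_ge0//.
  by rewrite mulrAC divfK// gt_eqF.
have T2 : normc (d * (g w - g z) * (w - z)) <= e / 3 * normc (w - z).
  rewrite !normcM; apply: ler_wpM2r => //.
  have dk : normc d <= normc d + 1 by rewrite lerDl.
  apply: (le_trans (ler_pM _ _ dk (ltW (cg2 _ wr2)))); rewrite ?normc_ge0//.
  by rewrite mulrC divfK// gt_eqF.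
have T3 : normc (f z * (g w - g z - d' * (w - z))) <= e / 3 * normc (w - z).
  have dk : normc (f z) <= normc (f z) + 1 by rewrite lerDl.
  rewrite normcM; apply: (le_trans (ler_pM _ _ dk (H' _ wr4))); rewrite ?normc_ge0//.
  by rewrite mulrA [X in X * _]mulrC divfK// gt_eqF.
have := le_normcD ((f w - f z - d * (w - z)) * g w) (d * (g w - g z) * (w - z)).
lra.
Qed.

Lemma cdiffZ (c : R[i]) f z d : cdiff f z d -> cdiff (fun x => c * f x) z (c * d).
Proof. by move=> H; have := cdiffM (cdiff_cst c z) H; rewrite mul0r add0r. Qed.

Lemma cdiffB f g z d d' : cdiff f z d -> cdiff g z d' ->
  cdiff (fun x => f x - g x) z (d - d').
Proof.
move=> H /(cdiffZ (-1)) H'; have := cdiffD H H'; rewrite mulN1r.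
by apply: cdiff_near; exists 1 => // w _; rewrite mulN1r.
Qed.

Lemma cdiff_comp f g z d d' : cdiff f z d -> cdiff g (f z) d' ->
  cdiff (fun x => g (f x)) z (d' * d).
Proof.
move=> H H' e e0.
have kd : 0 < normc d + 1 by rewrite ltr_wpDl// normc_ge0.
have kd' : 0 < normc d' + 1 by rewrite ltr_wpDl// normc_ge0.
have e2 : 0 < e / 2 by rewrite divr_gt0.
have [r1 r10 H1] := H 1 ltr01.
have [r2 r20 H2] := H _ (divr_gt0 e2 kd').
have [r3 r30 H3] := H' _ (divr_gt0 e2 kd).
have [r4 r40 H4] := cdiff_ccont H r30.
exists (Num.min (Num.min r1 r2) r4); first by rewrite !lt_min r10 r20.
move=> w; rewrite !lt_min => /andP[/andP[wr1 wr2] wr4].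
have -> : g (f w) - g (f z) - d' * d * (w - z) =
  (g (f w) - g (f z) - d' * (f w - f z)) + d' * (f w - f z - d * (w - z)) by ring.
have h0 : 0 <= normc (w - z) by exact: normc_ge0.
have fw : normc (f w - f z) <= (normc d + 1) * normc (w - z).
  have -> : f w - f z = (f w - f z - d * (w - z)) + d * (w - z) by ring.
  apply: (le_trans (le_normcD _ _)); rewrite normcM mulrDl addrC lerD2l.
  exact: H1.
apply: (le_trans (le_normcD _ _)).
have T1 := H3 _ (H4 _ wr4).
have T2 : normc (g (f w) - g (f z) - d' * (f w - f z)) <= e / 2 * normc (w - z).
  apply: (le_trans T1).
  apply: (@le_trans _ _ (e / 2 / (normc d + 1) * ((normc d + 1) * normc (w - z)))).
    by apply: ler_wpM2l => //; rewrite ltW// divr_gt0.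
  by rewrite mulrA divfK// gt_eqF.
have T3 : normc (d' * (f w - f z - d * (w - z))) <= e / 2 * normc (w - z).
  have dk : normc d' <= normc d' + 1 by rewrite lerDl.
  rewrite normcM; apply: (le_trans (ler_pM _ _ dk (H2 _ wr2))); rewrite ?normc_ge0//.
  by rewrite mulrA [X in X * _]mulrC divfK// gt_eqF.
lra.
Qed.

Lemma cdiffV z : z != 0 -> cdiff (fun x => x^-1) z (- z^-1 ^+ 2).
Proof.
move=> z0 e e0.
have nz : 0 < normc z by rewrite normc_gt0.
have k0 : 0 < e * normc z ^+ 3 / 2 by rewrite divr_gt0// mulr_gt0// exprn_gt0.
(* The remainder is (w - z)^2 / (z^2 w). The first bound gives |w| > |z| / 2, so its modulus is at
   most 2 |w - z|^2 / |z|^3, and the second bound absorbs one factor |w - z|. *)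
exists (Num.min (normc z / 2) (e * normc z ^+ 3 / 2)).
  by rewrite lt_min k0 andbT divr_gt0.
move=> w; rewrite lt_min => /andP[w1 w2].
have wz : normc z / 2 < normc w.
  by have := ler_normcB z (z - w); rewrite subKr (normcB z); lra.
have w0 : w != 0 by rewrite -normc_gt0 (lt_trans _ wz)// divr_gt0.
have -> : w^-1 - z^-1 - - z^-1 ^+ 2 * (w - z) = (w - z) ^+ 2 * (z ^+ 2 * w)^-1.
  by field; rewrite w0 z0.
rewrite normcM normcV !normcM.
rewrite -mulrA mulrC; apply: ler_wpM2r; first exact: normc_ge0.
rewrite ler_pdivrMr; last by rewrite !mulr_gt0// (lt_trans _ wz)// divr_gt0.
apply: (le_trans (ltW w2)).
have -> : e * normc z ^+ 3 / 2 = e * ((normc z * normc z) * (normc z / 2)).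
  by rewrite !exprS expr0; field.
by rewrite ler_pM2l// ler_pM2l ?mulr_gt0// ltW.
Qed.

Lemma cdiff_div f g z d d' : g z != 0 -> cdiff f z d -> cdiff g z d' ->
  cdiff (fun x => f x / g x) z (d / g z - f z * d' / g z ^+ 2).
Proof.
move=> gz H H'; have := cdiffM H (cdiff_comp H' (cdiffV gz)).
by congr cdiff; rewrite exprVn; ring.
Qed.

Lemma ccontM f g z : ccont f z -> ccont g z -> ccont (fun x => f x * g x) z.
Proof.
move=> H H' e e0.
have kg : 0 < normc (g z) + 1 by rewrite ltr_wpDl// normc_ge0.
have kf : 0 < normc (f z) + 1 by rewrite ltr_wpDl// normc_ge0.
have e2 : 0 < e / 2 by rewrite divr_gt0.
have [r1 r10 H1] := H' 1 ltr01.
have [r2 r20 H2] := H _ (divr_gt0 e2 kg).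
have [r3 r30 H3] := H' _ (divr_gt0 e2 kf).
exists (Num.min (Num.min r1 r2) r3); first by rewrite !lt_min r10 r20.
move=> w; rewrite !lt_min => /andP[/andP[wr1 wr2] wr3].
have -> : f w * g w - f z * g z = (f w - f z) * g w + f z * (g w - g z) by ring.
have gw : normc (g w) <= normc (g z) + 1.
  have := H1 _ wr1; have := ler_normcB (g w) (g z); lra.
apply: (le_lt_trans (le_normcD _ _)); rewrite !normcM.
have T1 : normc (f w - f z) * normc (g w) <= e / 2.
  apply: (le_trans (ler_pM _ _ (ltW (H2 _ wr2)) gw)); rewrite ?normc_ge0//.
  by rewrite divfK// gt_eqF.
have T2 : normc (f z) * normc (g w - g z) < e / 2.
  apply: (@le_lt_trans _ _ (normc (f z) * (e / 2 / (normc (f z) + 1)))).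
    by apply: ler_wpM2l; [exact: normc_ge0|exact: ltW (H3 _ wr3)].
  rewrite mulrA ltr_pdivrMr// mulrC ltr_pM2l//; lra.
lra.
Qed.

Lemma ccontD f g z : ccont f z -> ccont g z -> ccont (fun x => f x + g x) z.
Proof.
move=> H H' e e0; have e2 : 0 < e / 2 by rewrite divr_gt0.
have [r2 r20 H2] := H _ e2.
have [r3 r30 H3] := H' _ e2.
exists (Num.min r2 r3); first by rewrite !lt_min r20.
move=> w; rewrite !lt_min => /andP[wr2 wr3].
have -> : f w + g w - (f z + g z) = (f w - f z) + (g w - g z) by ring.
apply: (le_lt_trans (le_normcD _ _)); have := H2 _ wr2; have := H3 _ wr3; lra.
Qed.

End ComplexDerivative.

(** * Nested bisection of a rectangle *)

Section Bisection.
Context {R : realType}.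
Variables (w h : R) (L : R -> R -> R -> R).

(** The fourth quarter is taken without a test: subadditivity makes it good as soon as the other
    three are not. *)
Let step (e : R) (p : R * R * R) : R * R * R :=
  let: (x, y, s) := p in
  let s' := s / 2 in
  let good a b := e * s' ^+ 2 <= L a b s' in
  if good x y then (x, y, s') else
  if good (x + w * s') y then (x + w * s', y, s') else
  if good x (y + h * s') then (x, y + h * s', s') else
  (x + w * s', y + h * s', s').

(** Here [L x y s] is a quantity attached to the rectangle with lower left corner (x, y) and sides
    [w * s], [h * s]. If its value e at scale 1 were positive, some quarter would keep at least the
    share e s^2 at every stage; the nested quarters shrink to a point, where the local bound with e
    / 2 is violated. This serves Goursat's theorem and the area formula. *)
Lemma bisection (x0 y0 : R) : 0 < w -> 0 < h ->
  (forall x y s, 0 < s -> x0 <= x -> x + w * s <= x0 + w ->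
     y0 <= y -> y + h * s <= y0 + h ->
     L x y s <= L x y (s / 2) + L (x + w * (s / 2)) y (s / 2) +
       (L x (y + h * (s / 2)) (s / 2) +
        L (x + w * (s / 2)) (y + h * (s / 2)) (s / 2))) ->
  (forall p q, x0 <= p <= x0 + w -> y0 <= q <= y0 + h ->
    forall e, 0 < e -> exists2 d, 0 < d & forall x y s, 0 < s < d ->
      x0 <= x -> x + w * s <= x0 + w ->
      y0 <= y -> y + h * s <= y0 + h ->
      x <= p <= x + w * s -> y <= q <= y + h * s ->
      L x y s <= e * s ^+ 2) ->
  L x0 y0 1 <= 0.
Proof.
move=> w0 h0 Lsub Lloc; rewrite leNgt; apply/negP => e0.
set e := L x0 y0 1 in e0.
pose u n := iter n (step e) (x0, y0, 1).
pose X n := (u n).1.1; pose Y n := (u n).1.2; pose S n := (u n).2.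
have SE n : S n = 2^-1 ^+ n.
  rewrite /S; elim: n => [|n]; first by rewrite expr0.
  rewrite /u iterS; case: (iter n _ _) => [[x y] s] /= ->.
  by do 3?case: ifPn => _ /=; rewrite exprS mulrC.
have S0 n : 0 < S n by rewrite SE exprn_gt0// invr_gt0.
have inv n : [/\ x0 <= X n, X n + w * S n <= x0 + w, y0 <= Y n,
    Y n + h * S n <= y0 + h & e * S n ^+ 2 <= L (X n) (Y n) (S n)] /\
    [/\ X n <= X n.+1, X n.+1 + w * S n.+1 <= X n + w * S n,
        Y n <= Y n.+1 & Y n.+1 + h * S n.+1 <= Y n + h * S n].
  have stepP m : [/\ x0 <= X m, X m + w * S m <= x0 + w, y0 <= Y m,
     Y m + h * S m <= y0 + h & e * S m ^+ 2 <= L (X m) (Y m) (S m)] ->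
     [/\ X m <= X m.+1, X m.+1 + w * S m.+1 <= X m + w * S m,
        Y m <= Y m.+1 & Y m.+1 + h * S m.+1 <= Y m + h * S m] /\
     e * S m.+1 ^+ 2 <= L (X m.+1) (Y m.+1) (S m.+1).
    have := S0 m; rewrite /X /Y /S /u iterS; case: (iter m _ _) => [[x y] s] /= s0.
    move=> [h1 h2 h3 h4 h5]; have := Lsub _ _ _ s0 h1 h2 h3 h4.
    have ws : 0 < w * s by rewrite mulr_gt0.
    have hs : 0 < h * s by rewrite mulr_gt0.
    have E : e * s ^+ 2 = e * (s / 2) ^+ 2 + e * (s / 2) ^+ 2 + (e * (s / 2) ^+ 2 + e * (s / 2) ^+ 2).
      by field.
    move: h5; rewrite E; set A := e * (s / 2) ^+ 2.
    have hw : w * (s / 2) = w * s / 2 by rewrite mulrA.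
    have hh : h * (s / 2) = h * s / 2 by rewrite mulrA.
    case: ifPn => /=; first by move=> K _ _; split; [split; clear K; lra|exact: K].
    rewrite -ltNge => H1; case: ifPn => /=; first by move=> K _ _; split; [split; clear K; lra|exact: K].
    rewrite -ltNge => H2; case: ifPn => /=; first by move=> K _ _; split; [split; clear K; lra|exact: K].
    rewrite -ltNge => H3 h5 h6; rewrite -/A; split; last by lra.
    by clear h5 h6; split; lra.
  suff H m : [/\ x0 <= X m, X m + w * S m <= x0 + w, y0 <= Y m,
     Y m + h * S m <= y0 + h & e * S m ^+ 2 <= L (X m) (Y m) (S m)].
    by split => //; have [] := stepP _ (H n).
  elim: m => [|m IH].
    by rewrite /X/Y/S/u/= !mulr1 expr1n mulr1; split.
  have [[h1 h2 h3 h4] h5] := stepP _ IH; case: IH => *.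
  by split; lra.
have X00 : X 0 = x0 /\ Y 0 = y0 /\ S 0 = 1 by [].
clearbody X Y S.
have mono m n : (m <= n)%N -> [/\ X m <= X n, X n + w * S n <= X m + w * S m,
     Y m <= Y n & Y n + h * S n <= Y m + h * S m].
  elim: n => [|n IH]; first by rewrite leqn0 => /eqP ->; split.
  rewrite leq_eqVlt => /orP[/eqP ->|]; first by split.
  rewrite ltnS => /IH[? ? ? ?]; have [_ [? ? ? ?]] := inv n.
  by split; lra.
have nest m n : X n <= X m + w * S m /\ Y n <= Y m + h * S m.
  have ? := mulr_gt0 w0 (S0 m); have ? := mulr_gt0 w0 (S0 n).
  have ? := mulr_gt0 h0 (S0 m); have ? := mulr_gt0 h0 (S0 n).
  by case: (leqP m n) => [|/ltnW] /mono[? ? ? ?]; split; lra.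
(* Left and lower corners increase and stay below all right and upper corners, so their suprema lie
   in every nested rectangle. *)
pose p := sup (range X); pose q := sup (range Y).
have pX n : X n <= p <= X n + w * S n.
  apply/andP; split.
    apply: ub_le_sup; last by exists n.
    by exists (X 0 + w * S 0) => _ [m _ <-]; exact: (nest 0 m).1.
  apply: ge_sup; first by exists (X 0), 0.
  by move=> _ [m _ <-]; exact: (nest n m).1.
have qY n : Y n <= q <= Y n + h * S n.
  apply/andP; split.
    apply: ub_le_sup; last by exists n.
    by exists (Y 0 + h * S 0) => _ [m _ <-]; exact: (nest 0 m).2.
  apply: ge_sup; first by exists (Y 0), 0.
  by move=> _ [m _ <-]; exact: (nest n m).2.
have [|||d d0 H] := Lloc p q _ _ (e / 2).
- by have := pX 0; rewrite X00.1 X00.2.2 mulr1.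
- by have := qY 0; rewrite X00.2.1 X00.2.2 mulr1.
- by rewrite divr_gt0.
have [n Sn] : exists n, S n < d.
  have /cvgrPdist_lt/(_ _ d0)[n _ /(_ n (leqnn n))] : (fun n => 2^-1 ^+ n : R) @ \oo --> 0.
    by apply: cvg_expr; rewrite gtr0_norm ?invr_gt0// invf_lt1// ltr1n.
  rewrite /= sub0r normrN -SE gtr0_norm// => ?; by exists n.
have [[h1 h2 h3 h4 h5] _] := inv n.
have := H (X n) (Y n) (S n); rewrite S0 Sn => /(_ isT h1 h2 h3 h4 (pX n) (qY n)) h6.
have := le_trans h5 h6; rewrite ler_pM2r ?exprn_gt0//; lra.
Qed.

End Bisection.

(** * Integrals of complex functions over real segments *)

Section ComplexIntegral.
Context {R : realType}.
Local Notation mu := (@lebesgue_measure R).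
Implicit Types (f g : R -> R[i]) (a b t : R) (z c : R[i]).

Definition cint a b f : R[i] :=
  Complex (\int[mu]_(t in `[a, b]) Re (f t)) (\int[mu]_(t in `[a, b]) Im (f t)).

(** The point [s] ranges over a full neighbourhood of [t], also at the end points, since the
    integrands are restrictions of functions continuous around the contour. *)
Definition pcont a b f := forall t, a <= t <= b -> forall e : R, 0 < e ->
  exists2 r : R, 0 < r & forall s, `|s - t| < r -> normc (f s - f t) < e.

Lemma cReB z c : Re (z - c) = Re z - Re c.
Proof. by case: z c => [? ?] []. Qed.

Lemma cImB z c : Im (z - c) = Im z - Im c.
Proof. by case: z c => [? ?] []. Qed.

Lemma cReD z c : Re (z + c) = Re z + Re c.
Proof. by case: z c => [? ?] []. Qed.

Lemma cImD z c : Im (z + c) = Im z + Im c.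
Proof. by case: z c => [? ?] []. Qed.

Lemma cReM z c : Re (z * c) = Re z * Re c - Im z * Im c.
Proof. by case: z c => [? ?] []. Qed.

Lemma cImM z c : Im (z * c) = Re z * Im c + Im z * Re c.
Proof. by case: z c => [? ?] []. Qed.

Lemma pcont_Re a b f : pcont a b f -> {within `[a, b], continuous (fun t => Re (f t))}.
Proof.
move=> H; apply: continuous_in_subspaceT => t; rewrite inE/= in_itv/= => tab.
apply/cvgrPdist_lt => e e0; have [r r0 {}H] := H t tab e e0.
near=> s; rewrite -cReB; apply: (le_lt_trans (Re_le_normc _)).
by rewrite normcB H// distrC; near: s; exact: cvgr_dist_lt.
Unshelve. all: by end_near. Qed.

Lemma pcont_Im a b f : pcont a b f -> {within `[a, b], continuous (fun t => Im (f t))}.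
Proof.
move=> H; apply: continuous_in_subspaceT => t; rewrite inE/= in_itv/= => tab.
apply/cvgrPdist_lt => e e0; have [r r0 {}H] := H t tab e e0.
near=> s; rewrite -cImB; apply: (le_lt_trans (Im_le_normc _)).
by rewrite normcB H// distrC; near: s; exact: cvgr_dist_lt.
Unshelve. all: by end_near. Qed.

Lemma pcont_integrable a b f : pcont a b f ->
  mu.-integrable `[a, b] (EFin \o (fun t => Re (f t))) /\
  mu.-integrable `[a, b] (EFin \o (fun t => Im (f t))).
Proof.
move=> H; split; apply: continuous_compact_integrable; first exact: segment_compact.
- exact: pcont_Re.
- exact: segment_compact.
- exact: pcont_Im.
Qed.

Lemma cint_cst a b c : a <= b -> cint a b (fun=> c) = ((b - a)%:C)%C * c.
Proof.
move=> ab; rewrite /cint !Rintegral_cst//= !lebesgue_measure_itv/= lte_fin.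
have -> : fine (if (a < b)%R then (b%:E + (- a)%R%:E)%E else 0%E) = b - a.
  by case: ltP => //= ba; apply/eqP; rewrite eq_sym subr_eq0 eq_le ab ba.
by case: c => x y /=; rewrite [RHS]/GRing.mul/= !mul0r subr0 addr0; congr Complex; rewrite mulrC.
Qed.

Lemma cintD a b f g : pcont a b f -> pcont a b g ->
  cint a b (fun t => f t + g t) = cint a b f + cint a b g.
Proof.
move=> /pcont_integrable[f1 f2] /pcont_integrable[g1 g2]; rewrite /cint.
rewrite [RHS]/GRing.add/= -!RintegralD//.
by congr Complex; apply: eq_Rintegral => t _; rewrite ?cReD ?cImD.
Qed.

Lemma cintZ a b c f : pcont a b f -> cint a b (fun t => c * f t) = c * cint a b f.
Proof.
move=> /pcont_integrable[f1 f2]; rewrite /cint.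
case: c => x y; rewrite [RHS]/GRing.mul/=.
rewrite -!RintegralZl// -RintegralB//; last 2 first.
- exact: (integrableZl _ _ f1).
- exact: (integrableZl _ _ f2).
rewrite -RintegralD//; last 2 first.
- exact: (integrableZl _ _ f2).
- exact: (integrableZl _ _ f1).
by congr Complex; apply: eq_Rintegral => t _; rewrite ?cReM ?cImM.
Qed.

Lemma eq_cint a b f g : (forall t, a <= t <= b -> f t = g t) -> cint a b f = cint a b g.
Proof.
move=> fg; rewrite /cint; congr Complex; apply: eq_Rintegral => t;
  by rewrite inE/= in_itv/= => /fg ->.
Qed.

(** Real and imaginary parts are estimated separately, whence the factor 2; only the order of
    magnitude matters later. *)
Lemma normc_cint a b f (M : R) : a <= b -> pcont a b f ->
  (forall t, a <= t <= b -> normc (f t) <= M) -> normc (cint a b f) <= 2 * M * (b - a).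
Proof.
move=> ab /pcont_integrable[f1 f2] fM.
apply: (le_trans (normc_le_ReIm _)); rewrite /cint/= mulrAC mulr_natl mulr2n mulrDl.
have E : \int[mu]_(t in `[a, b]) M = M * (b - a).
  rewrite Rintegral_cst//= lebesgue_measure_itv/= lte_fin.
  by case: ltP => //= ba; rewrite (_ : b = a) ?subrr ?mulr0//; apply/eqP; rewrite eq_le ab ba.
have iM : mu.-integrable `[a, b] (EFin \o cst M).
  apply: continuous_compact_integrable; first exact: segment_compact.
  by apply: continuous_subspaceT => x; exact: cst_continuous.
rewrite [X in _ <= X + _]mulrC [X in _ <= _ + X]mulrC -E; apply: lerD;
  apply: (le_trans (le_normr_Rintegral _ _)) => //; apply: le_Rintegral => //;
  do ?by apply: (@integrable_norm _ _ _ mu _ (_ : R -> R)).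
- move=> t; rewrite /= in_itv/= => /fM; apply: le_trans; exact: Re_le_normc.
- move=> t; rewrite /= in_itv/= => /fM; apply: le_trans; exact: Im_le_normc.
Qed.

Lemma Rintegral_split (h : R -> R) a b m : a <= m <= b ->
  mu.-integrable `[a, b] (EFin \o h) ->
  \int[mu]_(t in `[a, b]) h t = \int[mu]_(t in `[a, m]) h t + \int[mu]_(t in `[m, b]) h t.
Proof.
move=> /andP[am mb] ih.
have := Rintegral_itvB (x := m) ih.
rewrite !bnd_simp => /(_ am mb) E.
rewrite -[X in _ = _ + X]Rintegral_itv_obnd_cbnd; last first.
  by apply: (integrableS _ _ _ ih) => //; apply: subset_itv; rewrite bnd_simp.
by rewrite -E addrC subrK.
Qed.

Lemma cint_split a b m f : a <= m <= b -> pcont a b f ->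
  cint a b f = cint a m f + cint m b f.
Proof.
move=> amb /pcont_integrable[f1 f2].
by rewrite /cint (Rintegral_split amb f1) (Rintegral_split amb f2).
Qed.

Lemma cint_id a b : a <= b -> cint a b (fun t => (t%:C)%C) = (((b ^+ 2 - a ^+ 2) / 2)%:C)%C.
Proof.
rewrite le_eqVlt => /predU1P[->|ab].
  by rewrite /cint set_itv1 !Rintegral_set1 subrr mul0r.
rewrite /cint /= Rintegral_cst//= mul0r; congr Complex.
rewrite /Rintegral (@continuous_FTC2 _ (fun t => t) (fun t => t ^+ 2 / 2) a b)//.
- by rewrite -EFinB/= mulrBl.
- by apply: continuous_subspaceT => x; exact: cvg_id.
- split.
  + move=> x _; exact: derivableM.
  + apply: cvg_at_right_filter; apply: cvgM; last exact: cvg_cst.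
    exact: exprn_continuous.
  + apply: cvg_at_left_filter; apply: cvgM; last exact: cvg_cst.
    exact: exprn_continuous.
- move=> x _; rewrite derive1E deriveM// exp_derive derive_cst.
  by rewrite /GRing.scale/= !mulr0 add0r expr1 !mulr1; field.
Qed.

End ComplexIntegral.

(** * Goursat's theorem *)

Section Goursat.
Context {R : realType}.
Implicit Types (f g F : R[i] -> R[i]) (a b c d t : R) (z w p : R[i]).

(** The contour integral of f dz along the boundary of the rectangle, counterclockwise; on the
    vertical sides dz = i dt. *)
Definition bint f a b c d : R[i] :=
  cint a b (fun t => f (Complex t c)) - cint a b (fun t => f (Complex t d)) +
  'i%C * (cint c d (fun t => f (Complex b t)) - cint c d (fun t => f (Complex a t))).

Definition rect a b c d : set R[i] := [set z | a <= Re z <= b /\ c <= Im z <= d].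

Definition brect a b c d : set R[i] :=
  [set z | rect a b c d z /\ (Re z = a \/ Re z = b \/ Im z = c \/ Im z = d)].

Lemma normc_re (s t c : R) : normc (Complex s c - Complex t c) = `|s - t|.
Proof. by rewrite /= subrr expr0n addr0 sqrtr_sqr. Qed.

Lemma normc_im (s t c : R) : normc (Complex c s - Complex c t) = `|s - t|.
Proof. by rewrite /= subrr expr0n add0r sqrtr_sqr. Qed.

Lemma pcont_re f a b c : (forall t, a <= t <= b -> ccont f (Complex t c)) ->
  pcont a b (fun t => f (Complex t c)).
Proof.
move=> H t /H{}H e /H [r r0 {}H]; exists r => // s st; apply: H; by rewrite normc_re.
Qed.

Lemma pcont_im f a b c : (forall t, a <= t <= b -> ccont f (Complex c t)) ->
  pcont a b (fun t => f (Complex c t)).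
Proof.
move=> H t /H{}H e /H [r r0 {}H]; exists r => // s st; apply: H; by rewrite normc_im.
Qed.

Lemma brect_bot a b c d t : c <= d -> a <= t <= b -> brect a b c d (Complex t c).
Proof. by move=> cd tab; split; [split|right; right; left] => //=; rewrite lexx cd. Qed.

Lemma brect_top a b c d t : c <= d -> a <= t <= b -> brect a b c d (Complex t d).
Proof. by move=> cd tab; split; [split|right; right; right] => //=; rewrite lexx cd. Qed.

Lemma brect_left a b c d t : a <= b -> c <= t <= d -> brect a b c d (Complex a t).
Proof. by move=> cd tab; split; [split|left] => //=; rewrite lexx cd. Qed.

Lemma brect_right a b c d t : a <= b -> c <= t <= d -> brect a b c d (Complex b t).
Proof. by move=> cd tab; split; [split|right; left] => //=; rewrite lexx cd. Qed.

Definition bcont f a b c d := forall z, brect a b c d z -> ccont f z.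

Lemma bcont_pcont f a b c d : a <= b -> c <= d -> bcont f a b c d ->
  [/\ pcont a b (fun t => f (Complex t c)), pcont a b (fun t => f (Complex t d)),
   pcont c d (fun t => f (Complex b t)) & pcont c d (fun t => f (Complex a t))].
Proof.
move=> ab cd H; split; first [apply: pcont_re|apply: pcont_im] => t ht; apply: H.
- exact: brect_bot.
- exact: brect_top.
- exact: brect_right.
- exact: brect_left.
Qed.

Lemma bintD f g a b c d : a <= b -> c <= d -> bcont f a b c d -> bcont g a b c d ->
  bint (fun z => f z + g z) a b c d = bint f a b c d + bint g a b c d.
Proof.
move=> ab cd /(bcont_pcont ab cd)[? ? ? ?] /(bcont_pcont ab cd)[? ? ? ?].
rewrite /bint !cintD//; ring.
Qed.

Lemma bintZ z0 f a b c d : a <= b -> c <= d -> bcont f a b c d ->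
  bint (fun z => z0 * f z) a b c d = z0 * bint f a b c d.
Proof.
move=> ab cd /(bcont_pcont ab cd)[? ? ? ?]; rewrite /bint !cintZ//; ring.
Qed.

Lemma normc_bint f a b c d (M : R) : a <= b -> c <= d -> bcont f a b c d ->
  (forall z, brect a b c d z -> normc (f z) <= M) ->
  normc (bint f a b c d) <= 4 * M * ((b - a) + (d - c)).
Proof.
move=> ab cd /(bcont_pcont ab cd)[c1 c2 c3 c4] fM.
have H1 := normc_cint ab c1 (fun t ht => fM _ (brect_bot cd ht)).
have H2 := normc_cint ab c2 (fun t ht => fM _ (brect_top cd ht)).
have H3 := normc_cint cd c3 (fun t ht => fM _ (brect_right ab ht)).
have H4 := normc_cint cd c4 (fun t ht => fM _ (brect_left ab ht)).
rewrite /bint; apply: (le_trans (le_normcD _ _)); rewrite normcM.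
have -> : normc 'i%C = 1 :> R by rewrite /= expr0n expr1n add0r sqrtr1.
rewrite mul1r.
have N1 := le_normcD (cint a b (fun t => f (Complex t c))) (- cint a b (fun t => f (Complex t d))).
have N2 := le_normcD (cint c d (fun t => f (Complex b t))) (- cint c d (fun t => f (Complex a t))).
rewrite !normcN in N1 N2.
lra.
Qed.

Lemma ccont_cst (k z : R[i]) : ccont (fun=> k) z.
Proof. exact: cdiff_ccont (cdiff_cst _ _). Qed.

Lemma ccont_id z : ccont id z.
Proof. exact: cdiff_ccont (cdiff_id _). Qed.

(** An explicit computation on the four sides. It allows the first-order expansion of an integrand
    at a point to be subtracted at no cost. *)
Lemma bint_affine a b c d (A B : R[i]) : a <= b -> c <= d ->
  bint (fun z => A + B * z) a b c d = 0.
Proof.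
move=> ab cd.
have cid : bcont id a b c d by move=> z _; exact: ccont_id.
have cZ : bcont (fun z => B * z) a b c d.
  by move=> z _; apply: ccontM; [exact: ccont_cst|exact: ccont_id].
have cc : bcont (fun=> A) a b c d by move=> z _; exact: ccont_cst.
rewrite bintD// bintZ//.
have -> : bint (fun=> A) a b c d = 0 by rewrite /bint !cint_cst//; ring.
suff -> : bint id a b c d = 0 by rewrite mulr0 addr0.
have E s t : Complex s t = (s%:C)%C + 'i%C * (t%:C)%C :> R[i].
  exact: complexE.
have pid x y : pcont x y (fun t : R => (t%:C)%C : R[i]).
  by apply: (@pcont_re id) => ? _; exact: ccont_id.
have pcst x y (k : R[i]) : pcont x y (fun=> k).
  by apply: (@pcont_re (fun=> k) _ _ 0) => ? _; exact: ccont_cst.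
have pidi x y : pcont x y (fun t : R => 'i%C * (t%:C)%C : R[i]).
  apply: (@pcont_re (fun z => 'i%C * z)) => ? _.
  by apply: ccontM; [exact: ccont_cst|exact: ccont_id].
have H1 k : cint a b (fun t => Complex t k) =
    (((b ^+ 2 - a ^+ 2) / 2)%:C)%C + ((b - a)%:C)%C * ('i%C * (k%:C)%C).
  under [cint a b _]eq_cint do rewrite E.
  by rewrite cintD// cint_id// cint_cst.
have H2 k : cint c d (fun t => Complex k t) =
    ((d - c)%:C)%C * (k%:C)%C + 'i%C * (((d ^+ 2 - c ^+ 2) / 2)%:C)%C.
  under [cint c d _]eq_cint do rewrite E.
  by rewrite cintD// cintZ// cint_id// cint_cst.
rewrite /bint /= !H1 !H2.
have i2 : 'i%C * 'i%C = -1 :> R[i] by rewrite -expr2 sqr_i.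
rewrite !raddfB/=; ring.
Qed.

Lemma bint_splitx f a b c d m : a <= m <= b ->
  (forall t, a <= t <= b -> ccont f (Complex t c) /\ ccont f (Complex t d)) ->
  bint f a b c d = bint f a m c d + bint f m b c d.
Proof.
move=> amb cf; have /andP[am mb] := amb; have ab := le_trans am mb.
rewrite /bint !(@cint_split _ a b m)//.
- by ring.
- by apply: pcont_re => t /cf[].
- by apply: pcont_re => t /cf[].
Qed.

Lemma bint_splity f a b c d m : c <= m <= d ->
  (forall t, c <= t <= d -> ccont f (Complex a t) /\ ccont f (Complex b t)) ->
  bint f a b c d = bint f a b c m + bint f a b m d.
Proof.
move=> cmd cf; have /andP[cm md] := cmd; have cd := le_trans cm md.
rewrite /bint !(@cint_split _ c d m)//.
- by ring.
- by apply: pcont_im => t /cf[].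
- by apply: pcont_im => t /cf[].
Qed.

(** By [bisection]: near a point, subtracting the first-order expansion leaves an integrand of size
    o(s) on a contour of length O(s), hence an integral of size o(s^2). *)
Lemma goursat0 f a b c d : a <= b -> c <= d ->
  (forall z, rect a b c d z -> exists k, cdiff f z k) -> bint f a b c d = 0.
Proof.
move=> + + df; have cf z : rect a b c d z -> ccont f z.
  by move=> /df[k]; exact: cdiff_ccont.
rewrite le_eqVlt => /predU1P[->|ab] cd.
  by rewrite /bint /cint set_itv1 !Rintegral_set1 !subrr mulr0 addr0.
move: cd; rewrite le_eqVlt => /predU1P[->|cd].
  by rewrite /bint /cint set_itv1 !Rintegral_set1 !subrr mulr0 addr0.
set w := b - a; set h := d - c.
have w0 : 0 < w by rewrite subr_gt0.
have h0 : 0 < h by rewrite subr_gt0.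
have wh0 : 0 < w + h by rewrite addr_gt0.
apply/eqP; rewrite -normc_eq0 eq_le normc_ge0 andbT.
have aw : a + w = b by rewrite /w addrC subrK.
have ch : c + h = d by rewrite /h addrC subrK.
clearbody w h.
have := @bisection _ w h
  (fun x y s => normc (bint f x (x + w * s) y (y + h * s))) a c w0 h0.
rewrite !mulr1 aw ch; apply.
- move=> x y s s0 ax xb cy yd.
  have ws : 0 < w * s by rewrite mulr_gt0.
  have hs : 0 < h * s by rewrite mulr_gt0.
  have hw : w * (s / 2) = w * s / 2 by rewrite mulrA.
  have hh : h * (s / 2) = h * s / 2 by rewrite mulrA.
  have E x' (w' : R) : x' + w' * (s / 2) + w' * (s / 2) = x' + w' * s.
    by rewrite -addrA -mulrDr -splitr.
  have -> : bint f x (x + w * s) y (y + h * s) =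
    (bint f x (x + w * (s / 2)) y (y + h * (s / 2)) +
     bint f (x + w * (s / 2)) (x + w * s) y (y + h * (s / 2))) +
    (bint f x (x + w * (s / 2)) (y + h * (s / 2)) (y + h * s) +
     bint f (x + w * (s / 2)) (x + w * s) (y + h * (s / 2)) (y + h * s)).
    rewrite (@bint_splity _ _ _ _ _ (y + h * (s / 2))); last 2 first.
    - by rewrite hh; apply/andP; split; lra.
    - by move=> t /andP[? ?]; split; apply: cf; split => /=; apply/andP; split; lra.
    congr (_ + _); apply: bint_splitx.
    - by rewrite hw; apply/andP; split; lra.
    - by move=> t /andP[? ?]; split; apply: cf; split => /=; apply/andP; split; lra.
    - by rewrite hw; apply/andP; split; lra.
    - by move=> t /andP[? ?]; split; apply: cf; split => /=; apply/andP; split; lra.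
  rewrite !E.
  apply: (le_trans (le_normcD _ _)); apply: lerD; exact: le_normcD.
- move=> p q pab qcd e e0.
  have [|k dk] := df (Complex p q); first by split.
  (* The distance to (p, q) and the sum of the sides are both at most (w + h) s, and [normc_bint]
     contributes 4, so this tolerance produces exactly e s^2. *)
  have e1 : 0 < e / (4 * (w + h) ^+ 2) by rewrite divr_gt0// mulr_gt0// exprn_gt0.
  have [r r0 H] := dk _ e1.
  exists (r / (w + h)); first by rewrite divr_gt0.
  move=> x y s /andP[s0 sr] ax xb cy yd xp yq.
  have ws : 0 < w * s by rewrite mulr_gt0.
  have hs : 0 < h * s by rewrite mulr_gt0.
  have ns z : rect x (x + w * s) y (y + h * s) z -> normc (z - Complex p q) <= (w + h) * s.
    case: z => u v [hu hv]; apply: (le_trans (normc_le_ReIm _)).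
    rewrite /= in hu hv *; rewrite mulrDl.
    apply: lerD; rewrite ler_norml; apply/andP; split; lra.
  have xx : x <= x + w * s by lra.
  have yy : y <= y + h * s by lra.
  pose aff z := (k * Complex p q - f (Complex p q)) + (- k) * z.
  have cfr z : brect x (x + w * s) y (y + h * s) z -> ccont f z.
    by move=> [[? ?] _]; apply: cf; split; apply/andP; split; lra.
  have caff z : ccont aff z.
    apply: ccontD; first exact: ccont_cst.
    by apply: ccontM; [exact: ccont_cst|exact: ccont_id].
  have -> : bint f x (x + w * s) y (y + h * s) =
     bint (fun z => f z + aff z) x (x + w * s) y (y + h * s).
    by rewrite bintD// bint_affine// addr0.
  apply: (@le_trans _ _ (4 * (e / (4 * (w + h) ^+ 2) * ((w + h) * s)) * ((w + h) * s))).
    rewrite [X in _ <= _ * X](_ : _ = (x + w * s - x) + (y + h * s - y)); last by ring.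
    apply: normc_bint => //.
      by move=> z hz; apply: ccontD => //; exact: cfr.
    move=> z [hz _].
    have hn := ns _ hz.
    have -> : f z + aff z = f z - f (Complex p q) - k * (z - Complex p q).
      by rewrite /aff; ring.
    apply: (le_trans (H _ _)).
      by rewrite (le_lt_trans hn)// mulrC -ltr_pdivlMr.
    by rewrite ler_pM2l.
  rewrite le_eqVlt; apply/orP; left; apply/eqP; field.
  by rewrite gt_eqF.
Qed.

(** Four rectangles that avoid the exceptional point are cut off, each with integral zero by
    [goursat0]. *)
Lemma bint_centre f a b c d px py e : 0 < e ->
  e <= px - a -> e <= b - px -> e <= py - c -> e <= d - py ->
  (forall z, rect a b c d z -> z <> Complex px py -> exists k, cdiff f z k) ->
  bint f a b c d = bint f (px - e) (px + e) (py - e) (py + e).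
Proof.
move=> e0 e1 e2 e3 e4 df.
have cf z : rect a b c d z -> z <> Complex px py -> ccont f z.
  by move=> hz zp; have [k] := df _ hz zp; exact: cdiff_ccont.
have G x x' y y' : a <= x -> x <= x' -> x' <= b -> c <= y -> y <= y' -> y' <= d ->
    (px < x \/ x' < px \/ py < y \/ y' < py) -> bint f x x' y y' = 0.
  move=> *; apply: goursat0 => // -[u v] [/= /andP[? ?] /andP[? ?]]; apply: df.
    by split; apply/andP; split => /=; lra.
  move=> [? ?]; subst; lra.
rewrite (@bint_splitx _ _ _ _ _ (px - e)); last 2 first.
- by apply/andP; split; lra.
- by move=> t ?; split; apply: cf => [|[? ?]]; try lra; split => /=; apply/andP; split; lra.
rewrite G ?add0r; [|lra..].
rewrite (@bint_splitx _ _ _ _ _ (px + e)); last 2 first.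
- by apply/andP; split; lra.
- by move=> t ?; split; apply: cf => [|[? ?]]; try lra; split => /=; apply/andP; split; lra.
rewrite [X in _ + X]G ?addr0; [|lra..].
rewrite (@bint_splity _ _ _ _ _ (py - e)); last 2 first.
- by apply/andP; split; lra.
- by move=> t ?; split; apply: cf => [|[? ?]]; try lra; split => /=; apply/andP; split; lra.
rewrite G ?add0r; [|lra..].
rewrite (@bint_splity _ _ _ _ _ (py + e)); last 2 first.
- by apply/andP; split; lra.
- by move=> t ?; split; apply: cf => [|[? ?]]; try lra; split => /=; apply/andP; split; lra.
by rewrite [X in _ + X]G ?addr0; [|lra..].
Qed.

(** The growth condition says that |f| is o(1 / |w - p|). On a square of half-side e around p the
    contour has length O(e), so the integral is arbitrarily small, while by [bint_centre] it does
    not depend on e. *)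
Lemma goursat f a b c d p : a < Re p < b -> c < Im p < d ->
  (forall z, rect a b c d z -> z <> p -> exists k, cdiff f z k) ->
  (forall e : R, 0 < e -> exists2 r : R, 0 < r &
     forall w, w <> p -> normc (w - p) < r -> normc (f w) * normc (w - p) <= e) ->
  bint f a b c d = 0.
Proof.
case: p => px py /= /andP[apx pxb] /andP[cpy pyd] df fp.
apply/eqP; rewrite -normc_eq0; apply/negPn/negP => /eqP n0.
have {}n0 : 0 < normc (bint f a b c d) by rewrite lt_neqAle normc_ge0 andbT eq_sym; apply/eqP.
set N := normc _ in n0.
(* With 32 the estimate on the small square equals N / 2: [normc_bint] contributes 4 and the two
   sides add up to 4 e. *)
have [r r0 H] := fp _ (divr_gt0 n0 (ltr0n _ 32)).
pose m := Num.min (Num.min (px - a) (b - px)) (Num.min (py - c) (d - py)).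
have m0 : 0 < m by rewrite !lt_min !subr_gt0 apx pxb cpy pyd.
pose e := Num.min m (r / 4).
have e0 : 0 < e by rewrite lt_min m0 divr_gt0.
have [em er] : e <= m /\ e <= r / 4 by split; rewrite ge_min lexx ?orbT.
have : e <= m by [].
rewrite /m !le_min => /andP[/andP[e1 e2] /andP[e3 e4]].
have cf z : rect a b c d z -> z <> Complex px py -> ccont f z.
  by move=> hz zp; have [k] := df _ hz zp; exact: cdiff_ccont.
have E := bint_centre e0 e1 e2 e3 e4 df.
clearbody e; clear m m0 em fp apx pxb cpy pyd.
have xx : px - e <= px + e by lra.
have yy : py - e <= py + e by lra.
have : N <= 4 * (N / 32 / e) * (((px + e) - (px - e)) + ((py + e) - (py - e))).
  rewrite {1}/N E; apply: normc_bint => //.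
    move=> -[u v] [[/= ? ?] h]; apply: cf; first by split; apply/andP; split => /=; lra.
    by move=> [? ?]; subst; lra.
  move=> [u v] [[/= /andP[u1 u2] /andP[v1 v2]] h].
  have ne : Complex u v <> Complex px py by move=> [? ?]; subst; lra.
  have nr : normc (Complex u v - Complex px py) < r.
    apply: (le_lt_trans (normc_le_ReIm _)) => /=.
    apply: (@le_lt_trans _ _ (e + e)); last by lra.
    by apply: lerD; rewrite ler_norml; apply/andP; split; lra.
  have ge : e <= normc (Complex u v - Complex px py).
    have := Re_le_normc (Complex u v - Complex px py).
    have := Im_le_normc (Complex u v - Complex px py).
    rewrite /= => I1 I2.
    have := ler_norm (u - px); have := ler_norm (v - py).
    have := ler_norm (- (u - px)); have := ler_norm (- (v - py)).
    rewrite !normrN; lra.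
  have := H _ ne nr; rewrite -ler_pdivlMr; last exact: (lt_le_trans e0 ge).
  move/le_trans; apply; apply: ler_pM => //; first by rewrite divr_ge0// ltW.
    by rewrite invr_ge0 normc_ge0.
  by rewrite lef_pV2// posrE// (lt_le_trans e0 ge).
have -> : 4 * (N / 32 / e) * (((px + e) - (px - e)) + ((py + e) - (py - e))) = N / 2.
  by field; rewrite gt_eqF.
lra.
Qed.

End Goursat.

(** * Directional derivatives from an error estimate *)

Section IsDeriveEps.
Context {R : realType}.

Lemma is_derive_eps (V W : normedModType R) (f : V -> W) (a v : V) (d : W) :
  (forall e : R, 0 < e -> exists2 r : R, 0 < r & forall h : R, `|h| < r ->
     `|f (h *: v + a) - f a - h *: d| <= e * `|h|) -> is_derive a v f d.
Proof.
move=> H.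
have K : h^-1 *: (f (h *: v + a) - f a) @[h --> (0 : R)^'] --> d.
  apply/cvgrPdist_le => e e0; have [r r0 {}H] := H e e0.
  near=> h.
  have h0 : h != 0 by near: h; exact: nbhs_dnbhs_neq.
  have hr : `|h| < r by near: h; exact: dnbhs0_lt.
  rewrite distrC.
  have -> : h^-1 *: (f (h *: v + a) - f a) - d =
      h^-1 *: (f (h *: v + a) - f a - h *: d).
    by rewrite [RHS]scalerBr scalerA mulVf// scale1r.
  rewrite normrZ normfV ler_pdivrMl ?normr_gt0//.
  by rewrite mulrC; exact: H.
split.
  exact: (cvgP _ K).
exact/cvg_lim.
Unshelve. all: by end_near. Qed.

End IsDeriveEps.

(** * Differentiation of contour integrals with respect to a parameter *)

Section ParamIntegral.
Context {R : realType}.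
Implicit Types (f g F G P : R[i] -> R[i]) (a b c d t : R) (z w p : R[i]).

Lemma ccont_comp f g z : ccont f z -> ccont g (f z) -> ccont (fun x => g (f x)) z.
Proof.
move=> cf cg e /cg[r r0 H]; have [s s0 H'] := cf _ r0.
by exists s => // w /H'/H.
Qed.

Lemma ccontV f z : f z != 0 -> ccont f z -> ccont (fun x => (f x)^-1) z.
Proof.
move=> fz cf; apply: (ccont_comp cf (g := fun x => x^-1)).
exact: cdiff_ccont (cdiffV fz).
Qed.

Lemma ccontX f z n : ccont f z -> ccont (fun x => f x ^+ n) z.
Proof.
move=> cf; elim: n => [|n IH].
  by move=> e e0; exists 1 => // w _; rewrite subrr normc0.
have := ccontM cf IH => H e /H[r r0 {}H]; exists r => // w /H; by rewrite !exprS.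
Qed.

Lemma ccontZ (k : R[i]) f z : ccont f z -> ccont (fun x => k * f x) z.
Proof. by move=> cf; apply: ccontM => //; exact: ccont_cst. Qed.

Lemma ccontB f g z : ccont f z -> ccont g z -> ccont (fun x => f x - g x) z.
Proof.
move=> cf /(ccontZ (-1)) cg; have := ccontD cf cg => H e /H[r r0 {}H].
by exists r => // w /H; rewrite !mulN1r.
Qed.

Lemma pcont_normc a b (f : R -> R[i]) : pcont a b f ->
  {within `[a, b], continuous (fun t => normc (f t))}.
Proof.
move=> H; apply: continuous_in_subspaceT => t; rewrite inE/= in_itv/= => tab.
apply/cvgrPdist_lt => e e0; have [r r0 {}H] := H t tab e e0.
near=> s; apply: (@le_lt_trans _ _ (normc (f s - f t))).
  apply/ler_normlP; split; first by rewrite opprB ler_normcB.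
  by rewrite normcB; exact: ler_normcB.
rewrite H// distrC; near: s; exact: cvgr_dist_lt.
Unshelve. all: by end_near. Qed.

Lemma pcont_bounded a b (f : R -> R[i]) : a <= b -> pcont a b f ->
  exists2 M, 0 < M & forall t, a <= t <= b -> normc (f t) <= M.
Proof.
move=> ab /pcont_normc/(EVT_max ab)[c _ H].
exists (normc (f c) + 1); first by rewrite ltr_wpDl// normc_ge0.
move=> t tab; apply: (@le_trans _ _ (normc (f c))); last by rewrite lerDl.
by apply: H; rewrite in_itv.
Qed.

Lemma pcont_min a b (f : R -> R[i]) : a <= b -> pcont a b f ->
  (forall t, a <= t <= b -> f t != 0) ->
  exists2 m, 0 < m & forall t, a <= t <= b -> m <= normc (f t).
Proof.
move=> ab /pcont_normc/(EVT_min ab)[c + H] f0.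
rewrite in_itv/= => /f0 fc; exists (normc (f c)); first by rewrite normc_gt0.
by move=> t tab; apply: H; rewrite in_itv.
Qed.

Lemma brect_cases a b c d z : brect a b c d z ->
  (exists2 t, a <= t <= b & z = Complex t c) \/ (exists2 t, a <= t <= b & z = Complex t d) \/
  (exists2 t, c <= t <= d & z = Complex b t) \/ (exists2 t, c <= t <= d & z = Complex a t).
Proof.
case: z => u v [[/= hu hv]] [->|[->|[->|->]]].
- by right; right; right; exists v.
- by right; right; left; exists v.
- by left; exists u.
- by right; left; exists u.
Qed.

Lemma bcont_bounded f a b c d : a <= b -> c <= d -> bcont f a b c d ->
  exists2 M, 0 < M & forall z, brect a b c d z -> normc (f z) <= M.
Proof.
move=> ab cd /(bcont_pcont ab cd)[].
move=> /(pcont_bounded ab)[M1 M10 H1] /(pcont_bounded ab)[M2 M20 H2].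
move=> /(pcont_bounded cd)[M3 M30 H3] /(pcont_bounded cd)[M4 M40 H4].
exists (M1 + M2 + M3 + M4); first by lra.
move=> z /brect_cases[[t /H1 ? ->]|[[t /H2 ? ->]|[[t /H3 ? ->]|[t /H4 ? ->]]]]; lra.
Qed.

Lemma bcont_min f a b c d : a <= b -> c <= d -> bcont f a b c d ->
  (forall z, brect a b c d z -> f z != 0) ->
  exists2 m, 0 < m & forall z, brect a b c d z -> m <= normc (f z).
Proof.
move=> ab cd /(bcont_pcont ab cd)[] + + + + f0.
move=> /(pcont_min ab)[t ?|m1 m10 H1]; first exact/f0/brect_bot.
move=> /(pcont_min ab)[t ?|m2 m20 H2]; first exact/f0/brect_top.
move=> /(pcont_min cd)[t ?|m3 m30 H3]; first exact/f0/brect_right.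
move=> /(pcont_min cd)[t ?|m4 m40 H4]; first exact/f0/brect_left.
exists (Num.min (Num.min m1 m2) (Num.min m3 m4)); first by rewrite !lt_min m10 m20 m30.
move=> z /brect_cases[[t /H1 h ->]|[[t /H2 h ->]|[[t /H3 h ->]|[t /H4 h ->]]]];
  by rewrite !ge_min h ?orbT.
Qed.

(** A quadratic remainder that is uniform on the contour integrates to a quadratic remainder; this
    is differentiation under the integral sign. *)
Lemma bint_param (K : R[i] -> R[i] -> R[i]) K' w0 a b c d (C r : R) :
  a <= b -> c <= d -> 0 < r -> 0 <= C ->
  (forall w, normc (w - w0) < r -> bcont (K w) a b c d) -> bcont K' a b c d ->
  (forall w z, normc (w - w0) < r -> brect a b c d z ->
     normc (K w z - K w0 z - (w - w0) * K' z) <= C * normc (w - w0) ^+ 2) ->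
  cdiff (fun w => bint (K w) a b c d) w0 (bint K' a b c d).
Proof.
move=> ab cd r0 C0 cK cK' H e e0.
set p := (b - a) + (d - c).
have p0 : 0 <= p by rewrite addr_ge0// subr_ge0.
have k0 : 0 < 4 * C * p + 1 by rewrite ltr_wpDl// !mulr_ge0.
exists (Num.min r (e / (4 * C * p + 1))); first by rewrite lt_min r0 divr_gt0.
move=> w; rewrite lt_min => /andP[wr we].
have cw := cK _ wr.
have cw0 : bcont (K w0) a b c d by apply: cK; rewrite subrr normc0.
have -> : bint (K w) a b c d - bint (K w0) a b c d - bint K' a b c d * (w - w0) =
  bint (fun z => K w z + ((-1) * K w0 z + (- (w - w0)) * K' z)) a b c d.
  rewrite bintD//; last first.
    by move=> z hz; apply: ccontD; apply: ccontZ; [exact: cw0|exact: cK'].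
  rewrite bintD//; last 2 first.
  - by move=> z hz; apply: ccontZ; exact: cw0.
  - by move=> z hz; apply: ccontZ; exact: cK'.
  by rewrite !bintZ//; ring.
apply: (@le_trans _ _ (4 * (C * normc (w - w0) ^+ 2) * p)).
  apply: normc_bint => //.
    move=> z hz; apply: ccontD; first exact: cw.
    by apply: ccontD; apply: ccontZ; [exact: cw0|exact: cK'].
  move=> z hz; have := H _ _ wr hz.
  by congr (normc _ <= _); ring.
rewrite (_ : _ * p = 4 * C * p * normc (w - w0) * normc (w - w0)); last by ring.
apply: ler_wpM2r; first exact: normc_ge0.
move: we; rewrite ltr_pdivlMr// => we.
by apply: le_trans (ltW we); rewrite [_ * (_ + 1)]mulrDr mulr1 mulrC lerDl normc_ge0.
Qed.

(** The inner function has two uses: [P = id] is the Cauchy kernel, and [P = phi] is the kernel that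
    represents the inverse of [phi]. *)
Definition ckernel (G P : R[i] -> R[i]) n w z := G z * (P z - w)^-1 ^+ n.

Lemma bcont_ckernel G P n w a b c d : bcont G a b c d -> bcont P a b c d ->
  (forall z, brect a b c d z -> P z - w != 0) ->
  bcont (ckernel G P n w) a b c d.
Proof.
move=> cG cP H z hz; apply: ccontM; first exact: cG.
apply: ccontX; apply: ccontV; first exact: H.
by apply: ccontB; [exact: cP|exact: ccont_cst].
Qed.

Lemma ckernel_neq P w0 w a b c d (m : R) : (forall z, brect a b c d z -> m <= normc (P z - w0)) ->
  normc (w - w0) < m / 2 -> forall z, brect a b c d z -> m / 2 <= normc (P z - w).
Proof.
move=> H ww z /H h.
have := ler_normcB (P z - w0) (w - w0).
have -> : P z - w0 - (w - w0) = P z - w by ring.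
lra.
Qed.

Lemma cdiff_ckernel G P w0 a b c d (m : R) : a <= b -> c <= d -> 0 < m ->
  bcont G a b c d -> bcont P a b c d ->
  (forall z, brect a b c d z -> m <= normc (P z - w0)) ->
  cdiff (fun w => bint (ckernel G P 1 w) a b c d) w0 (bint (ckernel G P 2 w0) a b c d) /\
  cdiff (fun w => bint (ckernel G P 2 w) a b c d) w0
    (bint (fun z => 2 * ckernel G P 3 w0 z) a b c d).
Proof.
move=> ab cd m0 cG cP Hm.
have m20 : 0 < m / 2 by rewrite divr_gt0.
have neq w : normc (w - w0) < m / 2 -> forall z, brect a b c d z -> P z - w != 0.
  move=> ww z hz; rewrite -normc_gt0; apply: lt_le_trans m20 _.
  exact: (ckernel_neq Hm).
have cK n w : normc (w - w0) < m / 2 -> bcont (ckernel G P n w) a b c d.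
  by move=> ww; apply: bcont_ckernel => //; exact: neq.
have c00 : normc (w0 - w0) < m / 2 by rewrite subrr normc0.
have [M M0 HM] := bcont_bounded ab cd cG.
have Mm n : 0 <= M / m ^+ n by rewrite divr_ge0// ?ltW ?exprn_gt0.
have bnd w z : normc (w - w0) < m / 2 -> brect a b c d z ->
  [/\ P z - w0 != 0, P z - w != 0, normc (P z - w0)^-1 <= m^-1 & normc (P z - w)^-1 <= 2 / m].
  move=> ww hz; split; [exact: neq|exact: neq| |].
    by rewrite normcV lef_pV2 ?posrE// ?(lt_le_trans m0)// Hm.
  rewrite normcV -[2 / m]invrK invf_div lef_pV2 ?posrE// ?(lt_le_trans m20)//;
    exact: (ckernel_neq Hm).
split.
- apply: (@bint_param _ _ _ _ _ _ _ (M * 2 / m ^+ 3) (m / 2)) => //.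
  + by rewrite -mulrA mulrCA mulr_ge0.
  + by move=> w; exact: cK.
  + exact: cK.
  + move=> w z ww hz; have [n1 n2 b1 b2] := bnd _ _ ww hz.
    have -> : ckernel G P 1 w z - ckernel G P 1 w0 z - (w - w0) * ckernel G P 2 w0 z =
       (w - w0) * (w - w0) * (G z * ((P z - w0)^-1 * (P z - w0)^-1 * (P z - w)^-1)).
      by rewrite /ckernel !expr1; field; rewrite n1 n2.
    rewrite !normcM -expr2 mulrC; apply: ler_wpM2r; first exact: sqr_ge0.
    have -> : M * 2 / m ^+ 3 = M * (m^-1 * m^-1 * (2 / m)) by field; rewrite gt_eqF.
    apply: ler_pM; rewrite ?normc_ge0 ?mulr_ge0 ?normc_ge0 ?HM//.
    apply: ler_pM; rewrite ?normc_ge0 ?mulr_ge0 ?normc_ge0//.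
    by apply: ler_pM; rewrite ?normc_ge0.
(* Divided by (w - w0)^2, the remainder is G (3 - 2 (w - w0) / (P - w0)) / ((P - w0)^2 (P - w)^2).
   The bracket is at most 4 and the reciprocal of the denominator at most 4 / m^4. *)
- apply: (@bint_param _ _ _ _ _ _ _ (M * 16 / m ^+ 4) (m / 2)) => //.
  + by rewrite -mulrA mulrCA mulr_ge0.
  + by move=> w; exact: cK.
  + by move=> z hz; apply: ccontZ; exact: cK.
  + move=> w z ww hz; have [n1 n2 b1 b2] := bnd _ _ ww hz.
    have -> : ckernel G P 2 w z - ckernel G P 2 w0 z - (w - w0) * (2 * ckernel G P 3 w0 z) =
       (w - w0) * (w - w0) * (G z * ((3%:R - 2%:R * ((w - w0) * (P z - w0)^-1)) *
        ((P z - w0)^-1 * (P z - w0)^-1 * ((P z - w)^-1 * (P z - w)^-1)))).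
      by rewrite /ckernel; field; rewrite n1 n2.
    rewrite normcM [normc (_ * _)]normcM -expr2 mulrC.
    apply: ler_wpM2r; first exact: sqr_ge0.
    have -> : M * 16 / m ^+ 4 = M * (4 * (m^-1 * m^-1 * (2 / m * (2 / m)))).
      by field; rewrite gt_eqF.
    rewrite normcM; apply: ler_pM; rewrite ?normc_ge0 ?HM//.
    rewrite normcM; apply: ler_pM; rewrite ?normc_ge0//.
      apply: (le_trans (le_normcD _ _)); rewrite normcN !normcM.
      have nR k : normc (k%:R : R[i]) = k%:R.
        by rewrite -[k%:R in LHS]mulr_natr mul1r normcMn normc1.
      rewrite !nR.
      have : normc (w - w0) * normc (P z - w0)^-1 <= m / 2 * m^-1.
        by apply: ler_pM; rewrite ?normc_ge0// ltW.
      by rewrite mulrAC mulfV ?gt_eqF//; lra.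
    rewrite normcM; apply: ler_pM; rewrite ?normc_ge0//.
      by rewrite normcM; apply: ler_pM; rewrite ?normc_ge0.
    by rewrite normcM; apply: ler_pM; rewrite ?normc_ge0.
Qed.

End ParamIntegral.

(** * Cauchy's formula for rectangles *)

Section Cauchy.
Context {R : realType}.
Implicit Types (f g F G P : R[i] -> R[i]) (a b c d t : R) (z w p : R[i]) (U : set R[i]).

Definition inrect a b c d : set R[i] := [set z | a < Re z < b /\ c < Im z < d].

Definition holo U f := forall z, U z -> exists k, cdiff f z k.

Definition copen U := forall z, U z -> exists2 r : R, 0 < r &
  forall w, normc (w - z) < r -> U w.

Definition csquare z (s : R) := rect (Re z - s) (Re z + s) (Im z - s) (Im z + s).

Lemma inrect_le a b c d z : inrect a b c d z -> a < b /\ c < d.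
Proof. by move=> [/andP[h1 h2] /andP[h3 h4]]; split; [exact: lt_trans h2|exact: lt_trans h4]. Qed.

Lemma inrect_rect a b c d z : inrect a b c d z -> rect a b c d z.
Proof. by move=> [/andP[h1 h2] /andP[h3 h4]]; split; rewrite !ltW. Qed.

Lemma brect_rect a b c d z : brect a b c d z -> rect a b c d z.
Proof. by case. Qed.

Lemma holo_bcont f a b c d : holo (rect a b c d) f -> bcont f a b c d.
Proof. by move=> H z /brect_rect/H[k]; exact: cdiff_ccont. Qed.

Lemma inrect_dist a b c d z : inrect a b c d z ->
  exists2 m : R, 0 < m & forall w, brect a b c d w -> m <= normc (w - z).
Proof.
move=> hz; have [ab cd] := inrect_le hz.
have cB : bcont (fun w => w - z) a b c d.
  by move=> w _; apply: ccontB; [exact: ccont_id|exact: ccont_cst].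
apply: (bcont_min (ltW ab) (ltW cd) cB) => w [_ hw]; rewrite subr_eq0; apply/eqP => wz.
move: hz hw; rewrite -wz => -[/andP[h1 h2] /andP[h3 h4]].
by move=> [|[|[|]]] E; move: h1 h2 h3 h4; rewrite E ?ltxx.
Qed.

(** The number 2 pi i, kept as an integral: what the sequel needs is that it is nonzero and depends
    differentiably on [z]. *)
Definition kappa a b c d z := bint (ckernel (fun=> 1) id 1 z) a b c d.

(** The difference of the two sides is the integral of (f(w) - f(z)) / (w - z), whose singularity at
    z satisfies the growth condition of [goursat]. *)
Lemma cauchy f a b c d z : inrect a b c d z -> holo (rect a b c d) f ->
  bint (ckernel f id 1 z) a b c d = f z * kappa a b c d z.
Proof.
move=> hz hf; have [/ltW ab /ltW cd] := inrect_le hz.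
have [m m0 Hm] := inrect_dist hz.
have neq w : brect a b c d w -> id w - z != 0.
  by move=> /Hm h; rewrite -normc_gt0 (lt_le_trans m0).
have cf := holo_bcont hf.
have cid : bcont id a b c d by move=> w _; exact: ccont_id.
have c1 : bcont (fun=> 1) a b c d by move=> w _; exact: ccont_cst.
apply/eqP; rewrite -subr_eq0 -mulN1r; apply/eqP.
rewrite /kappa mulrA -bintZ//; last exact: bcont_ckernel.
rewrite -bintD//; last 2 first.
- exact: bcont_ckernel.
- by move=> w hw; apply: ccontZ; exact: bcont_ckernel hw.
have [k dk] := hf _ (inrect_rect hz).
apply: (@goursat _ _ _ _ _ _ z); rewrite ?hz.1 ?hz.2//.
- move=> w hw wz; have [k' dk'] := hf _ hw.
  have wz0 : w - z != 0 by rewrite subr_eq0; apply/eqP.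
  have dw : cdiff (fun w => w - z) w (1 - 0) by apply: cdiffB; [exact: cdiff_id|exact: cdiff_cst].
  have dV := cdiff_comp dw (cdiffV wz0).
  have := cdiffD (cdiffM dk' dV) (cdiffZ (- 1 * f z) (cdiffM (cdiff_cst 1 w) dV)).
  by rewrite /ckernel; eexists; eassumption.
- move=> e e0; have [r r0 H] := cdiff_ccont dk e0.
  exists r => // w wz wr; rewrite -normcM /ckernel !expr1.
  have wz0 : w - z != 0 by rewrite subr_eq0; apply/eqP.
  rewrite (_ : _ * (w - z) = f w - f z); first exact/ltW/H.
  by field.
Qed.

Lemma cReV z : Re z^-1 = Re z / normc z ^+ 2.
Proof. by rewrite sqr_normc; case: z. Qed.

Lemma cImV z : Im z^-1 = - Im z / normc z ^+ 2.
Proof. by rewrite sqr_normc; case: z => x y; rewrite /= mulNr. Qed.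

Lemma Rintegral_ge_cst (h : R -> R) (u v k : R) : u <= v ->
  (@lebesgue_measure R).-integrable `[u, v] (EFin \o h) ->
  (forall t, u <= t <= v -> k <= h t) ->
  (v - u) * k <= \int[lebesgue_measure]_(t in `[u, v]) h t.
Proof.
move=> uv ih H.
have -> : (v - u) * k = \int[lebesgue_measure]_(t in `[u, v]) (cst k t).
  have := cint_cst (k%:C)%C uv; rewrite /cint => -[] /= -> _; rewrite mul0r subr0//.
apply: le_Rintegral => //.
  apply: continuous_compact_integrable; first exact: segment_compact.
  by apply: continuous_subspaceT => ?; exact: cst_continuous.
Qed.

Lemma Rintegral_le_cst (h : R -> R) (u v k : R) : u <= v ->
  (@lebesgue_measure R).-integrable `[u, v] (EFin \o h) ->
  (forall t, u <= t <= v -> h t <= k) ->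
  \int[lebesgue_measure]_(t in `[u, v]) h t <= (v - u) * k.
Proof.
move=> uv ih H.
have -> : (v - u) * k = \int[lebesgue_measure]_(t in `[u, v]) (cst k t).
  have := cint_cst (k%:C)%C uv; rewrite /cint => -[] /= -> _; rewrite mul0r subr0//.
apply: le_Rintegral => //.
  apply: continuous_compact_integrable; first exact: segment_compact.
  by apply: continuous_subspaceT => ?; exact: cst_continuous.
Qed.

(** The imaginary part is the increment of the argument of w - z, and each of the four sides
    contributes a positive amount to it. *)
Lemma kappa_neq0 a b c d z : inrect a b c d z -> kappa a b c d z != 0.
Proof.
move=> hz; have [ab cd] := inrect_le hz; have [m m0 Hm] := inrect_dist hz.
have neq w : brect a b c d w -> id w - z != 0.
  by move=> /Hm h; rewrite -normc_gt0 (lt_le_trans m0).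
have cid : bcont id a b c d by move=> w _; exact: ccont_id.
have c1 : bcont (fun=> 1) a b c d by move=> w _; exact: ccont_cst.
have cK := @bcont_ckernel _ _ _ 1%N _ _ _ _ _ c1 cid neq.
have [p1 p2 p3 p4] := bcont_pcont (ltW ab) (ltW cd) cK.
have [[_ i1] [_ i2] [i3 _] [i4 _]] := And4 (pcont_integrable p1)
  (pcont_integrable p2) (pcont_integrable p3) (pcont_integrable p4).
have [M M0 HM] := bcont_bounded (ltW ab) (ltW cd) (fun w hw => ccontB (cid w hw) (ccont_cst z w)).
case: z hz Hm neq cK p1 p2 p3 p4 i1 i2 i3 i4 HM => x y [/= /andP[ax xb] /andP[cy yd]].
move=> Hm neq cK p1 p2 p3 p4 i1 i2 i3 i4 HM.
have den w : brect a b c d w -> 0 < normc (w - Complex x y) ^+ 2 <= M ^+ 2.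
  move=> hw; rewrite exprn_gt0/=; last by rewrite normc_gt0; exact: neq.
  by apply: lerXn2r; rewrite ?nnegrE ?normc_ge0 ?(ltW M0)//; exact: HM.
apply/eqP => k0; suff : 0 < Im (kappa a b c d (Complex x y)) by rewrite k0 ltxx.
have bot t : a <= t <= b -> (y - c) / M ^+ 2 <=
    Im (ckernel (fun=> 1) id 1 (Complex x y) (Complex t c)).
  move=> ht; have /andP[d1 d2] := den _ (brect_bot (ltW cd) ht).
  rewrite /ckernel expr1 mul1r cImV cImB/= opprB; apply: ler_wpM2l; first lra.
  by rewrite lef_pV2 ?posrE// (lt_le_trans d1).
have top t : a <= t <= b ->
    Im (ckernel (fun=> 1) id 1 (Complex x y) (Complex t d)) <= - ((d - y) / M ^+ 2).
  move=> ht; have /andP[d1 d2] := den _ (brect_top (ltW cd) ht).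
  rewrite /ckernel expr1 mul1r cImV cImB/= mulNr lerN2; apply: ler_wpM2l; first lra.
  by rewrite lef_pV2 ?posrE// (lt_le_trans d1).
have rig t : c <= t <= d -> (b - x) / M ^+ 2 <=
    Re (ckernel (fun=> 1) id 1 (Complex x y) (Complex b t)).
  move=> ht; have /andP[d1 d2] := den _ (brect_right (ltW ab) ht).
  rewrite /ckernel expr1 mul1r cReV cReB/=; apply: ler_wpM2l; first lra.
  by rewrite lef_pV2 ?posrE// (lt_le_trans d1).
have lef t : c <= t <= d ->
    Re (ckernel (fun=> 1) id 1 (Complex x y) (Complex a t)) <= - ((x - a) / M ^+ 2).
  move=> ht; have /andP[d1 d2] := den _ (brect_left (ltW ab) ht).
  rewrite /ckernel expr1 mul1r cReV cReB [complex.Re _]/= [complex.Re _]/= -[X in X / _ <= _]opprB mulNr lerN2; apply: ler_wpM2l; first lra.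
  by rewrite lef_pV2 ?posrE// (lt_le_trans d1).
have M20 : 0 < M ^+ 2 by rewrite exprn_gt0.
have R1 : (b - a) * ((y - c) / M ^+ 2) <=
    \int[lebesgue_measure]_(t in `[a, b]) Im (ckernel (fun=> 1) id 1 (Complex x y) (Complex t c)).
  exact: (Rintegral_ge_cst (ltW ab)).
have R2 : \int[lebesgue_measure]_(t in `[a, b]) Im (ckernel (fun=> 1) id 1 (Complex x y) (Complex t d))
   <= (b - a) * (- ((d - y) / M ^+ 2)).
  exact: (Rintegral_le_cst (ltW ab)).
have R3 : (d - c) * ((b - x) / M ^+ 2) <=
    \int[lebesgue_measure]_(t in `[c, d]) Re (ckernel (fun=> 1) id 1 (Complex x y) (Complex b t)).
  exact: (Rintegral_ge_cst (ltW cd)).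
have R4 : \int[lebesgue_measure]_(t in `[c, d]) Re (ckernel (fun=> 1) id 1 (Complex x y) (Complex a t))
   <= (d - c) * (- ((x - a) / M ^+ 2)).
  exact: (Rintegral_le_cst (ltW cd)).
rewrite /kappa /bint cImD cImB cImM cReB /= mul0r add0r mul1r.
have P1 : 0 < (b - a) * ((y - c) / M ^+ 2) by rewrite mulr_gt0 ?divr_gt0 ?subr_gt0.
have P2 : 0 < (b - a) * ((d - y) / M ^+ 2) by rewrite mulr_gt0 ?divr_gt0 ?subr_gt0.
have P3 : 0 < (d - c) * ((b - x) / M ^+ 2) by rewrite mulr_gt0 ?divr_gt0 ?subr_gt0.
have P4 : 0 < (d - c) * ((x - a) / M ^+ 2) by rewrite mulr_gt0 ?divr_gt0 ?subr_gt0.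
rewrite mulrN in R2; rewrite mulrN in R4.
clear - R1 R2 R3 R4 P1 P2 P3 P4; lra.
Qed.

(* The Cauchy kernel exhibits [f] near [z] as a quotient of functions with two derivatives. *)
Lemma holo_derive U f f' : copen U -> (forall z, U z -> cdiff f z (f' z)) -> holo U f'.
Proof.
move=> oU df z Uz; have [r r0 rU] := oU _ Uz.
pose s := r / 4; have s0 : 0 < s by rewrite divr_gt0.
have sqU : csquare z s `<=` U.
  move=> w [h1 h2]; apply: rU; apply: (le_lt_trans (normc_le_ReIm _)).
  apply: (@le_lt_trans _ _ (s + s)); last by rewrite /s; clear -r0; lra.
  by rewrite cReB cImB; apply: lerD; rewrite ler_norml lerBlDl lerBrDl.
have [ab cd] : Re z - s <= Re z + s /\ Im z - s <= Im z + s by clear -s0; split; lra.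
have hf : holo (csquare z s) f by move=> w /sqU/df ?; exists (f' w).
have inr w : normc (w - z) < s -> inrect (Re z - s) (Re z + s) (Im z - s) (Im z + s) w.
  move=> ws; have := le_lt_trans (Re_le_normc _) ws; have := le_lt_trans (Im_le_normc _) ws.
  rewrite cReB cImB !ltr_norml => /andP[a1 a2] /andP[b1 b2].
  by split; apply/andP; split; clear - a1 a2 b1 b2; lra.
pose A n w := bint (ckernel f id n w) (Re z - s) (Re z + s) (Im z - s) (Im z + s).
pose K n w := bint (ckernel (fun=> 1) id n w) (Re z - s) (Re z + s) (Im z - s) (Im z + s).
have cid : bcont id (Re z - s) (Re z + s) (Im z - s) (Im z + s) by move=> w _; exact: ccont_id.
have c1 : bcont (fun=> 1) (Re z - s) (Re z + s) (Im z - s) (Im z + s) by move=> w _; exact: ccont_cst.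
have dA w : normc (w - z) < s -> cdiff (A 1%N) w (A 2%N w) /\ exists k, cdiff (A 2%N) w k.
  move=> /inr/inrect_dist[m m0 Hm].
  have [h1 h2] := cdiff_ckernel ab cd m0 (holo_bcont hf) cid Hm.
  by split => //; eexists; exact: h2.
have dK w : normc (w - z) < s -> cdiff (K 1%N) w (K 2%N w) /\ exists k, cdiff (K 2%N) w k.
  move=> /inr/inrect_dist[m m0 Hm].
  have [h1 h2] := cdiff_ckernel ab cd m0 c1 cid Hm.
  by split => //; eexists; exact: h2.
have K0 w : normc (w - z) < s -> K 1%N w != 0 by move=> /inr/kappa_neq0.
have fE w : normc (w - z) < s -> f w = A 1%N w / K 1%N w.
  by move=> ws; rewrite [A _ _](cauchy (inr _ ws) hf) mulfK// K0.
have f'E w : normc (w - z) < s -> f' w = A 2%N w / K 1%N w - A 1%N w * K 2%N w / K 1%N w ^+ 2.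
  move=> ws; apply: cdiff_unique (df _ _) _; first exact/sqU/inrect_rect/inr.
  have := cdiff_div (K0 _ ws) (dA _ ws).1 (dK _ ws).1.
  apply: cdiff_near; exists (s - normc (w - z)); first by rewrite subr_gt0.
  move=> v vw; rewrite fE//; have := le_normcD (v - w) (w - z).
  by rewrite addrA subrK; clear - vw; lra.
have zs : normc (z - z) < s by rewrite subrr normc0.
have [dA1 [kA dA2]] := dA _ zs; have [dK1 [kK dK2]] := dK _ zs.
have K20 : K 1%N z * K 1%N z != 0 by rewrite mulf_neq0// K0.
have D1 := cdiff_div (K0 _ zs) dA2 dK1.
have D2 := cdiff_div (g := fun w => K 1%N w * K 1%N w) K20 (cdiffM dA1 dK2) (cdiffM dK1 dK1).
eexists; apply: cdiff_near (cdiffB D1 D2); exists s => // w ws.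
by rewrite f'E// expr2.
Qed.

End Cauchy.

(** * Univalent maps and their inverses *)

Section Inverse.
Context {R : realType}.
Implicit Types (f g phi psi : R[i] -> R[i]) (a b c d t : R) (z w p : R[i]) (U V : set R[i]).

(** A weak maximum principle read off from Cauchy's formula. The constant may exceed 1, but it
    depends on the rectangle and on z alone, so one constant serves all the functions 1 / (phi - w)
    in [holo_open]. *)
Lemma holo_bound a b c d z : inrect a b c d z -> exists2 C : R, 0 < C &
  forall f (M : R), holo (rect a b c d) f ->
    (forall w, brect a b c d w -> normc (f w) <= M) -> normc (f z) <= C * M.
Proof.
move=> hz; have [/ltW ab /ltW cd] := inrect_le hz; have [m m0 Hm] := inrect_dist hz.
have k0 : 0 < normc (kappa a b c d z) by rewrite normc_gt0 kappa_neq0.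
have cid : bcont id a b c d by move=> w _; exact: ccont_id.
have neq w : brect a b c d w -> id w - z != 0.
  by move=> /Hm h; rewrite -normc_gt0 (lt_le_trans m0).
set p := (b - a) + (d - c).
have p0 : 0 < p by have [? ?] := inrect_le hz; rewrite addr_gt0// subr_gt0.
exists (4 / m * p / normc (kappa a b c d z)).
  by rewrite divr_gt0// mulr_gt0// divr_gt0.
move=> f M hf HM.
rewrite mulrAC ler_pdivlMr// -normcM -cauchy//.
rewrite (_ : _ * M = 4 * (M / m) * p); last by ring.
apply: normc_bint => //; first by apply: bcont_ckernel => //; exact: holo_bcont.
move=> w hw; rewrite /ckernel normcM expr1 normcV; apply: ler_pM => //.
- exact: normc_ge0.
- by rewrite invr_ge0 normc_ge0.
- exact: HM.
- by rewrite lef_pV2 ?posrE ?Hm// (lt_le_trans m0 (Hm _ hw)).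
Qed.

(** If w close to phi(z) were omitted, 1 / (phi - w) would be holomorphic on the rectangle, very
    large at z and bounded on the boundary, against [holo_bound]. *)
Lemma holo_open phi a b c d z : inrect a b c d z -> holo (rect a b c d) phi ->
  (forall w, brect a b c d w -> phi w != phi z) ->
  exists2 e : R, 0 < e & forall w, normc (w - phi z) < e ->
    exists2 x, rect a b c d x & phi x = w.
Proof.
move=> hz hphi neq; have [/ltW ab /ltW cd] := inrect_le hz.
have [C C0 HC] := holo_bound hz.
have cB : bcont (fun w => phi w - phi z) a b c d.
  by move=> w hw; apply: ccontB; [exact: (holo_bcont hphi)|exact: ccont_cst].
have [w hw|m m0 Hm] := bcont_min ab cd cB; first by rewrite subr_eq0 neq.
have C1 : 0 < C + 1 by rewrite addr_gt0.
(* With u = |w - phi z| the interior value is 1 / u and the boundary bound is 1 / (m - u); u < m /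
   (C + 1) is exactly the condition 1 / u > C / (m - u). *)
exists (m / (C + 1)); first by rewrite divr_gt0.
move=> w wm; apply: contrapT => H.
have nz x : rect a b c d x -> phi x - w != 0.
  by move=> hx; rewrite subr_eq0; apply/eqP => E; apply: H; exists x.
have mw : 0 < m - normc (w - phi z).
  rewrite subr_gt0 (lt_le_trans wm)// ler_pdivrMr// mulrDr mulr1 lerDr.
  by apply: mulr_ge0; exact: ltW.
have : normc (phi z - w)^-1 <= C * (m - normc (w - phi z))^-1.
  apply: (HC (fun x => (phi x - w)^-1)).
  - move=> x hx; have [k dk] := hphi _ hx.
    have dw : cdiff (fun x => phi x - w) x (k - 0) by apply: cdiffB dk _; exact: cdiff_cst.
    by eexists; exact: cdiff_comp dw (cdiffV (nz _ hx)).
  - move=> x hx; have := nz _ (brect_rect hx); rewrite -normc_gt0 => nx.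
    rewrite normcV lef_pV2 ?posrE//.
    have := ler_normcB (phi x - phi z) (w - phi z); have := Hm _ hx.
    have -> : phi x - phi z - (w - phi z) = phi x - w by ring.
    by clear; lra.
apply/negP; rewrite normcV normcB -ltNge.
have nw : 0 < normc (w - phi z) by rewrite normcB normc_gt0 nz//; exact: inrect_rect.
rewrite ltr_pdivrMr// mulrC ltr_pdivlMr//.
move: wm; rewrite ltr_pdivlMr//; clear; lra.
Qed.

Lemma csquare_ball z (s : R) w : csquare z s w -> normc (w - z) <= s + s.
Proof.
move=> [h1 h2]; apply: (le_trans (normc_le_ReIm _)).
by rewrite cReB cImB; apply: lerD; rewrite ler_norml lerBlDl lerBrDl.
Qed.

Lemma inrect_ball z (s : R) w : normc (w - z) < s ->
  inrect (Re z - s) (Re z + s) (Im z - s) (Im z + s) w.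
Proof.
move=> ws; have := le_lt_trans (Re_le_normc _) ws; have := le_lt_trans (Im_le_normc _) ws.
rewrite cReB cImB !ltr_norml => /andP[a1 a2] /andP[b1 b2].
by split; apply/andP; split; clear - a1 a2 b1 b2; lra.
Qed.

Lemma copen_square U z (r : R) : copen U -> U z -> 0 < r ->
  exists2 s : R, 0 < s & forall w, csquare z s w -> U w /\ normc (w - z) < r.
Proof.
move=> oU Uz r0; have [r1 r10 rU] := oU _ Uz.
exists (Num.min r r1 / 4); first by rewrite divr_gt0// lt_min r0.
move=> w /csquare_ball h.
have : normc (w - z) < Num.min r r1.
  have : 0 < Num.min r r1 by rewrite lt_min r0.
  by move: h; clear; lra.
by rewrite lt_min => /andP[? /rU].
Qed.

Lemma cdiff_is_derive_Re f z k t : cdiff f (z + (t%:C)%C) k ->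
  is_derive t (1 : R) (fun s => Re (f (z + (s%:C)%C))) (Re k).
Proof.
move=> df; apply: is_derive_eps => e /df[r r0 H]; exists r => // h hr.
have E : z + ((h *: (1 : R) + t)%:C)%C - (z + (t%:C)%C) = (h%:C)%C.
  by rewrite [h *: _]mulr1 rmorphD/=; ring.
have := H (z + ((h *: (1 : R) + t)%:C)%C); rewrite E normc_real => /(_ hr).
apply: le_trans; apply: le_trans (Re_le_normc _).
by rewrite !cReB cReM /= mulr0 subr0 [h *: Re k]mulrC.
Qed.

Lemma derive0_eq (F : R -> R) (a b : R) : a <= b ->
  (forall t, a <= t <= b -> is_derive t (1 : R) F 0) -> F b = F a.
Proof.
move=> ab der.
have d1 x : x \in `]a, b[%R -> is_derive x 1 F (cst 0 x).
  by rewrite in_itv/= => /andP[? ?]; apply: der; rewrite !ltW.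
have [|c _] := MVT_segment ab d1.
  by apply: derivable_within_continuous => t; rewrite in_itv/= => /der[].
by rewrite mul0r => /eqP; rewrite subr_eq0 => /eqP.
Qed.

(** A derivative vanishing on a whole ball would make phi constant along a horizontal segment,
    against injectivity. *)
Lemma derive_neq0_dense U phi phi' z (r : R) : copen U -> {in U &, injective phi} ->
  (forall z, U z -> cdiff phi z (phi' z)) -> U z -> 0 < r ->
  exists w, [/\ U w, normc (w - z) < r & phi' w != 0].
Proof.
move=> oU inj dphi Uz r0; apply: contrapT => H.
have [r1 r10 rU] := oU _ Uz.
pose m := Num.min r r1.
have m0 : 0 < m by rewrite lt_min r0.
have d0 w : normc (w - z) < m -> cdiff phi w 0.
  rewrite lt_min => /andP[wr /rU Uw]; have := dphi _ Uw.
  suff -> : phi' w = 0 by [].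
  by apply/eqP; apply: contrapT => /negP h; apply: H; exists w.
pose s := m / 2.
have s0 : 0 < s by rewrite divr_gt0.
have sm : s < m by rewrite /s; move: m0; clear; lra.
have nt t : `|t| <= s -> normc (z + (t%:C)%C - z) < m.
  by rewrite addrC addKr normc_real => /le_lt_trans; exact.
(* Only real parts are differentiated; c = 1 and c = i recover both parts of phi. *)
have cst (c : R[i]) : Re (c * phi (z + (s%:C)%C)) = Re (c * phi (z + (0%:C)%C)).
  pose F t : R := Re (c * phi (z + (t%:C)%C)).
  have der t : 0 <= t <= s -> is_derive t (1 : R) F 0.
    move=> /andP[t0 ts].
    have -> : (0 : R) = Re (c * 0 : R[i]) by rewrite mulr0.
    apply: (cdiff_is_derive_Re (f := fun w => c * phi w)); apply: cdiffZ; apply: d0.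
    by apply: nt; rewrite ger0_norm.
  exact: (derive0_eq (F := F) (ltW s0)).
have E : phi (z + (s%:C)%C) = phi (z + (0%:C)%C).
  have := cst 1; have := cst ('i%C); rewrite !mul1r !cReM /= !mul0r !sub0r !mul1r.
  case: (phi _) => [x y]; case: (phi _) => [x' y'] /= /eqP.
  by rewrite eqr_opp => /eqP -> ->.
have Us : U (z + (s%:C)%C).
  apply: rU; have := nt s; rewrite (ger0_norm (ltW s0)) lexx => /(_ isT).
  by rewrite lt_min => /andP[].
have := inj _ _ _ _ E; rewrite !inE addr0 => /(_ Us Uz)/eqP.
rewrite addrC -subr_eq0 addrK => /eqP[s00].
by move: s0; rewrite s00 ltxx.
Qed.

Section inverse.
Variables (U V : set R[i]) (phi psi : R[i] -> R[i]).
Hypotheses (oU : copen U) (hphi : holo U phi)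
  (phiK : forall z, U z -> psi (phi z) = z) (phiV : forall z, U z -> V (phi z))
  (psiU : forall w, V w -> U (psi w)) (psiK : forall w, V w -> phi (psi w) = w).


(** Injectivity keeps the boundary values of phi on a small square away from phi(z), so [holo_open]
    applies at every scale. Openness of [V] and continuity of [psi] come out together. *)
Lemma inverse_open z (r : R) : U z -> 0 < r -> exists2 e : R, 0 < e &
  forall w, normc (w - phi z) < e -> V w /\ normc (psi w - z) < r.
Proof.
move=> Uz r0; have [s s0 Hs] := copen_square oU Uz r0.
have zs : normc (z - z) < s by rewrite subrr normc0.
have hr : holo (csquare z s) phi by move=> w /Hs[/hphi].
have [|e e0 H] := holo_open (inrect_ball zs) hr.
  move=> w [/Hs[Uw _] hb]; apply/eqP => E.
  have wz : w = z by rewrite -(phiK Uw) -(phiK Uz) E.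
  move: hb; rewrite wz; have [] := inrect_ball zs; move=> /andP[a1 a2] /andP[b1 b2] h.
  by move: a1 a2 b1 b2; case: h => [<-|[<-|[<-|<-]]]; rewrite ltxx.
exists e => // w /H[x /Hs[Ux xr] <-]; split; first exact: phiV.
by rewrite phiK.
Qed.


Variable phi' : R[i] -> R[i].
Hypothesis dphi : forall z, U z -> cdiff phi z (phi' z).

Lemma phi_inj z w : U z -> U w -> phi z = phi w -> z = w.
Proof. by move=> Uz Uw E; rewrite -(phiK Uz) E phiK. Qed.

Lemma inverse_ccont w : V w -> ccont psi w.
Proof.
move=> Vw e e0; have [r r0 H] := inverse_open (psiU Vw) e0.
by exists r => // v; rewrite -{1}(psiK Vw) => /H[].
Qed.

(** When phi'(z) is nonzero, q phi' / (phi - phi(z)) has a simple pole at z with residue q(z).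
    Subtracting q(z) / (w - z) leaves o(1 / |w - z|), which [goursat] integrates to zero. *)
Lemma residue q a b c d z : holo setT q -> rect a b c d `<=` U -> inrect a b c d z ->
  phi' z != 0 ->
  bint (ckernel (fun x => q x * phi' x) phi 1 (phi z)) a b c d = q z * kappa a b c d z.
Proof.
move=> hq rU hz d0; have [/ltW ab /ltW cd] := inrect_le hz.
have hphi' := holo_derive oU dphi.
have [m m0 Hm] := inrect_dist hz.
have Uz := rU _ (inrect_rect hz).
have neq w : brect a b c d w -> id w - z != 0.
  by move=> /Hm h; rewrite -normc_gt0 (lt_le_trans m0).
have neq' w : U w -> w <> z -> phi w - phi z != 0.
  by move=> Uw wz; rewrite subr_eq0; apply/eqP => /(phi_inj Uw Uz).
have cid : bcont id a b c d by move=> w _; exact: ccont_id.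
have c1 : bcont (fun=> 1) a b c d by move=> w _; exact: ccont_cst.
have hqp w : U w -> exists k, cdiff (fun x => q x * phi' x) w k.
  move=> /hphi'[k dk]; have [k' dk'] := hq w I.
  by eexists; exact: cdiffM dk' dk.
have cqp : bcont (fun x => q x * phi' x) a b c d.
  by move=> w /brect_rect/rU/hqp[k]; exact: cdiff_ccont.
have cphi : bcont phi a b c d by move=> w /brect_rect/rU/dphi; exact: cdiff_ccont.
have cK1 : bcont (ckernel (fun x => q x * phi' x) phi 1 (phi z)) a b c d.
  apply: bcont_ckernel => // w hw; apply: neq'; first exact/rU/brect_rect.
  by move=> wz; have := neq _ hw; rewrite wz subrr eqxx.
have cK2 := @bcont_ckernel _ (fun=> 1) _ 1%N _ _ _ _ _ c1 cid neq.
apply/eqP; rewrite -subr_eq0 -mulN1r; apply/eqP.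
rewrite /kappa mulrA -bintZ// -bintD//; last by move=> w hw; apply: ccontZ; exact: cK2.
apply: (@goursat _ _ _ _ _ _ z); rewrite ?hz.1 ?hz.2//.
- move=> w hw wz; have [k' dk'] := hqp _ (rU _ hw).
  have wz0 : w - z != 0 by rewrite subr_eq0; apply/eqP.
  have dw : cdiff (fun w => w - z) w (1 - 0) by apply: cdiffB; [exact: cdiff_id|exact: cdiff_cst].
  have dV := cdiff_comp dw (cdiffV wz0).
  have dw' : cdiff (fun w => phi w - phi z) w (phi' w - 0).
    by apply: cdiffB; [exact/dphi/rU|exact: cdiff_cst].
  have dV' := cdiff_comp dw' (cdiffV (neq' _ (rU _ hw) wz)).
  have := cdiffD (cdiffM dk' dV') (cdiffZ (- 1 * q z) (cdiffM (cdiff_cst 1 w) dV)).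
  by rewrite /ckernel; eexists; eassumption.
- move=> e e0.
  have nd : 0 < normc (phi' z) by rewrite normc_gt0.
  have nq : 0 < normc (q z) + 1 by rewrite ltr_wpDl// normc_ge0.
  have ed : 0 < e * normc (phi' z) / 4 by rewrite divr_gt0// mulr_gt0.
  have [k dk] := hqp _ Uz.
  have [r1 r10 H1] := cdiff_ccont dk ed.
  have [r2 r20 H2] := dphi Uz (divr_gt0 ed nq).
  have [r3 r30 H3] := dphi Uz (divr_gt0 nd (ltr0n _ 2)).
  have [r4 r40 H4] := oU Uz.
  exists (Num.min (Num.min r1 r2) (Num.min r3 r4)); first by rewrite !lt_min r10 r20 r30.
  move=> w wz; rewrite !lt_min => /andP[/andP[/H1 {}H1 /H2 {}H2] /andP[/H3 {}H3 /H4 Uw]].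
  have wz0 : w - z != 0 by rewrite subr_eq0; apply/eqP.
  have D0 := neq' _ Uw wz.
  have h0 : 0 < normc (w - z) by rewrite normc_gt0.
  have HD : normc (phi' z) / 2 * normc (w - z) <= normc (phi w - phi z).
    have := ler_normcB (phi' z * (w - z)) (phi' z * (w - z) - (phi w - phi z)).
    rewrite subKr normcM (normcB (phi' z * _)).
    by move: H3; set A := normc _; set B := normc (phi w - phi z); lra.
  rewrite -normcM /ckernel !expr1 (_ : _ * (w - z) =
    ((q w * phi' w - q z * phi' z) * (w - z) -
      q z * (phi w - phi z - phi' z * (w - z))) / (phi w - phi z)); last first.
    by field; rewrite D0 wz0.
  rewrite normcM normcV ler_pdivrMr; last by rewrite normc_gt0.
  apply: (@le_trans _ _ (e * (normc (phi' z) / 2 * normc (w - z)))); last first.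
    by rewrite ler_pM2l.
  apply: (le_trans (le_normcD _ _)); rewrite normcN !normcM.
  have T1 : normc (q w * phi' w - q z * phi' z) * normc (w - z) <=
       e * normc (phi' z) / 4 * normc (w - z).
    by rewrite ler_pM2r// ltW.
  have T2 : normc (q z) * normc (phi w - phi z - phi' z * (w - z)) <=
       e * normc (phi' z) / 4 * normc (w - z).
    have qk : normc (q z) <= normc (q z) + 1 by rewrite lerDl.
    apply: (le_trans (ler_pM _ _ qk H2)); rewrite ?normc_ge0//.
    by rewrite mulrA [X in X * _ <= _]mulrC divfK// gt_eqF.
  by apply: (le_trans (lerD T1 T2)); rewrite le_eqVlt; apply/orP; left; apply/eqP; field.
Qed.

Lemma ccont_eq f g w : ccont f w -> ccont g w ->
  (forall r : R, 0 < r -> exists2 v, normc (v - w) < r & f v = g v) -> f w = g w.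
Proof.
move=> cf cg H; apply/eqP; rewrite -subr_eq0 -normc_eq0; apply/negPn/negP => n0.
have {}n0 : 0 < normc (f w - g w) by rewrite lt_neqAle eq_sym n0 normc_ge0.
have [r1 r10 H1] := cf _ (divr_gt0 n0 (ltr0n _ 2)).
have [r2 r20 H2] := cg _ (divr_gt0 n0 (ltr0n _ 2)).
have [|v] := H (Num.min r1 r2); first by rewrite lt_min r10.
rewrite lt_min => /andP[/H1 {}H1 /H2 {}H2] E.
have := le_normcD (f w - f v) (g v - g w).
rewrite (_ : f w - f v + _ = f w - g w); last by rewrite E; ring.
by rewrite (normcB (f w) (f v)); lra.
Qed.

(** The contour integrals for q = id and q = 1 are differentiable in w, and their quotient is psi.
    The identity behind this is [residue], available where phi' is nonzero; such points are dense
    and both sides are continuous, so it holds everywhere. No prior knowledge about zeros of phi'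
    enters; their absence follows afterwards in [cder_neq0]. *)
Lemma inverse_holo : holo V psi.
Proof.
move=> w0 Vw0; pose z := psi w0; have Uz : U z := psiU Vw0.
have zw0 : phi z = w0 := psiK Vw0.
have [s s0 Hs] := copen_square oU Uz (@ltr01 R).
have rU : csquare z s `<=` U by move=> w /Hs[].
have [e0 e00 He] := inverse_open Uz s0.
have zs : normc (z - z) < s by rewrite subrr normc0.
have [/ltW ab /ltW cd] := inrect_le (inrect_ball zs).
have hphi' := holo_derive oU dphi.
have cid : bcont id (Re z - s) (Re z + s) (Im z - s) (Im z + s).
  by move=> w _; exact: ccont_id.
have c1 : bcont (fun=> 1) (Re z - s) (Re z + s) (Im z - s) (Im z + s).
  by move=> w _; exact: ccont_cst.
have cphi : bcont phi (Re z - s) (Re z + s) (Im z - s) (Im z + s).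
  by move=> w /brect_rect/rU/dphi; exact: cdiff_ccont.
have [m m0 Hm] : exists2 m : R, 0 < m &
   forall w, brect (Re z - s) (Re z + s) (Im z - s) (Im z + s) w -> m <= normc (phi w - w0).
  apply: bcont_min => //.
    by move=> w hw; apply: ccontB; [exact: cphi|exact: ccont_cst].
  move=> w hw; rewrite subr_eq0; apply/eqP; rewrite -zw0 => /(phi_inj (rU _ (brect_rect hw)) Uz) E.
  have [n n0] := inrect_dist (inrect_ball zs); move=> /(_ _ hw).
  by rewrite E subrr normc0 leNgt n0.
have m20 : 0 < m / 2 by rewrite divr_gt0.
pose N q w := bint (ckernel (fun x => q x * phi' x) phi 1 w)
  (Re z - s) (Re z + s) (Im z - s) (Im z + s).
have cqp q : holo setT q ->
    bcont (fun x => q x * phi' x) (Re z - s) (Re z + s) (Im z - s) (Im z + s).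
  move=> hq w /brect_rect/rU Uw; apply: ccontM.
    by have [k] := hq w I; exact: cdiff_ccont.
  by have [k] := hphi' _ Uw; exact: cdiff_ccont.
have dN q w : holo setT q -> normc (w - w0) < m / 2 -> exists k, cdiff (N q) w k.
  move=> hq ww; have [h _] := cdiff_ckernel ab cd m20 (cqp _ hq) cphi (ckernel_neq Hm ww).
  by eexists; exact: h.
pose r := Num.min (m / 2) e0.
have r0 : 0 < r by rewrite lt_min m20.
have NE q w : holo setT q -> normc (w - w0) < r ->
    N q w = q (psi w) * kappa (Re z - s) (Re z + s) (Im z - s) (Im z + s) (psi w).
  move=> hq; rewrite lt_min => /andP[wm we].
  have [Vw ps] : V w /\ normc (psi w - z) < s by apply: He; rewrite zw0.
  have inw := inrect_ball ps; have Upw := psiU Vw.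
  apply: (@ccont_eq (N q) (fun w => q (psi w) *
      kappa (Re z - s) (Re z + s) (Im z - s) (Im z + s) (psi w))).
  - by have [k] := dN _ _ hq wm; exact: cdiff_ccont.
  - have cp := inverse_ccont Vw.
    have [k dk] := hq (psi w) I; have [n n0 Hn] := inrect_dist inw.
    have [dk' _] := cdiff_ckernel ab cd n0 c1 cid Hn.
    apply: ccontM; apply: ccont_comp => //; [exact: cdiff_ccont dk|exact: cdiff_ccont dk'].
  (* A point x near psi(w) with phi'(x) nonzero stays in the square, and phi(x) is as close to w as
     desired; [residue] gives the identity at phi(x). *)
  - move=> r' r'0.
    have [r1 r10 H1] := cdiff_ccont (dphi Upw) r'0.
    have ps0 : 0 < s - normc (psi w - z) by rewrite subr_gt0.
    have [||x [Ux xr dx]] := @derive_neq0_dense U phi phi' (psi w)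
        (Num.min r1 (s - normc (psi w - z))) oU _ dphi Upw.
      by move=> x y; rewrite !inE; exact: phi_inj.
      by rewrite lt_min r10.
    move: xr; rewrite lt_min => /andP[x1 x2].
    exists (phi x); first by rewrite -{1}(psiK Vw) H1.
    rewrite phiK// /N residue//; apply: inrect_ball.
    have := le_normcD (x - psi w) (psi w - z); rewrite addrA subrK; lra.
have h1 : holo setT (fun=> 1 : R[i]) by move=> w _; eexists; exact: cdiff_cst.
have hid : holo setT (@id R[i]) by move=> w _; eexists; exact: cdiff_id.
have w00 : normc (w0 - w0) < r by rewrite subrr normc0.
have w0m : normc (w0 - w0) < m / 2 by rewrite subrr normc0.
have K0 w : normc (w - w0) < r -> N (fun=> 1) w != 0.
  move=> wr; rewrite NE// mul1r; apply: kappa_neq0; apply: inrect_ball.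
  by move: wr; rewrite lt_min -zw0 => /andP[_ /He[]].
have [k1 dk1] := dN _ _ h1 w0m; have [k2 dk2] := dN _ _ hid w0m.
eexists; apply: cdiff_near (cdiff_div (K0 _ w00) dk2 dk1); exists r => // w wr.
have := K0 _ wr; rewrite !NE// mul1r => nk; by rewrite mulfK.
Qed.

End inverse.
End Inverse.

(** * The complex plane as [R * R]: norms, open sets, rational boxes *)

Section Plane.
Context {R : realType}.
Local Notation P := (measurableTypeR R * measurableTypeR R)%type.
Implicit Types (p q v : R * R) (z w : R[i]) (A B : set (R * R)) (U V : set R[i]).

Definition pt z : R * R := (Re z, Im z).

Lemma ptK : cancel pt (@cplx R).
Proof. by case. Qed.

Lemma cplxK : cancel (@cplx R) pt.
Proof. by case. Qed.

Lemma cplxD p q : cplx (p + q) = cplx p + cplx q.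
Proof. by []. Qed.

Lemma cplxB p q : cplx (p - q) = cplx p - cplx q.
Proof. by []. Qed.

Lemma cplxZ (h : R) p : cplx (h *: p) = (h%:C)%C * cplx p.
Proof. by case: p => x y; rewrite /cplx /= [RHS]/GRing.mul/= !mul0r subr0 addr0. Qed.

Lemma norm_le_normc p : `|p| <= normc (cplx p).
Proof.
rewrite ge_max; apply/andP; split; [exact: (Re_le_normc (cplx p))|exact: (Im_le_normc (cplx p))].
Qed.

Lemma normc_le_norm p : normc (cplx p) <= 2 * `|p|.
Proof.
apply: (le_trans (normc_le_ReIm _)); rewrite mulr_natl mulr2n /=.
by apply: lerD; rewrite le_max lexx ?orbT.
Qed.

Lemma open_ballP A : open A <-> forall p, A p -> exists2 r : R, 0 < r & forall q, `|q - p| < r -> A q.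
Proof.
rewrite openE; split=> H p /H.
  move=> /nbhs_ballP[r /= r0 pA]; exists r => // q qp; apply: pA.
  by rewrite -ball_normE /ball_/= distrC.
move=> [r r0 pA]; apply/nbhs_ballP; exists r => //= q.
by rewrite -ball_normE /ball_/= distrC => /pA.
Qed.

Lemma plane_open U : copen U -> open (plane U).
Proof.
move=> oU; apply/open_ballP => p /oU[r r0 H]; exists (r / 2); first by rewrite divr_gt0.
move=> q qp; apply: H; rewrite -cplxB; apply: le_lt_trans (normc_le_norm _) _.
by rewrite mulrC -ltr_pdivlMr.
Qed.

Lemma open_copen (U : set R[i]^o) : open U -> copen U.
Proof.
rewrite openE => oU z /oU /nbhs_ballP[[a b]] /=.
rewrite ltcE/= => /andP[/eqP -> a0] H; exists a => // w wz; apply: H.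
by rewrite /ball/= /ball_/= distrC /Num.norm/= ltcR.
Qed.

Definition rbox (a : rat * rat * (rat * rat)) : set (R * R) :=
  `]ratr a.1.1, ratr a.1.2[%classic `*` `]ratr a.2.1, ratr a.2.2[%classic.

Definition rcbox (a : rat * rat * (rat * rat)) : set (R * R) :=
  `[ratr a.1.1, ratr a.1.2]%classic `*` `[ratr a.2.1, ratr a.2.2]%classic.

(** Asking for the closed boxes to lie in [A] makes bounds from compactness available on each member
    of this countable cover. *)
Lemma open_rbox A : open A -> A = \bigcup_(a in [set a | rcbox a `<=` A]) rbox a.
Proof.
move=> /open_ballP oA; apply/seteqP; split => [[x y] /oA[r r0 H]|p [a aA pa]]; last first.
  apply: aA; case: pa; rewrite /= !in_itv/= => /andP[? ?] /andP[? ?].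
  by split; rewrite /= in_itv/=; apply/andP; split; exact: ltW.
have rat_near (u : R) : exists a b : rat, [/\ u - r / 2 < ratr a, ratr a < u, u < ratr b & ratr b < u + r / 2].
  have [|a] := @rat_in_itvoo R (u - r / 2) u; first by rewrite ltrBlDr ltrDl divr_gt0.
  have [|b] := @rat_in_itvoo R u (u + r / 2); first by rewrite ltrDl divr_gt0.
  by rewrite !in_itv/= => /andP[? ?] /andP[? ?]; exists a, b.
have [a [b [h1 h2 h3 h4]]] := rat_near x; have [c [d [k1 k2 k3 k4]]] := rat_near y.
exists ((a, b), (c, d)); last by split; rewrite /= in_itv/= ?h2 ?k2.
move=> [u v] [/=]; rewrite !in_itv/= => /andP[u1 u2] /andP[v1 v2]; apply: H.
rewrite gt_max/= !ltr_norml; apply/andP; split; apply/andP; split.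
- by clear - h1 h4 u1 u2 r0; lra.
- by clear - h1 h4 u1 u2 r0; lra.
- by clear - k1 k4 v1 v2 r0; lra.
- by clear - k1 k4 v1 v2 r0; lra.
Qed.

Lemma measurable_rbox a : measurable (rbox a : set P).
Proof. by apply: measurableX; exact: measurable_itv. Qed.

Lemma open_measurable2 A : open A -> measurable (A : set P).
Proof.
move=> /open_rbox ->; rewrite bigcup_mkcond; apply: countable_bigcupT_measurable => [//|a].
by case: ifP => // _; exact: measurable_rbox.
Qed.

Lemma open_continuous_measurable (A : set (R * R)) (f : R * R -> R) :
  open A -> {in A, continuous f} -> measurable_fun (A : set P) f.
Proof.
move=> oA cf; apply: (measurability _ (RGenOpens.measurableE R)).
move=> _ [_ [a [b ->] <-]]; apply: open_measurable2.
rewrite openE => p [Ap /= pab].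
near=> q; split.
  by near: q; exact: open_nbhs_nbhs.
by near: q; have := cf p (mem_set Ap); apply; apply: open_nbhs_nbhs.
Unshelve. all: by end_near. Qed.

Lemma measurable_plane U : copen U -> measurable (plane U : set P).
Proof. by move=> /plane_open/open_measurable2. Qed.

End Plane.

(** * Area and holomorphic maps *)

Section PushMeasure.
Context d d' (T1 : measurableType d) (T2 : measurableType d') (R : realType).
Variables (m : {measure set T1 -> \bar R}) (f : T1 -> T2) (mf : measurable_fun [set: T1] f).

(* The proof terms are recorded in [pushm] and [density] so that the measure
   structures can be inferred. *)
Definition pushm (A : set T2) : \bar R := let _ := mf in m (f @^-1` A).

Let pushm0 : pushm set0 = 0%E.
Proof. by rewrite /pushm preimage_set0 measure0. Qed.

Let pushm_ge0 A : (0 <= pushm A)%E.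
Proof. exact: measure_ge0. Qed.

Let pushm_additive : semi_sigma_additive pushm.
Proof.
move=> F mF tF mUF; rewrite /pushm preimage_bigcup.
apply: measure_semi_sigma_additive.
- by move=> n; rewrite -[X in measurable X]setTI; exact: mf.
- apply/trivIsetP => /= i j _ _ ij; rewrite -preimage_setI.
  by move/trivIsetP : tF => /(_ _ _ _ _ ij) ->//; rewrite preimage_set0.
- by rewrite -preimage_bigcup -[X in measurable X]setTI; exact: mf.
Qed.

HB.instance Definition _ := isMeasure.Build _ _ _ pushm pushm0 pushm_ge0 pushm_additive.

Lemma ge0_integral_pushm (g : T2 -> \bar R) :
  measurable_fun setT g -> (forall y, 0 <= g y)%E ->
  (\int[pushm]_y g y = \int[m]_x g (f x))%E.
Proof. by move=> mg g0; exact: (@ge0_integral_pushforward _ _ _ _ _ f mf m setT g). Qed.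

End PushMeasure.

Section Density.
Context d (T : measurableType d) (R : realType).
Variables (m : {measure set T -> \bar R}) (g : T -> R) (g0 : forall x, 0 <= g x)
  (mg : measurable_fun setT g).

Definition density (A : set T) : \bar R :=
  let _ := g0 in let _ := mg in (\int[m]_(x in A) (g x)%:E)%E.

Let density0 : density set0 = 0%E.
Proof. exact: integral_set0. Qed.

Let density_ge0 A : (0 <= density A)%E.
Proof. by apply: integral_ge0 => x _; rewrite lee_fin. Qed.

Let density_additive : semi_sigma_additive density.
Proof.
move=> F mF tF mUF; rewrite /density ge0_integral_bigcup//.
- by apply: is_cvg_nneseries_cond => n _ _; exact: density_ge0.
- by apply/measurable_EFinP; exact: measurable_funTS.
- by move=> x _; rewrite lee_fin.
Qed.

HB.instance Definition _ := isMeasure.Build _ _ _ density density0 density_ge0 density_additive.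

Import HBNNSimple.

(** Monotone convergence along simple functions reduces the identity to indicators, where it is the
    definition of [density]. *)
Lemma ge0_integral_density (f : T -> \bar R) :
  measurable_fun setT f -> (forall x, 0 <= f x)%E ->
  (\int[density]_x f x = \int[m]_x (f x * (g x)%:E))%E.
Proof.
move=> mf f0; pose h := nnsfun_approx measurableT mf.
have fE x : f x = lim ((EFin \o h n) x @[n --> \oo]).
  by apply/esym/cvg_lim => //; exact: cvg_nnsfun_approx.
have meg : measurable_fun setT (EFin \o g) by exact/measurable_EFinP.
transitivity (lim ((\int[density]_x (h n x)%:E)%E @[n --> \oo])).
  rewrite -monotone_convergence//.
  - by apply: eq_integral => x _; rewrite fE.
  - by move=> n; exact/measurable_EFinP.
  - by move=> n x _; rewrite lee_fin.
  - by move=> x _ a b ab; rewrite lee_fin; exact/lefP/nd_nnsfun_approx.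
transitivity (lim ((\int[m]_x ((h n x)%:E * (g x)%:E))%E @[n --> \oo])); last first.
  rewrite -monotone_convergence//.
  - apply: eq_integral => x _; rewrite fE; apply/cvg_lim => //.
    rewrite -fE; apply: cvgeZr => //.
    by have := cvg_nnsfun_approx measurableT mf (fun x _ => f0 x) (I : setT x).
  - by move=> n; apply: emeasurable_funM => //; exact/measurable_EFinP.
  - by move=> n x _; rewrite -EFinM lee_fin mulr_ge0.
  - move=> x _ a b ab; rewrite -!EFinM lee_fin ler_wpM2r//.
    exact/lefP/nd_nnsfun_approx.
apply: congr_lim; apply/funext => n.
have indich r : measurable_fun setT (fun x => (r * \1_(h n @^-1` [set r]) x)%:E).
  by apply: (measurable_comp measurableT) => //; exact: measurable_funM.
transitivity (\int[density]_x
   (\sum_(y \in range (h n)) (y * \1_(h n @^-1` [set y]) x)%:E)%E)%E.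
  by apply: eq_integral => t tE; rewrite /= fimfunE -fsumEFin.
rewrite ge0_integral_fsum//; last by move=> r y Ey; exact: nnfun_muleindic_ge0.
transitivity (\int[m]_x (\sum_(y \in range (h n))
    ((y * \1_(h n @^-1` [set y]) x)%:E * (g x)%:E)%E)%E)%E; last first.
  under [LHS]eq_integral => x xE.
    rewrite -ge0_mule_fsuml => [|y]; last exact: nnfun_muleindic_ge0.
    rewrite fsumEFin // -(fimfunE _ x); over.
  by [].
rewrite ge0_integral_fsum//; last 2 first.
  - by move=> y; apply: emeasurable_funM.
  - move=> r y Ey; apply: mule_ge0; last by rewrite lee_fin.
    exact: nnfun_muleindic_ge0.
apply: eq_fsbigr => r rhn.
under [RHS]eq_integral do rewrite EFinM -muleA.
rewrite integralZl_indic_nnsfun//.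
have mr : measurable (h n @^-1` [set r]) by [].
rewrite ge0_integralZl//; last 3 first.
- by apply: emeasurable_funM => //; exact/measurable_EFinP.
- by move=> x _; rewrite mule_ge0 ?lee_fin.
- by move: rhn; rewrite inE => -[x _ <-]; rewrite lee_fin.
congr (_ * _)%E; rewrite integral_indic// setIT.
transitivity (\int[m]_(x in h n @^-1` [set r]) (g x)%:E)%E; first by [].
rewrite integral_mkcond; apply: eq_integral => x _; rewrite patchE indicE.
by case: ifPn => _; rewrite ?mul1e ?mul0e.
Qed.

End Density.

(** * Lebesgue measure under linear maps and translations *)

Section LinearScaling.
Context {R : realType}.
Local Notation P := (measurableTypeR R * measurableTypeR R)%type.
Local Notation mu := (@lebesgue_measure R).

Lemma lebesgue_measure_shift (a : R) (A : set R) : measurable A ->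
  mu ((fun x => x + a) @^-1` A) = mu A.
Proof.
move=> mA.
have ms : measurable_fun [set: measurableTypeR R] (fun x : R => x + a : measurableTypeR R).
  by apply: measurable_funD => //; exact: measurable_cst.
transitivity (pushm mu ms A); first by [].
apply/esym/(@lebesgue_measure_unique R (pushm mu ms)) => //.
move=> _ [[x y] _ <-]; rewrite /pushm/=.
rewrite (_ : _ @^-1` _ = `]x - a, y - a]%classic); last first.
  by apply/seteqP; split => t; rewrite /= !in_itv/= ltrBlDr lerBrDr.
rewrite !lebesgue_measure_itv/= !lte_fin ltrD2r.
by case: ifP => // _; rewrite -!EFinB; congr EFin; ring.
Qed.

Lemma lebesgue_measure_scale (k : R) (A : set R) : k != 0 -> measurable A ->
  mu A = (`|k|%:E * mu ((fun x => k * x)%R @^-1` A))%E.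
Proof.
move=> k0 mA.
have ms : measurable_fun [set: measurableTypeR R] (fun x : R => k * x : measurableTypeR R).
  by apply: measurable_funM => //; exact: measurable_cst.
have nk : 0 <= `|k| by [].
transitivity (mscale (NngNum nk) (pushm mu ms) A); last by [].
apply: (@lebesgue_measure_unique R (mscale (NngNum nk) (pushm mu ms))) => //.
move=> _ [[x y] _ <-].
transitivity (`|k|%:E * mu ((fun x => k * x)%R @^-1` `]x, y]%classic))%E; last by [].
have [kp|kn] := ltP 0 k.
  rewrite (_ : _ @^-1` _ = `]x / k, y / k]%classic); last first.
    by apply/seteqP; split => t; rewrite /= !in_itv/= ltr_pdivrMr// ler_pdivlMr// mulrC.
  rewrite !lebesgue_measure_itv/= !lte_fin ltr_pM2r ?invr_gt0//.
  case: ifP => // _; last by rewrite mule0.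
  by rewrite -!EFinB -EFinM gtr0_norm//; congr EFin; field.
have {}kn : k < 0 by rewrite lt_neqAle k0.
(* A negative factor flips the interval and moves its open end to the right. *)
rewrite (_ : _ @^-1` _ = `[y / k, x / k[%classic); last first.
  apply/seteqP; split => t; rewrite /= !in_itv/= ltr_ndivlMr// ler_ndivrMr// mulrC;
    by move=> /andP[-> ->].
rewrite !lebesgue_measure_itv/= !lte_fin ltr_nM2r ?invr_lt0//.
case: ifP => // _; last by rewrite mule0.
by rewrite -!EFinB -EFinM ltr0_norm//; congr EFin; field.
Qed.

(** For linear [T] the factor is the modulus of the determinant. Stated through preimages, it
    multiplies under composition. *)
Definition scales (T : P -> P) (k : R) := measurable_fun setT T /\
  forall A : set P, measurable A -> leb2 A = (k%:E * leb2 (T @^-1` A))%E.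

Lemma scales_comp T1 T2 k1 k2 : 0 <= k1 -> 0 <= k2 -> scales T1 k1 -> scales T2 k2 ->
  scales (T2 \o T1) (k2 * k1).
Proof.
move=> k10 k20 [m1 s1] [m2 s2]; split; first exact: measurableT_comp.
move=> A mA; rewrite s2// (s1 (T2 @^-1` A)).
  by rewrite muleA EFinM comp_preimage.
by rewrite -[_ @^-1` _]setTI; exact: m2.
Qed.

Lemma leb2E (A : set P) : leb2 A = (\int[mu]_x mu (xsection A x))%E.
Proof. by []. Qed.

Lemma scales_swap : scales (fun p => (p.2, p.1)) 1.
Proof.
have ms : measurable_fun [set: P] (fun p : P => (p.2, p.1) : P).
  by apply: measurable_fun_pair.
split => // A mA; rewrite mul1e.
transitivity (pushm leb2 ms A); last by [].
apply: (@product_measure_unique _ _ _ _ _ mu mu (pushm leb2 ms)) => //.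
move=> B C mB mC; rewrite /pushm/= (_ : _ @^-1` _ = C `*` B); last first.
  by apply/seteqP; split => -[x y] [].
by rewrite /leb2 product_measure1E// muleC.
Qed.

Lemma scales_sheary (k : R) : scales (fun p => (p.1, p.2 + k * p.1)) 1.
Proof.
have ms : measurable_fun [set: P] (fun p : P => (p.1, p.2 + k * p.1) : P).
  apply: measurable_fun_pair => //; apply: measurable_funD => //.
  by apply: measurable_funM => //; exact: measurable_cst.
split => // A mA; rewrite mul1e !leb2E; apply: eq_integral => x _.
rewrite -(@lebesgue_measure_shift (k * x) (xsection A x)); last exact: measurable_xsection.
by congr (mu _); apply/seteqP; split => y /=; rewrite /xsection/= !inE.
Qed.

Lemma scales_scaley (k : R) : k != 0 -> scales (fun p => (p.1, k * p.2)) `|k|.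
Proof.
move=> k0.
have ms : measurable_fun [set: P] (fun p : P => (p.1, k * p.2) : P).
  by apply: measurable_fun_pair => //; apply: measurable_funM => //; exact: measurable_cst.
split => // A mA; rewrite !leb2E -ge0_integralZl//; last first.
  apply: measurable_fun_xsection; rewrite -[_ @^-1` _]setTI; exact: ms.
apply: eq_integral => x _; rewrite (lebesgue_measure_scale k0); last exact: measurable_xsection.
by congr (_ * mu _)%E; apply/seteqP; split => y /=; rewrite /xsection/= !inE.
Qed.

Lemma scales_ext T T' k k' : T =1 T' -> k = k' -> scales T k -> scales T' k'.
Proof. by move=> /funext -> ->. Qed.

Lemma scales_shearx (k : R) : scales (fun p => (p.1 + k * p.2, p.2)) 1.
Proof.
have h : 0 <= 1 :> R by [].
have := scales_comp (mulr_ge0 h h) h (scales_comp h h scales_swap (scales_sheary k)) scales_swap.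
by apply: scales_ext => //=; rewrite !mulr1.
Qed.

Lemma scales_scalex (k : R) : k != 0 -> scales (fun p => (k * p.1, p.2)) `|k|.
Proof.
move=> k0; have h : 0 <= 1 :> R by [].
have := scales_comp (mulr_ge0 (normr_ge0 k) h) h
  (scales_comp h (normr_ge0 k) scales_swap (scales_scaley k0)) scales_swap.
by apply: scales_ext => //=; rewrite mulr1 mul1r.
Qed.

(** For c = a + i b with a nonzero, multiplication factors into a shear of x by - b / a, a scaling
    of x by a, a scaling of y by (a^2 + b^2) / a and a shear of y by b / a. For a = 0 it is a swap
    followed by scalings. *)
Lemma scales_mul (c : R[i]) : c != 0 -> scales (fun p => pt (c * cplx p)) (normc c ^+ 2).
Proof.
case: c => a b; rewrite sqr_normc/= => c0; have h : 0 <= 1 :> R by [].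
have [a0|a0] := eqVneq a 0.
  have b0 : b != 0 by apply: contraNneq c0 => b0; rewrite a0 b0.
  have nb : - b != 0 by rewrite oppr_eq0.
  have S1 := scales_comp h (normr_ge0 (- b)) scales_swap (scales_scalex nb).
  have := scales_comp (mulr_ge0 (normr_ge0 _) h) (normr_ge0 b) S1 (scales_scaley b0).
  apply: scales_ext => [[x y]|] /=.
    by rewrite a0 /pt/= !mul0r sub0r mulNr add0r.
  by rewrite a0 mulr1 normrN -normrM -expr2 expr0n add0r ger0_norm// sqr_ge0.
have n0 : a ^+ 2 + b ^+ 2 != 0 by rewrite gt_eqF// ltr_wpDr ?sqr_ge0// exprn_even_gt0.
have r0 : (a ^+ 2 + b ^+ 2) / a != 0 by rewrite mulf_neq0// invr_eq0.
have S1 := scales_comp h (normr_ge0 a) (scales_shearx (- (b / a))) (scales_scalex a0).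
have S2 := scales_comp (mulr_ge0 (normr_ge0 _) h) (normr_ge0 _) S1 (scales_scaley r0).
have := scales_comp (mulr_ge0 (normr_ge0 _) (mulr_ge0 (normr_ge0 _) h)) h S2
  (scales_sheary (b / a)).
apply: scales_ext => [[x y]|] /=.
  by rewrite /pt/=; congr pair; field.
by rewrite mul1r mulr1 -normrM divfK// ger0_norm// addr_ge0// sqr_ge0.
Qed.

Lemma scales_translate (q : P) : scales (fun p => p + q) 1.
Proof.
have ms : measurable_fun [set: P] (fun p : P => p + q : P).
  apply: (@measurable_fun_pair _ _ _ _ _ _ (fun p : P => p.1 + q.1) (fun p : P => p.2 + q.2)).
    by apply: measurable_funD => //; exact: measurable_cst.
  by apply: measurable_funD => //; exact: measurable_cst.
split => // A mA; rewrite mul1e.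
transitivity (pushm leb2 ms A); last by [].
apply: (@product_measure_unique _ _ _ _ _ mu mu (pushm leb2 ms)) => //.
move=> B C mB mC; rewrite /= /pushm.
rewrite (_ : _ @^-1` _ = ((fun x => x + q.1) @^-1` B) `*` ((fun x => x + q.2) @^-1` C)); last first.
  by apply/seteqP; split => -[x y] [].
have ms1 (a : R) (D : set (measurableTypeR R)) : measurable D ->
    measurable ((fun x => x + a) @^-1` D).
  move=> mD; have m : measurable_fun [set: measurableTypeR R] (fun x : R => x + a : measurableTypeR R).
    by apply: measurable_funD => //; exact: measurable_cst.
  by rewrite -[X in measurable X]setTI; exact: m.
rewrite /leb2 product_measure1E; [|exact: ms1|exact: ms1].
by congr (_ * _)%E; exact: lebesgue_measure_shift.
Qed.

End LinearScaling.

(** * Half-open boxes as generators of the planar measurable sets *)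

Section Boxes.
Context {R : realType}.
Local Notation P := (measurableTypeR R * measurableTypeR R)%type.

Definition obox (a b c d : R) : set P := `]a, b]%classic `*` `]c, d]%classic.

Definition oboxes : set (set P) := [set X | exists a b c d, X = obox a b c d].

Lemma measurable_obox a b c d : measurable (obox a b c d).
Proof. by apply: measurableX; exact: measurable_itv. Qed.

Lemma oboxI a b c d a' b' c' d' : obox a b c d `&` obox a' b' c' d' =
  obox (Num.max a a') (Num.min b b') (Num.max c c') (Num.min d d').
Proof.
apply/seteqP; split => -[x y]; rewrite /obox/= !in_itv/= !gt_max !le_min.
  by move=> [[/andP[-> ->] /andP[-> ->]] [/andP[-> ->] /andP[-> ->]]].
by move=> [/andP[/andP[-> ->] /andP[-> ->]] /andP[/andP[-> ->] /andP[-> ->]]].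
Qed.

Lemma leb2_obox a b c d : a <= b -> c <= d -> leb2 (obox a b c d) = ((b - a) * (d - c))%:E.
Proof.
move=> ab cd.
transitivity (@lebesgue_measure R `]a, b]%classic * @lebesgue_measure R `]c, d]%classic)%E.
  by apply: product_measure1E; exact: measurable_itv.
rewrite EFinM.
congr (_ * _)%E; rewrite lebesgue_measure_itv/= lte_fin.
  by case: ltP => // ba; rewrite (_ : b = a) ?subrr//; apply/eqP; rewrite eq_le ab ba.
by case: ltP => // ba; rewrite (_ : d = c) ?subrr//; apply/eqP; rewrite eq_le cd ba.
Qed.

Lemma setT_obox : \bigcup_(k : nat) obox (- k%:R) k%:R (- k%:R) k%:R = setT.
Proof.
apply/seteqP; split => // -[x y] _.
pose k := (Num.truncn (Num.max `|x| `|y|)).+1.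
have : Num.max `|x| `|y| < k%:R by rewrite truncnS_gt// le_max normr_ge0.
rewrite gt_max !ltr_norml => /andP[/andP[x1 x2] /andP[y1 y2]].
by exists k => //; split; rewrite /= in_itv/= ?x1 ?y1 ltW.
Qed.

Lemma measurable_oboxes : @measurable _ P = <<s oboxes >>.
Proof.
apply/seteqP; split; last first.
  apply: smallest_sub; first exact: sigma_algebra_measurable.
  by move=> _ [a [b [c [d ->]]]]; exact: measurable_obox.
have S : sigma_algebra setT <<s oboxes >> by exact: smallest_sigma_algebra.
have [S0 SC SU] := S.
have SI A B : <<s oboxes >> A -> <<s oboxes >> B -> <<s oboxes >> (A `&` B).
  move=> sA sB; rewrite -[A]setCK -[B]setCK -setCU -setTD; apply: (SC).
  rewrite -bigcup2E; apply: (SU) => -[|[|n]] /=; rewrite ?setTD//.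
  - by rewrite -setTD; exact: SC.
  - by rewrite -setTD; exact: SC.
have K (k : nat) (X : set (measurableTypeR R)) : measurable X -> True by [].
have S1 (A : set (measurableTypeR R)) : measurable A -> <<s oboxes >> (A `*` setT).
  have H : @measurable _ (measurableTypeR R) `<=` [set A | <<s oboxes >> (A `*` setT)].
    apply: smallest_sub.
      split => /=.
      - by rewrite set0X.
      - move=> B sB; rewrite setTD (_ : _ `*` _ = setT `\` (B `*` setT)); first exact: SC.
        by apply/seteqP; split => -[x y] /=; [move=> [Bx _]; split => // -[]|move=> [_ h]; split => // Bx; apply: h].
      - by move=> F sF; rewrite setX_bigcupl; exact: SU.
    move=> _ [[a b] _ <-] /=.
    rewrite (_ : _ `*` _ = \bigcup_(k : nat) obox a b (- k%:R) k%:R).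
      by apply: SU => k; apply: sub_sigma_algebra; exists a, b, (- k%:R), k%:R.
    apply/seteqP; split => [[x y] [/= xab _]|[x y] [k _ [/= xab _]]//].
    have : [set: P] (x, y) by []; rewrite -setT_obox => -[k _ [_ yk]].
    by exists k => //.
  exact: H.
have S2 (A : set (measurableTypeR R)) : measurable A -> <<s oboxes >> (setT `*` A).
  have H : @measurable _ (measurableTypeR R) `<=` [set A | <<s oboxes >> (setT `*` A)].
    apply: smallest_sub.
      split => /=.
      - by rewrite setX0.
      - move=> B sB; rewrite setTD (_ : _ `*` _ = setT `\` (setT `*` B)); first exact: SC.
        by apply/seteqP; split => -[x y] /=; [move=> [_ Bx]; split => // -[]|move=> [_ h]; split => // Bx; apply: h].
      - by move=> F sF; rewrite setX_bigcupr; exact: SU.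
    move=> _ [[a b] _ <-] /=.
    rewrite (_ : _ `*` _ = \bigcup_(k : nat) obox (- k%:R) k%:R a b).
      by apply: SU => k; apply: sub_sigma_algebra; exists (- k%:R), k%:R, a, b.
    apply/seteqP; split => [[x y] [/= _ xab]|[x y] [k _ [/= _ xab]]//].
    have : [set: P] (x, y) by []; rewrite -setT_obox => -[k _ [yk _]].
    by exists k => //.
  exact: H.
rewrite measurable_prod_measurableType; apply: smallest_sub => //.
move=> _ [A mA [B mB <-]].
rewrite (_ : _ `*` _ = (A `*` setT) `&` (setT `*` B)); first by apply: SI; [exact: S1|exact: S2].
by apply/seteqP; split => -[x y] /=; [move=> [? ?]|move=> [[? ?] [? ?]]].
Qed.

(** Half-open boxes are stable under intersection and countably many of them exhaust the plane, so
    measures finite on them are determined by their values there. *)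
Lemma obox_measure_unique (m1 m2 : {measure set P -> \bar R}) :
  (forall a b c d, m1 (obox a b c d) = m2 (obox a b c d)) ->
  (forall a b c d, m1 (obox a b c d) < +oo)%E ->
  forall A, measurable A -> m1 A = m2 A.
Proof.
move=> H fin A mA.
apply: (@measure_unique _ _ _ oboxes (fun k : nat => obox (- k%:R) k%:R (- k%:R) k%:R)) => //.
- exact: measurable_oboxes.
- move=> _ _ [a [b [c [d ->]]]] [a' [b' [c' [d' ->]]]]; rewrite oboxI.
  by do 4 eexists.
- by move=> k; do 4 eexists.
- exact: setT_obox.
- by move=> _ [a [b [c [d ->]]]].
Qed.

End Boxes.

(** * Derivatives, Jacobians and biholomorphic pairs *)

Section ComplexDerivativeFunction.
Context {R : realType}.
Implicit Types (f g phi psi : R[i] -> R[i]) (z w : R[i]) (U V : set R[i]) (p q : R * R).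

Definition cder f z : R[i] := xget 0 [set k | cdiff f z k].

Lemma cderP U f z : holo U f -> U z -> cdiff f z (cder f z).
Proof. by move=> hf /hf[k dk]; apply: xgetPex; exists k. Qed.

Lemma cdiff_cder f z k : cdiff f z k -> cder f z = k.
Proof. by move=> dk; apply: (cdiff_unique _ dk); apply: xgetPex; exists k. Qed.

Lemma holo_cder U f : copen U -> holo U f -> holo U (cder f).
Proof. by move=> oU hf; apply: holo_derive oU _ => z Uz; exact: cderP hf Uz. Qed.

Lemma holo_ccont U f z : holo U f -> U z -> ccont f z.
Proof. by move=> hf /hf[k]; exact: cdiff_ccont. Qed.

Definition pmap f p : R * R := pt (f (cplx p)).

Definition jac f p : R := normc (cder f (cplx p)) ^+ 2.

Definition cbox (a b c d : R) : set (R * R) := `[a, b]%classic `*` `[c, d]%classic.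

Lemma ccont_continuous (F : R[i] -> R) f p : (forall z w, `|F z - F w| <= normc (z - w)) ->
  ccont f (cplx p) -> {for p, continuous (fun q => F (f (cplx q)))}.
Proof.
move=> F1 cf; apply/cvgrPdist_lt => e e0; have [r r0 H] := cf _ e0.
near=> q; apply: (le_lt_trans (F1 _ _)); rewrite normcB; apply: H.
rewrite -cplxB; apply: (le_lt_trans (normc_le_norm _)).
rewrite mulrC -ltr_pdivlMr// distrC; near: q; apply: cvgr_dist_lt; first exact: cvg_id.
by rewrite divr_gt0.
Unshelve. all: by end_near. Qed.

Lemma Re_lip z w : `|Re z - Re w| <= normc (z - w).
Proof. by rewrite -cReB Re_le_normc. Qed.

Lemma Im_lip z w : `|Im z - Im w| <= normc (z - w).
Proof. by rewrite -cImB Im_le_normc. Qed.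

Lemma normc_lip z w : `|normc z - normc w| <= normc (z - w).
Proof.
by apply/ler_normlP; split; [rewrite opprB normcB ler_normcB|exact: ler_normcB].
Qed.

Lemma continuous_jac U f p : copen U -> holo U f -> plane U p -> {for p, continuous (jac f)}.
Proof.
move=> oU hf Up; apply: (@continuous_comp _ _ _ (fun q => normc (cder f (cplx q))) (fun x => x ^+ 2)).
  by apply: ccont_continuous; [exact: normc_lip|exact: holo_ccont (holo_cder oU hf) Up].
exact: exprn_continuous.
Qed.

Lemma jac_ge0 f p : 0 <= jac f p.
Proof. exact: sqr_ge0. Qed.

Lemma compact_bounded_on (K W : set (R * R)) (f : R * R -> R) : compact K -> K `<=` W ->
  (forall p, W p -> {for p, continuous f}) ->
  exists2 M, 0 < M & forall p, K p -> `|f p| <= M.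
Proof.
move=> cK KW cf; have [K0|K0] := pselect (K !=set0); last first.
  by exists 1 => // p Kp; case: K0; exists p.
have cf' : {within K, continuous (fun p => `|f p|)}.
  apply: continuous_in_subspaceT => p; rewrite inE => /KW Up.
  apply: (@continuous_comp _ _ _ f (fun x => `|x|)); last exact: norm_continuous.
  exact: cf.
have [m _ H] := compact_EVT_max K0 cK cf'.
exists (`|f m| + 1); first by rewrite ltr_wpDl.
by move=> p Kp; rewrite (le_trans (H p _)) ?inE// lerDl.
Qed.

Lemma compact_cbox (a b c d : R) : compact (cbox a b c d).
Proof. by apply: compact_setX; exact: segment_compact. Qed.

(** The inverse is carried along with its holomorphy, so that every transfer result can be used in
    both directions through [biholo_sym]. *)
Record biholo U V phi psi : Prop := Biholo {
  bi_oU : copen U; bi_oV : copen V;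
  bi_phiV : forall z, U z -> V (phi z); bi_psiU : forall w, V w -> U (psi w);
  bi_phiK : forall z, U z -> psi (phi z) = z; bi_psiK : forall w, V w -> phi (psi w) = w;
  bi_phi : holo U phi; bi_psi : holo V psi }.

Lemma biholo_sym U V phi psi : biholo U V phi psi -> biholo V U psi phi.
Proof. by case=> *; split. Qed.

(** The chain rule for psi o phi = id. As the inverse is already known to be holomorphic, this is
    also why phi' has no zeros. *)
Lemma cder_inv U V phi psi z : biholo U V phi psi -> U z ->
  cder psi (phi z) * cder phi z = 1.
Proof.
move=> bi Uz.
have d1 := cderP (bi_phi bi) Uz; have d2 := cderP (bi_psi bi) (bi_phiV bi Uz).
apply: cdiff_unique (cdiff_comp d1 d2) _.
have [r r0 H] := bi_oU bi Uz; apply: cdiff_near (cdiff_id _).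
by exists r => // w /H Uw; rewrite /= (bi_phiK bi).
Qed.

Lemma cder_neq0 U V phi psi z : biholo U V phi psi -> U z -> cder phi z != 0.
Proof.
move=> bi Uz; have := cder_inv bi Uz; apply: contra_eq_neq => ->.
by rewrite mulr0 eq_sym oner_eq0.
Qed.

Lemma cder_invE U V phi psi z : biholo U V phi psi -> U z ->
  cder psi (phi z) = (cder phi z)^-1.
Proof.
move=> bi Uz; have d0 := cder_neq0 bi Uz.
by apply: (mulIf d0); rewrite mulVf// (cder_inv bi).
Qed.

Lemma jac_inv U V phi psi p : biholo U V phi psi -> plane U p ->
  jac psi (pmap phi p) * jac phi p = 1.
Proof.
by move=> bi Up; rewrite /jac /pmap ptK -exprMn -normcM (cder_inv bi Up) normc1 expr1n.
Qed.

Lemma holo_biholo U V phi psi : copen U -> holo U phi ->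
  (forall z, U z -> psi (phi z) = z) -> (forall z, U z -> V (phi z)) ->
  (forall w, V w -> U (psi w)) -> (forall w, V w -> phi (psi w) = w) ->
  biholo U V phi psi.
Proof.
move=> oU hphi phiK phiV psiU psiK; split => //.
  move=> w Vw; have [e e0 H] := inverse_open oU hphi phiK phiV (psiU _ Vw) ltr01.
  by exists e => // v; rewrite -{1}(psiK _ Vw) => /H[].
exact: (inverse_holo oU hphi phiK phiV psiU psiK (fun z Uz => cderP hphi Uz)).
Qed.

Lemma measurable_pmap U f (A : set (R * R)) : copen U -> holo U f ->
  measurable_fun (plane U : set (measurableTypeR R * measurableTypeR R))
   (fun p => (pmap f p).1 : measurableTypeR R) /\
  measurable_fun (plane U : set (measurableTypeR R * measurableTypeR R))
   (fun p => (pmap f p).2 : measurableTypeR R).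
Proof.
move=> oU hf; split; apply: open_continuous_measurable; try exact: plane_open;
  move=> p; rewrite inE => Up; apply: ccont_continuous; try exact: holo_ccont Up.
- exact: Re_lip.
- exact: Im_lip.
Qed.

End ComplexDerivativeFunction.

Section Arithmetic.
Context {R : realType}.

Lemma local_error (J n w h e : R) : 0 < n ->
  n * (J * (2 * (w + h) + 4) + 1) <= e / 2 ->
  J * (4 * n ^+ 2) <= J * (4 * n) -> J * (2 * n * (w + h) + 4 * n ^+ 2) <= e / 2.
Proof. lra. Qed.

Lemma half_add (a e s : R) : a <= e / 2 * s -> a + e / 2 * s <= e * s.
Proof. lra. Qed.

Lemma midpoint (x u : R) : 0 < u -> x <= x + u / 2 <= x + u.
Proof. by move=> ?; apply/andP; split; lra. Qed.

Lemma fine_dist4 (a1 a2 a3 a4 b1 b2 b3 b4 : \bar R) :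
  a1 \is a fin_num -> a2 \is a fin_num -> a3 \is a fin_num -> a4 \is a fin_num ->
  b1 \is a fin_num -> b2 \is a fin_num -> b3 \is a fin_num -> b4 \is a fin_num ->
  `|fine (a1 + a2 + (a3 + a4))%E - fine (b1 + b2 + (b3 + b4))%E| <=
  `|fine a1 - fine b1| + `|fine a2 - fine b2| + (`|fine a3 - fine b3| + `|fine a4 - fine b4|).
Proof.
move=> *; rewrite !fineD ?fin_numD; do ?[by []|by apply/andP].
rewrite opprD addrACA; apply: le_trans (ler_normD _ _) _.
by apply: lerD; rewrite opprD addrACA; exact: ler_normD.
Qed.

End Arithmetic.

(** * Change of variables under a biholomorphic map *)

Section AreaFormula.
Context {R : realType}.
Local Notation P := (measurableTypeR R * measurableTypeR R)%type.
Variables (U V : set R[i]) (phi psi : R[i] -> R[i]).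
Hypothesis bi : biholo U V phi psi.

Let mU : measurable (plane U : set P) := measurable_plane (bi_oU bi).
Let mV : measurable (plane V : set P) := measurable_plane (bi_oV bi).

(** Extension by a constant outside [W] gives a map measurable on the whole plane, as a push-forward
    requires. *)
Definition pext (W : set R[i]) (f : R[i] -> R[i]) (p : P) : P :=
  (((fun p => (pmap f p).1) \_ (plane W)) p, ((fun p => (pmap f p).2) \_ (plane W)) p).

Lemma pextE (W : set R[i]) f p : plane W p -> pext W f p = pmap f p.
Proof. by move=> Wp; rewrite /pext !patchE mem_set. Qed.

Lemma measurable_pext (W : set R[i]) f : copen W -> holo W f -> measurable_fun setT (pext W f).
Proof.
move=> oW hf; have [m1 m2] := measurable_pmap setT oW hf.
have mW := measurable_plane oW.
by apply: measurable_fun_pair; exact/(measurable_restrictT _ mW).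
Qed.

Let mpsi := measurable_pext (bi_oV bi) (bi_psi bi).
Let mind : measurable_fun setT (\1_(plane V) : P -> R).
Proof. exact: measurable_indic. Qed.
Let ind0 (p : P) : 0 <= (\1_(plane V) p : R).
Proof. by rewrite indicE. Qed.

Definition jacU : P -> R := (jac phi) \_ (plane U).

Let jacU0 p : 0 <= jacU p.
Proof. by rewrite /jacU patchE; case: ifP => // _; exact: jac_ge0. Qed.

Let mjacU : measurable_fun setT jacU.
Proof.
apply/(measurable_restrictT _ mU); apply: open_continuous_measurable.
  exact: plane_open (bi_oU bi).
by move=> p; rewrite inE => Up; exact: continuous_jac (bi_oU bi) (bi_phi bi) Up.
Qed.

(** [mimage] gives to A the area of phi(A cap U), and [mjac] the integral of the Jacobian over A cap
    U. The area formula is the equality of these two measures. *)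
Definition mimage := pushm (density leb2 ind0 mind) mpsi.
Definition mjac := density leb2 jacU0 mjacU.

HB.instance Definition _ := Measure.on mimage.
HB.instance Definition _ := Measure.on mjac.

Lemma measurable_image (A : set P) : measurable A ->
  measurable (plane V `&` pmap psi @^-1` A : set P).
Proof.
move=> mA; rewrite (_ : plane V `&` _ = plane V `&` pext V psi @^-1` A).
  by apply: measurableI => //; rewrite -[X in measurable X]setTI; exact: mpsi.
by apply/seteqP; split => v [Vv]; rewrite /= pextE.
Qed.

Lemma mimageE (A : set P) : measurable A ->
  mimage A = leb2 (plane V `&` pmap psi @^-1` A).
Proof.
move=> mA; transitivity (\int[leb2]_(p in pext V psi @^-1` A) (\1_(plane V) p)%:E)%E.
  by [].
rewrite integral_indic//; last first.
  by rewrite -[X in measurable X]setTI; exact: mpsi.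
by congr (leb2 _); apply/seteqP; split => p [Vp]; rewrite /= pextE.
Qed.

Lemma mjacE (A : set P) : A `<=` plane U -> measurable A ->
  mjac A = (\int[leb2]_(p in A) (jac phi p)%:E)%E.
Proof.
by move=> AU mA; apply: eq_integral => p; rewrite inE => /AU Up; rewrite /jacU patchE mem_set.
Qed.


Lemma affine_preimage (c : R[i]) (q : P) (A : set P) : c != 0 -> measurable A ->
  measurable ((fun p => pt (c * cplx p) + q) @^-1` A) /\
  leb2 ((fun p => pt (c * cplx p) + q) @^-1` A) = ((normc c ^- 2)%:E * leb2 A)%E.
Proof.
move=> c0 mA; have h : 0 <= 1 :> R by [].
have [mT sT] := scales_comp (sqr_ge0 (normc c)) h (scales_mul c0) (scales_translate q).
split; first by rewrite -[X in measurable X]setTI; exact: mT.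
rewrite [in RHS](sT _ mA) mul1r muleA -EFinM mulVf ?mul1e//.
by rewrite expf_neq0// gt_eqF// normc_gt0.
Qed.

Lemma coord_le p q (e : R) : normc (cplx p - cplx q) <= e ->
  [/\ q.1 - e <= p.1, p.1 <= q.1 + e, q.2 - e <= p.2 & p.2 <= q.2 + e].
Proof.
move=> H; have := le_trans (Re_le_normc _) H; have := le_trans (Im_le_normc _) H.
rewrite cReB cImB /= !ler_norml => /andP[h1 h2] /andP[h3 h4].
by split; rewrite ?lerBlDl ?lerBlDr -?lerBlDl// lerBlDr -lerBlDl // -lerN2 opprB.
Qed.


Lemma obox_near (p v : P) (x y s w h : R) : 0 < s -> 0 < w -> 0 < h ->
  x <= p.1 <= x + w * s -> y <= p.2 <= y + h * s ->
  obox x (x + w * s) y (y + h * s) v -> normc (cplx v - cplx p) <= (w + h) * s.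
Proof.
move=> s0 w0 h0 /andP[x1 x2] /andP[y1 y2] [H1 H2].
apply: (le_trans (normc_le_ReIm _)); rewrite cReB cImB /= mulrDl.
move: H1 H2; rewrite /= !in_itv/= => /andP[x3 x4] /andP[y3 y4].
by apply: lerD; rewrite ler_norml; apply/andP; split; clear -x1 x2 x3 x4 y1 y2 y3 y4; lra.
Qed.

(** The map T below is the linearization of psi at phi(p). On the image of a box of scale s it
    differs from psi by at most n s, so that image lies between the T-preimages of the box shrunk
    and enlarged by n s on every side. *)
Lemma mimage_local (p : P) (w h n : R) : plane U p -> 0 < w -> 0 < h -> 0 < n ->
  exists2 e : R, 0 < e & forall x y s : R, 0 < s < e ->
    x <= p.1 <= x + w * s -> y <= p.2 <= y + h * s ->
    ((jac phi p)%:E * leb2 (obox (x + n * s) (x + w * s - n * s) (y + n * s) (y + h * s - n * s))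
      <= mimage (obox x (x + w * s) y (y + h * s)))%E /\
    (mimage (obox x (x + w * s) y (y + h * s)) <=
     (jac phi p)%:E * leb2 (obox (x - n * s) (x + w * s + n * s) (y - n * s) (y + h * s + n * s)))%E.
Proof.
move=> Up w0 h0 n0; set z := cplx p; set d := cder phi z.
have d0 : d != 0 := cder_neq0 bi Up.
have nd : 0 < normc d by rewrite normc_gt0.
have wh : 0 < w + h by rewrite addr_gt0.
have Vz := bi_phiV bi Up.
have dphi := cderP (bi_phi bi) Up.
have dpsi := cderP (bi_psi bi) Vz; rewrite (cder_invE bi Up) in dpsi.
(* The box lies within (w + h) s of p and its image roughly within |d| (w + h) s of phi(p); the two
   tolerances turn these distances into an error n s in the source plane. *)
have [r1 r10 H1] := dphi _ (divr_gt0 (mulr_gt0 n0 nd) wh).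
have [r2 r20 H2] := dpsi _ (divr_gt0 n0 (mulr_gt0 wh nd)).
have [r3 r30 H3] := bi_oV bi Vz.
have [r4 r40 H4] := bi_oU bi Up.
pose q : P := p - pt (d^-1 * phi z).
pose T (v : P) : P := pt (d^-1 * cplx v) + q.
have TE v : cplx (T v) = d^-1 * (cplx v - phi z) + z.
  by rewrite cplxD cplxB !ptK -/z; ring.
have di0 : d^-1 != 0 by rewrite invr_eq0.
have JE : normc d^-1 ^- 2 = jac phi p by rewrite normcV exprVn invrK.
pose e := Num.min (Num.min (r1 / (w + h)) (Num.min (r2 / (normc d * (w + h)))
    (r3 / (normc d * (w + h))))) (r4 / (w + h)).
have ndwh : 0 < normc d * (w + h) by rewrite mulr_gt0.
exists e; first by rewrite !lt_min !divr_gt0.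
move=> x y s /andP[s0]; rewrite !lt_min !ltr_pdivlMr// => /andP[/andP[s1 /andP[s2 s3]] s4] xp yp.
have ns0 : 0 < n * s by rewrite mulr_gt0.
set Q := obox x (x + w * s) y (y + h * s).
have mQ : measurable Q by exact: measurable_obox.
have QU v : Q v -> plane U v.
  move=> /(obox_near s0 w0 h0 xp yp) Qv; apply: H4; apply: le_lt_trans Qv _.
  by rewrite mulrC.
rewrite mimageE//; split.
- set A := obox (x + n * s) (x + w * s - n * s) (y + n * s) (y + h * s - n * s).
  have mA : measurable A by exact: measurable_obox.
  have [mT sT] := affine_preimage q di0 mA; rewrite JE in sT; rewrite -sT.
  apply: le_measure; rewrite ?inE//.
    exact: measurable_image.
  move=> v Av; have {}Av : A (T v) by [].
  have QTv : Q (T v).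
    move: Av; rewrite /A /Q /obox /= !in_itv/= => -[/andP[a1 a2] /andP[a3 a4]].
    by split; apply/andP; split; clear - a1 a2 a3 a4 ns0; lra.
  have TvE := obox_near s0 w0 h0 xp yp QTv.
  have vE : normc (cplx v - phi z) <= normc d * ((w + h) * s).
    have -> : cplx v - phi z = d * (cplx (T v) - z) by rewrite TE addrK mulrA mulfV// mul1r.
    by rewrite normcM ler_pM2l.
  have Vv : plane V v.
    by apply: H3; apply: le_lt_trans vE _; rewrite mulrA mulrC.
  split => //=.
  have := H2 (cplx v); rewrite (bi_phiK bi Up) => H2v.
  have {}H2v : normc (psi (cplx v) - cplx (T v)) <= n * s.
    have -> : psi (cplx v) - cplx (T v) = psi (cplx v) - z - d^-1 * (cplx v - phi z).
      by rewrite TE; ring.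
    apply: le_trans (H2v _) _.
      by apply: le_lt_trans vE _; rewrite mulrA mulrC.
    rewrite -mulrA; apply: ler_wpM2l; first exact: ltW.
    by rewrite ler_pdivrMl ?mulr_gt0// (mulrC (w + h)) -mulrA.
  have := @coord_le (pmap psi v) (T v) (n * s); rewrite /pmap ptK => /(_ H2v).
  move: Av; rewrite /A /Q /obox /= !in_itv/= => -[/andP[a1 a2] /andP[a3 a4]] [b1 b2 b3 b4].
  by split; apply/andP; split; clear - a1 a2 a3 a4 b1 b2 b3 b4; lra.
- set A := obox (x - n * s) (x + w * s + n * s) (y - n * s) (y + h * s + n * s).
  have mA : measurable A by exact: measurable_obox.
  have [mT sT] := affine_preimage q di0 mA; rewrite JE in sT; rewrite -sT.
  apply: le_measure; rewrite ?inE//.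
    exact: measurable_image.
  move=> v [Vv Qv]; suff : A (T v) by [].
  have QE := obox_near s0 w0 h0 xp yp Qv.
  have := H1 (psi (cplx v)); rewrite (bi_psiK bi Vv).
  move: QE; rewrite /pmap ptK => QE H1v.
  have {}H1v : normc (cplx (T v) - cplx (pmap psi v)) <= n * s.
    rewrite /pmap ptK TE.
    have -> : d^-1 * (cplx v - phi z) + z - psi (cplx v) =
        d^-1 * (cplx v - phi z - d * (psi (cplx v) - z)).
      by field; rewrite d0.
    rewrite normcM normcV ler_pdivrMl//; apply: le_trans (H1v _) _.
      by apply: le_lt_trans QE _; rewrite mulrC.
    rewrite (mulrC n) -!mulrA; apply: ler_wpM2l; first exact: ltW.
    by apply: ler_wpM2l; [exact: ltW|rewrite ler_pdivrMl].
  have := coord_le H1v.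
  move: Qv; rewrite /A /Q /obox /= !in_itv/= => -[/andP[a1 a2] /andP[a3 a4]] [b1 b2 b3 b4].
  by split; apply/andP; split; clear - a1 a2 a3 a4 b1 b2 b3 b4; lra.
Qed.

Lemma mjac_local (p : P) (w h n : R) : plane U p -> 0 < w -> 0 < h -> 0 < n ->
  exists2 e : R, 0 < e & forall x y s : R, 0 < s < e ->
    x <= p.1 <= x + w * s -> y <= p.2 <= y + h * s ->
    (((jac phi p - n) * (w * s * (h * s)))%:E <= mjac (obox x (x + w * s) y (y + h * s)))%E /\
    (mjac (obox x (x + w * s) y (y + h * s)) <= ((jac phi p + n) * (w * s * (h * s)))%:E)%E.
Proof.
move=> Up w0 h0 n0.
have wh : 0 < w + h by rewrite addr_gt0.
have [r4 r40 H4] := bi_oU bi Up.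
have := continuous_jac (bi_oU bi) (bi_phi bi) Up => /cvgrPdist_le/(_ _ n0)/nbhs_ballP[r /= r0 H].
exists (Num.min (r / (w + h)) (r4 / (w + h))); first by rewrite lt_min !divr_gt0.
move=> x y s /andP[s0]; rewrite lt_min !ltr_pdivlMr// => /andP[s1 s4] xp yp.
set Q := obox x (x + w * s) y (y + h * s).
have mQ : measurable Q by exact: measurable_obox.
have QU v : Q v -> plane U v.
  move=> /(obox_near s0 w0 h0 xp yp) Qv; apply: H4; apply: le_lt_trans Qv _.
  by rewrite mulrC.
have JQ v : Q v -> jac phi p - n <= jac phi v <= jac phi p + n.
  move=> /(obox_near s0 w0 h0 xp yp) Qv; have := H v.
  rewrite -ball_normE /ball_/= distrC => /(_ _).
  have -> : `|v - p| < r.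
    apply: le_lt_trans (norm_le_normc _) _; rewrite cplxB.
    by apply: le_lt_trans Qv _; rewrite mulrC.
  by move=> /(_ isT); rewrite ler_norml => /andP[? ?]; apply/andP; split; lra.
have mJ : measurable_fun Q (jac phi).
  apply: (measurable_funS mU QU); apply: open_continuous_measurable.
    exact: plane_open (bi_oU bi).
  by move=> v; rewrite inE => Uv; exact: continuous_jac (bi_oU bi) (bi_phi bi) Uv.
have ws : 0 < w * s by rewrite mulr_gt0.
have hs : 0 < h * s by rewrite mulr_gt0.
have cE (k : R) : (\int[leb2]_(v in Q) k%:E = (k * (w * s * (h * s)))%:E)%E.
  rewrite integral_cst// EFinM; congr (_ * _)%E.
  rewrite leb2_obox ?lerDl ?ltW//; congr EFin; ring.
rewrite mjacE//; split.
- have [jn|jn] := leP 0 (jac phi p - n); last first.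
    apply: (@le_trans _ _ 0%E); last by apply: integral_ge0 => v _; rewrite lee_fin jac_ge0.
    by rewrite lee_fin mulr_le0_ge0// ?ltW// mulr_gt0.
  rewrite -cE; apply: ge0_le_integral => //.
  + exact/measurable_EFinP.
  + by move=> v /JQ/andP[? _]; rewrite lee_fin.
- rewrite -cE; apply: ge0_le_integral => //.
  + by move=> v _; rewrite lee_fin jac_ge0.
  + exact/measurable_EFinP.
  + by move=> v /JQ/andP[_ ?]; rewrite lee_fin.
Qed.


Lemma fine_between (A B A' B' : R) (m m' : \bar R) :
  (A%:E <= m)%E -> (m <= B%:E)%E -> (A'%:E <= m')%E -> (m' <= B'%:E)%E ->
  `|fine m - fine m'| <= Num.max (B - A') (B' - A).
Proof.
case: m => [r| |]; case: m' => [r'| |]; rewrite ?lee_fin ?leNye ?leeNy_eq ?leye_eq//.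
move=> h1 h2 h3 h4; rewrite le_max /=.
by case: (ger0P (r - r')) => _; apply/orP; [left|right]; lra.
Qed.

(** Both measures of the box are close to J times its area: one up to J times the area of a frame of
    width n1 s, the other up to n2 times the area of the box. Suitable n1 and n2 make the sum at
    most e s^2. *)
Lemma area_local (p : P) (w h e : R) : plane U p -> 0 < w -> 0 < h -> 0 < e ->
  exists2 r : R, 0 < r & forall x y s : R, 0 < s < r ->
    x <= p.1 <= x + w * s -> y <= p.2 <= y + h * s ->
    `|fine (mimage (obox x (x + w * s) y (y + h * s))) -
      fine (mjac (obox x (x + w * s) y (y + h * s)))| <= e * s ^+ 2.
Proof.
move=> Up w0 h0 e0; set J := jac phi p.
have J0 : 0 <= J := jac_ge0 phi p.
have wh : 0 < w + h by rewrite addr_gt0.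
have wh2 : 0 < w * h by rewrite mulr_gt0.
(* The bound 1 gives n1^2 <= n1, the bounds w / 4 and h / 4 keep the shrunk box nonempty, and the
   last one limits J times the frame to e / 2 s^2. *)
pose n1 := Num.min (Num.min 1 (Num.min (w / 4) (h / 4)))
  (e / 2 / (J * (2 * (w + h) + 4) + 1)).
have K0 : 0 <= J * (2 * (w + h) + 4) by rewrite mulr_ge0// addr_ge0// mulr_ge0// ltW.
have K1 : 0 < J * (2 * (w + h) + 4) + 1 by rewrite ltr_wpDl.
have n10 : 0 < n1 by rewrite !lt_min ltr01 !divr_gt0.
have : n1 <= n1 by [].
rewrite {2}/n1 !le_min => /andP[/andP[n1a /andP[n1b n1c]]].
rewrite ler_pdivlMr// => n1d.
pose n2 := e / 2 / (w * h).
have n20 : 0 < n2 by rewrite !divr_gt0.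
have [r1 r10 H1] := mimage_local Up w0 h0 n10.
have [r2 r20 H2] := mjac_local Up w0 h0 n20.
exists (Num.min r1 r2); first by rewrite lt_min r10.
move=> x y s; rewrite lt_min => /andP[s0 /andP[s1 s2]] xp yp.
have [] := H1 x y s; rewrite ?s0//.
have [] := H2 x y s; rewrite ?s0// -/J.
have ns0 : 0 < n1 * s by rewrite mulr_gt0.
have nw : n1 * s <= w / 4 * s by rewrite ler_pM2r.
have nh : n1 * s <= h / 4 * s by rewrite ler_pM2r.
have ws : 0 < w * s by rewrite mulr_gt0.
have hs : 0 < h * s by rewrite mulr_gt0.
rewrite !leb2_obox; try by clear - ns0 nw nh ws hs; lra.
move=> h3 h4; rewrite -!EFinM => h1 h2.
apply: le_trans (fine_between h1 h2 h3 h4) _.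
have s20 : 0 <= s ^+ 2 by rewrite sqr_ge0.
have n2E : n2 * (w * s * (h * s)) = e / 2 * s ^+ 2.
  by rewrite /n2; field; rewrite !gt_eqF.
have n1E : J * (2 * n1 * (w + h) + 4 * n1 ^+ 2) <= e / 2.
  have : n1 ^+ 2 <= n1 by rewrite expr2 -[leRHS]mulr1 ler_pM2l.
  move=> n12; have : J * (4 * n1 ^+ 2) <= J * (4 * n1) by rewrite ler_wpM2l// ler_pM2l.
  exact: local_error.
have n1F : J * (2 * n1 * (w + h) + 4 * n1 ^+ 2) * s ^+ 2 <= e / 2 * s ^+ 2 by rewrite ler_wpM2r.
have n1G : 0 <= J * (8 * n1 ^+ 2) * s ^+ 2.
  by apply: mulr_ge0 => //; apply: mulr_ge0 => //; rewrite mulr_ge0// sqr_ge0.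
rewrite ge_max; apply/andP; split.
- rewrite (_ : _ - _ = J * (2 * n1 * (w + h) + 4 * n1 ^+ 2) * s ^+ 2 +
    n2 * (w * s * (h * s))); last by ring.
  by rewrite n2E; exact: half_add.
(* The inner frame has area (2 n1 (w + h) - 4 n1^2) s^2, which is the outer one minus 8 n1^2 s^2. *)
- rewrite (_ : _ - _ = J * (2 * n1 * (w + h) + 4 * n1 ^+ 2) * s ^+ 2 - J * (8 * n1 ^+ 2) * s ^+ 2 +
    n2 * (w * s * (h * s))); last by ring.
  rewrite n2E; apply: half_add; apply: le_trans n1F; by rewrite gerBl.
Qed.

Lemma pmap_bounded (W : set R[i]) f (a b c d : R) : copen W -> holo W f ->
  a <= b -> c <= d -> cbox a b c d `<=` plane W ->
  exists2 M, 0 < M & forall p, cbox a b c d p -> normc (f (cplx p)) <= M.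
Proof.
move=> oW hf ab cd sub.
have cf p : plane W p -> {for p, continuous (fun p => normc (f (cplx p)))}.
  move=> Wp; apply: ccont_continuous; first exact: normc_lip.
  exact: holo_ccont Wp.
have [M M0 H] := compact_bounded_on (@compact_cbox _ a b c d) sub cf.
by exists M => // p /H; rewrite ger0_norm ?normc_ge0.
Qed.

Lemma obox_cbox (a b c d : R) : obox a b c d `<=` cbox a b c d.
Proof.
by move=> p [] /=; rewrite !in_itv/= => /andP[? ?] /andP[? ?]; split; rewrite /= in_itv/=;
  apply/andP; split => //; exact: ltW.
Qed.

Lemma fin_mimage (a b c d : R) : a <= b -> c <= d -> cbox a b c d `<=` plane U ->
  (mimage (obox a b c d) < +oo)%E.
Proof.
move=> ab cd sub; rewrite mimageE; last exact: measurable_obox.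
have [M M0 H] := pmap_bounded (bi_oU bi) (bi_phi bi) ab cd sub.
apply: (@le_lt_trans _ _ (leb2 (obox (- M - 1) M (- M - 1) M))).
  apply: le_measure; rewrite ?inE//.
  - exact: measurable_image (measurable_obox _ _ _ _).
  - exact: measurable_obox.
  - move=> v [Vv /obox_cbox Qv]; have := H _ Qv; rewrite ptK (bi_psiK bi Vv) => nv.
    have := le_trans (Re_le_normc _) nv; have := le_trans (Im_le_normc _) nv.
    rewrite /= !ler_norml => /andP[b1 b2] /andP[b3 b4].
    by split; rewrite /= in_itv/=; apply/andP; split => //; lra.
by rewrite leb2_obox ?ltry//; lra.
Qed.

Lemma fin_mjac (a b c d : R) : a <= b -> c <= d -> cbox a b c d `<=` plane U ->
  (mjac (obox a b c d) < +oo)%E.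
Proof.
move=> ab cd sub.
have sub' : obox a b c d `<=` plane U := subset_trans (@obox_cbox _ _ _ _) sub.
have cJ v : plane U v -> {for v, continuous (jac phi)}.
  by move=> Uv; exact: continuous_jac (bi_oU bi) (bi_phi bi) Uv.
have [M M0 H] := compact_bounded_on (@compact_cbox _ a b c d) sub cJ.
rewrite mjacE//; last exact: measurable_obox.
apply: (@le_lt_trans _ _ (\int[leb2]_(p in obox a b c d) M%:E)%E).
  apply: ge0_le_integral; [exact: measurable_obox| | | |].
  - by move=> v _; rewrite lee_fin jac_ge0.
  - apply/measurable_EFinP; apply: (measurable_funS mU sub').
    apply: open_continuous_measurable; first exact: plane_open (bi_oU bi).
    by move=> v; rewrite inE => /cJ.
  - exact/measurable_EFinP/measurable_cst.
  - by move=> v /obox_cbox/H; rewrite lee_fin; apply: le_trans; exact: ler_norm.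
by rewrite integral_cst ?leb2_obox// -?EFinM ?ltry//; exact: measurable_obox.
Qed.

Lemma obox_split (m : {measure set P -> \bar R}) (a b c d x y : R) :
  a <= x <= b -> c <= y <= d ->
  m (obox a b c d) = ((m (obox a x c y) + m (obox x b c y)) +
     (m (obox a x y d) + m (obox x b y d)))%E.
Proof.
move=> /andP[ax xb] /andP[cy yd].
have sx c' d' : m (obox a b c' d') = (m (obox a x c' d') + m (obox x b c' d'))%E.
  rewrite -measureU; [|exact: measurable_obox|exact: measurable_obox|].
    congr (m _); apply/seteqP; split => [[u v]|[u v]]; rewrite /obox/= !in_itv/=.
      move=> [/andP[u1 u2] ->]; case: (leP u x) => ux; [left|right]; split => //.
        by rewrite u1.
    by move=> [[/andP[u1 u2] ->]|[/andP[u1 u2] ->]]; split => //; apply/andP; split => //;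
      [exact: le_trans xb|exact: le_lt_trans u1].
  apply/seteqP; split => // -[u v]; rewrite /obox/= !in_itv/=.
  by move=> [[/andP[_ u1] _] [/andP[u2 _] _]]; rewrite ltNge u1 in u2.
rewrite -!sx -measureU; [|exact: measurable_obox|exact: measurable_obox|].
  congr (m _); apply/seteqP; split => [[u v]|[u v]]; rewrite /obox/= !in_itv/=.
    move=> [-> /andP[u1 u2]]; case: (leP v y) => ux; [left|right]; split => //.
      by rewrite u1.
  by move=> [[-> /andP[u1 u2]]|[-> /andP[u1 u2]]]; split => //; apply/andP; split => //;
    [exact: le_trans yd|exact: le_lt_trans u1].
apply/seteqP; split => // -[u v]; rewrite /obox/= !in_itv/=.
by move=> [[_ /andP[_ u1]] [_ /andP[u2 _]]]; rewrite ltNge u1 in u2.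
Qed.

(** [bisection] is applied to the absolute difference of the two measures. Half-open boxes split
    into quarters exactly, and [area_local] is the local bound. *)
Lemma area_obox (a b c d : R) : a < b -> c < d -> cbox a b c d `<=` plane U ->
  mimage (obox a b c d) = mjac (obox a b c d).
Proof.
move=> ab cd sub; set w := b - a; set h := d - c.
have w0 : 0 < w by rewrite subr_gt0.
have h0 : 0 < h by rewrite subr_gt0.
have aw : a + w = b by rewrite /w addrC subrK.
have ch : c + h = d by rewrite /h addrC subrK.
have subb x y x' y' : a <= x -> x' <= b -> c <= y -> y' <= d -> cbox x x' y y' `<=` plane U.
  move=> ax xb cy yd; apply: subset_trans sub => p [] /=; rewrite !in_itv/=.
  move=> /andP[p1 p2] /andP[p3 p4]; split; rewrite /= in_itv/=; apply/andP; split.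
  - exact: le_trans p1.
  - exact: le_trans xb.
  - exact: le_trans p3.
  - exact: le_trans yd.
have fi x y x' y' : x <= x' -> y <= y' -> a <= x -> x' <= b -> c <= y -> y' <= d ->
    mimage (obox x x' y y') \is a fin_num.
  move=> *; rewrite ge0_fin_numE; last exact: measure_ge0.
  by apply: fin_mimage => //; exact: subb.
have fj x y x' y' : x <= x' -> y <= y' -> a <= x -> x' <= b -> c <= y -> y' <= d ->
    mjac (obox x x' y y') \is a fin_num.
  move=> *; rewrite ge0_fin_numE; last exact: measure_ge0.
  by apply: fin_mjac => //; exact: subb.
suff : `|fine (mimage (obox a b c d)) - fine (mjac (obox a b c d))| <= 0.
  rewrite normr_le0 subr_eq0 => /eqP E.
  have fE := fineK (fi _ _ _ _ (ltW ab) (ltW cd) (lexx _) (lexx _) (lexx _) (lexx _)).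
  have jE := fineK (fj _ _ _ _ (ltW ab) (ltW cd) (lexx _) (lexx _) (lexx _) (lexx _)).
  by rewrite -fE -jE E.
have := @bisection R w h (fun x y s =>
  `|fine (mimage (obox x (x + w * s) y (y + h * s))) -
    fine (mjac (obox x (x + w * s) y (y + h * s)))|) a c w0 h0.
rewrite !mulr1 aw ch; apply.
- move=> x y s s0 ax xb cy yd.
  have ws : 0 < w * s by rewrite mulr_gt0.
  have hs : 0 < h * s by rewrite mulr_gt0.
  have hw : w * (s / 2) = w * s / 2 by rewrite mulrA.
  have hh : h * (s / 2) = h * s / 2 by rewrite mulrA.
  have E x' (w' : R) : x' + w' * (s / 2) + w' * (s / 2) = x' + w' * s.
    by rewrite -addrA -mulrDr -splitr.
  rewrite !E hw hh.
  have l1 := midpoint x ws; have l2 := midpoint y hs.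
  have l3 : x + w * s / 2 <= b by apply: le_trans xb; case/andP: l1.
  have l4 : a <= x + w * s / 2 by apply: le_trans ax _; case/andP: l1.
  have l5 : y + h * s / 2 <= d by apply: le_trans yd; case/andP: l2.
  have l6 : c <= y + h * s / 2 by apply: le_trans cy _; case/andP: l2.
  rewrite (obox_split mimage l1 l2) (obox_split mjac l1 l2).
  move: l1 l2 => /andP[l1 l1'] /andP[l2 l2'].
  by apply: fine_dist4; [exact: fi|exact: fi|exact: fi|exact: fi|exact: fj|exact: fj|exact: fj|exact: fj].
- move=> p q pab qcd e e0.
  have [|r r0 H] := @area_local (p, q) w h e _ w0 h0 e0.
    by apply: sub; split; rewrite /= in_itv.
  by exists r => // x y s sr _ _ _ _ xp yq; exact: H.
Qed.


(** Restricted to one box both measures are finite on all boxes, so agreement on sub-boxes extends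
    to measurable subsets. *)
Lemma area_sub (a b c d : R) : cbox a b c d `<=` plane U ->
  forall A, measurable A -> A `<=` obox a b c d -> mimage A = mjac A.
Proof.
move=> sub A mA AQ.
have mQ : measurable (obox a b c d) by exact: measurable_obox.
have key a' b' c' d' : obox a' b' c' d' `<=` obox a b c d ->
    mimage (obox a' b' c' d') = mjac (obox a' b' c' d').
  move=> sQ; have [ab|ba] := ltP a' b'; last first.
    by rewrite /obox set_itv_ge ?bnd_simp -?leNgt// set0X !measure0.
  have [cd|dc] := ltP c' d'; last first.
    by rewrite /obox [X in _ `*` X]set_itv_ge ?bnd_simp -?leNgt// setX0 !measure0.
  apply: area_obox => //; apply: subset_trans sub => p [] /=; rewrite !in_itv/=.
  have H x y : a' < x <= b' -> c' < y <= d' -> [/\ a <= x, x <= b, c <= y & y <= d].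
    move=> hx hy; have := sQ (x, y); rewrite /obox/= !in_itv/= => /(_ (conj hx hy)).
    by move=> [/andP[/ltW ? ?] /andP[/ltW ? ?]]; split.
  have ab' : a' < b' <= b' by rewrite ab lexx.
  have cd' : c' < d' <= d' by rewrite cd lexx.
  have [_ b1 _ d1] := H _ _ ab' cd'.
  (* The edge a' does not belong to the half-open box, so the inequality comes from points at
     distance at most e to its right. *)
  have a1 : a <= a'.
    apply/ler_addgt0Pl => e e0; pose t := Num.min b' (a' + e).
    have [|at' _ _ _] := H t _ _ cd'; first by rewrite lt_min ab ltrDl e0 ge_min lexx.
    by apply: le_trans at' _; rewrite addrC ge_min lexx orbT.
  have c1 : c <= c'.
    apply/ler_addgt0Pl => e e0; pose t := Num.min d' (c' + e).
    have [|_ _ at' _] := H _ t ab' _; first by rewrite lt_min cd ltrDl e0 ge_min lexx.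
    by apply: le_trans at' _; rewrite addrC ge_min lexx orbT.
  move=> /andP[p1 p2] /andP[p3 p4]; split; rewrite /= in_itv/=; apply/andP; split.
  - exact: le_trans p1.
  - exact: le_trans b1.
  - exact: le_trans p3.
  - exact: le_trans d1.
have H : mrestr mimage mQ A = mrestr mjac mQ A.
  apply: (obox_measure_unique (m1 := mrestr mimage mQ) (m2 := mrestr mjac mQ)) => //.
    move=> a' b' c' d'; rewrite /mrestr.
    have E : obox a' b' c' d' `&` obox a b c d = _ := oboxI _ _ _ _ _ _ _ _.
    change (mimage (obox a' b' c' d' `&` obox a b c d) =
      mjac (obox a' b' c' d' `&` obox a b c d)).
    by rewrite E; apply: key; rewrite -E; exact: subIsetr.
  move=> a' b' c' d'; change (mimage (obox a' b' c' d' `&` obox a b c d) < +oo)%E.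
  have [ab|ba] := leP a b; last first.
    rewrite {2}/obox [X in X `*` _]set_itv_ge ?bnd_simp -?leNgt ?ltW//.
    by rewrite set0X setI0 measure0.
  have [cd|dc] := leP c d; last first.
    rewrite {2}/obox [X in _ `*` X]set_itv_ge ?bnd_simp -?leNgt ?ltW//.
    by rewrite setX0 setI0 measure0.
  apply: le_lt_trans (fin_mimage ab cd sub).
  by apply: le_measure; rewrite ?inE; [apply: measurableI => //; exact: measurable_obox| |
    exact: subIsetr].
by move: H; rewrite /mrestr setIidl.
Qed.

(** Both measures vanish off [U], and [U] is a countable union of boxes to which [area_sub] applies;
    [seqDU] makes the pieces disjoint. *)
Lemma area_measure (A : set P) : measurable A -> mimage A = mjac A.
Proof.
move=> mA.
have mIU (m : {measure set P -> \bar R}) : m (~` plane U) = 0%E -> m A = m (A `&` plane U).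
  move=> m0; rewrite -[in LHS](setUIDK A (plane U)) measureU; last 1 first.
  - by apply/seteqP; split => // p [[_ ?] [_ ?]].
  - rewrite [X in (_ + X)%E = _](_ : _ = 0%E) ?adde0//.
    apply/eqP; rewrite eq_le measure_ge0 andbT -m0.
    by apply: le_measure; rewrite ?inE; [exact: measurableD|exact: measurableC|move=> p []].
  - exact: measurableI.
  - exact: measurableD.
have i0 : mimage (~` plane U) = 0%E.
  rewrite mimageE; last exact: measurableC.
  rewrite (_ : _ `&` _ = set0) ?measure0//; apply/seteqP; split => // p [Vp] /=.
  by apply; rewrite /plane/= ptK; exact: bi_psiU bi _ Vp.
have j0 : mjac (~` plane U) = 0%E.
  by apply: integral0_eq => p /= Up; rewrite /jacU patchE memNset//.
rewrite (mIU mimage i0) (mIU mjac j0).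
have UE := open_rbox (plane_open (bi_oU bi)).
(* Rational boxes are enumerated by their codes; a code of no suitable box yields the empty set. *)
pose F n : set P := if unpickle n is Some a then
  if `[< rcbox a `<=` plane U >] then rbox a else set0 else set0.
have mF n : measurable (F n).
  by rewrite /F; case: unpickle => // a; case: ifP => // _; exact: measurable_rbox.
have UF : plane U = \bigcup_n F n.
  rewrite {1}UE; apply/seteqP; split => p.
    move=> [a aU ap]; have : F (pickle a) p by rewrite /F pickleK (asboolT aU); exact: ap.
    by move: (pickle a) => n Fp; exists n.
  move=> [n _]; rewrite /F; case: unpickle => [a|]//.
  by case: asboolP => // aU ap; exists a.
have key n : mimage (A `&` seqDU F n) = mjac (A `&` seqDU F n).
  have mAF : measurable (A `&` seqDU F n).
    apply: measurableI => //; apply: measurableD => //.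
    exact: bigsetU_measurable.
  have : A `&` seqDU F n `<=` F n by move=> p [_ []].
  rewrite {2}/F; case: unpickle => [q|]; last by rewrite subset0 => ->; rewrite !measure0.
  case: asboolP => [qU|_]; last by rewrite subset0 => ->; rewrite !measure0.
  case: q qU => -[a b] [c d] qU H.
  pose e (x : rat) : R := ratr x.
  apply: (@area_sub (e a) (e b) (e c) (e d)) => // p /H[/=].
  rewrite !in_itv/= => /andP[p1 p2] /andP[p3 p4]; split; rewrite /= in_itv/= ?p1 ?p3.
    exact: ltW.
  exact: ltW.
have mAF n : measurable (A `&` seqDU F n).
  by apply: measurableI => //; apply: measurableD => //; exact: bigsetU_measurable.
have tI : trivIset setT (fun n => A `&` seqDU F n).
  exact/trivIset_setIl/trivIset_seqDU.
have -> : A `&` plane U = \bigcup_n (A `&` seqDU F n).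
  by rewrite UF seqDU_bigcup_eq setI_bigcupr.
rewrite !measure_bigcup//.
by apply: eq_eseriesr => n _; exact: key.
Qed.

Lemma measurable_comp_pmap d' (T : measurableType d') (f : P -> T) :
  measurable_fun (plane V) f -> measurable_fun (plane U) (f \o pmap phi).
Proof.
move=> mf; apply: (eq_measurable_fun (f \o pext U phi)).
  by move=> p; rewrite inE => Up; rewrite /= pextE.
apply: measurable_comp mf _ => //; last first.
  exact: measurable_funTS (measurable_pext (bi_oU bi) (bi_phi bi)).
by move=> _ [p Up <-]; rewrite pextE// /plane/= ptK; exact: bi_phiV bi _ Up.
Qed.

Lemma area_formula (f : P -> \bar R) : measurable_fun (plane V) f ->
  (forall p, plane V p -> 0 <= f p)%E ->
  (\int[leb2]_(p in plane V) f p =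
   \int[leb2]_(p in plane U) (f (pmap phi p) * (jac phi p)%:E))%E.
Proof.
move=> mf f0; pose g := (f \o pmap phi) \_ (plane U).
have mg : measurable_fun setT g.
  by apply/(measurable_restrictT _ mU); exact: measurable_comp_pmap.
have g0 p : (0 <= g p)%E.
  rewrite /g patchE; case: ifP => //; rewrite inE => Up; apply: f0.
  by rewrite /plane/= ptK; exact: bi_phiV bi _ Up.
transitivity (\int[mimage]_p g p)%E.
  rewrite ge0_integral_pushm// ge0_integral_density//; last first.
    exact: measurableT_comp mg _.
  rewrite [LHS]integral_mkcond; apply: eq_integral => p _.
  rewrite patchE indicE; case: ifP => [|_]; last by rewrite mule0.
  rewrite inE => Vp; rewrite mule1 /g patchE mem_set ?pextE//=.
    by rewrite /pmap ptK (bi_psiK bi) ?cplxK.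
  by rewrite /plane/= ptK; exact: bi_psiU bi _ Vp.
transitivity (\int[mjac]_p g p)%E.
  by apply: eq_measure_integral => A mA _; exact: area_measure.
rewrite ge0_integral_density// [RHS]integral_mkcond; apply: eq_integral => p _.
by rewrite /g /jacU !patchE; case: ifP; rewrite // mule0.
Qed.

Lemma area_image (A : set P) : measurable A -> A `<=` plane U ->
  leb2 (plane V `&` pmap psi @^-1` A) = (\int[leb2]_(p in A) (jac phi p)%:E)%E.
Proof. by move=> mA AU; rewrite -mimageE// area_measure// mjacE. Qed.

End AreaFormula.

(** * Smooth functions in the plane *)

Section Smooth.
Context {R : realType}.
Implicit Types (f g : R * R -> R) (p q v : R * R) (V W : set (R * R)).

Lemma is_derive_along f p v d :
  is_derive (0 : R) (1 : R) (fun h => f (h *: v + p)) d -> is_derive p v f d.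
Proof.
move=> [d0 dE]; apply: DeriveDef; first exact/derivable1P.
rewrite -dE /derive/=; apply: congr1; apply: congr2 => //; apply/funext => h /=.
by rewrite scale0r add0r [h *: 1]mulr1 addr0.
Qed.

Lemma is_derive_alongV f p v d : is_derive p v f d ->
  is_derive (0 : R) (1 : R) (fun h => f (h *: v + p)) d.
Proof.
move=> [d0 dE]; apply: DeriveDef; first exact/(derivable1P f p v).1.
rewrite -dE /derive/=; apply: congr1; apply: congr2 => //; apply/funext => h /=.
by rewrite scale0r add0r [h *: 1]mulr1 addr0.
Qed.

(** Continuity is recorded at every order, which makes lowering the order ([CkOnW]) and the product
    rule immediate. Over all orders this agrees with [Ck], see [smooth_Ck]. *)
Fixpoint CkOn k V f : Prop :=
  (forall p, V p -> {for p, continuous f}) /\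
  if k is k'.+1 then
    (forall p, V p -> derivable f p e1 /\ derivable f p e2) /\
    CkOn k' V ('D_e1 f) /\ CkOn k' V ('D_e2 f)
  else True.

Definition smooth V f := forall k, CkOn k V f.

Lemma CkOn_cont k V f : CkOn k V f -> forall p, V p -> {for p, continuous f}.
Proof. by case: k => [|k] []. Qed.

Lemma smooth_cont V f : smooth V f -> forall p, V p -> {for p, continuous f}.
Proof. by move=> /(_ 0%N)/CkOn_cont. Qed.

Lemma smooth_is_derive1 V f p : smooth V f -> V p -> is_derive p e1 f ('D_e1 f p).
Proof. by move=> /(_ 1%N)[_ [H _]] /H[? _]; exact: derivableP. Qed.

Lemma smooth_is_derive2 V f p : smooth V f -> V p -> is_derive p e2 f ('D_e2 f p).
Proof. by move=> /(_ 1%N)[_ [H _]] /H[_ ?]; exact: derivableP. Qed.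

Lemma smooth_D1 V f : smooth V f -> smooth V ('D_e1 f).
Proof. by move=> sf k; have [_ [_ []]] := sf k.+1. Qed.

Lemma smooth_D2 V f : smooth V f -> smooth V ('D_e2 f).
Proof. by move=> sf k; have [_ [_ []]] := sf k.+1. Qed.

Lemma CkOnW k V f : CkOn k.+1 V f -> CkOn k V f.
Proof.
elim: k f => [|k IH] f; first by case.
by move=> [cf [df [/IH h1 /IH h2]]]; split.
Qed.

Lemma CkOn_eq k V f g : open V -> (forall p, V p -> f p = g p) -> CkOn k V f -> CkOn k V g.
Proof.
move=> oV; elim: k f g => [|k IH] f g fg.
all: have nfg p : V p -> \forall q \near p, f q = g q
  by move=> Vp; apply: filterS (open_nbhs_nbhs (conj oV Vp)) => q /fg.
all: have ct (cf : forall p, V p -> {for p, continuous f}) p : V p -> {for p, continuous g}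
  by move=> Vp; rewrite /prop_for /continuous_at -(fg _ Vp);
     apply: cvg_trans (cf _ Vp); apply: near_eq_cvg; exact: nfg.
  by move=> [cf _]; split => // p; exact: ct.
move=> [cf [df [d1 d2]]].
have D v p : V p -> derivable f p v -> is_derive p v g ('D_v f p).
  by move=> Vp dfp; apply: near_eq_is_derive (nfg _ Vp) _; exact: derivableP.
split; [by move=> p; exact: ct|split; [|split]].
- by move=> p Vp; have [h1 h2] := df _ Vp; split; apply: ex_derive; apply: D.
- by apply: IH d1 => p Vp; have [h1 h2] := df _ Vp; rewrite (@derive_val _ _ _ _ _ _ _ (D _ _ Vp h1)).
- by apply: IH d2 => p Vp; have [h1 h2] := df _ Vp; rewrite (@derive_val _ _ _ _ _ _ _ (D _ _ Vp h2)).
Qed.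

Lemma CkOnS k V f f1 f2 : open V -> (forall p, V p -> {for p, continuous f}) ->
  (forall p, V p -> is_derive p e1 f (f1 p)) ->
  (forall p, V p -> is_derive p e2 f (f2 p)) ->
  CkOn k V f1 -> CkOn k V f2 -> CkOn k.+1 V f.
Proof.
move=> oV cf h1 h2 c1 c2; split => //; split; [|split].
- by move=> p Vp; split; apply: ex_derive; [exact: h1|exact: h2].
- by apply: (CkOn_eq oV _ c1) => p /h1[_ ->].
- by apply: (CkOn_eq oV _ c2) => p /h2[_ ->].
Qed.

Lemma CkOn_cst k V (c : R) : open V -> CkOn k V (fun=> c).
Proof.
move=> oV; elim: k c => [|k IH] c; first by split => // p _; exact: cvg_cst.
apply: (@CkOnS k V _ (fun=> 0) (fun=> 0)) => // p _.
exact: cvg_cst.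
Qed.

Lemma CkOnD k V f g : open V -> CkOn k V f -> CkOn k V g -> CkOn k V (fun p => f p + g p).
Proof.
move=> oV; elim: k f g => [|k IH] f g [cf hf] [cg hg].
  by split => // p Vp; apply: cvgD; [exact: cf|exact: cg].
move: hf hg => [df [f1 f2]] [dg [g1 g2]].
apply: (@CkOnS k V _ (fun p => 'D_e1 f p + 'D_e1 g p) (fun p => 'D_e2 f p + 'D_e2 g p)) => //.
- by move=> p Vp; apply: cvgD; [exact: cf|exact: cg].
- move=> p Vp; have [hf _] := df _ Vp; have [hg _] := dg _ Vp.
  exact: is_deriveD (derivableP hf) (derivableP hg).
- move=> p Vp; have [_ hf] := df _ Vp; have [_ hg] := dg _ Vp.
  exact: is_deriveD (derivableP hf) (derivableP hg).
- exact: IH.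
- exact: IH.
Qed.

Lemma CkOnM k V f g : open V -> CkOn k V f -> CkOn k V g -> CkOn k V (fun p => f p * g p).
Proof.
move=> oV; elim: k f g => [|k IH] f g kf kg.
  by split => // p Vp; apply: cvgM; [exact: (CkOn_cont kf)|exact: (CkOn_cont kg)].
have [cf [df [f1 f2]]] := kf; have [cg [dg [g1 g2]]] := kg.
have [kf' kg'] := (CkOnW kf, CkOnW kg).
apply: (@CkOnS k V _ (fun p => f p * 'D_e1 g p + g p * 'D_e1 f p)
  (fun p => f p * 'D_e2 g p + g p * 'D_e2 f p)) => //.
- by move=> p Vp; apply: cvgM; [exact: cf|exact: cg].
- move=> p Vp; have [hf _] := df _ Vp; have [hg _] := dg _ Vp.
  exact: is_deriveM (derivableP hf) (derivableP hg).
- move=> p Vp; have [_ hf] := df _ Vp; have [_ hg] := dg _ Vp.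
  exact: is_deriveM (derivableP hf) (derivableP hg).
- by apply: CkOnD => //; exact: IH.
- by apply: CkOnD => //; exact: IH.
Qed.

Lemma CkOnB k V f g : open V -> CkOn k V f -> CkOn k V g -> CkOn k V (fun p => f p - g p).
Proof.
move=> oV cf cg; apply: (CkOn_eq (f := fun p => f p + -1 * g p)) => //.
  by move=> p _; rewrite mulN1r.
by apply: CkOnD => //; apply: CkOnM => //; exact: CkOn_cst.
Qed.

Lemma CkOn_setU k V W f : CkOn k V f -> CkOn k W f -> CkOn k (V `|` W) f.
Proof.
elim: k f => [|k IH] f; first by move=> [h _] [h' _]; split => // p [/h|/h'].
move=> [cV [dV [V1 V2]]] [cW [dW [W1 W2]]]; split; first by move=> p [/cV|/cW].
by split; [move=> p [/dV|/dW]|split; [exact: IH V1 W1|exact: IH V2 W2]].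
Qed.

Lemma smooth_Ck f : smooth setT f <-> forall k, Ck k f.
Proof.
split=> [sf k|sf k]; elim: k f sf => [|k IH] f sf.
- by move=> p; exact: (CkOn_cont (sf 0%N) I).
- split; first by move=> p; have [_ [H _]] := sf 1%N; exact: H.
  by split; apply: IH; [exact: smooth_D1|exact: smooth_D2].
- by split => // p _; exact: (sf 0%N p).
split; first by move=> p _; exact: (sf 0%N p).
split; first by move=> p _; have [H _] := sf 1%N; exact: H.
by split; apply: IH => j; have [_ []] := sf j.+1.
Qed.

(** Total differentiability at q with partial derivatives a and b; the chain rule for a curved inner
    map needs it, as directional derivatives would not be enough. *)
Definition ediff f q a b := forall e : R, 0 < e -> exists2 r : R, 0 < r &
  forall h, `|h| < r -> `|f (h + q) - f q - (a * h.1 + b * h.2)| <= e * (`|h.1| + `|h.2|).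

Lemma MVT_between (f df : R -> R) (a b : R) : (forall x : R, is_derive x (1 : R) f (df x)) ->
  exists2 c, `|c - a| <= `|b - a| & f b - f a = df c * (b - a).
Proof.
move=> H.
have cf x y : {within `[x, y], continuous f}.
  by apply/continuous_subspaceT => t; exact/differentiable_continuous/derivable1_diffP/ex_derive.
have [ab|/ltW ba] := leP a b.
  have [c ca E] := MVT_segment ab (fun x _ => H x) (cf _ _); exists c => //.
  move: ca; rewrite in_itv/= => /andP[h1 h2].
  by rewrite !ger0_norm ?subr_ge0// lerB.
have [c ca E] := MVT_segment ba (fun x _ => H x) (cf _ _); exists c.
  move: ca; rewrite in_itv/= => /andP[h1 h2].
  by rewrite !ler0_norm ?subr_le0// lerN2 lerB.
by rewrite -[LHS]opprB E -mulrN opprB.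
Qed.

Lemma is_derive_line1 f (x y d : R) : is_derive (x, y) e1 f d ->
  is_derive x (1 : R) (fun t => f (t, y)) d.
Proof.
have E : (fun h : R => f (h *: e1 + (x, y))) = (fun h : R => f (h *: 1 + x, y)).
  by apply/funext => h; congr (f (_, _)); rewrite /= scaler0 add0r.
move=> /is_derive_alongV; rewrite E => -[d0 <-].
by apply: DeriveDef; [exact/derivable1P|rewrite /derive/=; apply: congr1; apply: congr2 => //;
  apply/funext => h /=; rewrite scale0r add0r addr0 [(_ *: _) *: _]mulr1].
Qed.

Lemma is_derive_line2 f (x y d : R) : is_derive (x, y) e2 f d ->
  is_derive y (1 : R) (fun t => f (x, t)) d.
Proof.
have E : (fun h : R => f (h *: e2 + (x, y))) = (fun h : R => f (x, h *: 1 + y)).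
  by apply/funext => h; congr (f (_, _)); rewrite /= scaler0 add0r.
move=> /is_derive_alongV; rewrite E => -[d0 <-].
by apply: DeriveDef; [exact/derivable1P|rewrite /derive/=; apply: congr1; apply: congr2 => //;
  apply/funext => h /=; rewrite scale0r add0r addr0 [(_ *: _) *: _]mulr1].
Qed.

Lemma continuous_eps f q : {for q, continuous f} -> forall e : R, 0 < e ->
  exists2 r : R, 0 < r & forall p, `|p - q| < r -> `|f p - f q| <= e.
Proof.
move=> cf e e0; have : \forall p \near q, `|f p - f q| <= e.
  by near do rewrite distrC; apply: cvgr_dist_le e0; exact: cf.
move=> /nbhs_ballP[r/= r0 H]; exists r => // p pr; apply: H.
by rewrite -ball_normE /= distrC.
Unshelve. all: by end_near. Qed.

Let pnormE p : `|p| = Num.max `|p.1| `|p.2|.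
Proof. by []. Qed.

Let regroup (x y z u w : R) : x - y - (u + w) = (x - z - u) + (z - y - w).
Proof. by ring. Qed.

Let est1 (e N x y : R) : 0 <= e -> 0 < N -> 0 <= x -> y <= N -> e / N * (x * y) <= e * x.
Proof.
move=> e0 N0 x0 yN; apply: (@le_trans _ _ (e / N * (x * N))).
  by apply: ler_wpM2l; [rewrite divr_ge0// ltW|exact: ler_wpM2l].
by rewrite mulrCA [X in _ * X]divfK ?gt_eqF// mulrC.
Qed.

Let est2 (u n N x : R) : u <= x * N -> u + n * (x * N) <= x * ((n + 1) * N).
Proof. by move=> h; rewrite mulrDl mulrDr mul1r [x * (n * N)]mulrCA addrC lerD2l. Qed.

Let est3 (s t h a b x y u w : R) : s - t - h *: (a * x + b * y) =
  s - t - (a * u + b * w) + (a * (u - h * x) + b * (w - h * y)).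
Proof. by rewrite [h *: _]mulrDr; ring. Qed.

Let est4 (e M x : R) : 0 < M -> e / 4 / M * (2 * (x * M)) = e / 2 * x.
Proof. by move=> M0; field; exact: lt0r_neq0. Qed.

(** The increment is split along a horizontal and a vertical leg; the mean value theorem on each leg
    and continuity of the partial derivatives give the estimate. *)
Lemma smooth_ediff f q : smooth setT f -> ediff f q ('D_e1 f q) ('D_e2 f q).
Proof.
move=> sf e e0.
have [r1 r10 H1] := continuous_eps (smooth_cont (smooth_D1 sf) (I : setT q)) e0.
have [r2 r20 H2] := continuous_eps (smooth_cont (smooth_D2 sf) (I : setT q)) e0.
exists (Num.min r1 r2); first by rewrite lt_min r10.
case: q H1 H2 => x y H1 H2 [h k]; rewrite lt_min => /andP[hr1 hr2].
have [c cx E1] := @MVT_between (fun t => f (t, k + y)) (fun t => 'D_e1 f (t, k + y)) x (h + x)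
  (fun t => is_derive_line1 (smooth_is_derive1 sf I)).
have [d dy E2] := @MVT_between (fun t => f (x, t)) (fun t => 'D_e2 f (x, t)) y (k + y)
  (fun t => is_derive_line2 (smooth_is_derive2 sf I)).
rewrite !addrK in cx E1 dy E2.
have -> : f ((h, k) + (x, y)) - f (x, y) - ('D_e1 f (x, y) * h + 'D_e2 f (x, y) * k) =
  ('D_e1 f (c, k + y) - 'D_e1 f (x, y)) * h + ('D_e2 f (x, d) - 'D_e2 f (x, y)) * k.
  rewrite (regroup _ _ (f (x, k + y))) [in RHS]mulrBl [in RHS]mulrBl.
  by rewrite (_ : f ((h, k) + (x, y)) = f (h + x, k + y))// E1 E2.
apply: le_trans (ler_normD _ _) _; rewrite !normrM mulrDr; apply: lerD; apply: ler_wpM2r => //.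
  apply: H1; apply: le_lt_trans hr1; rewrite !pnormE /= addrK.
  by rewrite ge_max !le_max cx lexx orbT.
apply: H2; apply: le_lt_trans hr2; rewrite !pnormE /= subrr normr0.
by rewrite ge_max !le_max normr_ge0 dy orbT.
Qed.

Lemma is_derive_Re (g : R[i] -> R[i]) p v d : cdiff g (cplx p) d ->
  is_derive p v (fun q => Re (g (cplx q))) (Re (cplx v * d)).
Proof.
move=> dg; apply: is_derive_eps => e e0; pose N : R := normc (cplx v) + 1.
have N0 : 0 < N by rewrite ltr_wpDl// normc_ge0.
have [r r0 H] := dg _ (divr_gt0 e0 N0); exists (r / N); first exact: divr_gt0.
move=> h; rewrite ltr_pdivlMr// => hr.
have nh : normc (cplx (h *: v)) = `|h| * normc (cplx v) by rewrite cplxZ normcM normc_real.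
have E : cplx (h *: v + p) - cplx p = cplx (h *: v) by rewrite cplxD addrK.
have := H (cplx (h *: v + p)); rewrite E nh => /(_ _) H'.
have {}H' := H' (le_lt_trans (ler_wpM2l (normr_ge0 h) (ler_wpDr ler01 (lexx _))) hr).
have -> : Re (g (cplx (h *: v + p))) - Re (g (cplx p)) - h *: Re (cplx v * d) =
   Re (g (cplx (h *: v + p)) - g (cplx p) - d * cplx (h *: v)).
  rewrite !cReB cplxZ; congr (_ - _); rewrite [d * _]mulrC -mulrA.
  by rewrite [RHS]cReM /= mul0r subr0.
apply: le_trans (Re_le_normc _) _; apply: le_trans H' _.
by apply: est1 => //; [exact: ltW|rewrite lerDl].
Qed.

Lemma is_derive_Im (g : R[i] -> R[i]) p v d : cdiff g (cplx p) d ->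
  is_derive p v (fun q => Im (g (cplx q))) (Im (cplx v * d)).
Proof.
have E (z : R[i]) : Im z = Re (- 'i%C * z) by rewrite cReM /= oppr0 mul0r sub0r mulN1r opprK.
move=> dg; rewrite E mulrCA (_ : (fun q => _) = fun q => Re (- 'i%C * g (cplx q))).
  by apply: (is_derive_Re (g := fun z => - 'i%C * g z)); exact: cdiffZ.
by apply/funext => q; rewrite E.
Qed.

Lemma is_derive_comp (eta : R * R -> R) (g : R[i] -> R[i]) p v d (a b : R) :
  ediff eta (pmap g p) a b -> cdiff g (cplx p) d ->
  is_derive p v (fun q => eta (pmap g q)) (a * Re (cplx v * d) + b * Im (cplx v * d)).
Proof.
move=> deta dg; apply: is_derive_eps => e e0.
pose N : R := normc (cplx v) + 1; pose D : R := normc d + 1; pose A : R := `|a| + `|b| + 1.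
have N0 : 0 < N by rewrite ltr_wpDl// normc_ge0.
have D0 : 0 < D by rewrite ltr_wpDl// normc_ge0.
have A0 : 0 < A by rewrite ltr_wpDl// addr_ge0.
have [r1 r10 H1] := deta _ (divr_gt0 (divr_gt0 e0 (ltr0n R 4)) (mulr_gt0 D0 N0)).
(* The cap 1 gives |G| <= |h| D N. The second entry makes the remainder of g, amplified by |a| + |b|
   < A, at most e / 2 |h|; the remainder of eta takes the other half. *)
set ee := Num.min 1 (e / 2 / (A * N)).
have ee0 : 0 < ee by rewrite lt_min ltr01 !divr_gt0// mulr_gt0.
have [r2 r20 H2] := dg _ ee0.
exists (Num.min (r2 / N) (r1 / (D * N))).
  by rewrite lt_min !divr_gt0// mulr_gt0.
move=> h; rewrite lt_min !ltr_pdivlMr ?mulr_gt0// => /andP[hr2 hr1].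
have nv : normc (cplx (h *: v)) <= `|h| * N.
  by rewrite cplxZ normcM normc_real ler_wpM2l// lerDl.
have E : cplx (h *: v + p) - cplx p = cplx (h *: v) by rewrite cplxD addrK.
have := H2 (cplx (h *: v + p)); rewrite E => /(_ (le_lt_trans nv hr2)).
set G := g (cplx (h *: v + p)) - g (cplx p) => HG.
have {}HG : normc (G - d * cplx (h *: v)) <= ee * (`|h| * N).
  by apply: le_trans HG _; rewrite ler_wpM2l// ltW.
have nG : normc G <= `|h| * (D * N).
  rewrite -[G](subrK (d * cplx (h *: v))); apply: le_trans (le_normcD _ _) _.
  rewrite normcM; apply: le_trans (lerD HG (ler_wpM2l (normc_ge0 d) nv)) _.
  have e1 : ee * (`|h| * N) <= `|h| * N.
    by apply: ler_piMl; rewrite ?ge_min ?lexx// mulr_ge0// ltW.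
  exact: est2.
have Gk : pmap g (h *: v + p) = pt G + pmap g p.
  by apply: (can_inj (@cplxK R)); rewrite cplxD /pmap !ptK subrK.
have Gr : `|pt G| < r1.
  by apply: le_lt_trans hr1; apply: le_trans nG; rewrite -{2}[G]ptK; exact: norm_le_normc.
rewrite Gk; set k := pt G.
have -> : eta (k + pmap g p) - eta (pmap g p) - h *: (a * Re (cplx v * d) + b * Im (cplx v * d)) =
  (eta (k + pmap g p) - eta (pmap g p) - (a * k.1 + b * k.2)) +
  (a * Re (G - d * cplx (h *: v)) + b * Im (G - d * cplx (h *: v))).
  have -> : d * cplx (h *: v) = (h%:C)%C * (cplx v * d) by rewrite cplxZ mulrC mulrA.
  have rc z : Re ((h%:C)%C * z) = h * Re z by rewrite cReM mul0r subr0.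
  have ic z : Im ((h%:C)%C * z) = h * Im z by rewrite cImM mul0r addr0.
  rewrite cReB cImB rc ic; exact: est3.
apply: le_trans (ler_normD _ _) _.
rewrite [e]splitr mulrDl; apply: lerD.
  apply: le_trans (H1 _ Gr) _.
  apply: (@le_trans _ _ (e / 4 / (D * N) * (2 * (`|h| * (D * N))))).
    apply: ler_wpM2l; first by rewrite !divr_ge0 ?mulr_ge0// ltW.
    rewrite [2 * _]mulr_natl mulr2n.
    by apply: lerD; apply: le_trans nG; [exact: Re_le_normc|exact: Im_le_normc].
  rewrite le_eqVlt; apply/orP; left; apply/eqP.
  exact: est4 (mulr_gt0 D0 N0).
apply: (@le_trans _ _ (A * (ee * (`|h| * N)))).
  apply: le_trans (ler_normD _ _) _; rewrite !normrM.
  apply: (@le_trans _ _ ((`|a| + `|b|) * (ee * (`|h| * N)))).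
    rewrite mulrDl; apply: lerD; apply: ler_wpM2l => //; apply: le_trans HG;
    [exact: Re_le_normc|exact: Im_le_normc].
  by apply: ler_wpM2r; rewrite ?lerDl// !mulr_ge0// ltW.
rewrite !mulrA mulrAC [A * ee * N]mulrAC -mulrA [ee * _]mulrC mulrA.
have: A * N * ee <= e / 2 by rewrite mulrC -ler_pdivlMr ?mulr_gt0// ge_min lexx orbT.
by move=> H; rewrite mulrAC; apply: ler_wpM2r.
Qed.

Lemma smooth_eq V f g : open V -> (forall p, V p -> f p = g p) -> smooth V f -> smooth V g.
Proof. by move=> oV fg sf k; exact: CkOn_eq (sf k). Qed.

Lemma smooth_cst V (c : R) : open V -> smooth V (fun=> c).
Proof. by move=> oV k; exact: CkOn_cst. Qed.

Lemma smoothM V f g : open V -> smooth V f -> smooth V g -> smooth V (fun p => f p * g p).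
Proof. by move=> oV sf sg k; exact: CkOnM. Qed.

Lemma smooth_setU V W f : smooth V f -> smooth W f -> smooth (V `|` W) f.
Proof. by move=> sV sW k; exact: CkOn_setU. Qed.

Lemma cplx_e1 : cplx (@e1 R) = 1.
Proof. by []. Qed.

Lemma cplx_e2 : cplx (@e2 R) = 'i%C.
Proof. by []. Qed.

(** The partial derivatives of Re g are Re g' and Re (i g'), again real parts of holomorphic
    functions, so induction on the order runs over all g at once. *)
Lemma smooth_Re (U : set R[i]) (g : R[i] -> R[i]) : copen U -> holo U g ->
  smooth (plane U) (fun p => Re (g (cplx p))).
Proof.
move=> oU hg k; have oV := plane_open oU.
have ct (h : R[i] -> R[i]) p : holo U h -> plane U p ->
    {for p, continuous (fun p => Re (h (cplx p)))}.
  by move=> hh Up; apply: ccont_continuous; [exact: Re_lip|exact: holo_ccont hh Up].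
elim: k g hg => [|k IH] g hg; first by split => // p; exact: ct.
have hg' := holo_cder oU hg.
apply: (@CkOnS k _ _ (fun p => Re (cder g (cplx p))) (fun p => Re ('i%C * cder g (cplx p)))) => //.
- by move=> p; exact: ct.
- move=> p Up; rewrite -[X in Re X]mul1r -cplx_e1; apply: is_derive_Re; exact: cderP hg Up.
- move=> p Up; rewrite -cplx_e2; apply: is_derive_Re; exact: cderP hg Up.
- exact: IH.
- apply: (IH (fun z => 'i%C * cder g z)) => z Uz; have [k' dk] := hg' z Uz.
  by exists ('i%C * k'); exact: cdiffZ.
Qed.

Lemma smooth_Im (U : set R[i]) (g : R[i] -> R[i]) : copen U -> holo U g ->
  smooth (plane U) (fun p => Im (g (cplx p))).
Proof.
move=> oU hg; apply: (smooth_eq (f := fun p => Re (- 'i%C * g (cplx p)))).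
- exact: plane_open.
- by move=> p _; rewrite cReM /= oppr0 mul0r sub0r mulN1r opprK.
- apply: (smooth_Re (g := fun z => - 'i%C * g z)) => // z Uz.
  by have [k dk] := hg z Uz; exists (- 'i%C * k); exact: cdiffZ.
Qed.

Section Composition.
Variables (U : set R[i]) (g : R[i] -> R[i]).
Hypotheses (oU : copen U) (hg : holo U g).

Lemma is_derive_comp1 (eta : R * R -> R) p : smooth setT eta -> plane U p ->
  is_derive p e1 (eta \o pmap g)
    ('D_e1 eta (pmap g p) * Re (cder g (cplx p)) + 'D_e2 eta (pmap g p) * Im (cder g (cplx p))).
Proof.
move=> se Up; have := is_derive_comp e1 (smooth_ediff (pmap g p) se) (cderP hg Up).
by rewrite cplx_e1 mul1r.
Qed.

Lemma is_derive_comp2 (eta : R * R -> R) p : smooth setT eta -> plane U p ->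
  is_derive p e2 (eta \o pmap g)
    ('D_e2 eta (pmap g p) * Re (cder g (cplx p)) - 'D_e1 eta (pmap g p) * Im (cder g (cplx p))).
Proof.
move=> se Up; have := is_derive_comp e2 (smooth_ediff (pmap g p) se) (cderP hg Up).
by rewrite cplx_e2 cReM cImM !mul0r !mul1r sub0r add0r mulrN addrC.
Qed.

Lemma continuous_pmap p : plane U p -> {for p, continuous (pmap g)}.
Proof.
move=> Up; have cg := holo_ccont hg Up.
exact: (cvg_pair (ccont_continuous (@Re_lip R) cg) (ccont_continuous (@Im_lip R) cg)).
Qed.

Lemma smooth_comp (eta : R * R -> R) : smooth setT eta -> smooth (plane U) (eta \o pmap g).
Proof.
have oV := plane_open oU; have hg' := holo_cder oU hg.
have ct (eta' : R * R -> R) : smooth setT eta' -> forall p, plane U p ->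
    {for p, continuous (eta' \o pmap g)}.
  move=> se p Up; apply: continuous_comp; first exact: continuous_pmap.
  exact: (smooth_cont se I).
move=> se k; elim: k eta se => [|k IH] eta se; first by split => // p; exact: ct.
have c1 := IH _ (smooth_D1 se); have c2 := IH _ (smooth_D2 se).
have sR := smooth_Re oU hg' k; have sI := smooth_Im oU hg' k.
apply: (CkOnS oV (ct _ se) (fun p => is_derive_comp1 se) (fun p => is_derive_comp2 se)).
  by apply: (CkOnD oV); apply: (CkOnM oV).
by apply: (CkOnB oV); apply: (CkOnM oV).
Qed.

End Composition.

Section Pullback.
Variables (U V : set R[i]) (phi psi : R[i] -> R[i]).
Hypothesis bi : biholo U V phi psi.

(** Transplants a test function from [U] to [V] with a smooth factor. The factors used are Re psi'
    and Im psi'. *)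
Definition pull (eta r : R * R -> R) : R * R -> R :=
  (fun p => eta (pmap psi p) * r p) \_ (plane V).

Lemma compact_pmap (K : set (R * R)) : compact K -> K `<=` plane U ->
  compact (pmap phi @` K) /\ pmap phi @` K `<=` plane V.
Proof.
move=> cK KU; split; last first.
  by move=> _ [p /KU Up <-]; rewrite /plane/= ptK; exact: bi_phiV bi _ Up.
apply: continuous_compact => //; apply: continuous_in_subspaceT => p; rewrite inE => /KU Up.
exact: (continuous_pmap (bi_phi bi) Up).
Qed.

Lemma pull_test (eta r : R * R -> R) : test_function (plane U) eta -> smooth (plane V) r ->
  test_function (plane V) (pull eta r).
Proof.
move=> [/smooth_Ck se [K [cK KU K0]]] sr.
have [cK' KV] := compact_pmap cK KU.
have oV := plane_open (bi_oV bi).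
have F0 p : ~ (pmap phi @` K) p -> pull eta r p = 0.
  move=> pK; rewrite /pull patchE; case: ifP => // /[!inE] Vp.
  rewrite K0 ?mul0r// => Kp; apply: pK; exists (pmap psi p) => //.
  by rewrite /pmap ptK (bi_psiK bi)// cplxK.
split; last by exists (pmap phi @` K).
apply/smooth_Ck.
(* Smoothness is glued from two open sets: on [V] the function is a product of smooth ones, and off
   the compact phi(K) it is zero. *)
have -> : setT = plane V `|` ~` (pmap phi @` K).
  by apply/seteqP; split => // p _; have [/KV|] := pselect ((pmap phi @` K) p); [left|right].
apply: smooth_setU.
  apply: (smooth_eq (f := fun p => (eta \o pmap psi) p * r p)) => //.
    by move=> p Vp; rewrite /pull patchE mem_set.
  exact: (smoothM oV (smooth_comp (bi_oV bi) (bi_psi bi) se) sr).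
have oK : open (~` (pmap phi @` K)).
  by apply: closed_openC; apply: compact_closed cK'; exact: norm_hausdorff.
by apply: (smooth_eq (f := fun=> 0)) => //; [move=> p /F0 ->|exact: smooth_cst].
Qed.

Lemma is_derive_pull1 (eta r : R * R -> R) p : test_function (plane U) eta ->
  smooth (plane V) r -> plane V p ->
  'D_e1 (pull eta r) p = eta (pmap psi p) * 'D_e1 r p + r p *
    ('D_e1 eta (pmap psi p) * Re (cder psi (cplx p)) +
     'D_e2 eta (pmap psi p) * Im (cder psi (cplx p))).
Proof.
move=> [/smooth_Ck se _] sr Vp; have oV := plane_open (bi_oV bi).
suff [] : is_derive p e1 (pull eta r) (eta (pmap psi p) * 'D_e1 r p + r p *
    ('D_e1 eta (pmap psi p) * Re (cder psi (cplx p)) +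
     'D_e2 eta (pmap psi p) * Im (cder psi (cplx p)))) by [].
apply: (@near_eq_is_derive _ _ _ (fun p => (eta \o pmap psi) p * r p)).
  by apply: filterS (open_nbhs_nbhs (conj oV Vp)) => q Vq; rewrite /pull patchE mem_set.
exact: is_deriveM (is_derive_comp1 (bi_psi bi) se Vp) (smooth_is_derive1 sr Vp).
Qed.

Lemma is_derive_pull2 (eta r : R * R -> R) p : test_function (plane U) eta ->
  smooth (plane V) r -> plane V p ->
  'D_e2 (pull eta r) p = eta (pmap psi p) * 'D_e2 r p + r p *
    ('D_e2 eta (pmap psi p) * Re (cder psi (cplx p)) -
     'D_e1 eta (pmap psi p) * Im (cder psi (cplx p))).
Proof.
move=> [/smooth_Ck se _] sr Vp; have oV := plane_open (bi_oV bi).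
suff [] : is_derive p e2 (pull eta r) (eta (pmap psi p) * 'D_e2 r p + r p *
    ('D_e2 eta (pmap psi p) * Re (cder psi (cplx p)) -
     'D_e1 eta (pmap psi p) * Im (cder psi (cplx p)))) by [].
apply: (@near_eq_is_derive _ _ _ (fun p => (eta \o pmap psi) p * r p)).
  by apply: filterS (open_nbhs_nbhs (conj oV Vp)) => q Vq; rewrite /pull patchE mem_set.
exact: is_deriveM (is_derive_comp2 (bi_psi bi) se Vp) (smooth_is_derive2 sr Vp).
Qed.

Let rR p := Re (cder psi (cplx p)).
Let rI p := Im (cder psi (cplx p)).

(** By the Cauchy-Riemann equations for psi' the derivatives of the two factors cancel. A derivative
    of eta weighted by |psi'|^2 thus becomes a combination of derivatives of test functions on [V],
    ready for the definition of the weak gradient there. *)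
Lemma pull_D1 eta p : test_function (plane U) eta -> plane V p ->
  'D_e1 eta (pmap psi p) * jac psi p = 'D_e1 (pull eta rR) p - 'D_e2 (pull eta rI) p.
Proof.
move=> te Vp; have hp := holo_cder (bi_oV bi) (bi_psi bi).
have d := cderP hp Vp.
have sR : smooth (plane V) rR := smooth_Re (bi_oV bi) hp.
have sI : smooth (plane V) rI := smooth_Im (bi_oV bi) hp.
rewrite is_derive_pull1// is_derive_pull2//.
have [_ ->] := is_derive_Re e1 d; have [_ ->] := is_derive_Im e2 d.
rewrite cplx_e1 mul1r cplx_e2 cImM mul0r mul1r add0r /jac sqr_normc /rR /rI.
by ring.
Qed.

Lemma pull_D2 eta p : test_function (plane U) eta -> plane V p ->
  'D_e2 eta (pmap psi p) * jac psi p = 'D_e1 (pull eta rI) p + 'D_e2 (pull eta rR) p.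
Proof.
move=> te Vp; have hp := holo_cder (bi_oV bi) (bi_psi bi).
have d := cderP hp Vp.
have sR : smooth (plane V) rR := smooth_Re (bi_oV bi) hp.
have sI : smooth (plane V) rI := smooth_Im (bi_oV bi) hp.
rewrite is_derive_pull1// is_derive_pull2//.
have [_ ->] := is_derive_Re e2 d; have [_ ->] := is_derive_Im e1 d.
rewrite cplx_e1 mul1r cplx_e2 cReM mul0r mul1r sub0r /jac sqr_normc /rR /rI.
by ring.
Qed.

End Pullback.

End Smooth.

(** * Smooth cut-off functions *)

Section SmoothBumps.
Context {R : realType}.
Implicit Types (p : {poly R}) (x t : R) (q v : R * R).

Lemma poly_exp_bound p n : exists2 B : R, 0 <= B &
  forall x, 0 < x -> `|p.[x]| * x ^+ n.+1 * expR (- x) <= B.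
Proof.
elim/poly_ind: p n => [|p c IH] n.
  by exists 0 => // x _; rewrite horner0 normr0 !mul0r.
have [B B0 H] := IH n.+1; exists (B + `|c| * n.+1`!%:R); first by rewrite addr_ge0// mulr_ge0.
move=> x x0; rewrite hornerMXaddC.
have e0 : 0 <= x ^+ n.+1 * expR (- x) by rewrite mulr_ge0 ?expR_ge0// exprn_ge0// ltW.
rewrite -mulrA; apply: le_trans (ler_wpM2r e0 (ler_normD _ _)) _.
rewrite mulrDl; apply: lerD.
  apply: le_trans (H _ x0); rewrite normrM (gtr0_norm x0) [x ^+ n.+2]exprS.
  by rewrite !mulrA.
apply: ler_wpM2l => //; rewrite expRN ler_pdivrMr ?expR_gt0// mulrC.
rewrite -ler_pdivrMr ?ltr0n ?fact_gt0//; apply: le_trans (expR_ge1Dxn n (ltW x0)).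
by rewrite lerDr.
Qed.

(** With a polynomial factor in 1 / t the family is closed under differentiation: p is replaced by
    X^2 (p - p'). Smoothness follows by induction on the order, for all p simultaneously. *)
Definition ebump p t := if 0 < t then p.[t^-1] * expR (- t^-1) else 0.

Lemma ebump_pos p t : 0 < t -> ebump p t = p.[t^-1] * expR (- t^-1).
Proof. by rewrite /ebump => ->. Qed.

Lemma ebump_npos p t : t <= 0 -> ebump p t = 0.
Proof. by rewrite /ebump ltNge => ->. Qed.

Lemma is_derive_ebump p t :
  is_derive t (1 : R) (ebump p) (ebump ('X^2 * (p - p^`())) t).
Proof.
have [t0|t0|->] := ltrgtP t 0.
- rewrite ebump_npos ?ltW//; apply: (near_eq_is_derive (f := cst 0)).
  by near=> s; rewrite ebump_npos// ltW//; near: s; exact: lt_nbhsl.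
- rewrite ebump_pos//; apply: (near_eq_is_derive (f := fun s : R => p.[s^-1] * expR (- s^-1))).
    by near=> s; rewrite ebump_pos//; near: s; exact: lt_nbhsr.
  have tn : t != 0 by rewrite gt_eqF.
  have dV : is_derive t (1 : R) (fun s : R => s^-1) (- t ^- 2 *: 1).
    exact: (is_deriveV (f := id)).
  have dp : is_derive t (1 : R) (fun s : R => p.[s^-1]) (p^`().[t^-1] * (- t ^- 2 *: 1)).
    exact: (is_derive1_comp (f := horner p) (g := fun s => s^-1)).
  have dN : is_derive t (1 : R) (fun s : R => - s^-1) (- (- t ^- 2 *: 1)).
    exact: is_deriveN.
  have de : is_derive t (1 : R) (fun s : R => expR (- s^-1))
      (expR (- t^-1) * (- (- t ^- 2 *: 1))).
    exact: (is_derive1_comp (f := expR) (g := fun s => - s^-1)).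
  apply: (is_derive_eq (is_deriveM dp de)).
  rewrite hornerM hornerXn hornerD hornerN exprVn.
  rewrite ![_ *: 1]mulr1 ![_ *: (_ : R)]/GRing.scale/=.
  by ring.
- rewrite ebump_npos//; apply: is_derive_eps => e e0.
  (* At x = 1 / h with exponent 2 this reads |ebump p h| <= B h^2, so the derivative at 0 is
     zero. *)
  have [B B0 H] := poly_exp_bound p 1.
  exists (e / (B + 1)); first by rewrite divr_gt0// ltr_wpDl.
  move=> h hr; rewrite [h *: 1]mulr1 addr0 (ebump_npos p (lexx 0)) [h *: 0]mulr0 !subr0.
  have [h0|h0] := leP h 0; first by rewrite ebump_npos// normr0 mulr_ge0// ltW.
  rewrite ebump_pos// normrM (ger0_norm (expR_ge0 _)) (gtr0_norm h0).
  have hi : 0 < h^-1 by rewrite invr_gt0.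
  have := H _ hi; rewrite mulrAC -ler_pdivlMr ?exprn_gt0// exprVn invrK => K.
  apply: le_trans K _; rewrite expr2 mulrA; apply: ler_wpM2r; first exact: ltW.
  have h1 : h * (B + 1) < e by move: hr; rewrite gtr0_norm// ltr_pdivlMr// ltr_wpDl.
  by apply: le_trans (ltW h1); rewrite mulrC; apply: ler_wpM2l; [exact: ltW|rewrite lerDl].
Unshelve. all: by end_near.
Qed.

Definition aff (l : R * R * R) (q : R * R) : R := l.1.1 * q.1 + l.1.2 * q.2 + l.2.

Lemma is_derive_ebump_aff p l q v : is_derive q v (fun q => ebump p (aff l q))
  ((l.1.1 * v.1 + l.1.2 * v.2) * ebump ('X^2 * (p - p^`())) (aff l q)).
Proof.
set c := l.1.1 * v.1 + l.1.2 * v.2; apply: is_derive_along.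
have -> : (fun h : R => ebump p (aff l (h *: v + q))) =
    ebump p \o (fun h : R => h * c + aff l q).
  by apply/funext => h; rewrite /aff /c/=; congr ebump;
    rewrite ![h *: _]/GRing.scale/=; ring.
have d : is_derive (0 : R) (1 : R) (fun h : R => h * c + aff l q) c.
  have d1 : is_derive (0 : R) (1 : R) (fun h : R => h * c) c.
    have := @is_deriveM _ _ id (cst c) (0 : R) (1 : R) _ _ (is_derive_id _ _) (is_derive_cst _ _ _).
    by move=> /is_derive_eq; apply; rewrite scaler0 add0r [_ *: 1]mulr1.
  by apply: (is_derive_eq (is_deriveD d1 (is_derive_cst _ _ _))); rewrite addr0.
have d' : is_derive (0 * c + aff l q) (1 : R) (ebump p) (ebump ('X^2 * (p - p^`())) (aff l q)).
  by rewrite mul0r add0r; exact: is_derive_ebump.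
by rewrite [c * _]mulrC; exact: (is_derive1_comp (f := ebump p)
  (g := fun h : R => h * c + aff l q)) d' d.
Qed.

Lemma smooth_ebump p l : smooth setT (fun q => ebump p (aff l q)).
Proof.
move=> k; elim: k p => [|k IH] p.
all: have ct q : setT q -> {for q, continuous (fun q => ebump p (aff l q))}.
1,3: move=> _; apply: (continuous_comp (f := aff l) (g := ebump p));
  [by apply: cvgD; [apply: cvgD; apply: cvgM; [exact: cvg_cst|exact: cvg_fst|exact: cvg_cst|exact: cvg_snd]|exact: cvg_cst]|
   apply/differentiable_continuous/derivable1_diffP; by have [] := is_derive_ebump p (aff l q)].
  by split.
apply: (CkOnS openT ct (fun q _ => is_derive_ebump_aff p l q e1)
  (fun q _ => is_derive_ebump_aff p l q e2));
  by apply: CkOnM; [exact: openT|apply: CkOn_cst; exact: openT|exact: IH].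
Qed.

(** A smooth function with values in [0, 1] that is positive exactly on the open polygon where all
    the affine forms are positive. *)
Definition fbump (ls : seq (R * R * R)) (q : R * R) : R := \prod_(l <- ls) ebump 1 (aff l q).

Lemma smooth_fbump ls : smooth setT (fbump ls).
Proof.
elim: ls => [|l ls IH].
  apply: (smooth_eq (f := fun=> 1)); [exact: openT| |apply: smooth_cst; exact: openT].
  by move=> q _; rewrite /fbump big_nil.
apply: (smooth_eq (f := fun q => ebump 1 (aff l q) * fbump ls q)); first exact: openT.
  by move=> q _; rewrite /fbump big_cons.
by apply: smoothM; [exact: openT|exact: smooth_ebump|exact: IH].
Qed.

Lemma ebump_ge0 t : 0 <= ebump 1 t.
Proof. by rewrite /ebump hornerC mul1r; case: ifP => // _; exact: expR_ge0. Qed.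

Lemma ebump_gt0 t : 0 < t -> 0 < ebump 1 t.
Proof. by move=> t0; rewrite ebump_pos// hornerC mul1r expR_gt0. Qed.

Lemma ebump_le1 t : ebump 1 t <= 1.
Proof.
rewrite /ebump hornerC mul1r; case: ifP => // t0.
by rewrite -[leRHS]expR0 ler_expR oppr_le0 invr_ge0 ltW.
Qed.

Lemma fbump_ge0 ls q : 0 <= fbump ls q.
Proof. by apply: prodr_ge0 => l _; exact: ebump_ge0. Qed.

Lemma fbump_le1 ls q : fbump ls q <= 1.
Proof. by apply: prodr_ile1 => l _; rewrite ebump_ge0 ebump_le1. Qed.

Lemma fbump_eq0 ls q l : l \in ls -> aff l q <= 0 -> fbump ls q = 0.
Proof.
move=> lls l0; apply/eqP; rewrite /fbump prodf_seq_eq0; apply/hasP; exists l => //=.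
by rewrite ebump_npos.
Qed.

Lemma fbump_gt0 ls q : (forall l, l \in ls -> 0 < aff l q) -> 0 < fbump ls q.
Proof.
move=> H; rewrite /fbump big_seq; apply: prodr_gt0 => l /H; exact: ebump_gt0.
Qed.

Lemma cvg_ebump1 (u : nat -> R) (c : R) : 0 < c -> (forall n, c * n.+1%:R <= u n) ->
  (fun n => ebump 1 (u n)) @ \oo --> (1 : R).
Proof.
move=> c0 uc; have u0 n : 0 < u n by apply: lt_le_trans (uc n); rewrite mulr_gt0.
apply: (@squeeze_cvgr _ _ _ _ (fun n => 1 - c^-1 * n.+1%:R^-1) (fun=> 1)).
- near=> n; rewrite ebump_le1 andbT ebump_pos// hornerC mul1r.
  apply: le_trans (expR_ge1Dx _); rewrite lerD2l lerN2 -invfM.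
  by rewrite lef_pV2 ?posrE// ?uc// mulr_gt0.
- rewrite -[X in _ --> X]subr0 -(mulr0 c^-1); apply: cvgB; first exact: cvg_cst.
  by apply: cvgMr; exact: cvg_harmonic.
- exact: cvg_cst.
Unshelve. all: by end_near. Qed.

End SmoothBumps.

(** * Integrals over the plane and integration by parts *)

Section PlaneIntegrals.
Context {R : realType}.
Implicit Types (f g eta u : R * R -> R) (p q : R * R) (U K : set (R * R)).
Local Notation mu := (@lebesgue_measure R).
Local Notation P := (measurableTypeR R * measurableTypeR R)%type.

Lemma closed_compact2 K : compact K -> closed K.
Proof. by move=> cK; apply: compact_closed cK; exact: norm_hausdorff. Qed.

Lemma measurable_compact2 K : compact K -> measurable (K : set P).
Proof.
move=> cK; rewrite -[K]setCK; apply: measurableC; apply: open_measurable2.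
by apply: closed_openC; exact: closed_compact2.
Qed.

Lemma compact_coord K : compact K -> exists2 M : R, 0 < M &
  forall p, K p -> `|p.1| < M /\ `|p.2| < M.
Proof.
move=> cK.
have [M1 M10 H1] := compact_bounded_on cK (@subsetT _ K) (fun p _ => @cvg_fst _ _ _ _ _).
have [M2 M20 H2] := compact_bounded_on cK (@subsetT _ K) (fun p _ => @cvg_snd _ _ _ _ _).
exists (M1 + M2); first exact: addr_gt0.
move=> p Kp; split; first by apply: le_lt_trans (H1 _ Kp) _; rewrite ltrDl.
by apply: le_lt_trans (H2 _ Kp) _; rewrite ltrDr.
Qed.

Lemma compact_leb2 K : compact K -> (leb2 (K : set P) < +oo)%E.
Proof.
move=> cK; have [M M0 H] := compact_coord cK.
apply: (@le_lt_trans _ _ (leb2 (obox (- M) M (- M) M))).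
  apply: le_measure; rewrite ?inE; [exact: measurable_compact2|exact: measurable_obox|].
  move=> p /H[]; rewrite !ltr_norml => /andP[p1 p2] /andP[p3 p4].
  by split; rewrite /= in_itv/= ?p1 ?p3 ltW.
by rewrite leb2_obox ?ltry// ge0_cp// ltW.
Qed.

Lemma measurable_cont f : (forall p, {for p, continuous f}) -> measurable_fun (setT : set P) f.
Proof. by move=> cf; apply: open_continuous_measurable; [exact: openT|move=> p _; exact: cf]. Qed.

Lemma integral_supp U K (f : P -> \bar R) : K `<=` U -> (forall p, ~ K p -> f p = 0%E) ->
  (\int[leb2]_(p in U) f p = \int[leb2]_(p in K) f p)%E.
Proof.
move=> KU f0; rewrite -[in RHS](setIidr KU) integral_mkcondr; apply: eq_integral => p _.
by rewrite patchE; case: ifPn => // /negP pK; apply: f0 => Kp; apply: pK; rewrite inE.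
Qed.

Lemma integrable_test U K f g : measurable (U : set P) -> loc_integrable U f ->
  compact K -> K `<=` U -> (forall p, ~ K p -> g p = 0) -> (forall p, {for p, continuous g}) ->
  (@leb2 R).-integrable (U : set P) (EFin \o (fun p => f p * g p)).
Proof.
move=> mU [mf fK] cK KU g0 cg; apply/integrableP; split.
  apply/measurable_EFinP; apply: measurable_funM => //.
  by apply: measurable_funTS; exact: measurable_cont.
have mK := measurable_compact2 cK.
have [M M0 H] := compact_bounded_on cK (@subsetT _ K) (fun p _ => cg p).
rewrite (integral_supp KU); last by move=> p /g0 /= ->; rewrite mulr0 normr0.
have mfK : measurable_fun (K : set P) (fun p => (`|f p|)%:E).
  by apply/measurable_EFinP; apply: measurableT_comp => //; exact: measurable_funS mf.
apply: (@le_lt_trans _ _ (\int[leb2]_(p in K) (M%:E * (`|f p|)%:E))%E).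
  apply: ge0_le_integral => //.
  - apply: measurableT_comp => //; apply/measurable_EFinP; apply: measurable_funM.
      exact: measurable_funS mf.
    by apply: measurable_funTS; exact: measurable_cont.
  - exact: measurable_funeM.
  - by move=> p /H gM; rewrite -EFinM /= lee_fin normrM mulrC ler_wpM2r.
rewrite ge0_integralZl//; last by rewrite lee_fin ltW.
by apply: lte_mul_pinfty; rewrite ?lee_fin ?ltW// fK.
Qed.

Lemma loc_integrable_cont U f : open U -> (forall p, U p -> {for p, continuous f}) ->
  loc_integrable U f.
Proof.
move=> oU cf; split; first by apply: open_continuous_measurable => // p; rewrite inE => /cf.
move=> K cK KU; have mK := measurable_compact2 cK.
have [M M0 H] := compact_bounded_on cK KU cf.
apply: (@le_lt_trans _ _ (\int[leb2]_(p in K) M%:E)%E).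
  apply: ge0_le_integral; [exact: mK|by []| |exact/measurable_EFinP/measurable_cst|
    by move=> p Kp; rewrite lee_fin; exact: H].
  apply/measurable_EFinP; apply: measurableT_comp => //; apply: (measurable_funS _ KU).
    exact: open_measurable2.
  by apply: open_continuous_measurable => // p; rewrite inE => /cf.
rewrite integral_cst//; apply: lte_mul_pinfty; rewrite ?lee_fin ?ltW//.
exact: compact_leb2.
Qed.

Lemma deriv_supp f p v K : closed K -> (forall p, ~ K p -> f p = 0) -> ~ K p -> 'D_v f p = 0.
Proof.
move=> cK f0 Kp.
suff [] : is_derive p v f 0 by [].
apply: (near_eq_is_derive (f := cst 0)).
by apply: filterS (open_nbhs_nbhs (conj (closed_openC cK) Kp)) => q /= /f0 ->.
Qed.

Lemma integral_deriv0 (h h' : R -> R) (M : R) : 0 < M ->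
  (forall x : R, is_derive x (1 : R) h (h' x)) -> continuous h' ->
  (forall x, M <= `|x| -> h x = 0 /\ h' x = 0) -> (\int[mu]_x (h' x)%:E = 0)%E.
Proof.
move=> M0 dh ch' h0.
transitivity (\int[mu]_(x in `[(- M)%R, M]) (h' x)%:E)%E.
  rewrite [RHS]integral_mkcond; apply: eq_integral => x _; rewrite patchE.
  case: ifPn => //; rewrite notin_setE/= in_itv/= -ler_norml => /negP; rewrite -ltNge => /ltW.
  by move=> /h0[_ ->].
have hM : h M = 0 by have [] := h0 M; rewrite ?gtr0_norm.
have hN : h (- M) = 0 by have [] := h0 (- M); rewrite ?normrN ?gtr0_norm.
have ch : continuous h.
  by move=> x; apply/differentiable_continuous/derivable1_diffP; have [] := dh x.
rewrite (@continuous_FTC2 _ h' h); first by rewrite hM hN subee.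
- by rewrite gtrN.
- exact: continuous_subspaceT.
- split; first by move=> x _; have [] := dh x.
    by apply: cvg_at_right_filter; exact: ch.
  by apply: cvg_at_left_filter; exact: ch.
- by move=> x _; rewrite derive1E; have [_ ->] := dh x.
Qed.

(** Fubini's theorem with the differentiated variable integrated first; the inner integral vanishes
    by the fundamental theorem of calculus on a segment containing the support. *)
Lemma integral_D0 g K : smooth setT g -> compact K -> (forall p, ~ K p -> g p = 0) ->
  (\int[leb2]_p ('D_e1 g p)%:E = 0)%E /\ (\int[leb2]_p ('D_e2 g p)%:E = 0)%E.
Proof.
move=> sg cK g0; have [M M0 HM] := compact_coord cK.
have cl := closed_compact2 cK.
have ig v : smooth setT ('D_v g) -> (@leb2 R).-integrable setT (EFin \o ('D_v g)).
  move=> sD; have -> : EFin \o 'D_v g = EFin \o (fun p => 1 * 'D_v g p).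
    by apply/funext => p; rewrite /= mul1r.
  apply: (@integrable_test setT K) => //.
  - by apply: loc_integrable_cont; [exact: openT|move=> p _; exact: cvg_cst].
  - by move=> p; exact: deriv_supp.
  - by move=> p; exact: (smooth_cont sD I).
have K1 x y : M <= `|x| -> ~ K (x, y) by move=> Mx /HM[/=]; rewrite ltNge Mx.
have K2 x y : M <= `|y| -> ~ K (x, y) by move=> Mx /HM[_ /=]; rewrite ltNge Mx.
split.
  rewrite -(integral21_prod_meas1 (ig _ (smooth_D1 sg))); apply: integral0_eq => y _.
  apply: (@integral_deriv0 (fun x => g (x, y)) (fun x => 'D_e1 g (x, y)) M) => //.
  - by move=> x; apply: is_derive_line1; exact: (smooth_is_derive1 sg I).
  - move=> x; apply: (continuous_comp (f := fun x => (x, y)) (g := 'D_e1 g)).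
      exact: (cvg_pair (@cvg_id _ _) (@cvg_cst _ _ _ _ _)).
    exact: (smooth_cont (smooth_D1 sg) I).
  - by move=> x Mx; rewrite g0 ?(deriv_supp _ cl g0)//; exact: K1.
rewrite -(integral12_prod_meas1 (ig _ (smooth_D2 sg))); apply: integral0_eq => x _.
apply: (@integral_deriv0 (fun y => g (x, y)) (fun y => 'D_e2 g (x, y)) M) => //.
- by move=> y; apply: is_derive_line2; exact: (smooth_is_derive2 sg I).
- move=> y; apply: (continuous_comp (f := fun y => (x, y)) (g := 'D_e2 g)).
    exact: (cvg_pair (@cvg_cst _ _ _ _ _) (@cvg_id _ _)).
  exact: (smooth_cont (smooth_D2 sg) I).
- by move=> y My; rewrite g0 ?(deriv_supp _ cl g0)//; exact: K2.
Qed.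

Lemma smooth_weak_gradient U f : open U -> smooth setT f ->
  is_weak_gradient U f (fun p => ('D_e1 f p, 'D_e2 f p)).
Proof.
move=> oU sf; have mU := open_measurable2 oU.
have c1 p : {for p, continuous ('D_e1 f)} := smooth_cont (smooth_D1 sf) (I : setT p).
have c2 p : {for p, continuous ('D_e2 f)} := smooth_cont (smooth_D2 sf) (I : setT p).
have cf p : {for p, continuous f} := smooth_cont sf (I : setT p).
split; [exact: (loc_integrable_cont oU (fun p _ => c1 p))|exact: (loc_integrable_cont oU (fun p _ => c2 p))|].
move=> eta [/smooth_Ck se [K [cK KU e0]]].
have cl := closed_compact2 cK.
have ce p : {for p, continuous eta} := smooth_cont se (I : setT p).
have ce1 p : {for p, continuous ('D_e1 eta)} := smooth_cont (smooth_D1 se) (I : setT p).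
have ce2 p : {for p, continuous ('D_e2 eta)} := smooth_cont (smooth_D2 se) (I : setT p).
have sfe := smoothM openT sf se.
have fe0 p : ~ K p -> f p * eta p = 0 by move=> /e0 ->; rewrite mulr0.
have [I1 I2] := integral_D0 sfe cK fe0.
have ii g h : (forall p, {for p, continuous g}) -> (forall p, {for p, continuous h}) ->
   (forall p, ~ K p -> h p = 0) -> (@leb2 R).-integrable (U : set P) (EFin \o (fun p => g p * h p)).
  move=> cg ch h0; apply: (@integrable_test U K) => //.
  exact: loc_integrable_cont.
have main v (fv ev : R * R -> R) : 
    (forall p, 'D_v (fun p => f p * eta p) p = f p * ev p + eta p * fv p) ->
    (forall p, ~ K p -> ev p = 0) ->
    (forall p, {for p, continuous ev}) -> (forall p, {for p, continuous fv}) ->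
    (\int[leb2]_p ('D_v (fun p => f p * eta p) p)%:E = 0)%E ->
    \int[leb2]_(p in U) (f p * ev p) = - \int[leb2]_(p in U) (fv p * eta p).
  move=> DE ev0 cev cfv D0; apply/eqP; rewrite -addr_eq0 -RintegralD//; [|exact: ii|exact: ii].
  rewrite /Rintegral (_ : (\int[leb2]_(p in U) _)%E = 0%E)//.
  rewrite -[RHS]D0 [RHS](integral_supp (@subsetT _ K)); last by move=> p /(deriv_supp v cl fe0) ->.
  rewrite (integral_supp KU); last by move=> p Kp; rewrite ev0// e0// !mulr0 addr0.
  by apply: eq_integral => p _; rewrite DE [eta p * _]mulrC.
split.
  apply: (main e1 ('D_e1 f) ('D_e1 eta) _ _ ce1 c1 I1); last by move=> p; exact: deriv_supp.
  move=> p; have [_ E] := is_deriveM (smooth_is_derive1 sf (I : setT p))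
    (smooth_is_derive1 se (I : setT p)); exact: E.
apply: (main e2 ('D_e2 f) ('D_e2 eta) _ _ ce2 c2 I2); last by move=> p; exact: deriv_supp.
move=> p; have [_ E] := is_deriveM (smooth_is_derive2 sf (I : setT p))
  (smooth_is_derive2 se (I : setT p)); exact: E.
Qed.

End PlaneIntegrals.

(** * The fundamental lemma of the calculus of variations *)

Section CalculusOfVariations.
Context {R : realType}.
Implicit Types (f g eta u : R * R -> R) (p q : R * R) (U K : set (R * R)).
Local Notation P := (measurableTypeR R * measurableTypeR R)%type.

Lemma ae_imp (A B : P -> Prop) : (forall p, A p -> B p) ->
  {ae leb2, forall p, A p} -> {ae leb2, forall p, B p}.
Proof. by move=> H; apply: (@filterS _ _ (ae_filter_ringOfSetsType (@leb2 R))). Qed.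

Lemma ae_imp2 (A B C : P -> Prop) : (forall p, A p -> B p -> C p) ->
  {ae leb2, forall p, A p} -> {ae leb2, forall p, B p} -> {ae leb2, forall p, C p}.
Proof. by move=> H; apply: (@filterS2 _ _ (ae_filter_ringOfSetsType (@leb2 R))). Qed.

Section Box.
Variables (U : set (R * R)) (u : R * R -> R) (a b c d : R).
Hypotheses (oU : open U) (lu : loc_integrable U u).
Hypothesis u_test : forall eta, test_function U eta -> \int[leb2]_(p in U) (u p * eta p) = 0.
Hypothesis sub : cbox a b c d `<=` U.

Let K := cbox a b c d.
Let Q : set P := `]a, b[%classic `*` `]c, d[%classic.

Let cK : compact K. Proof. exact: compact_cbox. Qed.
Let mK : measurable (K : set P). Proof. exact: measurable_compact2. Qed.
Let mQ : measurable Q. Proof. by apply: measurableX; exact: measurable_itv. Qed.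
Let mU : measurable (U : set P). Proof. exact: open_measurable2. Qed.
Let QK : Q `<=` K.
Proof.
move=> p [] /=; rewrite !in_itv/= => /andP[p1 p2] /andP[p3 p4].
by split; rewrite /= in_itv/= !ltW.
Qed.
Let muK : measurable_fun (K : set P) u.
Proof. by have [mu _] := lu; exact: measurable_funS mu. Qed.

(* As n -> oo, all these affine forms become positive exactly on the part of
   ]a, b[ x ]c, d[ in the half-open box of a', b', c', d'; the square k * k makes
   the cuts at b' and d' closed. *)
Let forms (a' b' c' d' : R) n : seq (R * R * R) := let k : R := n.+1%:R in
  [:: (k, 0, - (k * a)); (- k, 0, k * b); (k, 0, - (k * a')); (- (k * k), 0, k * k * b' + k);
      (0, k, - (k * c)); (0, - k, k * d); (0, k, - (k * c')); (0, - (k * k), k * k * d' + k)].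

Let bumps a' b' c' d' n := fbump (forms a' b' c' d' n).

Let bumps0 a' b' c' d' n p : ~ K p -> bumps a' b' c' d' n p = 0.
Proof.
move=> Kp; rewrite /bumps; set k : R := n.+1%:R; have k0 : 0 < k by rewrite ltr0n.
have [h|h1] := leP p.1 a.
  apply: (@fbump_eq0 _ _ _ (k, 0, - (k * a))); first by rewrite !inE eqxx ?orbT.
  by rewrite /aff/= mul0r addr0 -mulrBr pmulr_rle0 ?subr_le0.
have [h|h2] := leP b p.1.
  apply: (@fbump_eq0 _ _ _ (- k, 0, k * b)); first by rewrite !inE eqxx ?orbT.
  by rewrite /aff/= mul0r addr0 mulNr addrC -mulrBr pmulr_rle0 ?subr_le0.
have [h|h3] := leP p.2 c.
  apply: (@fbump_eq0 _ _ _ (0, k, - (k * c))); first by rewrite !inE eqxx ?orbT.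
  by rewrite /aff/= mul0r add0r -mulrBr pmulr_rle0 ?subr_le0.
have [h|h4] := leP d p.2.
  apply: (@fbump_eq0 _ _ _ (0, - k, k * d)); first by rewrite !inE eqxx ?orbT.
  by rewrite /aff/= mul0r add0r mulNr addrC -mulrBr pmulr_rle0 ?subr_le0.
by case: Kp; split; rewrite /= in_itv/= !ltW.
Qed.

Let bumps_test a' b' c' d' n : test_function U (bumps a' b' c' d' n).
Proof.
split; first exact/smooth_Ck/smooth_fbump.
by exists K; split => // p; exact: bumps0.
Qed.

Let cvg1M (f g : nat -> R) : f @ \oo --> (1 : R) -> g @ \oo --> (1 : R) ->
  (fun n => f n * g n) @ \oo --> (1 : R).
Proof. by move=> h1 h2; rewrite -[X in _ --> X]mulr1; exact: cvgM. Qed.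

Let bumps_cvg a' b' c' d' p :
  (fun n => bumps a' b' c' d' n p) @ \oo --> (\1_(Q `&` obox a' b' c' d') p : R).
Proof.
have k0 n : 0 < n.+1%:R :> R by rewrite ltr0n.
have cvg0 : (\forall n \near \oo, bumps a' b' c' d' n p = 0) ->
    (fun n => bumps a' b' c' d' n p) @ \oo --> (0 : R).
  by move=> H; apply: cvg_near_cst.
have big (t : R) : 0 < t -> \forall n \near \oo, 1 <= n.+1%:R * t.
  move=> t0; near=> n; rewrite -ler_pdivrMr// div1r ltW//.
  apply: lt_le_trans (_ : n%:R <= _); last by rewrite ler_nat.
  by near: n; exact: nbhs_infty_gtr.
rewrite indicE; have [/set_mem|] := boolP (p \in Q `&` obox a' b' c' d').
  move=> [[/=]]; rewrite !in_itv/= => /andP[h1 h2] /andP[h3 h4] [/=].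
  rewrite !in_itv/= => /andP[h1' h2'] /andP[h3' h4'].
  have E (F : (nat -> R * R * R)) (t : R) : 0 < t -> (forall n, t * n.+1%:R <= aff (F n) p) ->
    (fun n => ebump 1 (aff (F n) p)) @ \oo --> (1 : R).
    by move=> t0; apply: cvg_ebump1.
  rewrite /bumps /fbump /forms; under eq_fun do rewrite !big_cons big_nil mulr1.
  have sq n (x y : R) : x <= y -> 1 * n.+1%:R <= - (n.+1%:R * n.+1%:R) * x + (n.+1%:R * n.+1%:R * y + n.+1%:R).
    move=> xy; rewrite mul1r addrA lerDr mulNr addrC -mulrBr.
    by rewrite mulr_ge0 ?subr_ge0// mulr_ge0.
  apply: cvg1M; [apply: (E _ (p.1 - a))|apply: cvg1M; [apply: (E _ (b - p.1))|
    apply: cvg1M; [apply: (E _ (p.1 - a'))|apply: cvg1M; [apply: (E _ 1)|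
    apply: cvg1M; [apply: (E _ (p.2 - c))|apply: cvg1M; [apply: (E _ (d - p.2))|
    apply: cvg1M; [apply: (E _ (p.2 - c'))|apply: (E _ 1)]]]]]]];
  rewrite ?subr_gt0// => n; rewrite /aff/= ?mul0r ?addr0 ?add0r; try exact: sq;
  by rewrite le_eqVlt; apply/orP; left; apply/eqP; ring.
rewrite notin_setE => H; apply: cvg0.
have [Kp|] := pselect (K p); last by move=> Kp; near=> n; exact: bumps0.
have [h1|h1] := leP p.1 a.
  near=> n; apply: (@fbump_eq0 _ _ _ (n.+1%:R, 0, - (n.+1%:R * a))); first by rewrite !inE eqxx ?orbT.
  by rewrite /aff/= mul0r addr0 -mulrBr pmulr_rle0 ?subr_le0.
have [h2|h2] := leP b p.1.
  near=> n; apply: (@fbump_eq0 _ _ _ (- n.+1%:R, 0, n.+1%:R * b)); first by rewrite !inE eqxx ?orbT.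
  by rewrite /aff/= mul0r addr0 mulNr addrC -mulrBr pmulr_rle0 ?subr_le0.
have [h3|h3] := leP p.2 c.
  near=> n; apply: (@fbump_eq0 _ _ _ (0, n.+1%:R, - (n.+1%:R * c))); first by rewrite !inE eqxx ?orbT.
  by rewrite /aff/= mul0r add0r -mulrBr pmulr_rle0 ?subr_le0.
have [h4|h4] := leP d p.2.
  near=> n; apply: (@fbump_eq0 _ _ _ (0, - n.+1%:R, n.+1%:R * d)); first by rewrite !inE eqxx ?orbT.
  by rewrite /aff/= mul0r add0r mulNr addrC -mulrBr pmulr_rle0 ?subr_le0.
have [h1'|h1'] := leP p.1 a'.
  near=> n; apply: (@fbump_eq0 _ _ _ (n.+1%:R, 0, - (n.+1%:R * a'))); first by rewrite !inE eqxx ?orbT.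
  by rewrite /aff/= mul0r addr0 -mulrBr pmulr_rle0 ?subr_le0.
have [h3'|h3'] := leP p.2 c'.
  near=> n; apply: (@fbump_eq0 _ _ _ (0, n.+1%:R, - (n.+1%:R * c'))); first by rewrite !inE eqxx ?orbT.
  by rewrite /aff/= mul0r add0r -mulrBr pmulr_rle0 ?subr_le0.
have sq n (x y : R) : 1 <= n.+1%:R * (x - y) ->
    - (n.+1%:R * n.+1%:R) * x + (n.+1%:R * n.+1%:R * y + n.+1%:R) <= 0.
  move=> xy; rewrite (_ : _ + _ = n.+1%:R * (1 - n.+1%:R * (x - y))); last by ring.
  by rewrite pmulr_rle0// subr_le0.
have [h2'|h2'] := ltP b' p.1.
  near=> n; apply: (@fbump_eq0 _ _ _ (- (n.+1%:R * n.+1%:R), 0, n.+1%:R * n.+1%:R * b' + n.+1%:R)).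
    by rewrite !inE eqxx ?orbT.
  rewrite /aff/= mul0r addr0; apply: sq; near: n; apply: big; by rewrite subr_gt0.
have [h4'|h4'] := ltP d' p.2.
  near=> n; apply: (@fbump_eq0 _ _ _ (0, - (n.+1%:R * n.+1%:R), n.+1%:R * n.+1%:R * d' + n.+1%:R)).
    by rewrite !inE eqxx ?orbT.
  rewrite /aff/= mul0r add0r; apply: sq; near: n; apply: big; by rewrite subr_gt0.
by case: H; split; split; rewrite /= in_itv/= ?h1 ?h2 ?h3 ?h4 ?h1' ?h3'.
Unshelve. all: by end_near. Qed.

Let iK : (@leb2 R).-integrable (K : set P) (EFin \o u).
Proof.
apply/integrableP; split; first exact/measurable_EFinP.
by have [_ fin] := lu; exact: fin.
Qed.

(** Dominated convergence with majorant |u| on the compact [K]: each bump is a test function, lies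
    in [0, 1] and vanishes off [K]. *)
Lemma box_integral0 a' b' c' d' :
  (\int[leb2]_(p in K) (u p * \1_(Q `&` obox a' b' c' d') p)%:E = 0)%E.
Proof.
set A := Q `&` obox a' b' c' d'; pose B := bumps a' b' c' d'.
have mA : measurable A by apply: measurableI => //; exact: measurable_obox.
have cB n p : {for p, continuous (B n)} := smooth_cont (smooth_fbump (forms a' b' c' d' n)) (I : setT p).
have [|||||_ _] := @dominated_convergence _ _ _ (@leb2 R) K mK (fun n p => (u p * B n p)%:E)
    (fun p => (u p * \1_A p)%:E) (fun p => `|u p|%:E).
- move=> n; apply/measurable_EFinP; apply: measurable_funM => //.
  by apply: measurable_funTS; exact: measurable_cont.
- by apply/measurable_EFinP; apply: measurable_funM.
- apply: aeW => p Kp; apply/cvg_EFin; first by near=> n.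
  by apply: cvgM; [exact: cvg_cst|exact: bumps_cvg].
- exact: integrable_abse iK.
- apply: aeW => p n Kp; rewrite lee_fin normrM ler_piMr//.
  by rewrite ger0_norm ?fbump_le1// fbump_ge0.
have -> : (fun n => \int[leb2]_(p in K) (u p * B n p)%:E)%E = cst 0%E.
  apply/funext => n /=; rewrite -(integral_supp sub); last first.
    by move=> p /(bumps0 a' b' c' d' n) E; rewrite /B E mulr0.
  have ii : (@leb2 R).-integrable (U : set P) (EFin \o (fun p => u p * B n p)).
    by apply: (@integrable_test _ U K) => // p; exact: bumps0.
  have := u_test (bumps_test a' b' c' d' n).
  by rewrite /Rintegral => h; rewrite -[LHS]fineK ?[X in X%:E]h//; exact: integrable_fin_num.
by move=> /cvg_lim <-//; rewrite lim_cst.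
Unshelve. all: by end_near. Qed.

Let gp (p : P) : R := ((fun p => Num.max (u p) 0) \_ Q) p.
Let gm (p : P) : R := ((fun p => Num.max (- u p) 0) \_ Q) p.

Let gp0 p : 0 <= gp p.
Proof. by rewrite /gp patchE; case: ifP => // _; rewrite le_max lexx orbT. Qed.
Let gm0 p : 0 <= gm p.
Proof. by rewrite /gm patchE; case: ifP => // _; rewrite le_max lexx orbT. Qed.
Let muQ : measurable_fun Q u. Proof. exact: measurable_funS muK. Qed.
Let mgp : measurable_fun setT gp.
Proof. by apply/(measurable_restrictT _ mQ); apply: measurable_maxr. Qed.
Let mgm : measurable_fun setT gm.
Proof. by apply/(measurable_restrictT _ mQ); apply: measurable_maxr => //; exact: measurableT_comp. Qed.

Let le_u (g : P -> R) A : measurable A -> (forall p, 0 <= g p) -> measurable_fun setT g ->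
  (forall p, g p <= (Num.norm \o u) \_ K p) -> (\int[leb2]_(p in A) (g p)%:E < +oo)%E.
Proof.
move=> mA g0 mg gu; have [_ fin] := lu; apply: le_lt_trans (fin _ cK sub).
rewrite [leRHS]integral_mkcond.
apply: (@le_trans _ _ (\int[leb2]_p (g p)%:E)%E).
  apply: ge0_subset_integral => //; first exact/measurable_EFinP.
  by move=> p _; rewrite lee_fin.
apply: ge0_le_integral => //.
- by move=> p _; rewrite lee_fin.
- exact/measurable_EFinP.
- apply/(measurable_restrictT _ mK)/measurable_EFinP; exact: measurableT_comp.
- by move=> p _; rewrite restrict_EFin lee_fin.
Qed.

Let gp_le p : gp p <= (Num.norm \o u) \_ K p.
Proof.
rewrite /gp !patchE; case: ifPn => [/set_mem/QK Kp|_]; last by case: ifP => // _; exact: normr_ge0.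
by rewrite mem_set// ge_max ler_norm normr_ge0.
Qed.
Let gm_le p : gm p <= (Num.norm \o u) \_ K p.
Proof.
rewrite /gm !patchE; case: ifPn => [/set_mem/QK Kp|_]; last by case: ifP => // _; exact: normr_ge0.
by rewrite mem_set// ge_max ler_normr lexx orbT normr_ge0.
Qed.

Let gpm p : gp p - gm p = u p * \1_Q p.
Proof.
rewrite /gp /gm !patchE indicE; case: ifPn => _; last by rewrite subrr mulr0.
rewrite mulr1; have [h|/ltW h] := leP 0 (u p).
  by rewrite max_r ?oppr_le0// subr0.
by rewrite max_l ?oppr_ge0// sub0r opprK.
Qed.

Let sub0_eq (x y : \bar R) : x \is a fin_num -> y \is a fin_num -> (x - y = 0)%E -> x = y.
Proof. by case: x y => [x||] [y||]// _ _ [] /eqP; rewrite subr_eq0 => /eqP ->. Qed.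

(** The positive and negative parts of u on Q are densities of two measures that agree on half-open
    boxes, hence everywhere. On the set where u > 0 in Q the second has no mass, so the first has
    none at all, and then neither has the second. *)
Lemma box_null : {ae leb2, forall p, Q p -> u p = 0}.
Proof.
have eqb a' b' c' d' : density leb2 gp0 mgp (obox a' b' c' d') =
    density leb2 gm0 mgm (obox a' b' c' d').
  have mo := measurable_obox a' b' c' d'.
  have fp := le_u mo gp0 mgp gp_le; have fm := le_u mo gm0 mgm gm_le.
  have ip (g : P -> R) : (forall p, 0 <= g p) -> measurable_fun setT g ->
     (\int[leb2]_(p in obox a' b' c' d') (g p)%:E < +oo)%E ->
     (@leb2 R).-integrable (obox a' b' c' d') (EFin \o g).
    move=> g0 mg fg; apply/integrableP; split; first exact/measurable_EFinP/measurable_funTS.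
    by under eq_integral do rewrite /= ger0_norm//.
  have [ip1 ip2] := (ip _ gp0 mgp fp, ip _ gm0 mgm fm).
  apply: sub0_eq; [exact: integrable_fin_num|exact: integrable_fin_num|].
  rewrite -[RHS](box_integral0 a' b' c' d') -integralB//.
  rewrite [RHS](@integral_supp _ _ (Q `&` obox a' b' c' d')); first last.
  - by move=> p Ap; rewrite indicE memNset// mulr0.
  - by move=> p [/QK].
  rewrite [RHS]integral_mkcondl; apply: eq_integral => p; rewrite inE => op.
  rewrite patchE -EFinB gpm indicE; case: ifPn => [pQ|]; last by rewrite mulr0.
  by rewrite indicE mem_set//; split => //; exact: set_mem.
have E := obox_measure_unique eqb (fun a' b' c' d' => le_u (measurable_obox a' b' c' d') gp0 mgp gp_le).
pose A := gp @^-1` `]0, +oo[.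
have mA : measurable A by rewrite -[A]setTI; apply: mgp => //; exact: measurable_itv.
have gm_A : (\int[leb2]_(p in A) (gm p)%:E = 0)%E.
  apply: integral0_eq => p; rewrite /A/= in_itv/= andbT /gp /gm !patchE.
  case: ifPn => // _ h; rewrite max_r// oppr_le0 leNgt; apply/negP => u0.
  by rewrite max_r ?ltxx// ltW in h.
have gp_T : (\int[leb2]_p (gp p)%:E = 0)%E.
  rewrite (@integral_supp _ _ A)//; first exact: etrans (E _ mA) gm_A.
  by move=> p /negP; rewrite /A/= in_itv/= andbT -leNgt => h; apply/eqP; rewrite eqe eq_le h gp0.
have gm_T : (\int[leb2]_p (gm p)%:E = 0)%E.
  exact: etrans (esym (E _ measurableT)) gp_T.
have ae0 (g : P -> R) : (forall p, 0 <= g p) -> measurable_fun setT g ->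
    (\int[leb2]_p (g p)%:E = 0)%E -> {ae leb2, forall p, g p = 0}.
  move=> g0 mg gT; have mg' : measurable_fun setT (EFin \o g) by exact/measurable_EFinP.
  have := (@ae_eq_integral_abs _ _ _ (@leb2 R) _ measurableT _ mg').1.
  move=> H; apply: ae_imp (H _); first by move=> p /(_ I) [].
  by rewrite -[RHS]gT; apply: eq_integral => p _; rewrite /= ger0_norm.
apply: ae_imp2 (ae0 _ gp0 mgp gp_T) (ae0 _ gm0 mgm gm_T) => p p0 m0 Qp.
by have := gpm p; rewrite p0 m0 subrr indicE mem_set// mulr1.
Qed.

End Box.

(** Countably many rational boxes with closures in [U] cover [U], and [box_null] treats each of
    them. *)
Lemma loc_integrable_null U u : open U -> loc_integrable U u ->
  (forall eta, test_function U eta -> \int[leb2]_(p in U) (u p * eta p) = 0) -> null_on U u.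
Proof.
move=> oU lu tu; pose F n (p : P) := if unpickle n is Some a then
  rcbox a `<=` U -> rbox a p -> u p = 0 else True.
have : {ae leb2, forall p n, F n p}.
  apply: ae_foralln => n; rewrite /F; case: unpickle => [r|]; last exact: aeW.
  have [sub|nsub] := pselect (rcbox r `<=` U); last by apply: aeW.
  by apply: ae_imp (box_null oU lu tu sub) => p.
apply: ae_imp => p Fp; rewrite {1}(open_rbox oU) => -[r rU pr].
by have := Fp (pickle r); rewrite /F pickleK; apply.
Qed.

End CalculusOfVariations.

(** * Weak gradients and their pullback *)

Section WeakGradients.
Context {R : realType}.
Implicit Types (f g u h : R * R -> R) (F G : R * R -> R * R) (p : R * R) (U K : set (R * R)).
Local Notation P := (measurableTypeR R * measurableTypeR R)%type.

Definition nsq (v : R * R) : R := v.1 ^+ 2 + v.2 ^+ 2.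

Lemma nsq_ge0 v : 0 <= nsq v.
Proof. by rewrite addr_ge0// sqr_ge0. Qed.

Lemma loc_integrable_lin U f g (c : R) : open U -> loc_integrable U f -> loc_integrable U g ->
  loc_integrable U (fun p => c * f p + g p).
Proof.
move=> oU [mf f1] [mg g1]; have mU := open_measurable2 oU.
have m : measurable_fun (U : set P) (fun p => c * f p + g p).
  by apply: measurable_funD => //; exact: measurable_funM.
split => // K cK KU; have mK := measurable_compact2 cK.
have mKe (k : P -> R) : measurable_fun (U : set P) k -> measurable_fun (K : set P) (fun p => (`|k p|)%:E).
  by move=> mk; apply/measurable_EFinP; apply: measurableT_comp => //; exact: measurable_funS mk.
apply: (@le_lt_trans _ _ (\int[leb2]_(p in K) (`|c|%:E * (`|f p|)%:E + (`|g p|)%:E))%E).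
  apply: ge0_le_integral => //.
  - exact: mKe.
  - by apply: emeasurable_funD; [apply: measurable_funeM; exact: mKe|exact: mKe].
  - by move=> p _; rewrite -EFinM -EFinD lee_fin -normrM ler_normD.
rewrite ge0_integralD//; first last.
- exact: mKe.
- by apply: measurable_funeM; exact: mKe.
rewrite ge0_integralZl//; last exact: mKe.
rewrite lte_add_pinfty//; last exact: g1.
by apply: lte_mul_pinfty; rewrite ?lee_fin// f1.
Qed.

Lemma is_weak_gradient_lin U f g F G (c : R) : open U -> loc_integrable U f ->
  loc_integrable U g -> is_weak_gradient U f F -> is_weak_gradient U g G ->
  is_weak_gradient U (fun p => c * f p + g p)
    (fun p => (c * (F p).1 + (G p).1, c * (F p).2 + (G p).2)).
Proof.
move=> oU lf lg [F1 F2 HF] [G1 G2 HG]; have mU := open_measurable2 oU.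
split; [exact: loc_integrable_lin|exact: loc_integrable_lin|move=> eta te].
have [f1 f2] := HF _ te; have [g1 g2] := HG _ te.
case: te => [/smooth_Ck se [K [cK KU e0]]]; have cl := closed_compact2 cK.
have ce p : {for p, continuous eta} := smooth_cont se (I : setT p).
have ce1 p : {for p, continuous ('D_e1 eta)} := smooth_cont (smooth_D1 se) (I : setT p).
have ce2 p : {for p, continuous ('D_e2 eta)} := smooth_cont (smooth_D2 se) (I : setT p).
have lin k1 k2 e : loc_integrable U k1 -> loc_integrable U k2 ->
    (forall p, ~ K p -> e p = 0) -> (forall p, {for p, continuous e}) ->
    \int[leb2]_(p in U) ((c * k1 p + k2 p) * e p) =
    c * \int[leb2]_(p in U) (k1 p * e p) + \int[leb2]_(p in U) (k2 p * e p).
  move=> l1 l2 z ke.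
  have i1 := integrable_test mU l1 cK KU z ke; have i2 := integrable_test mU l2 cK KU z ke.
  rewrite -RintegralZl// -RintegralD//; last first.
    by have := integrableZl mU c i1; apply: eq_integrable.
  by apply: eq_Rintegral => p _; rewrite mulrDl mulrA.
have d1 p : ~ K p -> 'D_e1 eta p = 0 by exact: deriv_supp.
have d2 p : ~ K p -> 'D_e2 eta p = 0 by exact: deriv_supp.
split.
  rewrite (lin _ _ _ lf lg d1 ce1) (lin _ _ _ F1 G1 e0 ce).
  by rewrite f1 g1 opprD mulrN.
rewrite (lin _ _ _ lf lg d2 ce2) (lin _ _ _ F2 G2 e0 ce).
by rewrite f2 g2 opprD mulrN.
Qed.

(** The difference G - F is a weak gradient of the zero function, so its components integrate to
    zero against all test functions. *)
Lemma weak_gradient_unique U f F G : open U -> loc_integrable U f ->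
  is_weak_gradient U f F -> is_weak_gradient U f G ->
  {ae leb2, forall p : P, U p -> F p = G p}.
Proof.
move=> oU lf gF gG.
have [l1 l2 H] := is_weak_gradient_lin (-1) oU lf lf gF gG.
have z (e : R * R -> R) : \int[leb2]_(p in U) ((-1 * f p + f p) * e p) = 0.
  by rewrite [LHS](_ : _ = \int[leb2]_(p in U) 0)//;
    [rewrite /Rintegral integral0|apply: eq_Rintegral => p _; rewrite mulN1r addNr mul0r].
have n1 := loc_integrable_null oU l1; have n2 := loc_integrable_null oU l2.
apply: ae_imp2 (n1 _) (n2 _); last first.
- by move=> eta te; have [_] := H _ te; rewrite z => /esym/eqP; rewrite oppr_eq0 => /eqP.
- by move=> eta te; have [+ _] := H _ te; rewrite z => /esym/eqP; rewrite oppr_eq0 => /eqP.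
move=> p /[swap] + /[swap] Up => /(_ Up) /= /eqP + /(_ Up) /= /eqP.
rewrite !mulN1r ![- _ + _]addrC !subr_eq0 => /eqP h2 /eqP h1; by case: (F p) (G p) h1 h2 => [x y] [x' y'] /= -> ->.
Qed.

Lemma weak_gradientP U f : weakly_differentiable U f -> is_weak_gradient U f (weak_gradient U f).
Proof. by move=> [_ [g gf]]; apply: (@xgetPex _ (fun=> (0, 0)) [set g | is_weak_gradient U f g]); exists g. Qed.

Lemma measurable_nsq U F : loc_integrable U (fun p => (F p).1) -> loc_integrable U (fun p => (F p).2) ->
  measurable_fun (U : set P) (fun p => nsq (F p)).
Proof.
by move=> [m1 _] [m2 _]; apply: measurable_funD; exact: measurable_funX.
Qed.

Lemma measurable_grad_sqr U f : weakly_differentiable U f ->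
  measurable_fun (U : set P) (fun p => grad_sqr U f p).
Proof. by move=> /weak_gradientP[l1 l2 _]; exact: measurable_nsq l1 l2. Qed.

(** Removes the arbitrary choice in [weak_gradient]: any weak gradient at hand computes the
    Dirichlet integral. *)
Lemma grad_sqrE U f F : open U -> loc_integrable U f -> is_weak_gradient U f F ->
  (\int[leb2]_(p in U) (grad_sqr U f p)%:E = \int[leb2]_(p in U) (nsq (F p))%:E)%E.
Proof.
move=> oU lf gF; have wf : weakly_differentiable U f by split => //; exists F.
have gW := weak_gradientP wf.
apply: ae_eq_integral; first exact: open_measurable2.
- by apply/measurable_EFinP; exact: measurable_grad_sqr.
- by have [l1 l2 _] := gF; apply/measurable_EFinP; exact: measurable_nsq l1 l2.
- by apply: ae_imp (weak_gradient_unique oU lf gW gF) => p E Up; rewrite /grad_sqr E.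
Qed.

Definition dirichlet U f := (\int[leb2]_(p in U) (grad_sqr U f p)%:E)%E.

Lemma dirichlet_ge0 U f : (0 <= dirichlet U f)%E.
Proof. by apply: integral_ge0 => p _; rewrite lee_fin (nsq_ge0 (weak_gradient U f p)). Qed.

Lemma weakly_differentiable_lin U f g (c : R) : open U -> weakly_differentiable U f ->
  weakly_differentiable U g -> weakly_differentiable U (fun p => c * f p + g p).
Proof.
move=> oU [lf [F gF]] [lg [G gG]]; split; first exact: loc_integrable_lin.
by eexists; exact: is_weak_gradient_lin gF gG.
Qed.

Lemma sqr_lin_le (c x y : R) : (c * x + y) ^+ 2 <= 2 * c ^+ 2 * x ^+ 2 + 2 * y ^+ 2.
Proof. by rewrite -subr_ge0 (_ : _ - _ = (c * x - y) ^+ 2) ?sqr_ge0//; ring. Qed.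

Lemma le_lin_integral U (a b k : R * R -> R) (x y : R) : measurable (U : set P) ->
  0 <= x -> 0 <= y -> (forall p, U p -> 0 <= a p) -> (forall p, U p -> 0 <= b p) ->
  (forall p, U p -> 0 <= k p <= x * a p + y * b p) ->
  measurable_fun (U : set P) a -> measurable_fun (U : set P) b -> measurable_fun (U : set P) k ->
  (\int[leb2]_(p in U) (k p)%:E <=
    x%:E * \int[leb2]_(p in U) (a p)%:E + y%:E * \int[leb2]_(p in U) (b p)%:E)%E.
Proof.
move=> mU x0 y0 a0 b0 H ma mb mk.
have ma' : measurable_fun (U : set P) (EFin \o a) by exact/measurable_EFinP.
have mb' : measurable_fun (U : set P) (EFin \o b) by exact/measurable_EFinP.
rewrite -!ge0_integralZl// -?ge0_integralD//.
- apply: ge0_le_integral => //.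
  + by move=> p /H/andP[+ _]; rewrite lee_fin.
  + exact/measurable_EFinP.
  + by apply: emeasurable_funD; exact: measurable_funeM.
  + by move=> p /H/andP[_]; rewrite -!EFinM -EFinD lee_fin.
- by move=> p /a0 ?; rewrite mule_ge0 ?lee_fin.
- exact: measurable_funeM.
- by move=> p /b0 ?; rewrite mule_ge0 ?lee_fin.
- exact: measurable_funeM.
Qed.

Lemma lin_lty (x y : R) (a b : \bar R) : 0 <= x -> 0 <= y -> (a < +oo)%E -> (b < +oo)%E ->
  (0 <= a)%E -> (0 <= b)%E -> (x%:E * a + y%:E * b < +oo)%E.
Proof. by move=> *; rewrite lte_add_pinfty// lte_mul_pinfty ?lee_fin. Qed.

Lemma dirichlet_lin U f g (c : R) : open U -> weakly_differentiable U f ->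
  weakly_differentiable U g ->
  (dirichlet U (fun p => c * f p + g p)%R <=
   (2 * c ^+ 2)%:E * dirichlet U f + 2%:E * dirichlet U g)%E.
Proof.
move=> oU wf wg; have gf := weak_gradientP wf; have gg := weak_gradientP wg.
have [lf _] := wf; have [lg _] := wg.
rewrite /dirichlet (grad_sqrE oU (loc_integrable_lin c oU lf lg)
  (is_weak_gradient_lin c oU lf lg gf gg)).
apply: le_lin_integral => //.
- exact: open_measurable2.
- by rewrite mulr_ge0// sqr_ge0.
- by move=> p _; exact: nsq_ge0.
- by move=> p _; exact: nsq_ge0.
- move=> p _; rewrite nsq_ge0 /=; rewrite /grad_sqr /nsq /=.
  apply: le_trans (lerD (sqr_lin_le _ _ _) (sqr_lin_le _ _ _)) _.
  by rewrite le_eqVlt; apply/orP; left; apply/eqP; ring.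
- exact: measurable_grad_sqr.
- exact: measurable_grad_sqr.
- have [l1 l2 _] := is_weak_gradient_lin c oU lf lg gf gg.
  exact: measurable_nsq l1 l2.
Qed.

Lemma W12w_lin U h f g (c : R) : open U -> measurable_fun (U : set P) h ->
  (forall p, U p -> 0 <= h p) -> W12w U h f -> W12w U h g -> W12w U h (fun p => c * f p + g p).
Proof.
move=> oU mh h0 [wf f2 df] [wg g2 dg]; have [[mf _] _] := wf; have [[mg _] _] := wg.
have mU := open_measurable2 oU; have wl := weakly_differentiable_lin c oU wf wg.
split; [exact: wl| |]; last first.
  apply: le_lt_trans (dirichlet_lin c oU wf wg) _.
  exact: (lin_lty (mulr_ge0 (ler0n R 2) (sqr_ge0 c)) (ler0n R 2) df dg
    (dirichlet_ge0 U f) (dirichlet_ge0 U g)).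
have m2 (k : P -> R) : measurable_fun (U : set P) k -> measurable_fun (U : set P) (fun p => `|k p| ^+ 2 * h p).
  by move=> mk; apply: measurable_funM => //; apply: measurable_funX; exact: measurableT_comp.
have k0 (k : P -> R) p : U p -> 0 <= `|k p| ^+ 2 * h p by move=> Up; rewrite mulr_ge0// ?sqr_ge0// h0.
apply: le_lt_trans (@le_lin_integral U (fun p => `|f p| ^+ 2 * h p)
  (fun p => `|g p| ^+ 2 * h p) _ (2 * c ^+ 2) 2 mU _ _ _ _ _ _ _ _) _ => //.
- by rewrite mulr_ge0// sqr_ge0.
- by move=> p; exact: k0.
- by move=> p; exact: k0.
- move=> p Up; apply/andP; split; first exact: (k0 (fun p => c * f p + g p)).
  rewrite !real_normK ?num_real// [X in _ <= X + _]mulrA [X in _ <= _ + X]mulrA -mulrDl; apply: ler_wpM2r; first exact: h0.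
  exact: sqr_lin_le.
- exact: m2.
- exact: m2.
- by apply: m2; have [[]] := wl.
- have pos (k : P -> R) : (0 <= \int[leb2]_(p in U) (`|k p| ^+ 2 * h p)%:E)%E.
    by apply: integral_ge0 => p Up; rewrite lee_fin k0.
  exact: (lin_lty (mulr_ge0 (ler0n R 2) (sqr_ge0 c)) (ler0n R 2) f2 g2 (pos f) (pos g)).
Qed.

End WeakGradients.

(** * Conformal invariance of the Dirichlet integral *)

Section ConformalTransfer.
Context {R : realType}.
Implicit Types (f g h r : R * R -> R) (F G : R * R -> R * R) (p : R * R) (K : set (R * R)).
Local Notation P := (measurableTypeR R * measurableTypeR R)%type.

Lemma integrable_test_function U f eta : open U -> loc_integrable U f -> test_function U eta ->
  [/\ (@leb2 R).-integrable (U : set P) (EFin \o (fun p => f p * eta p)),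
     (@leb2 R).-integrable (U : set P) (EFin \o (fun p => f p * 'D_e1 eta p)) &
     (@leb2 R).-integrable (U : set P) (EFin \o (fun p => f p * 'D_e2 eta p))].
Proof.
move=> oU lf [/smooth_Ck se [K [cK KU e0]]]; have mU := open_measurable2 oU.
have cl := closed_compact2 cK.
split; apply: (integrable_test mU lf cK KU) => // p; try exact: deriv_supp.
- exact: (smooth_cont se (I : setT p)).
- exact: (smooth_cont (smooth_D1 se) (I : setT p)).
- exact: (smooth_cont (smooth_D2 se) (I : setT p)).
Qed.

Lemma loc_integrable_cst U (c : R) : open U -> loc_integrable U (fun=> c).
Proof. by move=> oU; apply: loc_integrable_cont => // p _; exact: cvg_cst. Qed.

Lemma loc_integrableM U f r : open U -> loc_integrable U f ->
  (forall p, U p -> {for p, continuous r}) -> loc_integrable U (fun p => f p * r p).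
Proof.
move=> oU [mf lf] cr; have mU := open_measurable2 oU.
have mr : measurable_fun (U : set P) r.
  by apply: open_continuous_measurable => // p; rewrite inE => /cr.
split; first exact: measurable_funM.
move=> K cK KU; have mK := measurable_compact2 cK.
have [M M0 H] := compact_bounded_on cK KU cr.
have mfK : measurable_fun (K : set P) (fun p => (`|f p|)%:E).
  by apply/measurable_EFinP; apply: measurableT_comp => //; exact: measurable_funS mf.
apply: (@le_lt_trans _ _ (\int[leb2]_(p in K) (M%:E * (`|f p|)%:E))%E).
  apply: ge0_le_integral; [exact: mK|by []| |exact: measurable_funeM|].
    apply/measurable_EFinP; apply: measurableT_comp => //; apply: (measurable_funS mU KU).
    exact: measurable_funM.
  by move=> p Kp; rewrite -EFinM lee_fin normrM mulrC ler_wpM2r// H.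
rewrite ge0_integralZl//; last by rewrite lee_fin ltW.
by apply: lte_mul_pinfty; rewrite ?lee_fin ?ltW// lf.
Qed.

Section Pull.
Variables (U V : set R[i]) (phi psi : R[i] -> R[i]).
Hypothesis bi : biholo U V phi psi.

Let oU := plane_open (bi_oU bi).
Let oV := plane_open (bi_oV bi).
Let mU : measurable (plane U : set P) := open_measurable2 oU.
Let mV : measurable (plane V : set P) := open_measurable2 oV.

Let cj p : plane U p -> {for p, continuous (jac phi)}.
Proof. exact: (continuous_jac (bi_oU bi) (bi_phi bi)). Qed.

Let mj : measurable_fun (plane U : set P) (jac phi).
Proof. by apply: open_continuous_measurable => // p; rewrite inE => /cj. Qed.

Let phiV p : plane U p -> plane V (pmap phi p).
Proof. by move=> Up; rewrite /plane/= ptK; exact: bi_phiV bi _ Up. Qed.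

Let psiU p : plane V p -> plane U (pmap psi p).
Proof. by move=> Up; rewrite /plane/= ptK; exact: bi_psiU bi _ Up. Qed.

Let phiK p : plane U p -> pmap psi (pmap phi p) = p.
Proof. by move=> Up; rewrite /pmap ptK (bi_phiK bi)// cplxK. Qed.

Lemma Rarea_formula f : measurable_fun (plane V : set P) f ->
  \int[leb2]_(p in plane V) f p = \int[leb2]_(p in plane U) (f (pmap phi p) * jac phi p).
Proof.
move=> mf; have mf' : measurable_fun (plane V : set P) (EFin \o f) by exact/measurable_EFinP.
rewrite /Rintegral; congr fine; rewrite integralE [in RHS]integralE; congr (_ - _)%E.
  rewrite (area_formula bi)//; last exact: measurable_funepos.
  apply: eq_integral => p _; rewrite !funeposE/= -!EFin_max -EFinM maxr_pMl ?jac_ge0//.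
  by rewrite mul0r.
rewrite (area_formula bi)//; last exact: measurable_funeneg.
apply: eq_integral => p _; rewrite !funenegE/= -!EFin_max -EFinM maxr_pMl ?jac_ge0//.
by rewrite mul0r mulNr.
Qed.

(** The area formula over the compact phi(K) shows that (f o phi) |phi'|^2 is locally integrable;
    multiplying by the continuous function |psi'|^2 o phi restores f o phi. *)
Lemma pull_loc_integrable f : loc_integrable (plane V) f ->
  loc_integrable (plane U) (f \o pmap phi).
Proof.
move=> [mf lf]; have mfp := measurable_comp_pmap bi mf.
suff : loc_integrable (plane U) (fun p => (f (pmap phi p) * jac phi p) * jac psi (pmap phi p)).
  have E p : plane U p -> f (pmap phi p) * jac phi p * jac psi (pmap phi p) = (f \o pmap phi) p.
    by move=> Up; rewrite -mulrA [jac phi p * _]mulrC (jac_inv bi)// mulr1.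
  move=> [_ l]; split => // K cK KU; have := l K cK KU; congr (_ < _)%E.
  by apply: eq_integral => p; rewrite inE => /KU Up; rewrite E.
apply: loc_integrableM => //; last first.
  move=> p Up; apply: (continuous_comp (f := pmap phi)).
    exact: (continuous_pmap (bi_phi bi)).
  exact: (continuous_jac (bi_oV bi) (bi_psi bi) (phiV Up)).
split; first by apply: measurable_funM.
move=> K cK KU; have [cK' KV] := compact_pmap bi cK KU.
apply: le_lt_trans (lf _ cK' KV).
pose k : P -> \bar R := (fun p => (`|f p|)%:E) \_ (pmap phi @` K).
have k0 p : (0 <= k p)%E by rewrite /k patchE; case: ifP.
have mK' := measurable_compact2 cK'.
have mk : measurable_fun (plane V : set P) k.
  apply: measurable_funTS; apply/(measurable_restrictT _ mK')/measurable_EFinP.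
  by apply: measurableT_comp => //; exact: measurable_funS mf.
have -> : (\int[leb2]_(p in pmap phi @` K) (`|f p|)%:E = \int[leb2]_(p in plane V) k p)%E.
  by rewrite -(setIidr KV) integral_mkcondr.
rewrite (area_formula bi mk)// -(setIidr KU) integral_mkcondr.
rewrite le_eqVlt; apply/orP; left; apply/eqP; apply: eq_integral => p; rewrite inE => Up.
rewrite /k !patchE; case: ifPn => pK.
  rewrite mem_set; last by exists p => //; exact: set_mem.
  by rewrite -EFinM normrM (ger0_norm (jac_ge0 _ _)).
rewrite memNset ?mul0e// => -[q Kq] E; move/negP: pK; apply; rewrite inE.
by have := phiK Up; rewrite -E phiK//; [move=> <-|exact: KU].
Qed.

(** Read as a complex number this is G(phi(p)) times the conjugate of phi'(p), that is, the
    transposed differential of phi applied to G. *)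
Definition pull_grad G p : R * R :=
  ((G (pmap phi p)).1 * Re (cder phi (cplx p)) + (G (pmap phi p)).2 * Im (cder phi (cplx p)),
   (G (pmap phi p)).2 * Re (cder phi (cplx p)) - (G (pmap phi p)).1 * Im (cder phi (cplx p))).

Lemma nsq_pull_grad G p : nsq (pull_grad G p) = nsq (G (pmap phi p)) * jac phi p.
Proof. by rewrite /nsq /pull_grad /jac sqr_normc /=; ring. Qed.

Let cRI (rho : R[i] -> R[i]) (W : set R[i]) p : copen W -> holo W rho -> plane W p ->
  {for p, continuous (fun p => Re (cder rho (cplx p)))} /\
  {for p, continuous (fun p => Im (cder rho (cplx p)))}.
Proof.
move=> oW hr Wp; have h' := holo_cder oW hr.
by split; [exact: (smooth_cont (smooth_Re oW h') Wp)|exact: (smooth_cont (smooth_Im oW h') Wp)].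
Qed.

(** The area formula moves both integrals to [V]; [pull_D1] and [pull_D2] rewrite the derivatives of
    eta through transplanted test functions, and the identity defining G is applied to these. Of f
    itself only this identity is used. *)
Lemma pull_weak_gradient f G : loc_integrable (plane V) f ->
  is_weak_gradient (plane V) f G ->
  is_weak_gradient (plane U) (f \o pmap phi) (pull_grad G).
Proof.
move=> lf [G1 G2 HG].
have [p1 p2] := (pull_loc_integrable G1, pull_loc_integrable G2).
have cR p : plane U p -> {for p, continuous (fun p => Re (cder phi (cplx p)))}.
  by move=> Up; have [] := cRI (bi_oU bi) (bi_phi bi) Up.
have cI p : plane U p -> {for p, continuous (fun p => Im (cder phi (cplx p)))}.
  by move=> Up; have [] := cRI (bi_oU bi) (bi_phi bi) Up.
split.
- have := loc_integrable_lin 1 oU (loc_integrableM oU p1 cR) (loc_integrableM oU p2 cI).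
  by congr loc_integrable; apply/funext => p /=; rewrite mul1r.
- have := loc_integrable_lin (-1) oU (loc_integrableM oU p1 cI) (loc_integrableM oU p2 cR).
  by congr loc_integrable; apply/funext => p /=; rewrite mulN1r addrC.
move=> eta te; have [/smooth_Ck se [K [cK KU e0]]] := te.
pose rR p := Re (cder psi (cplx p)); pose rI p := Im (cder psi (cplx p)).
have hp := holo_cder (bi_oV bi) (bi_psi bi).
have tA : test_function (plane V) (pull V psi eta rR).
  exact: (pull_test bi te (smooth_Re (bi_oV bi) hp)).
have tB : test_function (plane V) (pull V psi eta rI).
  exact: (pull_test bi te (smooth_Im (bi_oV bi) hp)).
have [iA iA1 iA2] := integrable_test_function oV lf tA.
have [iB iB1 iB2] := integrable_test_function oV lf tB.
have [[iGA1 _ _] [iGA2 _ _]] := (integrable_test_function oV G1 tA, integrable_test_function oV G2 tA).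
have [[iGB1 _ _] [iGB2 _ _]] := (integrable_test_function oV G1 tB, integrable_test_function oV G2 tB).
have [A1 A2] := HG _ tA; have [B1 B2] := HG _ tB.
have [mf _] := lf; have [mG1 _] := G1; have [mG2 _] := G2.
have mcont k : smooth setT k -> measurable_fun (plane V : set P) (k \o pmap psi).
  move=> sk; apply: open_continuous_measurable => // p; rewrite inE => Vp.
  exact: (smooth_cont (smooth_comp (bi_oV bi) (bi_psi bi) sk) Vp).
have mjp : measurable_fun (plane V : set P) (jac psi).
  apply: open_continuous_measurable => // p; rewrite inE => Vp.
  exact: (continuous_jac (bi_oV bi) (bi_psi bi) Vp).
have mR : measurable_fun (plane V : set P) rR.
  apply: open_continuous_measurable => // p; rewrite inE => Vp.
  by have [] := cRI (bi_oV bi) (bi_psi bi) Vp.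
have mI : measurable_fun (plane V : set P) rI.
  apply: open_continuous_measurable => // p; rewrite inE => Vp.
  by have [] := cRI (bi_oV bi) (bi_psi bi) Vp.
have lhs e : smooth setT e -> \int[leb2]_(p in plane U) ((f \o pmap phi) p * e p) =
    \int[leb2]_(p in plane V) (f p * (e (pmap psi p) * jac psi p)).
  move=> se'; rewrite (Rarea_formula (f := fun p => f p * (e (pmap psi p) * jac psi p))).
    apply: eq_Rintegral => p; rewrite inE => Up.
    by rewrite phiK// -mulrA -[e p * _ * _]mulrA (jac_inv bi Up) mulr1.
  by apply: measurable_funM => //; apply: measurable_funM => //; exact: mcont.
have rhs (k k' : P -> R) : measurable_fun (plane V : set P) k' -> (forall p, plane U p -> k' (pmap phi p) * jac phi p = k p) ->
    \int[leb2]_(p in plane U) (k p * eta p) = \int[leb2]_(p in plane V) (k' p * eta (pmap psi p)).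
  move=> mk E; rewrite (Rarea_formula (f := fun p => k' p * eta (pmap psi p))).
    by apply: eq_Rintegral => p; rewrite inE => Up; rewrite phiK// mulrAC E.
  by apply: measurable_funM => //; exact: mcont.
have Rphi p : plane U p -> rR (pmap phi p) * jac phi p = Re (cder phi (cplx p)).
  move=> Up; rewrite /rR /pmap ptK (cder_invE bi)// cReV /jac divfK//.
  by rewrite sqrf_eq0 normc_eq0 (cder_neq0 bi).
have Iphi p : plane U p -> rI (pmap phi p) * jac phi p = - Im (cder phi (cplx p)).
  move=> Up; rewrite /rI /pmap ptK (cder_invE bi)// cImV /jac divfK//.
  by rewrite sqrf_eq0 normc_eq0 (cder_neq0 bi).
split.
  rewrite lhs; last exact: smooth_D1.
  rewrite (@rhs _ (fun p => (G p).1 * rR p - (G p).2 * rI p)); first last.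
  - by move=> p Up; rewrite mulrBl -!mulrA Rphi// Iphi// mulrN opprK.
  - by apply: measurable_funB; exact: measurable_funM.
  transitivity (\int[leb2]_(p in plane V) (f p * 'D_e1 (pull V psi eta rR) p -
    f p * 'D_e2 (pull V psi eta rI) p)).
    by apply: eq_Rintegral => p; rewrite inE => Vp; rewrite (pull_D1 bi)// mulrBr.
  rewrite (RintegralB mV iA1 iB2) A1 B2 opprK addrC -[LHS]opprB -(RintegralB mV iGA1 iGB2); congr (- _).
  apply: eq_Rintegral => p; rewrite inE => Vp; rewrite /pull !patchE mem_set//.
  by rewrite mulrBl; congr (_ - _); ring.
rewrite lhs; last exact: smooth_D2.
rewrite (@rhs _ (fun p => (G p).1 * rI p + (G p).2 * rR p)); first last.
- by move=> p Up; rewrite mulrDl -!mulrA Rphi// Iphi// mulrN addrC.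
- by apply: measurable_funD; exact: measurable_funM.
transitivity (\int[leb2]_(p in plane V) (f p * 'D_e1 (pull V psi eta rI) p +
  f p * 'D_e2 (pull V psi eta rR) p)).
  by apply: eq_Rintegral => p; rewrite inE => Vp; rewrite (pull_D2 bi)// mulrDr.
rewrite (RintegralD mV iB1 iA2) B1 A2 -opprD -(RintegralD mV iGB1 iGA2); congr (- _).
apply: eq_Rintegral => p; rewrite inE => Vp; rewrite /pull !patchE mem_set//.
by rewrite mulrDl; congr (_ + _); ring.
Qed.

Lemma pull_weakly_differentiable f : weakly_differentiable (plane V) f ->
  weakly_differentiable (plane U) (f \o pmap phi).
Proof.
move=> [lf [G gG]]; split; first exact: pull_loc_integrable.
by exists (pull_grad G); exact: pull_weak_gradient.
Qed.

Lemma dirichlet_pull f : weakly_differentiable (plane V) f ->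
  dirichlet (plane U) (f \o pmap phi) = dirichlet (plane V) f.
Proof.
move=> wf; have [lf _] := wf; have gG := weak_gradientP wf.
rewrite /dirichlet (grad_sqrE oU (pull_loc_integrable lf) (pull_weak_gradient lf gG)).
rewrite [RHS](area_formula bi); first last.
- by move=> p _; rewrite lee_fin; exact: (nsq_ge0 (weak_gradient _ f p)).
- by apply/measurable_EFinP; exact: measurable_grad_sqr.
by apply: eq_integral => p _; rewrite nsq_pull_grad.
Qed.

Lemma sqr_integral_pull h f : measurable_fun (plane V : set P) h ->
  (forall p, plane V p -> 0 <= h p) -> measurable_fun (plane V : set P) f ->
  (\int[leb2]_(p in plane U) (`|(f \o pmap phi) p| ^+ 2 * (h (pmap phi p) * jac phi p))%:E =
   \int[leb2]_(p in plane V) (`|f p| ^+ 2 * h p)%:E)%E.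
Proof.
move=> mh h0 mf; rewrite [RHS](area_formula bi); first last.
- by move=> p /h0 hp; rewrite lee_fin mulr_ge0// sqr_ge0.
- apply/measurable_EFinP; apply: measurable_funM => //.
  by apply: measurable_funX; exact: measurableT_comp.
by apply: eq_integral => p _; rewrite -EFinM mulrA.
Qed.

Lemma W12w_pull h f : measurable_fun (plane V : set P) h -> (forall p, plane V p -> 0 <= h p) ->
  W12w (plane V) h f -> W12w (plane U) (fun p => h (pmap phi p) * jac phi p) (f \o pmap phi).
Proof.
move=> mh h0 [wf f2 df]; split; first exact: pull_weakly_differentiable.
  by rewrite sqr_integral_pull//; have [[]] := wf.
by rewrite -/(dirichlet _ _) dirichlet_pull.
Qed.

(** The area formula equates the integral of |f o phi| |phi'|^2 with that of |f|, which is zero, and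
    the Jacobian is positive. *)
Lemma null_pull f : measurable_fun (plane V : set P) f ->
  null_on (plane V) f -> null_on (plane U) (f \o pmap phi).
Proof.
move=> mf nf.
have mf1 : measurable_fun (plane V : set P) (EFin \o f) by exact/measurable_EFinP.
have ma : measurable_fun (plane V : set P) (fun p => (`|f p|)%:E).
  by apply/measurable_EFinP; exact: measurableT_comp.
have z : (\int[leb2]_(p in plane V) `|(EFin \o f) p| = 0)%E.
  by apply/(ae_eq_integral_abs _ mV mf1); apply: ae_imp nf => p H /H /= ->.
have mf2 : measurable_fun (plane U : set P) (EFin \o (fun p => f (pmap phi p) * jac phi p)).
  by apply/measurable_EFinP; apply: measurable_funM => //; exact: (measurable_comp_pmap bi).
have : (\int[leb2]_(p in plane U) `|(EFin \o (fun p => f (pmap phi p) * jac phi p)%R) p| = 0)%E.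
  rewrite -[RHS]z [RHS](area_formula bi)//; apply: eq_integral => p _ /=.
  by rewrite -EFinM normrM (ger0_norm (jac_ge0 _ _)).
move=> /(ae_eq_integral_abs _ mU mf2); apply: ae_imp => p /[swap] Up /(_ Up) [] /eqP.
rewrite mulf_eq0 => /orP[/eqP//|/eqP j0].
by have := jac_inv bi Up; rewrite j0 mulr0 => /esym/eqP; rewrite oner_eq0.
Qed.

End Pull.

End ConformalTransfer.

(** * Min-max values for weighted problems *)

Section WeightedL2.
Context {R : realType}.
Implicit Types (f g h : R * R -> R) (p : R * R).
Local Notation P := (measurableTypeR R * measurableTypeR R)%type.

(** Solves x <= L (v1 + M x) for x. Here x is the Dirichlet integral of f, v0 the h2-norm squared of
    its mean-zero part, vs and v1s the h2- and h1-norms squared of f minus its h1-mean, and v1 the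
    h1-norm squared of f. *)
Lemma absorb (x L M v0 vs v1s v1 : R) : 0 <= L -> L * M < 1 -> x <= L * v0 -> v0 <= vs ->
  vs <= v1s + M * x -> v1s <= v1 -> x <= L / (1 - L * M) * v1.
Proof.
move=> L0 LM h1 h2 h3 h4.
have h5 : x <= L * (v1 + M * x).
  apply: le_trans h1 _; apply: ler_wpM2l => //; apply: le_trans h2 _; apply: le_trans h3 _.
  by rewrite lerD2r.
have l0 : 0 < 1 - L * M by rewrite subr_gt0.
rewrite mulrAC ler_pdivlMr//; move: h5; rewrite mulrDr -lerBlDr mulrA.
by rewrite mulrBr mulr1 [x * _]mulrC.
Qed.

Lemma le_sqrD1 (x : R) : 0 <= x -> x <= x ^+ 2 + 1.
Proof. by move=> x0; have := sqr_ge0 (x - 1); nra. Qed.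

Variable (D : set (R * R)).
Hypothesis oD : open D.
Let mD : measurable (D : set P) := open_measurable2 oD.

Definition admissible h := [/\ measurable_fun (D : set P) h, (forall p, D p -> 0 <= h p) &
  (\int[leb2]_(p in D) (h p)%:E < +oo)%E].

Definition wL2 h f := measurable_fun (D : set P) f /\
  (\int[leb2]_(p in D) (`|f p| ^+ 2 * h p)%:E < +oo)%E.

Definition wsq h f := \int[leb2]_(p in D) (`|f p| ^+ 2 * h p).
Definition wavg h f := \int[leb2]_(p in D) (f p * h p).
Definition wmass h := \int[leb2]_(p in D) h p.
Definition dir f := \int[leb2]_(p in D) grad_sqr D f p.

Lemma W12w_L2 h f : W12w D h f -> wL2 h f.
Proof. by move=> [[[mf _] _] f2 _]. Qed.

Lemma ge0_integrable (k : P -> R) : measurable_fun (D : set P) k -> (forall p, D p -> 0 <= k p) ->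
  (\int[leb2]_(p in D) (k p)%:E < +oo)%E -> (@leb2 R).-integrable (D : set P) (EFin \o k).
Proof.
move=> mk k0 fk; apply/integrableP; split; first exact/measurable_EFinP.
apply: le_lt_trans fk; rewrite le_eqVlt; apply/orP; left; apply/eqP.
by apply: eq_integral => p; rewrite inE => Dp /=; rewrite ger0_norm// k0.
Qed.

Section Weight.
Variable (h : R * R -> R).
Hypothesis ah : admissible h.

Let mh : measurable_fun (D : set P) h. Proof. by case: ah. Qed.
Let h0 p : D p -> 0 <= h p. Proof. by case: ah => _ + _; apply. Qed.

Lemma integrable_weight : (@leb2 R).-integrable (D : set P) (EFin \o h).
Proof. by case: ah => *; exact: ge0_integrable. Qed.

Lemma measurable_wsq f : measurable_fun (D : set P) f ->
  measurable_fun (D : set P) (fun p => `|f p| ^+ 2 * h p).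
Proof.
by move=> mf; apply: measurable_funM => //; apply: measurable_funX; exact: measurableT_comp.
Qed.

Lemma wsq_integrand_ge0 f p : D p -> 0 <= `|f p| ^+ 2 * h p.
Proof. by move=> Dp; rewrite mulr_ge0 ?sqr_ge0// h0. Qed.

Lemma integrable_wsq f : wL2 h f ->
  (@leb2 R).-integrable (D : set P) (EFin \o (fun p => `|f p| ^+ 2 * h p)).
Proof.
move=> [mf f2]; apply: ge0_integrable => //; first exact: measurable_wsq.
by move=> p; exact: wsq_integrand_ge0.
Qed.

Lemma integrable_wavg f : wL2 h f ->
  (@leb2 R).-integrable (D : set P) (EFin \o (fun p => f p * h p)).
Proof.
move=> lf; have [mf _] := lf.
have iD := integrableD mD (integrable_wsq lf) integrable_weight.
apply: le_integrable iD => //; first by apply/measurable_EFinP; exact: measurable_funM.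
move=> p Dp /=; rewrite lee_fin [X in _ <= X]ger0_norm; last first.
  by rewrite addr_ge0 ?wsq_integrand_ge0// h0.
rewrite normrM (ger0_norm (h0 Dp)) -{3}[h p]mul1r -mulrDl; apply: ler_wpM2r; first exact: h0.
exact: le_sqrD1.
Qed.

Lemma wsqE f : (\int[leb2]_(p in D) (`|f p| ^+ 2 * h p)%:E < +oo)%E ->
  measurable_fun (D : set P) f ->
  (wsq h f)%:E = (\int[leb2]_(p in D) (`|f p| ^+ 2 * h p)%:E)%E.
Proof. by move=> fin mf; rewrite fineK//; apply: integrable_fin_num => //; exact: integrable_wsq. Qed.

Lemma wsq_ge0 f : 0 <= wsq h f.
Proof. by apply: fine_ge0; apply: integral_ge0 => p Dp; rewrite lee_fin wsq_integrand_ge0. Qed.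

Lemma wsq_shift f s : wL2 h f ->
  wsq h (fun p => f p + s) = wsq h f + 2 * s * wavg h f + s ^+ 2 * wmass h.
Proof.
move=> lf; have i1 := integrable_wsq lf; have i2 := integrable_wavg lf; have i3 := integrable_weight.
have i2' : (@leb2 R).-integrable (D : set P) (EFin \o (fun p => 2 * s * (f p * h p))).
  by have := integrableZl mD (2 * s) i2; apply: eq_integrable.
have i3' : (@leb2 R).-integrable (D : set P) (EFin \o (fun p => s ^+ 2 * h p)).
  by have := integrableZl mD (s ^+ 2) i3; apply: eq_integrable.
have i12 : (@leb2 R).-integrable (D : set P) (EFin \o (fun p => `|f p| ^+ 2 * h p + 2 * s * (f p * h p))).
  by have := integrableD mD i1 i2'; apply: eq_integrable.
rewrite /wsq /wavg /wmass -(RintegralZl _ mD i2) -(RintegralZl _ mD i3).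
rewrite -(RintegralD mD i1 i2') -(RintegralD mD i12 i3').
by apply: eq_Rintegral => p _; rewrite !real_normK ?num_real//; ring.
Qed.

Lemma wL2_lin f g (c : R) : wL2 h f -> wL2 h g -> wL2 h (fun p => c * f p + g p).
Proof.
move=> [mf f2] [mg g2].
have m : measurable_fun (D : set P) (fun p => c * f p + g p).
  by apply: measurable_funD => //; exact: measurable_funM.
split => //.
apply: le_lt_trans (@le_lin_integral _ D (fun p => `|f p| ^+ 2 * h p)
  (fun p => `|g p| ^+ 2 * h p) _ (2 * c ^+ 2) 2 mD _ _ _ _ _ _ _ _) _.
- by rewrite mulr_ge0// sqr_ge0.
- by [].
- by move=> p; exact: wsq_integrand_ge0.
- by move=> p; exact: wsq_integrand_ge0.
- move=> p Dp; apply/andP; split; first exact: (wsq_integrand_ge0 (fun p => c * f p + g p)).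
  rewrite !real_normK ?num_real// [X in _ <= X + _]mulrA [X in _ <= _ + X]mulrA -mulrDl.
  by apply: ler_wpM2r; [exact: h0|exact: sqr_lin_le].
- exact: measurable_wsq.
- exact: measurable_wsq.
- exact: measurable_wsq.
- have pos (k : P -> R) : (0 <= \int[leb2]_(p in D) (`|k p| ^+ 2 * h p)%:E)%E.
    by apply: integral_ge0 => p Dp; rewrite lee_fin wsq_integrand_ge0.
  exact: (lin_lty (mulr_ge0 (ler0n R 2) (sqr_ge0 c)) (ler0n R 2) f2 g2 (pos f) (pos g)).
Qed.

Lemma wL2_cst (c : R) : wL2 h (fun=> c).
Proof.
split; first exact: measurable_cst.
have [_ _ fin] := ah; under eq_integral do rewrite EFinM.
have mh' : measurable_fun (D : set P) (EFin \o h) by exact/measurable_EFinP.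
have h0' p : D p -> (0 <= (EFin \o h) p)%E by move=> Dp; rewrite lee_fin h0.
have c0 : (0 <= (`|c| ^+ 2)%:E)%E by rewrite lee_fin sqr_ge0.
by rewrite (ge0_integralZl (@leb2 R) mD mh' h0' c0) lte_mul_pinfty.
Qed.

Lemma wavg_lin f g (c : R) : wL2 h f -> wL2 h g ->
  wavg h (fun p => c * f p + g p) = c * wavg h f + wavg h g.
Proof.
move=> lf lg; have i1 := integrable_wavg lf; have i2 := integrable_wavg lg.
have i1' : (@leb2 R).-integrable (D : set P) (EFin \o (fun p => c * (f p * h p))).
  by have := integrableZl mD c i1; apply: eq_integrable.
rewrite /wavg -(RintegralZl _ mD i1) -(RintegralD mD i1' i2).
by apply: eq_Rintegral => p _; rewrite mulrDl mulrA.
Qed.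

Lemma wavg_cst (c : R) : wavg h (fun=> c) = c * wmass h.
Proof. by rewrite /wavg /wmass -(RintegralZl _ mD integrable_weight). Qed.

Lemma lincombS n (b : 'I_n.+1 -> R * R -> R) c : lincomb b c =
  fun p => c ord0 * b ord0 p + lincomb (fun i => b (lift ord0 i)) (fun i => c (lift ord0 i)) p.
Proof. by apply/funext => p; rewrite /lincomb big_ord_recl. Qed.

Lemma lincomb0 (b : 'I_0 -> R * R -> R) c : lincomb b c = fun=> 0.
Proof. by apply/funext => p; rewrite /lincomb big_ord0. Qed.

Lemma wL2_lincomb n (b : 'I_n -> R * R -> R) c : (forall i, wL2 h (b i)) -> wL2 h (lincomb b c).
Proof.
elim: n b c => [|n IH] b c lb; first by rewrite lincomb0; exact: wL2_cst.
by rewrite lincombS; apply: wL2_lin => //; exact: IH.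
Qed.

Lemma wavg_lincomb n (b : 'I_n -> R * R -> R) c : (forall i, wL2 h (b i)) ->
  wavg h (lincomb b c) = \sum_(i < n) c i * wavg h (b i).
Proof.
elim: n b c => [|n IH] b c lb; first by rewrite lincomb0 wavg_cst mul0r big_ord0.
rewrite lincombS wavg_lin//; last exact: wL2_lincomb.
by rewrite big_ord_recl IH.
Qed.

End Weight.

Lemma is_weak_gradient_cst (c : R) : is_weak_gradient D (fun=> c) (fun=> (0, 0)).
Proof.
have := smooth_weak_gradient oD (smooth_cst (V := setT) c openT).
by congr is_weak_gradient; apply/funext => p; rewrite !derive_cst.
Qed.

Lemma dirichlet_cst (c : R) : dirichlet D (fun=> c) = 0%E.
Proof.
rewrite /dirichlet (grad_sqrE oD (loc_integrable_cst c oD) (is_weak_gradient_cst c)).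
by apply: integral0_eq => p _; rewrite /nsq/= expr0n addr0.
Qed.

Lemma W12w_cst h (c : R) : admissible h -> W12w D h (fun=> c).
Proof.
move=> ah; split; last by rewrite -/(dirichlet _ _) dirichlet_cst.
  split; first exact: loc_integrable_cst.
  by exists (fun=> (0, 0)); exact: is_weak_gradient_cst.
by have [] := wL2_cst ah c.
Qed.

Lemma W12w_lincomb h n (b : 'I_n -> R * R -> R) c : admissible h ->
  (forall i, W12w D h (b i)) -> W12w D h (lincomb b c).
Proof.
move=> ah; elim: n b c => [|n IH] b c lb; first by rewrite lincomb0; have [] := W12w_cst 0 ah.
have [mh h0 _] := ah.
by rewrite lincombS; apply: W12w_lin => //; exact: IH.
Qed.

Lemma dirichlet_shift f (c : R) : weakly_differentiable D f ->
  dirichlet D (fun p => f p + c) = dirichlet D f.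
Proof.
move=> wf; have [lf _] := wf; have gf := weak_gradientP wf.
have lc := loc_integrable_cst c oD; have gc := is_weak_gradient_cst c.
have -> : (fun p => f p + c) = (fun p => 1 * f p + c) by apply/funext => p; rewrite mul1r.
rewrite /dirichlet (grad_sqrE oD (loc_integrable_lin 1 oD lf lc) (is_weak_gradient_lin 1 oD lf lc gf gc)).
by apply: eq_integral => p _; rewrite /nsq /grad_sqr/= !addr0 !mul1r.
Qed.

Lemma dirE h f : W12w D h f -> (dir f)%:E = dirichlet D f.
Proof.
move=> [wf _ df]; rewrite fineK//; apply: integrable_fin_num => //.
apply: ge0_integrable => //; first exact: measurable_grad_sqr.
by move=> p _; exact: (nsq_ge0 (weak_gradient D f p)).
Qed.

Lemma dir_ge0 f : 0 <= dir f.
Proof. by apply: fine_ge0; exact: dirichlet_ge0. Qed.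

(** A level realized by some n-dimensional space. Spaces can be modified and compared at such a
    level, and infima are taken only when the eigenvalue is recovered. *)
Definition minmax h n (Lam : R) := exists b : 'I_n -> R * R -> R,
  [/\ forall i, W12w D h (b i),
     forall c, null_on D (lincomb b c) -> forall i, c i = 0 &
     forall c, dir (lincomb b c) <= Lam * wsq h (lincomb b c)].

Definition wbar h f := (wmass h)^-1 * wavg h f.

Lemma wsq_center h f : admissible h -> 0 < wmass h -> wL2 h f ->
  wsq h (fun p => f p - wbar h f) <= wsq h f.
Proof.
move=> ah mass0 lf; have E := wsq_shift ah (- wbar h f) lf.
have A : wavg h f = wbar h f * wmass h.
  by rewrite /wbar mulrC mulrA mulfV ?mul1r// gt_eqF.
move: E; rewrite A; move: (wbar h f) => w ->; rewrite -addrA gerDl.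
rewrite (_ : _ + _ = - (w ^+ 2 * wmass h)); last by ring.
by rewrite oppr_le0; apply: mulr_ge0; [exact: sqr_ge0|exact: ltW].
Qed.

Section Comparison.
Variables (h1 h2 : R * R -> R) (M : R).
Hypotheses (a1 : admissible h1) (a2 : admissible h2).
Hypotheses (m1 : 0 < wmass h1) (m2 : 0 < wmass h2).
Hypothesis HM1 : forall g, W12w D h1 g ->
  (\int[leb2]_(p in D) (`|g p - wbar h1 g| ^+ 2 * `|h1 p - h2 p|)%:E <= (M * dir g)%:E)%E.
Hypothesis HM2 : forall g, W12w D h2 g ->
  (\int[leb2]_(p in D) (`|g p - wbar h2 g| ^+ 2 * `|h1 p - h2 p|)%:E <= (M * dir g)%:E)%E.

Let mh1 : measurable_fun (D : set P) h1. Proof. by case: a1. Qed.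
Let mh2 : measurable_fun (D : set P) h2. Proof. by case: a2. Qed.
Let mh12 : measurable_fun (D : set P) (fun p => `|h1 p - h2 p|).
Proof. by apply: measurableT_comp => //; exact: measurable_funB. Qed.

Let sq_compare (k k' : R * R -> R) f : admissible k -> admissible k' ->
  measurable_fun (D : set P) f -> (forall p, `|k p - k' p| = `|h1 p - h2 p|) ->
  (\int[leb2]_(p in D) (`|f p| ^+ 2 * k p)%:E <=
   \int[leb2]_(p in D) (`|f p| ^+ 2 * k' p)%:E + \int[leb2]_(p in D) (`|f p| ^+ 2 * `|h1 p - h2 p|)%:E)%E.
Proof.
move=> ak ak' mf E; have [mk k0 _] := ak; have [mk' k0' _] := ak'.
have := @le_lin_integral _ D (fun p => `|f p| ^+ 2 * k' p) (fun p => `|f p| ^+ 2 * `|h1 p - h2 p|)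
  (fun p => `|f p| ^+ 2 * k p) 1 1 mD ler01 ler01.
rewrite !mul1e; apply.
- by move=> p Dp; rewrite mulr_ge0 ?sqr_ge0// k0'.
- by move=> p Dp; rewrite mulr_ge0 ?sqr_ge0.
- move=> p Dp; rewrite mulr_ge0 ?sqr_ge0 ?k0//= !mul1r -mulrDr ler_wpM2l ?sqr_ge0//.
  by rewrite -lerBlDl -E ler_norm.
- exact: measurable_wsq.
- apply: measurable_funM => //; apply: measurable_funX; exact: measurableT_comp.
- exact: measurable_wsq.
Qed.

(** The hypothesis [HM2] bounds the integral of |g - m|^2 |h1 - h2| for m the h2-mean, so g - m is
    square integrable for h1; constants are too, because h1 has finite mass. *)
Lemma W12w_change g : W12w D h2 g -> W12w D h1 g.
Proof.
move=> wg; have lg := W12w_L2 wg; have [wd _ dg] := wg; have [mg _] := lg.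
split => //; set m := wbar h2 g.
have lgm : wL2 h2 (fun p => 1 * g p + - m) by apply: wL2_lin => //; exact: wL2_cst.
have [mgm fgm] := lgm.
suff l1 : wL2 h1 (fun p => 1 * g p + - m).
  have [_] := wL2_lin a1 1 l1 (wL2_cst a1 m).
  by congr (_ < _)%E; apply: eq_integral => p _; rewrite !mul1r subrK.
split => //; apply: le_lt_trans (sq_compare a1 a2 mgm (fun p => erefl)) _.
rewrite lte_add_pinfty//; apply: le_lt_trans (ltry (M * dir g)).
by apply: le_trans (HM2 wg); under eq_integral do rewrite mul1r.
Qed.

Lemma wsq_compare f X : wL2 h1 f -> wL2 h2 f ->
  (\int[leb2]_(p in D) (`|f p| ^+ 2 * `|h1 p - h2 p|)%:E <= X%:E)%E ->
  wsq h2 f <= wsq h1 f + X.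
Proof.
move=> [mf l1] [_ l2] H; rewrite -lee_fin EFinD !wsqE//.
apply: le_trans (sq_compare a2 a1 mf _) _; first by move=> p; rewrite distrC.
exact: leeD2l.
Qed.

Lemma minmax_compare n Lam : (0 < n)%N -> 0 <= Lam -> Lam * M < 1 ->
  minmax h2 n Lam -> minmax h1 n (Lam / (1 - Lam * M)).
Proof.
case: n => // n _ Lam0 LM [b [bW bind bD]].
have lb i : wL2 h2 (b i) by exact: W12w_L2 (bW i).
pose m i := wavg h2 (b i).
(* An index with nonzero mean if there is one. Otherwise all means vanish, any index will do, and
   every [t i] is 0 / 0 = 0. *)
have [k mk] : exists k, m k = 0 -> forall i, m i = 0.
  have [[k mk]|H] := pselect (exists k, m k != 0); first by exists k => /eqP; rewrite (negPf mk).
  exists ord0 => _ i; apply/eqP/negPn/negP => mi; apply: H; by exists i.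
pose t i := m i / m k.
have tm i : t i * m k = m i.
  rewrite /t; have [z|nz] := eqVneq (m k) 0; last by rewrite divfK.
  by rewrite (mk z) !mul0r.
(* The constant takes the place of the k-th vector, and the others are corrected by a multiple of
   [b k] so as to have h2-mean zero. The dimension is kept. *)
pose b' i : R * R -> R := if i == k then fun=> 1 else lincomb b (fun j => (j == i)%:R - t i * (j == k)%:R).
(* Coefficients, in the old basis, of the part of a combination that has h2-mean zero; the level
   assumed for h2 applies to this part. *)
pose d (c : 'I_n.+1 -> R) j := if j == k then - \sum_(i | i != k) c i * t i else c j.
have lb'E c p : lincomb b' c p = lincomb b (d c) p + c k.
  rewrite /lincomb (bigD1 k)//= [in RHS](bigD1 k)//= /b' /d eqxx mulr1 addrC; congr (_ + _).
  rewrite mulNr mulr_suml addrC -sumrB; apply: eq_bigr => i /negPf ik.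
  rewrite ik -mulrA -mulrBr; congr (_ * _); rewrite /lincomb.
  under eq_bigr do rewrite mulrBl -mulrA.
  rewrite sumrB -mulr_sumr; congr (_ - _ * _).
    by rewrite (bigD1 i)//= eqxx mul1r big1 ?addr0// => j /negPf ->; rewrite mul0r.
  by rewrite (bigD1 k)//= eqxx mul1r big1 ?addr0// => j /negPf ->; rewrite mul0r.
have mean0 c : wavg h2 (lincomb b (d c)) = 0.
  rewrite wavg_lincomb// (bigD1 k)//= {1}/d eqxx mulNr mulr_suml addrC -sumrB big1// => i /negPf ik.
  by rewrite /d ik -mulrA tm subrr.
have W2 c : W12w D h2 (lincomb b c) by exact: W12w_lincomb.
have W2' c : W12w D h2 (lincomb b' c).
  have := W12w_lin 1 oD mh2 _ (W2 (d c)) (W12w_cst (c k) a2).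
  have [_ h20 _] := a2; move=> /(_ h20); congr (W12w _ _ _).
  by apply/funext => p; rewrite mul1r lb'E.
exists b'; split.
- move=> i; apply: W12w_change; rewrite /b'; case: ifP => _; last exact: W2.
  exact: W12w_cst.
- move=> c nc.
  have nd : {ae leb2, forall p : P, D p -> lincomb b (d c) p = - c k}.
    by apply: ae_imp nc => p H /H /eqP; rewrite lb'E addr_eq0 => /eqP.
  (* The mean-zero part would be constant almost everywhere, and h2 has positive mass, so this
     constant is zero. *)
  have ck : c k = 0.
    have : wavg h2 (lincomb b (d c)) = wavg h2 (fun=> - c k).
      rewrite /wavg /Rintegral; congr fine; apply: ae_eq_integral => //.
      - by apply/measurable_EFinP; apply: measurable_funM => //; have [[[]]] := W2 (d c).
      - by apply/measurable_EFinP; apply: measurable_funM.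
      - by apply: ae_imp nd => p H /H ->.
    rewrite mean0 wavg_cst// => /esym/eqP; rewrite mulf_eq0 oppr_eq0 (gt_eqF m2) orbF.
    by move=> /eqP.
  have dz := bind (d c) _; move=> i; have [->//|ik] := eqVneq i k.
  suff : d c i = 0 by rewrite /d (negPf ik).
  by apply: dz; apply: ae_imp nd => p H /H ->; rewrite ck oppr0.
- move=> c; set f := lincomb b' c; set f0 := lincomb b (d c).
  have fE : f = fun p => f0 p + c k by apply/funext => p; exact: lb'E.
  have W1f : W12w D h1 f by apply: W12w_change; exact: W2'.
  have DE : dir f = dir f0.
    have [wd _ _] := W2 (d c); rewrite fE; exact: (congr1 fine (dirichlet_shift (c k) wd)).
  have L1 := W12w_L2 W1f; have L2 := W12w_L2 (W2 (d c)).
  set w := wbar h1 f.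
  have L1w : wL2 h1 (fun p => f p - w).
    have := wL2_lin a1 1 L1 (wL2_cst a1 (- w)); congr wL2; apply/funext => p; by rewrite mul1r.
  have L2w : wL2 h2 (fun p => f p - w).
    have := wL2_lin a2 1 (W12w_L2 (W2' c)) (wL2_cst a2 (- w)); congr wL2; apply/funext => p; by rewrite mul1r.
  have s1 : dir f <= Lam * wsq h2 f0 by rewrite DE; exact: bD.
  (* Both functions differ by a constant and f0 has h2-mean zero, so the cross term disappears. *)
  have s2 : wsq h2 f0 <= wsq h2 (fun p => f p - w).
    have -> : (fun p => f p - w) = (fun p => f0 p + (c k - w)).
      by apply/funext => p; rewrite fE addrA.
    have E := wsq_shift a2 (c k - w) L2; rewrite mean0 mulr0 addr0 in E.
    by rewrite /f0 E lerDl; apply: mulr_ge0; [exact: sqr_ge0|exact: ltW].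
  have s3 := wsq_compare L1w L2w (HM1 W1f).
  have s4 : wsq h1 (fun p => f p - w) <= wsq h1 f := wsq_center a1 m1 L1.
  exact: (absorb Lam0 LM s1 s2 s3 s4).
Qed.

End Comparison.

End WeightedL2.

(** * Hoelder estimates linking the constant and the energy *)

Section Hoelder.
Context {R : realType}.

Lemma hoelder_on d (T : measurableType d) (mu : {measure set T -> \bar R}) (D : set T)
  (f g : T -> R) (p q : R) : measurable D -> measurable_fun D f -> measurable_fun D g ->
  (forall x, D x -> 0 <= f x) -> (forall x, D x -> 0 <= g x) ->
  0 < p -> 0 < q -> p^-1 + q^-1 = 1 ->
  (\int[mu]_(x in D) (f x * g x)%:E <=
   (\int[mu]_(x in D) (f x `^ p)%:E) `^ p^-1 * (\int[mu]_(x in D) (g x `^ q)%:E) `^ q^-1)%E.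
Proof.
move=> mD mf mg f0 g0 p0 q0 pq.
have mfD : measurable_fun setT (f \_ D) by exact/(measurable_restrictT _ mD).
have mgD : measurable_fun setT (g \_ D) by exact/(measurable_restrictT _ mD).
have := hoelder mu mfD mgD p0 q0 pq.
have NE (k : T -> R) (r : R) : 0 < r -> (forall x, D x -> 0 <= k x) ->
    ('N[mu]_r%:E[EFin \o (k \_ D)] = (\int[mu]_(x in D) (k x `^ r)%:E) `^ r^-1)%E.
  move=> r0 k0; rewrite unlock.
  rewrite [in RHS]integral_mkcond.
  apply: (congr1 (fun z => z `^ r^-1)%E).
  apply: eq_integral => x _; rewrite /= !patchE; case: ifPn => [/set_mem Dx|_].
    by rewrite ger0_norm// k0.
  by rewrite normr0 powR0// gt_eqF.
rewrite !NE// Lnorm1; apply: le_trans; rewrite le_eqVlt; apply/orP; left; apply/eqP.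
rewrite integral_mkcond; apply: eq_integral => x _; rewrite /= !patchE.
by case: ifPn => [/set_mem Dx|_]; rewrite ?mul0r ?normr0// ger0_norm// mulr_ge0 ?f0 ?g0.
Qed.

Lemma powRK (x r : R) : 0 <= x -> r != 0 -> (x `^ r^-1) `^ r = x.
Proof. by move=> x0 r0; rewrite -powRrM mulVf// powRr1. Qed.

(** Hoelder's inequality is used twice. First F^2 h^(1/p) is paired with h^(-1/p) w for p = 2 al /
    (al - 2); then F^2 in the p-norm is F with exponent 2 p = 4 al / (al - 2), which is the exponent
    in C. *)
Lemma hoelder3 d (T : measurableType d) (mu : {measure set T -> \bar R}) (D : set T)
  (F h w : T -> R) (al : R) : 2 < al -> measurable D ->
  measurable_fun D F -> measurable_fun D h -> measurable_fun D w ->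
  (forall x, D x -> 0 < h x) -> (forall x, D x -> 0 <= w x) ->
  (\int[mu]_(x in D) (`|F x| ^+ 2 * w x)%:E <=
   (\int[mu]_(x in D) (`|F x| `^ (4 * al / (al - 2)) * h x)%:E) `^ ((al - 2) / (2 * al)) *
   ((\int[mu]_(x in D) (w x)%:E) `^ 2^-1 *
    (\int[mu]_(x in D) (w x `^ (al / 2) * h x `^ (- ((al - 2) / 2)))%:E) `^ al^-1))%E.
Proof.
move=> al2 mD mF mh mw h0 w0.
have a0 : 0 < al by apply: lt_trans al2.
have b0 : 0 < al - 2 by rewrite subr_gt0.
have c0 : 0 < al + 2 by rewrite addr_gt0.
have [an bn cn] : [/\ al != 0, al - 2 != 0 & al + 2 != 0] by split; rewrite gt_eqF.
pose p : R := 2 * al / (al - 2); pose s : R := 2 * al / (al + 2).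
have p0 : 0 < p by rewrite divr_gt0// mulr_gt0.
have s0 : 0 < s by rewrite divr_gt0// mulr_gt0.
have [pn sn] : p != 0 /\ s != 0 by split; rewrite gt_eqF.
have ps : p^-1 + s^-1 = 1 by rewrite /p /s; field; rewrite ?an ?bn ?cn.
have mpow (k : T -> R) r : measurable_fun D k -> measurable_fun D (fun x => k x `^ r).
  by move=> mk; apply: (measurableT_comp (f := fun x => x `^ r)) => //; exact: measurable_powR.
pose f1 x := `|F x| ^+ 2 * h x `^ p^-1; pose g1 x := h x `^ (- p^-1) * w x.
have mf1 : measurable_fun D f1.
  apply: measurable_funM; last exact: mpow.
  by apply: measurable_funX; exact: measurableT_comp.
have mg1 : measurable_fun D g1 by apply: measurable_funM => //; exact: mpow.
have f10 x : D x -> 0 <= f1 x by move=> _; rewrite mulr_ge0 ?sqr_ge0 ?powR_ge0.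
have g10 x : D x -> 0 <= g1 x by move=> Dx; rewrite mulr_ge0 ?powR_ge0 ?w0.
have := hoelder_on mu mD mf1 mg1 f10 g10 p0 s0 ps.
have -> : (\int[mu]_(x in D) (f1 x * g1 x)%:E = \int[mu]_(x in D) (`|F x| ^+ 2 * w x)%:E)%E.
  apply: eq_integral => x; rewrite inE => Dx; rewrite /f1 /g1 powRN mulrA -[X in X * w x]mulrA.
  by rewrite mulfV ?mulr1// gt_eqF// powR_gt0// h0.
have -> : (\int[mu]_(x in D) (f1 x `^ p)%:E =
    \int[mu]_(x in D) (`|F x| `^ (4 * al / (al - 2)) * h x)%:E)%E.
  apply: eq_integral => x; rewrite inE => Dx.
  rewrite /f1 powRM ?sqr_ge0 ?powR_ge0// powRK ?ltW ?h0// -powR_mulrn// -powRrM.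
  by congr (_ `^ _ * _)%:E; rewrite /p; field; rewrite bn.
have -> : p^-1 = (al - 2) / (2 * al) by rewrite /p invf_div.
move=> /le_trans; apply; apply: lee_wpmul2l; first exact: poweR_ge0.
(* One half power of w is split off with exponent 2 / s, to be integrated alone; the rest has the
   conjugate exponent al / s, so that it appears to the power al as in the energy. *)
pose f2 x := w x `^ (s / 2); pose g2 x := (h x `^ (- p^-1) * w x `^ 2^-1) `^ s.
have mf2 : measurable_fun D f2 by exact: mpow.
have mg2 : measurable_fun D g2.
  by apply: (mpow); apply: measurable_funM; exact: mpow.
have f20 x : D x -> 0 <= f2 x by move=> _; exact: powR_ge0.
have g20 x : D x -> 0 <= g2 x by move=> _; exact: powR_ge0.
have P0 : 0 < 2 / s by rewrite divr_gt0.
have Q0 : 0 < al / s by rewrite divr_gt0.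
have PQ : (2 / s)^-1 + (al / s)^-1 = 1 by rewrite !invf_div /s; field; rewrite ?an ?bn ?cn.
have H : forall X Y Z, (\int[mu]_(x in D) (f2 x * g2 x)%:E = X)%E ->
    (\int[mu]_(x in D) (f2 x `^ (2 / s))%:E = Y)%E ->
    (\int[mu]_(x in D) (g2 x `^ (al / s))%:E = Z)%E ->
    (X <= Y `^ (2 / s)^-1 * Z `^ (al / s)^-1)%E.
  by move=> ? ? ? <- <- <-; exact: hoelder_on.
have I1 : (\int[mu]_(x in D) (f2 x * g2 x)%:E = \int[mu]_(x in D) (g1 x `^ s)%:E)%E.
  apply: eq_integral => x; rewrite inE => Dx; rewrite /f2 /g2 /g1.
  have wE : w x = w x `^ 2^-1 * w x `^ 2^-1.
    by rewrite -expr2 -powR_mulrn ?powR_ge0// powRK// w0.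
  have -> : w x `^ (s / 2) = (w x `^ 2^-1) `^ s by rewrite mulrC powRrM.
  by rewrite -powRM ?mulr_ge0 ?powR_ge0// mulrC -mulrA -wE.
have I2 : (\int[mu]_(x in D) (f2 x `^ (2 / s))%:E = \int[mu]_(x in D) (w x)%:E)%E.
  apply: eq_integral => x; rewrite inE => Dx; rewrite /f2 -powRrM.
  by rewrite (_ : s / 2 * (2 / s) = 1) ?powRr1 ?w0//; field; rewrite sn.
have I3 : (\int[mu]_(x in D) (g2 x `^ (al / s))%:E =
    \int[mu]_(x in D) (w x `^ (al / 2) * h x `^ (- ((al - 2) / 2)))%:E)%E.
  apply: eq_integral => x; rewrite inE => Dx; rewrite /g2 -powRrM.
  rewrite (_ : s * (al / s) = al); last by field; rewrite sn.
  rewrite powRM ?powR_ge0// -!powRrM mulrC [2^-1 * al]mulrC; congr (_ * _ `^ _)%:E.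
  by rewrite /p; field; rewrite ?an ?bn ?cn.
move: (H _ _ _ I1 I2 I3) => {H I1 I2 I3}.
set W := (\int[mu]_(x in D) (w x)%:E)%E; set G := (\int[mu]_(x in D) (w x `^ _ * _)%:E)%E.
have W0 : (0 <= W)%E by apply: integral_ge0 => x Dx; rewrite lee_fin w0.
have G0 : (0 <= G)%E by apply: integral_ge0 => x Dx; rewrite lee_fin mulr_ge0 ?powR_ge0.
move=> H; apply: le_trans (gt0_ler_poweR _ _ _ H) _.
- by rewrite invr_ge0 ltW.
- by rewrite in_itv/= leey andbT; apply: integral_ge0 => x Dx; rewrite lee_fin powR_ge0.
- by rewrite in_itv/= leey andbT mule_ge0 ?poweR_ge0.
rewrite poweRM ?poweR_ge0// -!poweRrM le_eqVlt; apply/orP; left; apply/eqP.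
by congr (_ `^ _ * _ `^ _)%E; field; rewrite ?an ?sn.
Qed.

(** By symmetry let a >= b. Then |a^2 - b^2| <= a^2 and c >= b for either value of c, which gives
    the first entry of the maximum. Allowing both values of c covers both weights. *)
Lemma energy_bound (a b c al : R) : 0 < a -> 0 < b -> 2 < al -> c = a \/ c = b ->
  `|a ^+ 2 - b ^+ 2| `^ (al / 2) * (c ^+ 2) `^ (- ((al - 2) / 2)) <=
  Num.max (a `^ al / b `^ (al - 2)) (b `^ al / a `^ (al - 2)).
Proof.
wlog ab : a b / b <= a => [H a0 b0 al2 cab|].
  have [ba|ab] := leP b a; first exact: H.
  by rewrite maxC distrC; apply: H => //; [exact: ltW|case: cab; [right|left]].
move=> a0 b0 al2 cab.
have al0 : 0 < al by apply: lt_trans al2.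
have be0 : 0 < al - 2 by rewrite subr_gt0.
have sq x r : 0 < x -> (x ^+ 2) `^ (r / 2) = x `^ r.
  by move=> x0; rewrite -powR_mulrn ?ltW// -powRrM mulrCA mulfV ?mulr1.
have c0 : 0 < c by case: cab => ->.
rewrite le_max; apply/orP; left; rewrite powRN sq//; apply: ler_pM.
- exact: powR_ge0.
- by rewrite invr_ge0 powR_ge0.
- have ab2 : b ^+ 2 <= a ^+ 2 by apply: lerXn2r; rewrite ?nnegrE// ltW.
  rewrite -[leRHS]sq//; apply: ge0_ler_powR; rewrite ?nnegrE ?sqr_ge0 ?divr_ge0//; first exact: ltW.
  by rewrite ger0_norm ?subr_ge0// gerBl sqr_ge0.
- rewrite lef_pV2 ?posrE ?powR_gt0//; apply: ge0_ler_powR; [exact: ltW|by rewrite nnegrE ltW|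
    by rewrite nnegrE ltW|by case: cab => ->].
Qed.

End Hoelder.

(** * Neumann eigenvalues as weighted levels *)

Section MinMax.
Context {R : realType}.
Implicit Types (f g h : R * R -> R) (p : R * R) (U : set (R * R)).
Local Notation P := (measurableTypeR R * measurableTypeR R)%type.

Lemma minmax_eq_weight U h h' n Lam : (forall p, U p -> h p = h' p) ->
  minmax U h n Lam -> minmax U h' n Lam.
Proof.
move=> hh [b [bW bi bD]].
have E f : (\int[leb2]_(p in U) (`|f p| ^+ 2 * h p)%:E = \int[leb2]_(p in U) (`|f p| ^+ 2 * h' p)%:E)%E.
  by apply: eq_integral => p; rewrite inE => /hh ->.
exists b; split => //.
- by move=> i; have [w1 w2 w3] := bW i; split => //; rewrite -E.
- by move=> c; have := bD c; rewrite /wsq /Rintegral E.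
Qed.

Lemma wsq_null U h f : open U -> admissible U h -> (forall p, U p -> 0 < h p) -> wL2 U h f ->
  wsq U h f <= 0 -> null_on U f.
Proof.
move=> oU ah h0 lf s0; have mU := open_measurable2 oU; have [mf fin] := lf.
have mk : measurable_fun (U : set P) (EFin \o (fun p => `|f p| ^+ 2 * h p)).
  by apply/measurable_EFinP; exact: measurable_wsq.
have z : (\int[leb2]_(p in U) `|(EFin \o (fun p => `|f p| ^+ 2 * h p)%R) p| = 0)%E.
  apply/eqP; rewrite eq_le; apply/andP; split; last exact: integral_ge0.
  rewrite -lee_fin (wsqE oU ah fin mf) in s0; apply: le_trans s0.
  rewrite le_eqVlt; apply/orP; left; apply/eqP; apply: eq_integral => p; rewrite inE => Up /=.
  by rewrite ger0_norm// mulr_ge0 ?sqr_ge0// ltW// h0.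
have := (ae_eq_integral_abs (@leb2 R) mU mk).1 z; apply: ae_imp => p H Up.
have [] := H Up => /eqP; rewrite mulf_eq0 (gt_eqF (h0 _ Up)) orbF sqrf_eq0 normr_eq0.
by move=> /eqP.
Qed.

Section Eigenvalue.
Variable (U : set (R * R)).
Hypothesis oU : open U.
Let one : R * R -> R := fun=> 1.
Hypothesis a1 : admissible U one.

Let rayleighE f : rayleigh U f = dir U f / wsq U one f.
Proof. by rewrite /rayleigh /dir /wsq; congr (_ / _); apply: eq_Rintegral => p _; rewrite mulr1. Qed.

Let wsq_gt0 f : wL2 U one f -> ~ null_on U f -> 0 < wsq U one f.
Proof.
by move=> lf nf; rewrite ltNge; apply/negP => h; apply: nf; apply: wsq_null lf h => // p _; exact: ltr01.
Qed.

Lemma minmax_eigenvalue n Lam : minmax U one n Lam -> (neumann_eigenvalue n U <= Lam%:E)%E.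
Proof.
move=> [b [bW bi bD]]; rewrite /neumann_eigenvalue.
apply: (@le_trans _ _ (ereal_sup [set (rayleigh U f)%:E | f in
    [set f | range (lincomb b) f /\ ~ null_on U f]])).
  by apply: ereal_inf_lbound; exists (range (lincomb b)) => //; exists b.
apply: ge_ereal_sup => _ [_ [[c _ <-] nf] <-].
have lf : wL2 U one (lincomb b c) by apply: W12w_L2; exact: W12w_lincomb.
by rewrite rayleighE lee_fin ler_pdivrMr ?wsq_gt0.
Qed.

(** Strictness lets some space lie below Lam although the infimum need not be attained. Null
    combinations, absent from the Rayleigh quotients, have zero coefficients by independence. *)
Lemma eigenvalue_minmax n Lam : (neumann_eigenvalue n U < Lam%:E)%E -> minmax U one n Lam.
Proof.
move=> /ereal_inf_lt[_ [L [b [bW bi ->]] <-]] HL; exists b; split => // c.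
have [nf|nf] := pselect (null_on U (lincomb b c)).
  have -> : lincomb b c = fun=> 0.
    by apply/funext => p; rewrite /lincomb big1// => i _; rewrite (bi c)// mul0r.
  have -> : dir U (fun=> 0) = 0 by rewrite /dir /Rintegral -/(dirichlet _ _) dirichlet_cst.
  rewrite (_ : wsq _ _ _ = 0) ?mulr0//.
  by rewrite /wsq /Rintegral integral0_eq// => p _; rewrite normr0 expr0n mul0r.
have lf : wL2 U one (lincomb b c) by apply: W12w_L2; exact: W12w_lincomb.
rewrite -ler_pdivrMr ?wsq_gt0// -rayleighE -lee_fin; apply: le_trans (ltW HL).
by apply: ereal_sup_ubound; exists (lincomb b c) => //; split => //; exists c.
Qed.

(** Positive dimension supplies a non-null element to test with; in dimension zero the supremum
    would be over the empty set, hence -oo. *)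
Lemma eigenvalue_ge0 n : (0 <= neumann_eigenvalue n.+1 U)%E.
Proof.
apply: le_ereal_inf_tmp => _ [L [b [bW bi ->]] <-].
have E : lincomb b (fun i => (i == ord0)%:R) = b ord0.
  by apply/funext => p; rewrite /lincomb big_ord_recl eqxx mul1r big1 ?addr0// => i _; rewrite mul0r.
have nb : ~ null_on U (b ord0).
  rewrite -E => /bi /(_ ord0) /eqP; by rewrite eqxx oner_eq0.
apply: (@le_trans _ _ (rayleigh U (b ord0))%:E).
  rewrite lee_fin rayleighE divr_ge0 ?dir_ge0//; exact: wsq_ge0.
by apply: ereal_sup_ubound; exists (b ord0) => //; split => //; exists (fun i => (i == ord0)%:R).
Qed.

End Eigenvalue.

(** The Dirichlet integral is unchanged and the Jacobian enters the weight; independence survives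
    because a null combination can be composed back with psi. *)
Lemma minmax_pull (U V : set R[i]) phi psi h n Lam : biholo U V phi psi ->
  measurable_fun (plane V : set P) h -> (forall p, plane V p -> 0 <= h p) ->
  minmax (plane V) h n Lam -> minmax (plane U) (fun p => h (pmap phi p) * jac phi p) n Lam.
Proof.
move=> bi mh h0 [b [bW bind bD]].
have oV := plane_open (bi_oV bi); have mb i : measurable_fun (plane V : set P) (b i).
  by have [[[]]] := bW i.
have E c : lincomb (fun i => b i \o pmap phi) c = lincomb b c \o pmap phi by [].
have wdl c : weakly_differentiable (plane V) (lincomb b c).
  elim: n b bW c {mb E bind bD} => [|n IH] b bW c.
    rewrite lincomb0; split; first exact: loc_integrable_cst.
    by exists (fun=> (0, 0)); exact: is_weak_gradient_cst.
  by rewrite lincombS; apply: weakly_differentiable_lin; [exact: oV|by have [] := bW ord0|exact: IH].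
have ml c : measurable_fun (plane V : set P) (lincomb b c) by have [[]] := wdl c.
exists (fun i => b i \o pmap phi); split.
- by move=> i; exact: (W12w_pull bi).
- move=> c nc i; apply: (bind c); rewrite E in nc.
  have m' : measurable_fun (plane U : set P) (lincomb b c \o pmap phi).
    exact: (measurable_comp_pmap bi (ml c)).
  have := null_pull (biholo_sym bi) m' nc; apply: ae_imp => p H Vp.
  by have := H Vp; rewrite /= /pmap ptK (bi_psiK bi)// cplxK.
- move=> c; rewrite E /dir /wsq /Rintegral -/(dirichlet _ _) (dirichlet_pull bi)//.
  by rewrite (sqr_integral_pull bi)//; exact: bD.
Qed.

Section Competitor.
Variable (U : set (R * R)).
Hypotheses (oU : open U) (a1 : admissible U (fun=> 1)).
Let mU : measurable (U : set P) := open_measurable2 oU.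

Lemma W12_bump K f : compact K -> K `<=` U -> (forall p, ~ K p -> f p = 0) -> smooth setT f ->
  (forall p, `|f p| <= 1) -> W12w U (fun=> 1) f.
Proof.
move=> cK KU f0 sf f1; have cl := closed_compact2 cK.
have cf p : {for p, continuous f} := smooth_cont sf (I : setT p).
have c1 p : {for p, continuous ('D_e1 f)} := smooth_cont (smooth_D1 sf) (I : setT p).
have c2 p : {for p, continuous ('D_e2 f)} := smooth_cont (smooth_D2 sf) (I : setT p).
have gf := smooth_weak_gradient oU sf.
have lf : loc_integrable U f by apply: (loc_integrable_cont oU) => p _; exact: cf.
split; first by split => //; eexists; exact: gf.
  have [_ _ fin] := a1; apply: le_lt_trans fin; apply: ge0_le_integral => //.
  - apply/measurable_EFinP; apply: measurable_funM => //; apply: measurable_funX.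
    by apply: measurableT_comp => //; exact: measurable_funTS (measurable_cont cf).
  - by move=> p _; rewrite mulr1 lee_fin exprn_ile1.
rewrite (grad_sqrE oU lf gf).
have cn p : {for p, continuous (fun p => nsq ('D_e1 f p, 'D_e2 f p))}.
  rewrite (_ : (fun p => nsq _) = fun p => 'D_e1 f p * 'D_e1 f p + 'D_e2 f p * 'D_e2 f p).
    by apply: cvgD; apply: cvgM; [exact: c1|exact: c1|exact: c2|exact: c2].
  by apply/funext => q; rewrite /nsq/= !expr2.
have [_ /(_ K cK KU) fin] := loc_integrable_cont oU (fun p (_ : U p) => cn p).
rewrite (integral_supp KU); last first.
  by move=> p Kp; rewrite /nsq/= !(deriv_supp _ cl f0 Kp) expr0n addr0.
apply: le_lt_trans fin; rewrite le_eqVlt; apply/orP; left; apply/eqP.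
by apply: eq_integral => p _; rewrite ger0_norm ?nsq_ge0.
Qed.

Let quad_le (A S d c dg : R) : 0 <= A -> 0 <= S -> 0 <= d -> 0 <= c -> dg <= A * S ->
  2 * c * d + 2 * dg <= 2 * (d + A) * (c + S).
Proof.
move=> A0 S0 d0 c0 h; have h1 := mulr_ge0 d0 S0; have h2 := mulr_ge0 A0 c0.
by rewrite (_ : 2 * (d + A) * (c + S) = 2 * c * d + 2 * (A * S) + 2 * (d * S + A * c));
  [lra|ring].
Qed.

(** A crude bound of the Dirichlet form by the squared length of the coefficient vector, obtained by
    adding one basis function at a time. *)
Lemma dirichlet_lincomb_le n (b : 'I_n -> R * R -> R) : (forall i, W12w U (fun=> 1) (b i)) ->
  exists2 A : R, 0 <= A & forall c, dir U (lincomb b c) <= A * \sum_(i < n) c i ^+ 2.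
Proof.
elim: n b => [|n IH] b bW.
  exists 0 => // c; rewrite lincomb0 mul0r.
  by rewrite /dir /Rintegral -/(dirichlet _ _) dirichlet_cst.
have [A A0 HA] := IH _ (fun i => bW (lift ord0 i)).
exists (2 * (dir U (b ord0) + A)); first by rewrite mulr_ge0// addr_ge0 ?dir_ge0.
move=> c; rewrite lincombS; set g := lincomb _ _.
have Wg : W12w U (fun=> 1) g by apply: W12w_lincomb => // i; exact: bW.
have [[wb _ _] [wg _ _]] := (bW ord0, Wg).
have [m1 one0 _] := a1.
have Wl := W12w_lin (c ord0) oU m1 one0 (bW ord0) Wg.
have := dirichlet_lin (c ord0) oU wb wg.
rewrite -(dirE oU Wl) -(dirE oU Wg) -(dirE oU (bW ord0)) -!EFinM -EFinD lee_fin => H.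
apply: le_trans H _; rewrite big_ord_recl.
have HS := HA (fun i => c (lift ord0 i)); rewrite -/g in HS.
set S := \sum_(i < n) _ in HS *.
have S0 : 0 <= S by apply: sumr_ge0 => i _; exact: sqr_ge0.
by apply: quad_le => //; [exact: dir_ge0|exact: sqr_ge0].
Qed.

(** Bumps in n disjoint strips of a box inside [U]: disjoint supports make the L^2 norm diagonal, so
    it controls the coefficients from below, while [dirichlet_lincomb_le] controls the energy from
    above. This is why the eigenvalues are finite. *)
Lemma minmax_exists n : U !=set0 -> exists2 Lam : R, 0 <= Lam & minmax U (fun=> 1) n Lam.
Proof.
move=> [q Uq]; have [[[ra rb] [rc rd]] /= sub qr] :
  (\bigcup_(a in [set a | rcbox a `<=` U]) rbox a) q by rewrite -(open_rbox oU).
pose a : R := ratr ra; pose b : R := ratr rb; pose c : R := ratr rc; pose d : R := ratr rd.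
case: qr => /=; rewrite !in_itv/= -/a -/b -/c -/d => /andP[aq qb] /andP[cq qd].
have ab : a < b by exact: lt_trans qb.
have cd : c < d by exact: lt_trans qd.
(* Division by n + 1 is safe for n = 0 as well; the first n of the n + 1 strips carry the bumps. *)
pose N : R := n.+1%:R; have N0 : 0 < N by rewrite ltr0n.
pose x (i : nat) : R := a + i%:R * ((b - a) / N).
have step0 : 0 < (b - a) / N by rewrite divr_gt0// subr_gt0.
have xS i : x i < x i.+1 by rewrite /x ltrD2l ltr_pM2r// ltr_nat.
have xle i j : (i <= j)%N -> x i <= x j by move=> ij; rewrite /x lerD2l ler_pM2r// ler_nat.
have x0 i : a <= x i by rewrite /x lerDl mulr_ge0// ltW.
have xn i : (i <= n.+1)%N -> x i <= b.
  move=> iN; apply: le_trans (xle _ _ iN) _; rewrite /x -/N mulrC divfK ?gt_eqF//.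
  by rewrite addrC subrK.
pose forms (i : nat) : seq (R * R * R) :=
  [:: (1, 0, - x i); (-1, 0, x i.+1); (0, 1, - c); (0, -1, d)].
pose f (i : nat) := fbump (forms i).
pose Q (i : nat) : set P := `]x i, x i.+1[%classic `*` `]c, d[%classic.
have affE i p : Q i p <-> forall l, l \in forms i -> 0 < aff l p.
  split.
    move=> [/=]; rewrite !in_itv/= => /andP[h1 h2] /andP[h3 h4] l.
    by rewrite !inE => /or4P[] /eqP ->; rewrite /aff/= ?mul0r ?mul1r ?mulN1r ?addr0 ?add0r
      ?subr_gt0// addrC subr_gt0.
  move=> H; have := H _ (mem_head _ _); have := H (-1, 0, x i.+1); have := H (0, 1, - c); have := H (0, -1, d).
  rewrite !inE !eqxx ?orbT /aff/= !mul0r !mul1r !mulN1r !addr0 !add0r ![- _ + _]addrC !subr_gt0.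
  by move=> /(_ isT) h1 /(_ isT) h2 /(_ isT) h3 h4; split; rewrite /= in_itv/= ?h1 ?h2 ?h3 ?h4.
have f_pos i p : Q i p -> 0 < f i p by move=> /affE H; apply: fbump_gt0.
have f_zero i p : ~ Q i p -> f i p = 0.
  move=> nQ; have [l [lf l0]] : exists l, l \in forms i /\ aff l p <= 0.
    apply/not_existsP => H; apply: nQ; apply/affE => l lf; rewrite ltNge; apply/negP => l0.
    by apply: (H l).
  exact: fbump_eq0 lf l0.
pose K := cbox a b c d; have cK : compact K := @compact_cbox _ a b c d.
have QK i : (i < n.+1)%N -> Q i `<=` K.
  move=> iN p [/=]; rewrite !in_itv/= => /andP[h1 h2] /andP[h3 h4]; split; rewrite /= in_itv/=.
    by rewrite (le_trans (x0 i) (ltW h1)) (le_trans (ltW h2) (xn _ iN)).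
  by rewrite !ltW.
have bW (i : 'I_n) : W12w U (fun=> 1) (f i).
  apply: (@W12_bump K) => //.
  - by move=> p Kp; apply: f_zero => /QK; apply: contra_not Kp; apply; rewrite ltnS ltnW.
  - exact: smooth_fbump.
  - by move=> p; rewrite ger0_norm ?fbump_ge0// fbump_le1.
have mQ i : measurable (Q i) by apply: measurableX; exact: measurable_itv.
have QU (i : 'I_n) : Q i `<=` U.
  by apply: subset_trans sub; apply: QK; rewrite ltnS ltnW.
pose v (i : 'I_n) := wsq U (fun=> 1) (f i).
have v0 i : 0 < v i.
  rewrite ltNge; apply/negP => h.
  have nf := wsq_null oU a1 (fun _ _ => ltr01) (W12w_L2 (bW i)) h.
  have : (leb2 (Q i) <= 0)%E.
    have [N' [mN N'0 sN]] := nf.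
    rewrite -N'0; apply: le_measure; rewrite ?inE//.
    by move=> p Qp; apply: sN => /= H; have := f_pos _ _ Qp; rewrite H ?ltxx//; exact: (QU i).
  (* Areas are known for half-open boxes, so one of half the size is placed inside the open strip to
     show that it is not null. *)
  have mid : 0 < (x i.+1 - x i) / 2 by rewrite divr_gt0// subr_gt0.
  have := @le_measure _ _ _ (@leb2 R) (obox (x i) (x i + (x i.+1 - x i) / 2) c (c + (d - c) / 2)) (Q i).
  rewrite !inE => /(_ (measurable_obox _ _ _ _) (mQ _)) /= H1 H2.
  have midd : 0 < (d - c) / 2 by rewrite divr_gt0// subr_gt0.
  have sb : obox (x i) (x i + (x i.+1 - x i) / 2) c (c + (d - c) / 2) `<=` Q i.
    move=> p [/=]; rewrite !in_itv/= => /andP[h1 h2] /andP[h3 h4].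
    split; rewrite /= in_itv/= ?h1 ?h3/=.
      by apply: le_lt_trans h2 _; have := xS i; clear; lra.
    by apply: le_lt_trans h4 _; clear -cd; lra.
  have le1 : x i <= x i + (x i.+1 - x i) / 2 by rewrite lerDl ltW.
  have le2 : c <= c + (d - c) / 2 by rewrite lerDl ltW.
  have := le_trans (H1 sb) H2; rewrite -[X in (X <= _)%E -> _]/(leb2 (obox _ _ _ _)) (leb2_obox le1 le2).
  have cancel (u t : R) : u + t - u = t by rewrite addrC addKr.
  by rewrite !cancel lee_fin leNgt mulr_gt0.
have [A A0 HA] := dirichlet_lincomb_le bW.
(* On its own strip the i-th bump alone survives, so each squared coefficient is at most the total
   squared norm divided by [v i]. *)
pose B := \sum_(i < n) (v i)^-1.
have key (cc : 'I_n -> R) : \sum_(i < n) cc i ^+ 2 <= B * wsq U (fun=> 1) (lincomb (fun i : 'I_n => f i) cc).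
  rewrite /B mulr_suml; apply: ler_sum => i _; rewrite mulrC ler_pdivlMr//.
  set g := lincomb _ _.
  have lg : wL2 U (fun=> 1) g by apply: W12w_L2; apply: W12w_lincomb.
  have lf := W12w_L2 (bW i).
  have lcf := wL2_lin oU a1 (cc i) lf (wL2_cst oU a1 0).
  have E : cc i ^+ 2 * v i = wsq U (fun=> 1) (fun p => cc i * f i p + 0).
    rewrite /v /wsq -RintegralZl//; last exact: integrable_wsq.
    by apply: eq_Rintegral => p _; rewrite addr0 !mulr1 normrM exprMn (real_normK (num_real (cc i))).
  rewrite E -lee_fin.
  have [mcf fcf] := lcf; have [mg fg] := lg.
  rewrite (wsqE oU a1 fcf mcf) (wsqE oU a1 fg mg).
  apply: ge0_le_integral => //.
  - by apply/measurable_EFinP; apply: (measurable_wsq a1).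
  - by apply/measurable_EFinP; apply: (measurable_wsq a1).
  - move=> p _; rewrite !mulr1 lee_fin addr0.
    have [Qp|nQp] := pselect (Q i p); last by rewrite f_zero// mulr0 normr0 expr0n sqr_ge0.
    rewrite le_eqVlt; apply/orP; left; apply/eqP; congr (`|_| ^+ 2).
    rewrite /g /lincomb (bigD1 i)//= big1 ?addr0// => j ji; rewrite f_zero ?mulr0//.
    case: Qp => /= + _ [/= + _]; rewrite !in_itv/= => /andP[h1 h2] /andP[h3 h4].
    have := ji; rewrite -val_eqE /= neq_ltn => /orP[h|h].
      by have := lt_trans h1 h4; rewrite ltNge xle.
    by have := lt_trans h3 h2; rewrite ltNge xle.
exists (A * B); first by rewrite mulr_ge0// sumr_ge0// => i _; rewrite invr_ge0 ltW.
exists (fun i : 'I_n => f i); split => //.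
- move=> cc nc i.
  have z : wsq U (fun=> 1) (lincomb (fun i : 'I_n => f i) cc) = 0.
    rewrite /wsq /Rintegral (_ : (\int[leb2]_(p in U) _)%E = 0%E)//.
    have lg : wL2 U (fun=> 1) (lincomb (fun i : 'I_n => f i) cc).
      by apply: W12w_L2; apply: W12w_lincomb.
    have [mg _] := lg.
    rewrite (@ae_eq_integral _ _ _ (@leb2 R) U (cst 0%E)) ?integral0//.
      by apply/measurable_EFinP; exact: measurable_wsq.
    by apply: ae_imp nc => p H /H ->; rewrite normr0 expr0n mul0r.
  have := key cc; rewrite z mulr0 => H.
  have S0 : \sum_(i < n) cc i ^+ 2 = 0.
    by apply/eqP; rewrite eq_le H sumr_ge0// => j _; exact: sqr_ge0.
  move/eqP: S0; rewrite psumr_eq0; last by move=> j _; exact: sqr_ge0.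
  by move=> /allP /(_ i); rewrite mem_index_enum sqrf_eq0 => /(_ isT) /eqP.
- by move=> cc; apply: le_trans (HA cc) _; rewrite -mulrA ler_wpM2l// key.
Qed.

End Competitor.

End MinMax.

(** * The disc and a pair of conformal maps *)

Section ConformalPair.
Context {R : realType}.
Local Notation P := (measurableTypeR R * measurableTypeR R)%type.
Local Notation D := (@plane R disc).

Lemma disc_copen : copen (@disc R).
Proof.
apply: open_copen; rewrite (_ : disc = ball (0 : R[i]^o) 1); first exact: ball_open.
by rewrite -ball_normE; apply/seteqP; split => z; rewrite /disc/= sub0r normrN.
Qed.

Lemma conformal_biholo (Om : set R[i]^o) (phi : R[i]^o -> R[i]^o) : conformal disc Om phi ->
  exists psi, biholo disc Om phi psi.
Proof.
move=> [dphi injphi imphi].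
pose psi w := xget 0 [set z | disc z /\ phi z = w].
have psiP w : Om w -> disc (psi w) /\ phi (psi w) = w.
  by rewrite -imphi => -[z zD <-]; apply: (@xgetPex _ 0 [set z' | disc z' /\ phi z' = phi z]); exists z.
have phiV z : disc z -> Om (phi z) by move=> zD; rewrite -imphi; exists z.
exists psi; apply: holo_biholo.
- exact: disc_copen.
- by move=> z /dphi/derivable_cdiff; exists (derive1 phi z).
- move=> z zD; have [h1 h2] := psiP _ (phiV _ zD).
  by apply: injphi => //; rewrite inE.
- exact: phiV.
- by move=> w /psiP[].
- by move=> w /psiP[].
Qed.

Let oD : open D := plane_open disc_copen.
Let mD : measurable (D : set P) := open_measurable2 oD.

Lemma discE (z : R[i]) : @disc R z <-> normc z < 1.
Proof. by rewrite /disc/= -[1]/(1%:C)%C -[`|z|]/((normc z)%:C)%C ltcR. Qed.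

Lemma leb2_disc_gt0 : (0 < leb2 (D : set P))%E.
Proof.
have q : (4^-1 : R) + 4^-1 < 1 by lra.
apply: (@lt_le_trans _ _ (leb2 (obox 0 (4^-1 : R) 0 4^-1))).
  by rewrite leb2_obox ?invr_ge0// lte_fin !subr0 mulr_gt0// invr_gt0.
apply: le_measure; rewrite ?inE//; first exact: measurable_obox.
move=> p [/=]; rewrite !in_itv/= => /andP[h1 h2] /andP[h3 h4].
apply/discE; apply: le_lt_trans (normc_le_ReIm _) _; apply: le_lt_trans q.
by rewrite /= !gtr0_norm// lerD.
Qed.

Lemma leb2_disc_lty : (leb2 (D : set P) < +oo)%E.
Proof.
apply: (@le_lt_trans _ _ (leb2 (obox (-1 : R) 1 (-1) 1))); last first.
  by rewrite leb2_obox ?ltry// lerNl lerN10.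
apply: le_measure; rewrite ?inE//; first exact: measurable_obox.
move=> p /discE h; have := le_lt_trans (Re_le_normc _) h; have := le_lt_trans (Im_le_normc _) h.
rewrite /= !ltr_norml => /andP[h1 h2] /andP[h3 h4].
by split; rewrite /= in_itv/= ?h1 ?h3 ltW.
Qed.

Lemma disc_integral_gt0 (k : P -> R) : measurable_fun (D : set P) k -> (forall p, D p -> 0 < k p) ->
  (0 < \int[leb2]_(p in D) (k p)%:E)%E.
Proof.
move=> mk k0; rewrite lt0e integral_ge0 ?andbT; last by move=> p /k0/ltW; rewrite lee_fin.
apply/eqP => z; have mk' : measurable_fun (D : set P) (EFin \o k) by exact/measurable_EFinP.
have z' : (\int[leb2]_(p in D) `|(EFin \o k) p| = 0)%E.
  by rewrite -[RHS]z; apply: eq_integral => p; rewrite inE => /k0 h; rewrite /= gtr0_norm.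
have [N [mN N0 sN]] := (ae_eq_integral_abs (@leb2 R) mD mk').1 z'.
have : (leb2 (D : set P) <= 0)%E.
  rewrite -N0; apply: le_measure; rewrite ?inE// => p Dp; apply: sN => /= H.
  by have [] := H Dp => e; have := k0 _ Dp; rewrite e ltxx.
by rewrite leNgt leb2_disc_gt0.
Qed.

Section OneMap.
Variables (Om : set R[i]^o) (phi : R[i]^o -> R[i]^o).
Hypothesis cphi : conformal disc Om phi.

Lemma mod_derivE z : disc z -> mod_deriv phi z = normc (cder phi z).
Proof.
move=> zD; have [dphi _ _] := cphi.
by rewrite /mod_deriv (cdiff_cder (derivable_cdiff (dphi _ zD))).
Qed.

Lemma weight_jac p : D p -> weight phi p = jac phi p.
Proof. by move=> Dp; rewrite /weight /cjacobian mod_derivE. Qed.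

Lemma W12w_weight f : W12w D (jac phi) f -> W12w D (weight phi) f.
Proof.
move=> [h1 h2 h3]; split => //; apply: le_lt_trans h2; rewrite le_eqVlt.
by apply/orP; left; apply/eqP; apply: eq_integral => p; rewrite inE => Dp; rewrite weight_jac.
Qed.

Let hphi : holo disc phi.
Proof. by move=> z zD; have [dphi _ _] := cphi; exists (derive1 phi z); exact/derivable_cdiff/dphi. Qed.

Lemma measurable_normder : measurable_fun (D : set P) (fun p => normc (cder phi (cplx p))).
Proof.
apply: open_continuous_measurable => // p; rewrite inE => Dp.
apply: ccont_continuous; first exact: normc_lip.
exact: holo_ccont (holo_cder disc_copen hphi) Dp.
Qed.

Lemma measurable_jac : measurable_fun (D : set P) (jac phi).
Proof. by apply: measurable_funX; exact: measurable_normder. Qed.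

Lemma normder_gt0 p : D p -> 0 < normc (cder phi (cplx p)).
Proof.
by move=> Dp; have [psi bi] := conformal_biholo cphi; rewrite normc_gt0 (cder_neq0 bi).
Qed.

Lemma jac_gt0 p : D p -> 0 < jac phi p.
Proof. by move=> /normder_gt0; exact: exprn_gt0. Qed.

Lemma meas_integral : (leb2 (plane Om : set P) = \int[leb2]_(p in D) (jac phi p)%:E)%E.
Proof.
have [psi bi] := conformal_biholo cphi.
have := area_formula bi (f := fun=> 1%E) (measurable_cst _) (fun p _ => lee01).
rewrite integral_cst ?mul1e; last exact: measurable_plane (bi_oV bi).
by move=> ->; apply: eq_integral => p _; rewrite mul1e.
Qed.

Lemma admissible_jac : (leb2 (plane Om : set P) < +oo)%E -> admissible D (jac phi).
Proof.
move=> fin; split; [exact: measurable_jac|by move=> p _; exact: jac_ge0|].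
by rewrite -meas_integral.
Qed.

Lemma wmass_gt0 : (leb2 (plane Om : set P) < +oo)%E -> 0 < wmass D (jac phi).
Proof.
move=> fin; have ah := admissible_jac fin; have := disc_integral_gt0 measurable_jac jac_gt0.
by rewrite -lte_fin /wmass /Rintegral fineK//; apply: integrable_fin_num => //; exact: integrable_weight.
Qed.

Lemma minmax_to_disc n Lam : minmax (plane Om) (fun=> 1) n Lam -> minmax D (jac phi) n Lam.
Proof.
have [psi bi] := conformal_biholo cphi.
move=> /(minmax_pull bi (measurable_cst _) (fun p _ => ler01)).
by apply: minmax_eq_weight => p _; rewrite mul1r.
Qed.

Lemma minmax_from_disc n Lam : minmax D (jac phi) n Lam -> minmax (plane Om) (fun=> 1) n Lam.
Proof.
have [psi bi] := conformal_biholo cphi.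
move=> /(minmax_pull (biholo_sym bi) measurable_jac (fun p _ => jac_ge0 _ _)).
by apply: minmax_eq_weight => p; exact: jac_inv (biholo_sym bi).
Qed.

Lemma meas_image (A : set R[i]^o) : A `<=` disc -> measurable (plane A : set P) ->
  (meas (phi @` A) = \int[leb2]_(p in plane A) (jac phi p)%:E)%E.
Proof.
have [psi bi] := conformal_biholo cphi; move=> AD mA.
rewrite -(area_image bi mA); last by move=> p /AD.
congr (leb2 _); apply/seteqP; split => p; rewrite /plane/= /pmap ptK.
  move=> [z Az <-]; have zD : disc z := AD _ Az.
  by rewrite (bi_phiK bi zD); split => //; exact: (bi_phiV bi zD).
by move=> [Op Ap]; exists (psi (cplx p)) => //; exact: bi_psiK bi _ Op.
Qed.

End OneMap.

(** The inequality |phi'|^2 <= 1 + |phi'|^al is integrated over the disc, whose area is finite. *)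
Lemma regular_finite (Om : set R[i]^o) (al : R) : 2 < al -> conformal_regular al Om ->
  (leb2 (plane Om : set P) < +oo)%E.
Proof.
move=> al2 [_ [phi [cphi Lphi]]]; rewrite (meas_integral cphi).
have mn := measurable_normder cphi.
have fin : (\int[leb2]_(p in D) (normc (cder phi (cplx p)) `^ al)%:E < +oo)%E.
  apply: le_lt_trans Lphi; rewrite le_eqVlt; apply/orP; left; apply/eqP.
  by apply: eq_integral => p; rewrite inE => Dp; rewrite (mod_derivE cphi).
have := @le_lin_integral R D (fun=> 1) (fun p => normc (cder phi (cplx p)) `^ al) (jac phi) 1 1
  mD ler01 ler01 (fun _ _ => ler01) (fun p _ => powR_ge0 _ _).
move=> /(_ _ _ _ _)/le_lt_trans; apply.
- move=> p Dp; rewrite jac_ge0 !mul1r/= /jac.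
  have n0 := ltW (normder_gt0 cphi Dp); set x := normc _ in n0 *.
  have [x1|x1] := leP x 1; first by rewrite ler_wpDr ?powR_ge0// exprn_ile1.
  by rewrite ler_wpDl// -powR_mulrn// ler_powR// ltW.
- exact: measurable_cst.
- by apply: (measurableT_comp (f := fun x => x `^ al)) => //; exact: measurable_powR.
- exact: measurable_jac cphi.
- rewrite !mul1e integral_cst// mul1e lte_add_pinfty//; exact: leb2_disc_lty.
Qed.

(** For fixed f the inequality passes to the infimum over admissible constants, so a finite infimum
    is itself admissible. *)
Lemma best_constant_le (h f : R * R -> R) (q C : R) : best_constant h q = C%:E -> W12w D h f ->
  ((\int[leb2]_(p in D) (`|f p - wmean h f| `^ q * h p)%:E) `^ q^-1 <=
   C%:E * (dirichlet D f) `^ 2^-1)%E.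
Proof.
move=> bC Wf; set X := (X in (X <= _)%E).
have X0 : (0 <= X)%E by exact: poweR_ge0.
pose A := [set K : R | 0 <= K /\ forall f, W12w D h f ->
  ((\int[leb2]_(p in D) (`|f p - wmean h f| `^ q * h p)%:E) `^ q^-1 <=
   K%:E * (\int[leb2]_(p in D) (grad_sqr D f p)%:E) `^ 2^-1)%E].
have bE : ereal_inf [set K%:E | K in A] = C%:E by [].
have XK K : A K -> (X <= K%:E * (dirichlet D f) `^ 2^-1)%E by move=> [_ H]; exact: H.
have [K0 AK0] : exists K, A K.
  have : (ereal_inf [set K%:E | K in A] < (C + 1)%:E)%E by rewrite bE lte_fin ltrDl.
  by move=> /ereal_inf_lt[_ [K AK _] _]; exists K.
have dfin : ((dirichlet D f) `^ 2^-1 \is a fin_num)%E.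
  apply: fin_num_poweR; rewrite ge0_fin_numE ?dirichlet_ge0//.
  by have [_ _] := Wf.
have d0 : (0 <= (dirichlet D f) `^ 2^-1)%E by exact: poweR_ge0.
move: ((dirichlet D f) `^ 2^-1)%E dfin d0 XK => d dfin; rewrite -(fineK dfin) lee_fin => d0 XK.
have : (X < +oo)%E by apply: le_lt_trans (XK _ AK0) _; rewrite -EFinM ltry.
move: X X0 XK => [x| |]// X0 XK _; rewrite -EFinM lee_fin.
(* When the Dirichlet integral is zero one cannot divide by it, but any single admissible constant
   already makes the left side vanish. *)
move: d0; rewrite le_eqVlt => /predU1P[dz|d0].
  by have := XK _ AK0; rewrite -dz !mule0 mulr0 lee_fin.
rewrite -ler_pdivrMr// -lee_fin -bE; apply: le_ereal_inf_tmp => _ [K AK <-].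
by have := XK _ AK; rewrite -EFinM !lee_fin ler_pdivrMr.
Qed.

Lemma best_constant_ge0 (h : R * R -> R) (q : R) : (0 <= best_constant h q)%E.
Proof. by apply: le_ereal_inf_tmp => _ [K [K0 _] <-]; rewrite lee_fin. Qed.

Lemma sqr_poweR (C d : R) : 0 <= C -> 0 <= d ->
  ((C%:E * d%:E `^ 2^-1) `^ 2%:R = (C ^+ 2 * d)%:E)%E.
Proof.
move=> C0 d0; have -> : (d%:E `^ 2^-1 = (d `^ 2^-1)%:E)%E by rewrite poweR_EFin.
rewrite -EFinM poweR_EFin; congr EFin; rewrite powR_mulrn; last by rewrite mulr_ge0 ?powR_ge0.
by rewrite exprMn -(powR_mulrn 2 (powR_ge0 _ _)) powRK.
Qed.

Section TwoMaps.
Variables (Om1 Om2 : set R[i]^o) (phi1 phi2 : R[i]^o -> R[i]^o) (al : R).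
Hypotheses (al2 : 2 < al) (c1 : conformal disc Om1 phi1) (c2 : conformal disc Om2 phi2).
Hypotheses (f1 : (leb2 (plane Om1 : set P) < +oo)%E) (f2 : (leb2 (plane Om2 : set P) < +oo)%E).

Let q : R := 4 * al / (al - 2).
Let j1 := jac phi1.
Let j2 := jac phi2.
Let w p := `|j1 p - j2 p|.
Let a1 : admissible D j1 := admissible_jac c1 f1.
Let a2 : admissible D j2 := admissible_jac c2 f2.

Let mw : measurable_fun (D : set P) w.
Proof.
apply: measurableT_comp => //; apply: measurable_funB;
  [exact: measurable_jac c1|exact: measurable_jac c2].
Qed.

Definition total_variation := (\int[leb2]_(p in D) (w p)%:E)%E.

Let integrand p := Num.max
  (mod_deriv phi1 (cplx p) `^ al / mod_deriv phi2 (cplx p) `^ (al - 2))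
  (mod_deriv phi2 (cplx p) `^ al / mod_deriv phi1 (cplx p) `^ (al - 2)).

Let d1 p := normc (cder phi1 (cplx p)).
Let d2 p := normc (cder phi2 (cplx p)).

Let integrandE p : D p -> integrand p =
  Num.max (d1 p `^ al / d2 p `^ (al - 2)) (d2 p `^ al / d1 p `^ (al - 2)).
Proof. by move=> Dp; rewrite /integrand (mod_derivE c1)// (mod_derivE c2). Qed.

Let m_integrand : measurable_fun (D : set P) integrand.
Proof.
apply: (eq_measurable_fun (fun p => Num.max (d1 p `^ al * d2 p `^ (- (al - 2)))
    (d2 p `^ al * d1 p `^ (- (al - 2))))).
  by move=> p; rewrite inE => Dp; rewrite integrandE// !powRN.
have mpow (k : P -> R) r : measurable_fun (D : set P) k -> measurable_fun (D : set P) (fun x => k x `^ r).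
  by move=> mk; apply: (measurableT_comp (f := fun x => x `^ r)) => //; exact: measurable_powR.
have md1 : measurable_fun (D : set P) d1 := measurable_normder c1.
have md2 : measurable_fun (D : set P) d2 := measurable_normder c2.
by apply: measurable_maxr; apply: measurable_funM; apply: (mpow).
Qed.

Let integrand_ge0 p : 0 <= integrand p.
Proof.
rewrite /integrand le_max; apply/orP; left; apply: mulr_ge0; first exact: powR_ge0.
by rewrite invr_ge0; exact: powR_ge0.
Qed.

Lemma energy_gt0 : (0 < energy al phi1 phi2)%E.
Proof.
have I0 : (0 < \int[leb2]_(p in D) (integrand p)%:E)%E.
  apply: disc_integral_gt0 => // p Dp; rewrite integrandE// lt_max; apply/orP; left.
  by rewrite divr_gt0// powR_gt0//; [exact: normder_gt0 c1 _ Dp|exact: normder_gt0 c2 _ Dp].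
exact: poweR_gt0.
Qed.

(** In [hoelder3] with F = f minus its mean and w = |h_1 - h_2|, the first factor is governed by the
    best constant and the last by the energy through [energy_bound]. The disjunction treats both
    maps at once. *)
Lemma weighted_bound (Om : set R[i]^o) (phi : R[i]^o -> R[i]^o) (C E S : R) (f : R * R -> R) :
  phi = phi1 /\ Om = Om1 \/ phi = phi2 /\ Om = Om2 ->
  best_constant (weight phi) q = C%:E -> energy al phi1 phi2 = E%:E -> total_variation = S%:E ->
  W12w D (jac phi) f ->
  (\int[leb2]_(p in D) (`|f p - wbar D (jac phi) f| ^+ 2 * w p)%:E <=
    (C ^+ 2 * (S `^ 2^-1 * E) * dir D f)%:E)%E.
Proof.
move=> hphi bC eE tS Wf.
have cf : conformal disc Om phi by case: hphi => -[-> ->].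
have ff : (leb2 (plane Om : set P) < +oo)%E by case: hphi => -[_ ->].
have ah := admissible_jac cf ff.
have al0 : 0 < al by apply: lt_trans al2.
have [[[mf _] _] _ _] := Wf.
have Ww : W12w D (weight phi) f := W12w_weight cf Wf.
have mE : wmean (weight phi) f = wbar D (jac phi) f.
  rewrite /wmean /wbar /wmass /wavg; congr (_^-1 * _); apply: eq_Rintegral => p;
  by rewrite inE => Dp; rewrite (weight_jac cf).
set F := fun p => f p - wbar D (jac phi) f.
have mF : measurable_fun (D : set P) F by apply: measurable_funB.
have := hoelder3 (@leb2 R) al2 mD mF (measurable_jac cf) mw (fun p Dp => jac_gt0 cf Dp)
  (fun p _ => normr_ge0 _).
move=> /le_trans; apply.
have -> : (C ^+ 2 * (S `^ 2^-1 * E) * dir D f)%:E =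
   ((C ^+ 2 * dir D f)%:E * ((S `^ 2^-1)%:E * E%:E))%E by rewrite -!EFinM mulrAC.
apply: lee_pmul.
- exact: poweR_ge0.
- by rewrite mule_ge0 ?poweR_ge0.
- have := best_constant_le bC Ww; rewrite mE.
  rewrite (_ : (\int[leb2]_(p in D) (`|f p - _| `^ q * weight phi p)%:E =
    \int[leb2]_(p in D) (`|F p| `^ q * jac phi p)%:E)%E); last first.
    by apply: eq_integral => p; rewrite inE => Dp; rewrite (weight_jac cf).
  set X := (\int[leb2]_(p in D) _)%E => H.
  (* The exponent is 2 / q, so this factor is the square of the q-norm that the best constant
     bounds. *)
  rewrite (_ : (al - 2) / (2 * al) = q^-1 * 2%:R); last first.
    by rewrite /q; field; rewrite !gt_eqF// subr_gt0.
  rewrite poweRrM; apply: le_trans (gt0_ler_poweR _ _ _ H) _ => //.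
  + by rewrite in_itv/= leey andbT poweR_ge0.
  + rewrite in_itv/= leey andbT mule_ge0 ?poweR_ge0//.
    by rewrite -bC best_constant_ge0.
  have C0 : 0 <= C by rewrite -lee_fin -bC best_constant_ge0.
  by rewrite -(dirE oD Wf) sqr_poweR ?dir_ge0.
- apply: lee_pmul; rewrite ?poweR_ge0//.
    by rewrite -poweR_EFin -tS.
  rewrite -eE /energy; apply: gt0_ler_poweR.
  + by rewrite invr_ge0 ltW.
  + by rewrite in_itv/= leey andbT; apply: integral_ge0 => p _; rewrite lee_fin mulr_ge0 ?powR_ge0.
  + rewrite in_itv/= leey andbT; apply: integral_ge0 => p _; rewrite lee_fin.
    exact: integrand_ge0.
  apply: ge0_le_integral => //.
  + by move=> p _; rewrite lee_fin mulr_ge0 ?powR_ge0.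
  + have mpow (k : P -> R) r : measurable_fun (D : set P) k -> measurable_fun (D : set P) (fun x => k x `^ r).
      by move=> mk; apply: (measurableT_comp (f := fun x => x `^ r)) => //; exact: measurable_powR.
    by apply/measurable_EFinP; apply: measurable_funM; apply: (mpow) => //; exact: measurable_jac cf.
  + exact/measurable_EFinP.
  + move=> p Dp; rewrite lee_fin -/(integrand p) integrandE//.
    apply: energy_bound => //; [exact: normder_gt0 c1 _ Dp|exact: normder_gt0 c2 _ Dp|].
    by case: hphi => -[-> _]; [left|right].
Qed.

Lemma total_variation_lty : (total_variation < +oo)%E.
Proof.
have [m1 p1 i1] := a1; have [m2 p2 i2] := a2.
have := @le_lin_integral R D j1 j2 w 1 1 mD ler01 ler01 p1 p2.
move=> /(_ _ m1 m2 mw)/le_lt_trans; apply; last by rewrite !mul1e lte_add_pinfty.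
move=> p Dp; rewrite normr_ge0 !mul1r /w; apply: le_trans (ler_normB _ _) _.
by rewrite !ger0_norm ?p1 ?p2.
Qed.

Lemma total_variation_meas :
  let Dp := [set z | disc z /\ cjacobian phi1 z >= cjacobian phi2 z] in
  let Dm := [set z | disc z /\ cjacobian phi1 z < cjacobian phi2 z] in
  ((meas (phi1 @` Dp) - meas (phi2 @` Dp)) + (meas (phi2 @` Dm) - meas (phi1 @` Dm)) =
   total_variation)%E.
Proof.
move=> Dp Dm; have [m1 p1 i1] := a1; have [m2 p2 i2] := a2.
have m12 : measurable_fun (D : set P) (fun p => j1 p - j2 p) by exact: measurable_funB.
have DpE : plane Dp = D `&` (fun p => j1 p - j2 p) @^-1` `[0, +oo[.
  apply/seteqP; split => p; rewrite /plane/= in_itv/= andbT subr_ge0 /j1 /j2 => -[Dz];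
  by rewrite -(weight_jac c1 Dz) -(weight_jac c2 Dz).
have DmE : plane Dm = D `&` (fun p => j1 p - j2 p) @^-1` `]-oo, 0[.
  apply/seteqP; split => p; rewrite /plane/= in_itv/= subr_lt0 /j1 /j2 => -[Dz];
  by rewrite -(weight_jac c1 Dz) -(weight_jac c2 Dz).
have mDp : measurable (plane Dp : set P) by rewrite DpE; apply: m12 => //; exact: measurable_itv.
have mDm : measurable (plane Dm : set P) by rewrite DmE; apply: m12 => //; exact: measurable_itv.
have sp : Dp `<=` disc by move=> z [].
have sm : Dm `<=` disc by move=> z [].
have I1 := integrable_weight a1; have I2 := integrable_weight a2.
have sub (A : set P) (k : P -> R) : measurable A -> A `<=` D ->
    (@leb2 R).-integrable (D : set P) (EFin \o k) -> (@leb2 R).-integrable A (EFin \o k).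
  by move=> mA AD; exact: integrableS.
have spD : plane Dp `<=` D by move=> p /sp.
have smD : plane Dm `<=` D by move=> p /sm.
have E1 := meas_image c1 sp mDp; have E2 := meas_image c2 sp mDp.
have E3 := meas_image c2 sm mDm; have E4 := meas_image c1 sm mDm.
transitivity ((\int[leb2]_(p in plane Dp) (j1 p)%:E - \int[leb2]_(p in plane Dp) (j2 p)%:E) +
  (\int[leb2]_(p in plane Dm) (j2 p)%:E - \int[leb2]_(p in plane Dm) (j1 p)%:E))%E.
  exact: (f_equal2 +%E (f_equal2 (fun x y : \bar R => x - y)%E E1 E2)
                       (f_equal2 (fun x y : \bar R => x - y)%E E3 E4)).
move: E1 E2 E3 E4 => _ _ _ _.
rewrite -(integralB mDp (sub _ _ mDp spD I1) (sub _ _ mDp spD I2)).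
rewrite -(integralB mDm (sub _ _ mDm smD I2) (sub _ _ mDm smD I1)).
have U : D = plane Dp `|` plane Dm.
  apply/seteqP; split => [p Dz|p [/sp|/sm]//].
  by have [h|h] := leP (cjacobian phi2 (cplx p)) (cjacobian phi1 (cplx p)); [left|right].
have dj : [disjoint plane Dp & plane Dm].
  by apply/disj_setPS => p [[_ h1] [_ h2]]; move: h2; rewrite /= ltNge h1.
have mU : measurable_fun (plane Dp `|` plane Dm : set P) (fun p => (w p)%:E).
  by rewrite -U; apply/measurable_EFinP; exact: mw.
have w0 p : (plane Dp `|` plane Dm : set P) p -> (0 <= (w p)%:E)%E.
  by move=> _; rewrite lee_fin normr_ge0.
transitivity (\int[leb2]_(p in plane Dp) (w p)%:E + \int[leb2]_(p in plane Dm) (w p)%:E)%E; last first.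
  rewrite -(ge0_integral_setU (@leb2 R) mDp mDm mU w0 dj).
  exact: (congr1 (fun A : set P => (\int[leb2]_(p in A) (w p)%:E)%E) (esym U)).
congr (_ + _)%E; apply: eq_integral => p; rewrite inE => -[Dz h].
  have Dp' : D p by []; rewrite /w ger0_norm// subr_ge0 /j1 /j2.
  by rewrite -(weight_jac c1 Dp') -(weight_jac c2 Dp').
have Dp' : D p by []; rewrite /w ler0_norm ?opprB// subr_le0 /j1 /j2 ltW//.
by rewrite -(weight_jac c1 Dp') -(weight_jac c2 Dp').
Qed.

(** Keeps the product of C^2 with an infinite energy from collapsing to zero. With best constant 0
    every function of the weighted space would be constant almost everywhere, yet [minmax_exists]
    supplies two independent ones. *)
Lemma best_constant_gt0 : plane Om1 !=set0 -> (0 < best_constant (weight phi1) q)%E.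
Proof.
move=> ne; rewrite lt0e best_constant_ge0 andbT; apply/eqP => b0.
have [psi bi] := conformal_biholo c1; have oO := plane_open (bi_oV bi).
have q0 : 0 < q by rewrite /q divr_gt0 ?subr_gt0// mulr_gt0//; apply: lt_trans al2.
have cst_ae f : W12w D j1 f -> exists m, {ae leb2, forall p : P, D p -> f p = m}.
  move=> Wf; exists (wmean (weight phi1) f); have [[[mf _] _] _ _] := Wf.
  have := best_constant_le b0 (W12w_weight c1 Wf); rewrite mul0e.
  set k := fun p => `|f p - wmean (weight phi1) f| `^ q * j1 p.
  have -> : (\int[leb2]_(p in D) (`|f p - wmean (weight phi1) f| `^ q * weight phi1 p)%:E =
      \int[leb2]_(p in D) (k p)%:E)%E.
    by apply: eq_integral => p; rewrite inE => Dp; rewrite (weight_jac c1).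
  have k0 p : 0 <= k p by rewrite /k mulr_ge0 ?powR_ge0 ?jac_ge0.
  have mk : measurable_fun (D : set P) (EFin \o k).
    apply/measurable_EFinP; apply: measurable_funM; last exact: measurable_jac c1.
    apply: (measurableT_comp (f := fun x => x `^ q)); first exact: measurable_powR.
    by apply: measurableT_comp => //; exact: measurable_funB.
  have X0 : (0 <= \int[leb2]_(p in D) (k p)%:E)%E by apply: integral_ge0 => p _; rewrite lee_fin.
  move=> H; have /(poweR_eq0_eq0 X0) z : ((\int[leb2]_(p in D) (k p)%:E) `^ q^-1 = 0)%E.
    by apply/eqP; rewrite eq_le H poweR_ge0.
  have z' : (\int[leb2]_(p in D) `|(EFin \o k) p| = 0)%E.
    by rewrite -[RHS]z; apply: eq_integral => p _; rewrite /= ger0_norm.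
  have := (ae_eq_integral_abs (@leb2 R) mD mk).1 z'; apply: ae_imp => p Hp Dp.
  have [/eqP] := Hp Dp; rewrite mulf_eq0 (gt_eqF (jac_gt0 c1 Dp)) orbF powR_eq0.
  by rewrite normr_eq0 subr_eq0 => /andP[/eqP].
have a : admissible (plane Om1) (fun=> 1).
  split => //; rewrite integral_cst ?mul1e//; exact: open_measurable2.
have [L _ mm] := minmax_exists oO a 2 ne.
have [b [bW bind _]] := minmax_to_disc c1 mm.
have [m0 h0] := cst_ae _ (bW ord0); have [m1 h1] := cst_ae _ (bW ord_max).
(* The combination m1 b0 - m0 b1 is null, so independence kills both constants; then b0 is null,
   which is again impossible. *)
have z : m0 = 0 /\ m1 = 0.
  pose c (i : 'I_2) : R := if i == ord0 then m1 else - m0.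
  have nc : null_on D (lincomb b c).
    apply: ae_imp2 h0 h1 => p e0 e1 Dp.
    rewrite /lincomb big_ord_recl big_ord_recl big_ord0 addr0.
    have -> : lift ord0 ord0 = ord_max :> 'I_2 by apply/val_inj.
    by rewrite (e0 Dp) (e1 Dp) /c/= mulNr [m0 * _]mulrC subrr.
  have := bind c nc ord0; have := bind c nc ord_max; rewrite /c/=.
  by move=> /eqP; rewrite oppr_eq0 => /eqP ->.
have := bind (fun i => (i == ord0)%:R) _ ord0; rewrite eqxx => H.
have /eqP : (1 : R) = 0.
  apply: H; apply: ae_imp h0 => p e0 Dp.
  by rewrite /lincomb big_ord_recl big1 ?addr0 => [|i _]; rewrite ?eqxx ?mul1r ?mul0r// (e0 Dp) z.1.
by rewrite oner_eq0.
Qed.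

End TwoMaps.

(** For L M < 1 the level L / (1 - L M) gives l1 <= L (1 + l1 M), a form that stays meaningful, and
    true, when L M is large. It can therefore be used for all L > l2, and L tends to l2. *)
Lemma eigenvalue_compare (Om1 Om2 : set R[i]^o) (phi1 phi2 : R[i]^o -> R[i]^o) (M : R) n l1 l2 :
  conformal disc Om1 phi1 -> conformal disc Om2 phi2 ->
  (leb2 (plane Om1 : set P) < +oo)%E -> (leb2 (plane Om2 : set P) < +oo)%E ->
  (forall g, W12w D (jac phi1) g -> (\int[leb2]_(p in D)
    (`|g p - wbar D (jac phi1) g| ^+ 2 * `|jac phi1 p - jac phi2 p|)%:E <= (M * dir D g)%:E)%E) ->
  (forall g, W12w D (jac phi2) g -> (\int[leb2]_(p in D)
    (`|g p - wbar D (jac phi2) g| ^+ 2 * `|jac phi1 p - jac phi2 p|)%:E <= (M * dir D g)%:E)%E) ->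
  0 <= M -> (0 < n)%N -> 0 <= l1 -> 0 <= l2 ->
  neumann_eigenvalue n (plane Om1) = l1%:E -> neumann_eigenvalue n (plane Om2) = l2%:E ->
  l1 <= l2 + l1 * l2 * M.
Proof.
move=> c1 c2 f1 f2 H1 H2 M0 n0 l10 l20 e1 e2.
have adm Om phi : conformal disc Om phi -> (leb2 (plane Om : set P) < +oo)%E ->
    open (plane Om) /\ admissible (plane Om) (fun=> 1).
  move=> cf ff; have [psi bi] := conformal_biholo cf; have oO := plane_open (bi_oV bi).
  by split => //; split => //; rewrite integral_cst ?mul1e//; exact: open_measurable2.
have [oO1 b1] := adm _ _ c1 f1; have [oO2 b2] := adm _ _ c2 f2.
have step L : l2 < L -> l1 <= L * (1 + l1 * M).
  move=> l2L; have L0 : 0 <= L by apply: le_trans (ltW l2L).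
  (* If L M >= 1 the bound is trivial, since the term l1 L M alone is at least l1. *)
  have [LM|LM] := ltP (L * M) 1; last first.
    rewrite mulrDr mulr1; apply: (@le_trans _ _ (l1 * (L * M))); first by rewrite ler_peMr.
    by rewrite mulrCA lerDr.
  have mm2 : minmax (plane Om2) (fun=> 1) n L by apply: eigenvalue_minmax => //; rewrite e2 lte_fin.
  have mm1 := minmax_compare oD (admissible_jac c1 f1) (admissible_jac c2 f2)
    (wmass_gt0 c1 f1) (wmass_gt0 c2 f2) H1 H2 n0 L0 LM (minmax_to_disc c2 mm2).
  have := minmax_eigenvalue oO1 b1 (minmax_from_disc c1 mm1).
  rewrite e1 lee_fin ler_pdivlMr ?subr_gt0// mulrBr mulr1 lerBlDr mulrDr mulr1.
  by rewrite [l1 * (L * M)]mulrCA.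
have K0 : 0 < 1 + l1 * M by rewrite ltr_pwDl// mulr_ge0.
rewrite (_ : l2 + _ = l2 * (1 + l1 * M)); last by ring.
rewrite leNgt; apply/negP => h.
have l2x : l2 < l1 / (1 + l1 * M) by rewrite ltr_pdivlMr.
have := step ((l2 + l1 / (1 + l1 * M)) / 2); rewrite leNgt => /(_ _)/negP; apply.
  by rewrite midf_lt.
by rewrite -ltr_pdivlMr// midf_lt.
Qed.

Lemma eigenvalue_real (Om : set R[i]^o) (phi : R[i]^o -> R[i]^o) n : conformal disc Om phi ->
  (leb2 (plane Om : set P) < +oo)%E -> plane Om !=set0 -> (0 < n)%N ->
  exists2 l : R, 0 <= l & neumann_eigenvalue n (plane Om) = l%:E.
Proof.
move=> cf ff ne; case: n => // n _.
have [psi bi] := conformal_biholo cf; have oO := plane_open (bi_oV bi).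
have a : admissible (plane Om) (fun=> 1).
  by split => //; rewrite integral_cst ?mul1e//; exact: open_measurable2.
have [L _ mm] := minmax_exists oO a n.+1 ne.
have := minmax_eigenvalue oO a mm; have := eigenvalue_ge0 a n.
by case: neumann_eigenvalue => [l||]//; rewrite ?lee_fin => l0 _; exists l.
Qed.

(** When the Jacobians agree almost everywhere the comparison holds with M = 0, also if C or E is
    infinite. *)
Lemma weighted_null (Om Om1 Om2 : set R[i]^o) (phi phi1 phi2 : R[i]^o -> R[i]^o) (f : R * R -> R) :
  conformal disc Om1 phi1 -> conformal disc Om2 phi2 -> conformal disc Om phi ->
  W12w D (jac phi) f -> total_variation phi1 phi2 = 0%E ->
  (\int[leb2]_(p in D)
    (`|f p - wbar D (jac phi) f| ^+ 2 * `|jac phi1 p - jac phi2 p|)%:E <= 0)%E.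
Proof.
move=> c1 c2 cf Wf tv0; have [[[mf _] _] _ _] := Wf.
have mw : measurable_fun (D : set P) (fun p => `|jac phi1 p - jac phi2 p|).
  apply: measurableT_comp => //; apply: measurable_funB;
    [exact: measurable_jac c1|exact: measurable_jac c2].
have z : (\int[leb2]_(p in D) `|(`|jac phi1 p - jac phi2 p|)%:E| = 0)%E.
  by rewrite -[RHS]tv0; apply: eq_integral => p _; rewrite /= normr_id.
have mw' : measurable_fun (D : set P) (fun p => (`|jac phi1 p - jac phi2 p|)%:E).
  exact/measurable_EFinP.
have ae0 := (ae_eq_integral_abs (@leb2 R) mD mw').1 z.
rewrite (ae_eq_integral (cst 0%E)) ?integral0//.
- apply/measurable_EFinP; apply: measurable_funM => //; apply: measurable_funX.
  by apply: measurableT_comp => //; exact: measurable_funB.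
- by apply: ae_imp ae0 => p Hp Dp; have [->] := Hp Dp; rewrite mulr0.
Qed.

Lemma best_constant_le_Cq (phi phi1 phi2 : R[i]^o -> R[i]^o) q :
  phi = phi1 \/ phi = phi2 -> (best_constant (weight phi) q <= Cq phi1 phi2 q)%E.
Proof.
have H (x y : \bar R) : (x <= Order.max x y)%E /\ (y <= Order.max x y)%E.
  by rewrite !le_max !lexx orbT.
by case=> ->; [exact: (H _ _).1|exact: (H _ _).2].
Qed.

End ConformalPair.

(** * Assembly of the estimate and its degenerate values *)

Theorem mainTheorem2 (R : realType) (alpha : R) (Om1 Om2 : set R[i]^o)
    (phi1 phi2 : R[i]^o -> R[i]^o)
    (alpha_gt2 : 2 < alpha)
    (regular_pair : conformal_regular_pair alpha Om1 Om2)
    (conf1 : conformal disc Om1 phi1)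
    (conf2 : conformal disc Om2 phi2)
    (n : nat) (n_gt0 : (0 < n)%N) :
  let lam1 := neumann_eigenvalue n (plane Om1) in
  let lam2 := neumann_eigenvalue n (plane Om2) in
  let c_n := Order.max (lam1 ^+ 2)%E (lam2 ^+ 2)%E in
  let Dp := [set z | disc z /\ cjacobian phi1 z >= cjacobian phi2 z] in
  let Dm := [set z | disc z /\ cjacobian phi1 z < cjacobian phi2 z] in
  (`|lam1 - lam2| <=
     2%:E * c_n * (Cq phi1 phi2 (4 * alpha / (alpha - 2))) ^+ 2 *
     energy alpha phi1 phi2 *
     ((meas (phi1 @` Dp) - meas (phi2 @` Dp)) +
      (meas (phi2 @` Dm) - meas (phi1 @` Dm))) `^ 2^-1)%E.
Proof.
cbv zeta.
have [reg1 reg2 _] := regular_pair; have [[_ _ ne1] _] := reg1.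
have f1 := regular_finite alpha_gt2 reg1; have f2 := regular_finite alpha_gt2 reg2.
have ptne (A : set R[i]^o) : A !=set0 -> plane A !=set0.
  by move=> [z Az]; exists (pt z); rewrite /plane/= ptK.
have [l1 l10 e1] := eigenvalue_real conf1 f1 (ptne _ ne1) n_gt0.
have [l2 l20 e2] : exists2 l : R, 0 <= l & neumann_eigenvalue n (plane Om2) = l%:E.
  by apply: (eigenvalue_real conf2 f2) n_gt0; have [[_ _ /ptne]] := reg2.
rewrite (total_variation_meas conf1 conf2 f1 f2) e1 e2.
have tv0 : (0 <= total_variation phi1 phi2)%E by apply: integral_ge0 => p _; rewrite lee_fin.
have tvfin : total_variation phi1 phi2 \is a fin_num.
  by rewrite ge0_fin_numE// (total_variation_lty conf1 conf2 f1 f2).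
set S := fine (total_variation phi1 phi2).
have tS : total_variation phi1 phi2 = S%:E by rewrite fineK.
have S0 : 0 <= S by rewrite -lee_fin -tS.
set c := Num.max (l1 ^+ 2) (l2 ^+ 2).
have -> : Order.max (l1%:E ^+ 2)%E (l2%:E ^+ 2)%E = c%:E by rewrite -!EFin_expe -EFin_max.
have c0 : 0 <= c by rewrite le_max sqr_ge0.
set q := 4 * alpha / (alpha - 2).
(* Strict positivity of E and C is prepared here for the products with an infinite factor below. *)
have E0 := energy_gt0 alpha conf1 conf2.
have C0 : (0 < Cq phi1 phi2 q)%E.
  apply: lt_le_trans (best_constant_gt0 alpha_gt2 conf1 f1 (ptne _ ne1)) _.
  by apply: best_constant_le_Cq; left.
rewrite tS poweR_EFin.
(* Then both eigenvalues are zero, as for n = 1, and the two sides vanish whatever C and E are. *)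
have [cz|cn] := eqVneq c 0.
  have lz (l : R) : l ^+ 2 <= c -> l = 0.
    by rewrite cz => h; apply/eqP; rewrite -sqrf_eq0 eq_le h sqr_ge0.
  have -> : l1 = 0 by apply: lz; rewrite le_max lexx.
  have -> : l2 = 0 by apply: lz; rewrite le_max lexx orbT.
  by rewrite sube0 abse0 cz mule0 !mul0e.
have cgt : 0 < c by rewrite lt_def cn.
have l12 : l1 * l2 <= c.
  have [h|h] := leP l1 l2.
    by apply: (@le_trans _ _ (l2 ^+ 2)); rewrite ?le_max ?lexx ?orbT// expr2 ler_wpM2r.
  by apply: (@le_trans _ _ (l1 ^+ 2)); rewrite ?le_max ?lexx// expr2 ler_wpM2l// ltW.
have main (M : R) : 0 <= M ->
    (forall Om phi, phi = phi1 /\ Om = Om1 \/ phi = phi2 /\ Om = Om2 ->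
      forall g, W12w (plane disc) (jac phi) g -> (\int[leb2]_(p in plane disc)
       (`|g p - wbar (plane disc) (jac phi) g| ^+ 2 * `|jac phi1 p - jac phi2 p|)%:E <=
        (M * dir (plane disc) g)%:E)%E) -> `|l1 - l2| <= c * M.
  move=> M0 H; have H1 := H _ _ (or_introl (conj erefl erefl)).
  have H2 := H _ _ (or_intror (conj erefl erefl)).
  have h12 := eigenvalue_compare conf1 conf2 f1 f2 H1 H2 M0 n_gt0 l10 l20 e1 e2.
  (* The bounds on both weights are symmetric in the two maps up to the sign inside |h_1 - h_2|, so
     the comparison can be run the other way round. *)
  have h21 : l2 <= l1 + l2 * l1 * M.
    apply: (eigenvalue_compare conf2 conf1 f2 f1 _ _ M0 n_gt0 l20 l10 e2 e1) => g /[dup] Wg;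
    [move=> /H2|move=> /H1]; apply: le_trans; rewrite le_eqVlt; apply/orP; left; apply/eqP;
    by apply: eq_integral => p _; rewrite [X in _ * X]distrC.
  apply: (@le_trans _ _ (l1 * l2 * M)); last by rewrite ler_wpM2r.
  by rewrite ler_norml lerBlDl h12 andbT lerNl opprB lerBlDl [l1 * l2]mulrC.
(* The right-hand side is 0 by convention even next to infinite factors, so equality of the
   eigenvalues has to be proved; [main] with M = 0 does it. *)
have [Sz|Sn] := eqVneq S 0.
  have := main 0 (lexx _); rewrite mulr0 => /(_ _)/le_trans => h.
  rewrite Sz powR0 ?invr_eq0// mule0 -EFinB lee_fin; apply: h => //.
  move=> Om phi hphi g Wg; rewrite mul0r.
  have cf : conformal disc Om phi by case: hphi => -[-> ->].
  exact: (weighted_null conf1 conf2 cf Wg (etrans tS (congr1 EFin Sz))).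
have Sgt : 0 < S by rewrite lt_def Sn.
have sgt : 0 < S `^ 2^-1 by rewrite powR_gt0.
have two0 : (0 < 2%:E * c%:E :> \bar R)%E by rewrite -EFinM lte_fin mulr_gt0.
(* All the other factors are now positive, so an infinite energy or constant makes the right-hand
   side +oo. *)
have [Einf|Efin] := eqVneq (energy alpha phi1 phi2) +oo%E.
  rewrite Einf gt0_muley; last by rewrite mule_gt0// expe_gt0.
  by rewrite gt0_mulye ?lte_fin// leey.
have [Cinf|Cfin] := eqVneq (Cq phi1 phi2 q) +oo%E.
  by rewrite Cinf expe2 mulyy gt0_muley// gt0_mulye// gt0_mulye ?lte_fin// leey.
have EE : energy alpha phi1 phi2 \is a fin_num by rewrite ge0_fin_numE ?ltey// ltW.
have CC : Cq phi1 phi2 q \is a fin_num by rewrite ge0_fin_numE ?ltey// ltW.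
have eE := esym (fineK EE); set E := fine _ in eE.
have eC := esym (fineK CC); set C := fine _ in eC.
have Ege : 0 <= E by rewrite -lee_fin -eE ltW.
have Cge : 0 <= C by rewrite -lee_fin -eC ltW.
have M0 : 0 <= C ^+ 2 * (S `^ 2^-1 * E) by rewrite !mulr_ge0 ?sqr_ge0// ltW.
have H := main _ M0 _.
rewrite eE eC -EFin_expe -EFinB -!EFinM lee_fin.
(* The bound c M obtained from [main] is half of the stated right-hand side. *)
apply: (@le_trans _ _ (c * (C ^+ 2 * (S `^ 2^-1 * E)))); last first.
  have X0 : 0 <= c * (C ^+ 2 * (S `^ 2^-1 * E)) by rewrite mulr_ge0.
  set X := _ * (_ * _) in X0 *; rewrite (_ : _ * _ = 2 * X); last by rewrite /X; ring.
  by rewrite ler_peMl// ler1n.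
apply: H => Om phi hphi g Wg.
have bk : (best_constant (weight phi) q <= C%:E)%E.
  by rewrite -eC; apply: best_constant_le_Cq; case: hphi => -[-> _]; [left|right].
have b0 := best_constant_ge0 (weight phi) q.
have bfin : best_constant (weight phi) q \is a fin_num.
  by rewrite ge0_fin_numE//; apply: le_lt_trans bk (ltry _).
have eb := esym (fineK bfin).
apply: le_trans (weighted_bound alpha_gt2 conf1 conf2 f1 f2 hphi eb eE tS Wg) _.
have k0 : 0 <= fine (best_constant (weight phi) q) by rewrite -lee_fin -eb.
have kC : fine (best_constant (weight phi) q) <= C by rewrite -lee_fin -eb.
rewrite lee_fin ler_wpM2r ?dir_ge0// ler_wpM2r ?mulr_ge0//; first exact: ltW.
by rewrite ler_sqr ?nnegrE.
Qed.
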